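(* Suppose that for each $n\in\mathbb N\cup\{\infty\}$ the pair $(A_n,f_n)$ satisfies the following assumptions. (I.a) $A_n:[t_0,\infty)\times X_p\to\mathcal L(X_1,X_0)$ is continuous, and $f_n:[t_0,\infty)\times X_p\to X_0$ is of Carathéodory type: for each fixed $u\in X_p$ the map $t\mapsto f_n(t,u)$ is measurable, and for almost every $t\ge t_0$ the map $u\mapsto f_n(t,u)$ is continuous. (I.b) For every $R>0$ there is a constant $L_R^n>0$ such that for all $u_1,u_2\in X_p$ with $\|u_1\|_{X_p}\le R$, $\|u_2\|_{X_p}\le R$, all $v\in X_1$ and all $t\in[t_0,t_0+R]$, $$\|A_n(t,u_1)v-A_n(t,u_2)v\|_{X_0}\le L_R^n\|u_1-u_2\|_{X_p}\|v\|_{X_1}.$$ (I.c) $f_n(\cdot,0)\in L^p_{\mathrm{loc}}([t_0,\infty);X_0)$. (I.d) For every $R>0$ there is a function $\Psi_R^n\in L^p_{\mathrm{loc}}([t_0,\infty))$ such that for all $u_1,u_2\in X_p$ with $\|u_1\|_{X_p}\le R$, $\|u_2\|_{X_p}\le R$, the inequality $$\|f_n(t,u_1)-f_n(t,u_2)\|_{X_0}\le\Psi_R^n(t)\|u_1-u_2\|_{X_p}$$ holds for almost every $t\ge t_0$. (I.e) For each $t\in[t_0,\infty)$ and each $v\in X_p$, the operator $A_n(t,v)$ has maximal $L^p$-regularity on any compact interval. Assume additionally: (II) For every $\varepsilon>0$, every compact subinterval $K\subset[t_0,\infty)$ and every $\eta>0$ there exists $N\ge1$ such that for all $n\ge N$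 $$\sup_{t\in K}\sup_{\|u\|_{X_p}\le\eta}\|f_n(t,u)-f_\infty(t,u)\|_{X_0}<\varepsilon\quad\text{and}\quad \sup_{t\in K}\sup_{\|u\|_{X_p}\le\eta}\|A_n(t,u)-A_\infty(t,u)\|_{\mathcal L(X_1,X_0)}<\varepsilon.$$ (III) $u_0^n\in X_p$ for $n\in\mathbb N\cup\{\infty\}$, and $\|u_0^n-u_0^\infty\|_{X_p}\to0$ as $n\to\infty$. For each $n\in\mathbb N\cup\{\infty\}$ let $\phi_n$ denote the unique solution of $$\frac{d\phi_n}{dt}+A_n(t,\phi_n)\phi_n=f_n(t,\phi_n)\quad (t>t_0),\qquad \phi_n(t_0)=u_0^n,$$ defined on its maximal interval of existence $[t_0,t_0+T_n)$, with $\phi_n\in E_1(I)$ for every compact subinterval $I$ of $[t_0,t_0+T_n)$. Then: 1. For every compact subinterval $K\subset[t_0,t_0+T_\infty)$, $\displaystyle\lim_{n\to\infty}\|\phi_n-\phi_\infty\|_{E_1(K)}=0$. 2. $\displaystyle T_\infty\le\limsup_{n\to\infty}T_n$.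
   Context: $X_0,X_1$ are Banach spaces with $X_1\hookrightarrow X_0$ continuously and densely; $p\in(1,\infty)$; $t_0>0$. $\mathcal L(X_1,X_0)$ is the space of bounded linear operators from $X_1$ to $X_0$ with the operator norm; its elements are also regarded as (possibly unbounded) closed operators in $X_0$ with domain $X_1$. For an interval $I$, $E_1(I):=W^{1,p}(I;X_0)\cap L^p(I;X_1)$ with the usual norm of the intersection (e.g. the sum of the two norms). $X_p:=(X_0,X_1)_{1-\frac1p,p}$ is the real interpolation space, with norm $\|f\|_{X_p}=\inf\{\|F\|_{E_1([0,\infty))}: f=F(0)\}$; for compact $I$, elements of $E_1(I)$ are identified with their continuous representatives $I\to X_p$. Maximal $L^p$-regularity: for a compact interval $J=[a,a+T]$, an operator $A\in\mathcal L(X_1,X_0)$ has maximal $L^p$-regularity on $J$ if for every $f\in L^p(J;X_0)$ there exists a unique $u\in E_1(J)$ satisfying $\frac{du}{dt}+Au=f$ on $J$ (in the $L^p$-sense, i.e. almost everywhere) and $u(a)=0$. Solutions are understood in the strong sense: the equation holds almost everywhere in time. Assumptions (I.a)–(I.e) are known to guarantee existence and uniqueness of local solutions, so that $T_n\in(0,\infty]$ is well defined for each $n\in\mathbb N\cup\{\infty\}$. The limit in conclusion 1 is understood to include that $K\subset[t_0,t_0+T_n)$ for all sufficiently large $n$, so that $\|\phi_n-\phi_\infty\|_{E_1(K)}$ is defined. *)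

(* Defs.v *)
From HB Require Import structures.
From mathcomp Require Import all_boot all_order all_algebra.
From mathcomp Require Import all_classical all_reals all_analysis.
Set Implicit Arguments.
Unset Strict Implicit.
Unset Printing Implicit Defensive.
Import Order.TTheory GRing.Theory Num.Theory.
Import numFieldNormedType.Exports.
Local Open Scope classical_set_scope.
Local Open Scope ring_scope.

(* Banach spaces are taken over the reals; a complex Banach space is one by
   restriction of scalars. *)

Section BochnerSpaces.
Context {R : realType} {X : completeNormedModType R}.
Local Notation mu := (@lebesgue_measure R).

Definition simple_function (s : R -> X) : Prop :=
  finite_set (range s) /\ forall x, measurable (s @^-1` [set x]).

(* [lebesgue_measure] lives on Borel sets and is not complete; convergence
   almost everywhere makes this Lebesgue (not just Borel) strong
   measurability. *)
Definition strongly_measurable (D : set R) (f : R -> X) : Prop :=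
  exists s : nat -> R -> X, (forall k, simple_function (s k)) /\
    {ae mu, forall t, D t -> s k t @[k --> \oo] --> f t}.

Definition simple_integral (D : set R) (s : R -> X) : X :=
  \sum_(x \in range s) fine (mu (D `&` s @^-1` [set x])) *: x.

(* "f is Bochner integrable on D with integral x"; the simple functions [s k]
   are integrable on D for k large, hence [fine] above is harmless. *)
Definition has_bochner_integral (D : set R) (f : R -> X) (x : X) : Prop :=
  [/\ strongly_measurable D f,
      (\int[mu]_(t in D) (`|f t|)%:E < +oo)%E &
      exists s : nat -> R -> X,
        [/\ forall k, simple_function (s k),
            (\int[mu]_(t in D) (`|f t - s k t|)%:E)%E @[k --> \oo] --> 0%E &
            simple_integral D (s k) @[k --> \oo] --> x]].

Definition Lp_norm (p : R) (D : set R) (f : R -> X) : \bar R :=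
  ((\int[mu]_(t in D) (`|f t| `^ p)%:E) `^ p^-1)%E.

Definition in_Lp (p : R) (D : set R) (f : R -> X) : Prop :=
  strongly_measurable D f /\ (Lp_norm p D f < +oo)%E.

Definition in_Lp_loc (p t0 : R) (f : R -> X) : Prop :=
  forall a b, t0 <= a -> in_Lp p `[a, b] f.

(* C^1 functions whose support is a compact subset of the interior of I, the
   class of test functions used for W^{1,p}(I) in Brezis's textbook. *)
Definition test_function (I : set R) (phi : R -> R) : Prop :=
  [/\ forall t, derivable phi t 1,
      continuous (derive1 phi),
      compact (closure [set t | phi t != 0]) &
      closure [set t | phi t != 0] `<=` interior I].

Definition is_weak_derivative (I : set R) (u g : R -> X) : Prop :=
  forall phi, test_function I phi ->
    exists2 x : X,
      has_bochner_integral I (fun t => derive1 phi t *: u t) x &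
      has_bochner_integral I (fun t => phi t *: g t) (- x).

End BochnerSpaces.

Section MaximalRegularitySpaces.
Context {R : realType} {X0 X1 : completeNormedModType R}.
Local Notation mu := (@lebesgue_measure R).

Definition dense_embedding (i : {linear X1 -> X0}) : Prop :=
  [/\ injective i, continuous i & dense (range i)].

(* Operator norm on L(X1, X0); it is +oo on unbounded linear maps. *)
Definition op_norm (B : X1 -> X0) : \bar R :=
  ereal_sup [set (`|B v|)%:E | v in [set v : X1 | `|v| <= 1]].

Variables (p : R) (i : {linear X1 -> X0}).

(* u belongs to E_1(I) = W^{1,p}(I; X0) /\ L^p(I; X1), with du/dt = g and
   with v the function u seen as X1-valued (X1 being a subspace of X0 via i).
   The class of u is represented by its continuous member; v and g are
   determined by u up to null sets. *)
Definition E1_data (I : set R) (u : R -> X0) (v : R -> X1) (g : R -> X0) :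
    Prop :=
  [/\ {within I, continuous u},
      in_Lp p I u,
      in_Lp p I g /\ is_weak_derivative I u g &
      in_Lp p I v /\ {ae mu, forall t, I t -> u t = i (v t)}].

Definition in_E1 (I : set R) (u : R -> X0) : Prop :=
  exists v g, E1_data I u v g.

(* The infimum is over the a.e.-unique pair (v, g), so it just selects the
   value of the norm; it is +oo if u is not in E_1(I). *)
Definition E1_norm (I : set R) (u : R -> X0) : \bar R :=
  ereal_inf [set N | exists v g, E1_data I u v g /\
    N = (Lp_norm p I u + Lp_norm p I g + Lp_norm p I v)%E].

(* The real interpolation space (X0, X1)_{1-1/p,p} as a trace space. *)
Definition Xp : set X0 :=
  [set f | exists2 F, in_E1 `[0, +oo[ F & F 0 = f].

Definition Xp_norm (f : X0) : \bar R :=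
  ereal_inf [set E1_norm `[0, +oo[ F |
             F in [set F | in_E1 `[0, +oo[ F /\ F 0 = f]].

(* Maps on [t0, +oo) x X_p are encoded by maps on R x X0 whose values outside
   that set are irrelevant. The values on I of an element of E_1(I) are in
   X_p, for I a nondegenerate interval. *)
Definition strong_solution (I : set R)
    (A : R -> X0 -> {linear X1 -> X0}) (f : R -> X0 -> X0) (u : R -> X0) :
    Prop :=
  exists v g, E1_data I u v g /\
    {ae mu, forall t, I t -> g t + A t (u t) (v t) = f t (u t)}.

Definition maximal_regularity (a b : R) (A : {linear X1 -> X0}) : Prop :=
  forall h : R -> X0, in_Lp p `[a, b] h ->
    let sol u := strong_solution `[a, b] (fun _ _ => A) (fun t _ => h t) u /\
                 u a = 0 in
    exists2 u, sol u & forall w, sol w -> {in `[a, b], w =1 u}.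

Record standing_assumptions (t0 : R)
    (A : R -> X0 -> {linear X1 -> X0}) (f : R -> X0 -> X0) : Prop := {
  A_bounded : forall t u, t0 <= t -> Xp u -> continuous (A t u) ;
  A_continuous : forall t u, t0 <= t -> Xp u ->
    forall e : R, 0 < e -> exists2 d : R, 0 < d &
      forall s w, t0 <= s -> Xp w ->
        `|s - t| < d -> (Xp_norm (w - u)%R < d%:E)%E ->
        (op_norm (A s w \- A t u)%R < e%:E)%E ;
  f_measurable : forall u, Xp u -> strongly_measurable `[t0, +oo[ (f ^~ u) ;
  f_continuous : {ae mu, forall t, t0 <= t -> forall u, Xp u ->
    forall e : R, 0 < e -> exists2 d : R, 0 < d &
      forall w, Xp w -> (Xp_norm (w - u)%R < d%:E)%E -> `|f t w - f t u| < e} ;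
  A_lipschitz : forall r : R, 0 < r -> exists2 L : R, 0 < L &
    forall u1 u2, Xp u1 -> Xp u2 ->
      (Xp_norm u1 <= r%:E)%E -> (Xp_norm u2 <= r%:E)%E ->
      forall (v : X1) t, t0 <= t <= t0 + r ->
        ((`|A t u1 v - A t u2 v|)%:E
           <= L%:E * Xp_norm (u1 - u2)%R * (`|v|)%:E)%E ;
  f_zero_Lp_loc : in_Lp_loc p t0 (f ^~ 0) ;
  f_lipschitz : forall r : R, 0 < r -> exists2 Psi : R -> R^o,
    in_Lp_loc p t0 Psi &
    forall u1 u2, Xp u1 -> Xp u2 ->
      (Xp_norm u1 <= r%:E)%E -> (Xp_norm u2 <= r%:E)%E ->
      {ae mu, forall t, t0 <= t ->
        ((`|f t u1 - f t u2|)%:E <= (Psi t)%:E * Xp_norm (u1 - u2)%R)%E} ;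
  A_maximal_regularity : forall t u, t0 <= t -> Xp u ->
    forall a b, a < b -> maximal_regularity a b (A t u)
}.

Definition solution (t0 : R) (A : R -> X0 -> {linear X1 -> X0})
    (f : R -> X0 -> X0) (u0 : X0) (T : \bar R) (phi : R -> X0) : Prop :=
  phi t0 = u0 /\
  forall a b, t0 <= a -> a < b -> (b%:E < t0%:E + T)%E ->
    strong_solution `[a, b] A f phi.

Definition maximal_solution (t0 : R) (A : R -> X0 -> {linear X1 -> X0})
    (f : R -> X0 -> X0) (u0 : X0) (T : \bar R) (phi : R -> X0) : Prop :=
  [/\ (0 < T)%E,
      solution t0 A f u0 T phi &
      forall T' psi, (T <= T')%E -> solution t0 A f u0 T' psi ->
        (forall t, t0 <= t -> (t%:E < t0%:E + T)%E -> psi t = phi t) ->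
        T' = T].

End MaximalRegularitySpaces.

(* Main.v *)
(* Fix b < t0 + T_oo and put w = phi_n - phi_oo.  Around a time s freeze the
   operator As = A_oo(s, phi_oo(s)); then w solves the linear equation
     w' + As w = (As - A_n(t, phi_n)) phi_n + f_n(t, phi_n)
                 - (As - A_oo(t, phi_oo)) phi_oo - f_oo(t, phi_oo),
   whose right-hand side is at most a small multiple of |w|_{E_1} plus a small
   error, on a short interval and as long as phi_n stays X_p-close to phi_oo.
   Maximal regularity with a constant M independent of the subinterval (M exists
   by a Baire argument in the form of Zabreiko's lemma; right-hand sides are
   extended by 0) turns this into a bound of |w|_{E_1} by the initial error
   |w(s)|_{X_p} and the distance of the data.  The trace estimate
   |u(t)|_{X_p} <= |u|_{E_1[a,t]} + |u(a)|_{X_p}, which follows by running the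
   path backwards, and the continuity of t |-> |w(t)|_{X_p} allow a bootstrap:
   the closeness assumption can never be lost.  If phi_n died inside the short
   interval, the same bound would give phi_n a limit in X_p at its final time, and
   local existence (Picard iteration for the frozen equation) would extend it,
   against maximality.  A real induction over s in [t0, b] carries closeness at
   t0 to closeness on [t0, b].

   Traces and weak derivatives are handled with explicit data (u, v, g): the path,
   its lift to X_1 and its weak derivative. *)
Require Import Defs.
From HB Require Import structures.
From mathcomp Require Import all_boot all_order all_algebra.
From mathcomp Require Import all_classical all_reals all_analysis.
From mathcomp Require Import measurable_realfun.
From mathcomp Require Import ring lra.
Set Implicit Arguments.
Unset Strict Implicit.
Unset Printing Implicit Defensive.
Import Order.TTheory GRing.Theory Num.Theory.
Import numFieldNormedType.Exports.
Local Open Scope classical_set_scope.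
Local Open Scope ring_scope.

(** * Strong measurability *)

(** Maximal regularity is assumed only as existence and uniqueness, so every constant of the linear
    theory has to be extracted from that. In the nonlinear estimates the splitting decides what must
    be small: the Lipschitz difference of the operators is paired with the lift [v] of the reference
    path, which is fixed and therefore small in L^p on short intervals, while the lift of the
    perturbed path is never assumed small. The X_p-distance of two paths is bounded by the E_1 norm
    of their difference plus its initial value, so a smallness condition in X_p can be recovered
    from the estimate it was used for. Primitives of Bochner integrable functions are avoided: where
    a path has to be continued to the end of its interval, an auxiliary linear problem is solved and
    compared with it. Evaluating [A] and [f] along a path raises two problems of null sets and
    measurability; both are reduced to countably many frozen points by the continuity of paths in
    X_p. *)

Section LowerIntegral.
Context {d} {T : measurableType d} {R : realType} (mu : {measure set T -> \bar R}).
Import HBNNSimple.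

(* The integral of a nonnegative function is a supremum over simple minorants,
   so no measurability is needed. *)
Lemma ge0_le_integral_ae (D : set T) (f g : T -> \bar R) : measurable D ->
  (forall t, D t -> 0 <= f t)%E -> (forall t, D t -> 0 <= g t)%E ->
  {ae mu, forall t, D t -> (f t <= g t)%E} ->
  (\int[mu]_(t in D) f t <= \int[mu]_(t in D) g t)%E.
Proof.
move=> mD f0 g0 [N [mN N0 badN]].
rewrite !ge0_integralE//; apply: ge_ereal_sup => _ [h hf <-].
have mNC := measurableC mN.
(* The simple minorant [h] of [f] is set to 0 on the null set [N]: its integral is unchanged and it
   becomes a minorant of [g]. *)
have -> : sintegral mu h = sintegral mu (proj_nnsfun h mNC).
  rewrite -!integralT_nnsfun.
  rewrite [LHS](ge0_negligible_integral mN)//; last first.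
  - by move=> x _; rewrite lee_fin.
  - exact/measurable_EFinP.
  rewrite [RHS](ge0_negligible_integral mN)//; last first.
  - by move=> x _; rewrite lee_fin.
  - exact/measurable_EFinP.
  apply: eq_integral => x; rewrite inE => -[_ Nx] /=.
  by rewrite /mindic indicE mem_set// mulr1.
apply: ereal_sup_ubound; exists (proj_nnsfun h mNC) => // x /=.
have [xN|xN] := pselect (N x).
  rewrite /mindic indicE memNset ?mulr0; last by move=> /(_ xN).
  rewrite patchE; case: ifPn => // /set_mem; exact: g0.
rewrite /mindic indicE mem_set// mulr1 (le_trans (hf x))// !patchE.
case: ifPn => // /set_mem Dx; apply: contrapT => fg; apply: xN.
by apply: badN => /= /(_ Dx).
Qed.

End LowerIntegral.

Lemma ge0_eq_integral_ae {d} {T : measurableType d} {R : realType}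
    (mu : {measure set T -> \bar R}) (D : set T) (f g : T -> \bar R) :
  measurable D ->
  (forall t, D t -> 0 <= f t)%E -> (forall t, D t -> 0 <= g t)%E ->
  {ae mu, forall t, D t -> f t = g t} ->
  (\int[mu]_(t in D) f t = \int[mu]_(t in D) g t)%E.
Proof.
move=> mD f0 g0 fg; apply/eqP; rewrite eq_le; apply/andP; split.
- apply: ge0_le_integral_ae => //.
  by apply: filterS fg => t fg Dt; rewrite fg.
- apply: ge0_le_integral_ae => //.
  by apply: filterS fg => t fg Dt; rewrite fg.
Qed.

Section AlmostEverywhere.
Context {R : realType}.
Local Notation mu := (@lebesgue_measure R).
Implicit Types P Q : R -> Prop.

Lemma aeS P Q : (forall t, P t -> Q t) ->
  {ae mu, forall t, P t} -> {ae mu, forall t, Q t}.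
Proof. by move=> PQ; exact: (@filterS _ _ (ae_filter_ringOfSetsType mu)). Qed.

Lemma aeI P Q : {ae mu, forall t, P t} -> {ae mu, forall t, Q t} ->
  {ae mu, forall t, P t /\ Q t}.
Proof. exact: (@filterI _ _ (ae_filter_ringOfSetsType mu)). Qed.

Lemma ae_all P : (forall t, P t) -> {ae mu, forall t, P t}.
Proof. by move=> PT; exact: aeW. Qed.

End AlmostEverywhere.

Section SimpleFunctions.
Context {R : realType}.
Implicit Types X Y Z : completeNormedModType R.

Lemma simple_function_cst X (x : X) : simple_function (fun _ : R => x).
Proof.
split.
  by apply: (@sub_finite_set _ _ [set x]) => // _ [t _ <-].
move=> y; have [<-|xy] := pselect (x = y).
  by rewrite (_ : _ @^-1` _ = setT)//; apply/seteqP; split.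
by rewrite (_ : _ @^-1` _ = set0)//; apply/seteqP; split.
Qed.

Lemma simple_function2 X Y Z (F : X -> Y -> Z) (s : R -> X) (r : R -> Y) :
  simple_function s -> simple_function r ->
  simple_function (fun t => F (s t) (r t)).
Proof.
move=> [fs ms] [fr mr]; split.
  apply: (@sub_finite_set _ _
    ((fun xy => F xy.1 xy.2) @` (range s `*` range r))).
    by move=> _ [t _ <-]; exists (s t, r t) => //; split; exists t.
  by apply: finite_image; exact: finite_setX.
move=> z.
rewrite (_ : _ @^-1` _ = \bigcup_(xy in [set xy | (range s `*` range r) xy
    /\ F xy.1 xy.2 = z]) (s @^-1` [set xy.1] `&` r @^-1` [set xy.2])).
  apply: fin_bigcup_measurable.
    apply: (@sub_finite_set _ _ (range s `*` range r)).
      by move=> xy [].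
    exact: finite_setX.
  by move=> xy _; apply: measurableI.
apply/seteqP; split=> [t Ft|t [[x y] [_ /= <-]] [/= <- <-]//].
by exists (s t, r t) => //; split => //; split; exists t.
Qed.

Lemma simple_function1 X Y (F : X -> Y) (s : R -> X) :
  simple_function s -> simple_function (F \o s).
Proof. by move=> ss; exact: (simple_function2 (fun x _ => F x) ss ss). Qed.

Lemma simple_function_if X (E : set R) (s r : R -> X) : measurable E ->
  simple_function s -> simple_function r ->
  simple_function (fun t => if t \in E then s t else r t).
Proof.
move=> mE [fs ms] [fr mr]; split.
  apply: (@sub_finite_set _ _ (range s `|` range r)).
    by move=> _ [t _ <-]; case: ifP => _; [left|right]; exists t.
  by rewrite finite_setU.
move=> x; rewrite (_ : _ @^-1` _ =
  (E `&` s @^-1` [set x]) `|` (~` E `&` r @^-1` [set x])).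
  by apply: measurableU; apply: measurableI => //; exact: measurableC.
apply/seteqP; split=> t /=.
  by case: ifPn => [/set_mem|/negP tE]; [left|right; split => // /mem_set].
by case=> [[tE]|[tE]]; [rewrite mem_set|rewrite memNset].
Qed.

End SimpleFunctions.

Section Pettis.
Context {R : realType}.
Implicit Types X Y Z : completeNormedModType R.
Local Notation mu := (@lebesgue_measure R).

(** Pettis' criterion in metric form: measurable distances to all points, and a range contained in
    the closure of a countable set. Unlike approximability by simple functions it is visibly stable
    under pointwise limits, and it involves no null set. *)
Definition pettis X (g : R -> X) : Prop :=
  (forall x, measurable_fun setT (fun t => `|g t - x|)) /\
  exists x_ : nat -> X, forall t (e : R), 0 < e -> exists j, `|g t - x_ j| < e.

Lemma simple_function_pettis X (s : R -> X) : simple_function s -> pettis s.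
Proof.
move=> ss; split.
  move=> x; have [fr mr] := simple_function1 (fun y => (`|y - x| : R^o)) ss.
  have -> : (fun t => `|s t - x|) = (fun y => `|y - x|) \o s by [].
  move=> _ Y mY; rewrite setTI.
  rewrite (_ : _ @^-1` Y = \bigcup_(y in range ((fun y => `|y - x|) \o s) `&` Y)
      (((fun y => `|y - x|) \o s) @^-1` [set y])).
    apply: fin_bigcup_measurable; last by move=> y _; exact: mr.
    exact: (sub_finite_set (@subIsetl _ _ _)).
  apply/seteqP; split=> [t Yt|t [_ [[u _ <-]] Yu /= ->]//].
  by exists (`|s t - x|) => //; split => //; exists t.
have [fs _] := ss.
have /finite_setP[n] := fs; rewrite card_eq_sym => /card_set_bijP[h [_ _ hs]].
exists h => t e e0.
have [j _ <-] := hs (s t) (ex_intro2 _ _ t I erefl).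
by exists j; rewrite subrr normr0.
Qed.

Lemma pettis_lim X (g_ : nat -> R -> X) (g : R -> X) :
  (forall k, pettis (g_ k)) -> (forall t, g_ k t @[k --> \oo] --> g t) ->
  pettis g.
Proof.
move=> pg gg; split.
  move=> x; apply: (@measurable_fun_cvg _ _ _ _ (fun k t => `|g_ k t - x|)).
    by move=> k; have [] := pg k.
  by move=> t _; apply: cvg_norm; apply: cvgB => //; exact: cvg_cst.
have /choice[x_ x_P] : forall k, exists x_ : nat -> X, forall t (e : R),
    0 < e -> exists j, `|g_ k t - x_ j| < e by move=> k; have [] := pg k.
pose y_ n := if unpickle n is Some (k, j) then x_ k j else 0.
exists y_ => t e e0.
have /cvgrPdist_lt/(_ _ (divr_gt0 e0 (ltr0n R 2)))[k _ kP] := gg t.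
have [j jP] := x_P k t _ (divr_gt0 e0 (ltr0n R 2)).
exists (pickle (k, j)); rewrite /y_ pickleK.
rewrite (splitr e) (le_lt_trans (ler_distD (g_ k t) _ _))// ltrD//.
by apply: kP => /=.
Qed.

(** The approximant [s k] picks greedily among the first [k + 1] points of the sequence: it moves to
    the new point exactly where that is strictly closer to [g]. Its distance to [g] is then a
    minimum of measurable functions, so the next switching set is measurable. *)
Lemma pettis_approx X (g : R -> X) : pettis g ->
  exists s : nat -> R -> X, (forall k, simple_function (s k)) /\
    forall t, s k t @[k --> \oo] --> g t.
Proof.
move=> [mg [x_ gx]].
pose s := fix s k t := if k is k'.+1 then
  (if t \in [set t | `|g t - x_ k'.+1| < `|g t - s k' t|] then x_ k'.+1
   else s k' t) else x_ 0%N.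
have sP k : simple_function (s k) /\ measurable_fun setT (fun t => `|g t - s k t|).
  elim: k => [|k [IH1 IH2]]; first by split; [exact: simple_function_cst|exact: mg].
  have mE : measurable [set t | `|g t - x_ k.+1| < `|g t - s k t|].
    rewrite -[X in measurable X]setTI.
    have : measurable_fun setT (fun t => `|g t - x_ k.+1| < `|g t - s k t|).
      exact: measurable_fun_ltr.
    by move=> /(_ measurableT [set true]); apply.
  split; first by apply: simple_function_if => //; exact: simple_function_cst.
  rewrite (_ : (fun t => _) =
    (fun t => Num.min `|g t - x_ k.+1| `|g t - s k t|)).
    exact: measurable_minr.
  apply/funext => t /=; case: ifPn => [/set_mem /=|/negP tE].
    by rewrite minElt => ->.
  by rewrite minElt; case: ifPn => // ?; exfalso; apply: tE; rewrite inE.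
exists s; split; first by move=> k; have [] := sP k.
have le_s t j k : (j <= k)%N -> `|g t - s k t| <= `|g t - x_ j|.
  elim: k => [|k IH]; first by rewrite leqn0 => /eqP ->.
  rewrite leq_eqVlt => /orP[/eqP ->|]; rewrite /=; case: ifPn => //.
  - by rewrite notin_setE/= => /negP; rewrite -leNgt.
  - by rewrite ltnS inE/= => lt1 /IH; apply: le_trans; rewrite ltW.
move=> t; apply/cvgrPdist_lt => e e0; have [j jP] := gx t e e0.
by exists j => // k /= jk; rewrite (le_lt_trans (le_s _ _ _ jk)).
Qed.

(** Setting everything to 0 off the part of [D] where the simple functions converge turns almost
    everywhere convergence into convergence everywhere, where [pettis_lim] applies. *)
Lemma strongly_measurableP X (D : set R) (f : R -> X) : measurable D ->
  strongly_measurable D f <->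
  exists2 g, pettis g & {ae mu, forall t, D t -> f t = g t}.
Proof.
move=> mD; split.
  move=> [s [ss [N [mN N0 badN]]]].
  pose E := D `\` N.
  have mE : measurable E by exact: measurableD.
  pose s' k t := if t \in E then s k t else 0.
  exists (fun t => if t \in E then f t else 0).
    apply: (@pettis_lim _ s').
      move=> k; apply/simple_function_pettis/simple_function_if => //.
      exact: simple_function_cst.
    move=> t; rewrite /s'; case: ifPn => [/set_mem[Dt Nt]|_]; last exact: cvg_cst.
    by apply: contrapT => h; apply/Nt/badN => /= /(_ Dt).
  exists N; split => // t /= h; apply: contrapT => Nt; apply: h => Dt.
  by rewrite mem_set.
move=> [g /pettis_approx[s [ss sg]] fg]; exists s; split => //.
by apply: aeS fg => t fg Dt; rewrite fg.
Qed.

End Pettis.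

Section StronglyMeasurable.
Context {R : realType}.
Implicit Types X Y Z : completeNormedModType R.
Local Notation mu := (@lebesgue_measure R).
Implicit Types D E : set R.

Lemma simple_strongly_measurable X D (s : R -> X) :
  simple_function s -> strongly_measurable D s.
Proof.
by move=> ss; exists (fun _ => s); split => //; apply: ae_all => t _; exact: cvg_cst.
Qed.

Lemma strongly_measurable_cst X D (x : X) : strongly_measurable D (fun=> x).
Proof. exact/simple_strongly_measurable/simple_function_cst. Qed.

Lemma strongly_measurable_ae X D (f g : R -> X) :
  {ae mu, forall t, D t -> f t = g t} ->
  strongly_measurable D f -> strongly_measurable D g.
Proof.
move=> fg [s [ss sf]]; exists s; split => //.
by apply: aeS (aeI fg sf) => t [+ +] Dt => /(_ Dt) <-; exact.
Qed.

Lemma strongly_measurableS X D E (f : R -> X) : E `<=` D ->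
  strongly_measurable D f -> strongly_measurable E f.
Proof.
move=> ED [s [ss sf]]; exists s; split => //.
by apply: aeS sf => t + /ED.
Qed.

Lemma strongly_measurable2 X Y Z D (F : X -> Y -> Z) (f : R -> X) (g : R -> Y) :
  (forall (x_ : nat -> X) (y_ : nat -> Y) x y,
    x_ k @[k --> \oo] --> x -> y_ k @[k --> \oo] --> y ->
    F (x_ k) (y_ k) @[k --> \oo] --> F x y) ->
  strongly_measurable D f -> strongly_measurable D g ->
  strongly_measurable D (fun t => F (f t) (g t)).
Proof.
move=> FC [s [ss sf]] [r [sr rg]]; exists (fun k t => F (s k t) (r k t)); split.
  by move=> k; exact: simple_function2.
by apply: aeS (aeI sf rg) => t [+ +] Dt => /(_ Dt) sft /(_ Dt) rgt; exact: FC.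
Qed.

Lemma strongly_measurableD X D (f g : R -> X) :
  strongly_measurable D f -> strongly_measurable D g ->
  strongly_measurable D (f \+ g).
Proof. by apply: strongly_measurable2 => *; exact: cvgD. Qed.

Lemma strongly_measurableB X D (f g : R -> X) :
  strongly_measurable D f -> strongly_measurable D g ->
  strongly_measurable D (f \- g).
Proof. by apply: (@strongly_measurable2 _ _ _ _ (fun x y => x - y)) => *; exact: cvgB. Qed.

Lemma strongly_measurable_scale X D (h : R -> R^o) (f : R -> X) :
  strongly_measurable D h -> strongly_measurable D f ->
  strongly_measurable D (fun t => (h t : R) *: f t).
Proof. by apply: (@strongly_measurable2 R^o) => *; exact: cvgZ. Qed.

Lemma strongly_measurableZ X D (c : R) (f : R -> X) :
  strongly_measurable D f -> strongly_measurable D (fun t => c *: f t).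
Proof. by apply: (@strongly_measurable_scale _ _ (fun=> c)); exact: strongly_measurable_cst. Qed.

Lemma strongly_measurable_comp X Y D (F : X -> Y) (f : R -> X) : continuous F ->
  strongly_measurable D f -> strongly_measurable D (F \o f).
Proof.
move=> FC mf; apply: (@strongly_measurable2 _ _ _ _ (fun x _ => F x) f f) => //.
by move=> x_ _ x _ xx _; apply: continuous_cvg => //; exact: FC.
Qed.

(** A diagonal choice among the simple approximants would need a rate of convergence. Passing to
    representatives satisfying [pettis], cut off on one common null set, needs none. *)
Lemma strongly_measurable_lim X D (f_ : nat -> R -> X) (f : R -> X) :
  measurable D -> (forall k, strongly_measurable D (f_ k)) ->
  {ae mu, forall t, D t -> f_ k t @[k --> \oo] --> f t} ->
  strongly_measurable D f.
Proof.
move=> mD mf ff; apply/strongly_measurableP => //.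
have /choice[g_ g_P] : forall k, exists g, pettis g /\
    {ae mu, forall t, D t -> f_ k t = g t}.
  by move=> k; have /(strongly_measurableP _ mD)[g] := mf k; exists g.
have : {ae mu, forall t, (D t -> f_ k t @[k --> \oo] --> f t) /\
    (forall k, D t -> f_ k t = g_ k t)}.
  apply: aeI => //; apply/ae_foralln => k; by case: (g_P k).
move=> [N [mN N0 badN]].
pose E := D `\` N; have mE : measurable E by exact: measurableD.
exists (fun t => if t \in E then f t else 0).
  apply: (@pettis_lim _ _ (fun k t => if t \in E then g_ k t else 0)).
    move=> k; have [/pettis_approx[s [ss sg]] _] := g_P k.
    apply: (@pettis_lim _ _ (fun j t => if t \in E then s j t else 0)).
      move=> j; apply/simple_function_pettis/simple_function_if => //.
      exact: simple_function_cst.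
    by move=> t; case: ifPn => // _; exact: cvg_cst.
  move=> t; case: ifPn => [/set_mem[Dt Nt]|_]; last exact: cvg_cst.
  have : (D t -> f_ k t @[k --> \oo] --> f t) /\
      (forall k, D t -> f_ k t = g_ k t).
    by apply: contrapT => h; apply/Nt/badN.
  move=> [/(_ Dt) + gk]; rewrite (_ : (fun k => f_ k t) = (fun k => g_ k t))//.
  by apply/funext => k; rewrite gk.
exists N; split => // t /= h; apply: contrapT => Nt; apply: h => Dt.
by rewrite mem_set.
Qed.

Lemma strongly_measurable_if X D E (f g : R -> X) : measurable E ->
  strongly_measurable (D `&` E) f -> strongly_measurable (D `\` E) g ->
  strongly_measurable D (fun t => if t \in E then f t else g t).
Proof.
move=> mE [s [ss sf]] [r [sr rg]].
exists (fun k t => if t \in E then s k t else r k t); split.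
  by move=> k; exact: simple_function_if.
apply: aeS (aeI sf rg) => t [h1 h2] Dt.
by case: ifPn => [/set_mem Et|/negP Et]; [exact: h1|apply: h2; split => // /mem_set].
Qed.

Lemma strongly_measurable_bigcup X D (E : nat -> set R) (f : R -> X) :
  measurable D -> (forall j, measurable (E j)) -> D `<=` \bigcup_j E j ->
  (forall j, strongly_measurable (D `&` E j) f) -> strongly_measurable D f.
Proof.
move=> mD mE DE mf.
pose U n := \big[setU/set0]_(j < n) E j.
have mU n : measurable (U n) by exact: bigsetU_measurable.
apply: (@strongly_measurable_lim _ _ (fun n t => if t \in U n then f t else 0)) => //.
  move=> n; apply: strongly_measurable_if => //; last exact: strongly_measurable_cst.
  elim: n => [|n IH].
    apply: (@strongly_measurableS _ (D `&` E 0%N)) => //.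
    by rewrite /U big_ord0 => t [].
  apply: (@strongly_measurable_ae _ _ (fun t => if t \in U n then f t else f t)).
    by apply: ae_all => t _; case: ifP.
  apply: strongly_measurable_if => //.
    by apply: strongly_measurableS IH => t [[]].
  apply: strongly_measurableS (mf n) => t [[Dt]].
  by rewrite /U big_ord_recr/= => -[]// Ut /(_ Ut).
apply: ae_all => t Dt; have [j _ Ejt] := DE t Dt.
apply/cvgrPdist_lt => e e0; exists j.+1 => // n /= jn.
rewrite mem_set ?subrr ?normr0//.
by rewrite /U -bigcup_mkord; exists j.
Qed.

(** The second argument is frozen at the grid point of mesh [1 / (k + 1)] just below [t]. On each
    cell of the grid this is one of the functions [H ^~ s], and the grid points converge to [t].
    This is the measurability of superposition for Carathéodory functions. *)
Lemma strongly_measurable_diag X (a b : R) (H : R -> R -> X) :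
  (forall s, s \in `[a, b] -> strongly_measurable `[a, b] (H ^~ s)) ->
  {ae mu, forall t, `[a, b]%classic t -> forall s_ : nat -> R,
    (forall k, s_ k \in `[a, b]) -> s_ k @[k --> \oo] --> t ->
    H t (s_ k) @[k --> \oo] --> H t t} ->
  strongly_measurable `[a, b] (fun t => H t t).
Proof.
move=> mH Hc.
pose sg (k : nat) t := a + (Num.truncn (k.+1%:R * (t - a)))%:R / k.+1%:R.
have trunc k t : a <= t -> (Num.truncn (k.+1%:R * (t - a)))%:R <= k.+1%:R * (t - a)
    < (Num.truncn (k.+1%:R * (t - a))).+1%:R.
  by move=> at_; apply: truncn_itv; rewrite mulr_ge0// subr_ge0.
have sg_le k t : a <= t -> sg k t <= t.
  move=> at_; have /andP[h _] := trunc k t at_.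
  by rewrite /sg -lerBrDl ler_pdivrMr// [leRHS]mulrC.
have sg_in k t : t \in `[a, b] -> sg k t \in `[a, b].
  rewrite !in_itv/= => /andP[at_ tb]; rewrite (le_trans (sg_le _ _ at_) tb) andbT.
  by rewrite /sg lerDl.
have sg_cvg t : a <= t -> sg k t @[k --> \oo] --> t.
  move=> at_; apply/cvgrPdist_le => e e0.
  have /cvgrPdist_le/(_ e e0)[N _ NP] := @cvg_harmonic R.
  exists N => // k /NP /=; rewrite sub0r normrN ger0_norm ?harmonic_ge0//= => ke.
  rewrite ger0_norm ?subr_ge0 ?sg_le//; apply: le_trans ke.
  have /andP[_ h] := trunc k t at_.
  rewrite /sg opprD addrA lerBlDr /harmonic/=.
  set n := (X in X / _).
  rewrite [leRHS](_ : _ = (1 + n) / k.+1%:R); last by rewrite mulrDl mul1r.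
  by rewrite ler_pdivlMr// [leLHS]mulrC /n nat1r ltW//; have /andP[] := trunc k t at_.
apply: (@strongly_measurable_lim _ _ (fun k t => H t (sg k t))) => //.
  move=> k.
  pose E j := `[a + j%:R / k.+1%:R, a + j.+1%:R / k.+1%:R[%classic.
  have EP t j : E j t -> sg k t = a + j%:R / k.+1%:R.
    rewrite /E/= in_itv/= => /andP[h1 h2]; rewrite /sg; congr (_ + _%:R / _).
    apply: truncn_def.
    rewrite -lerBrDl ler_pdivrMr// [leRHS]mulrC in h1.
    by rewrite -ltrBlDl ltr_pdivlMr// [ltLHS]mulrC in h2; rewrite h1.
  apply: (@strongly_measurable_bigcup _ _ E) => //.
  - by move=> j; exact: measurable_itv.
  - move=> t /=; rewrite in_itv/= => /andP[at_ tb].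
    exists (Num.truncn (k.+1%:R * (t - a))) => //.
    have /andP[h1 h2] := trunc k t at_.
    rewrite /E /= in_itv/= -lerBrDl ler_pdivrMr// [leRHS]mulrC h1/=.
    by rewrite -ltrBlDl ltr_pdivlMr// [ltLHS]mulrC.
  - move=> j; have [[t [Dt Et]]|noE] :=
        pselect (exists t, `[a, b]%classic t /\ E j t); last first.
      exists (fun=> fun=> 0); split=> [?|]; first exact: simple_function_cst.
      by apply: ae_all => t DE; exfalso; apply: noE; exists t.
    apply: (@strongly_measurable_ae _ _ (H ^~ (a + j%:R / k.+1%:R))).
      by apply: ae_all => u [_ /EP ->].
    apply: (@strongly_measurableS _ `[a, b]%classic); first exact: subIsetl.
    by apply: mH; rewrite -(EP t)//; exact: sg_in.
apply: aeS Hc => t Hc Dt; apply: Hc => //; first by move=> k; exact: sg_in.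
by apply: sg_cvg; move: Dt; rewrite /= in_itv/= => /andP[].
Qed.

(** A Borel representative of the norm, vanishing off [D]: through it the scalar theorems
    (Minkowski, Fatou, monotone and dominated convergence) reach vector-valued functions. *)
Lemma strongly_measurable_norm X D (f : R -> X) : measurable D ->
  strongly_measurable D f -> exists G : R -> R,
  [/\ measurable_fun setT G, forall t, 0 <= G t, forall t, ~ D t -> G t = 0 &
      {ae mu, forall t, D t -> `|f t| = G t}].
Proof.
move=> mD /(strongly_measurableP _ mD)[g [mg _] fg].
exists (fun t => if t \in D then `|g t - 0| else 0); split.
- apply: measurable_fun_if => //.
  + apply: (@measurable_fun_bool _ _ _ _ true).
    rewrite setTI (_ : _ @^-1` _ = D)//.
    by apply/seteqP; split => t /=; [exact: set_mem|exact: mem_set].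
  + exact: measurable_funS (mg 0).
- by move=> t; case: ifP.
- by move=> t Dt; rewrite memNset.
- by apply: aeS fg => t fg Dt; rewrite mem_set// subr0 fg.
Qed.

End StronglyMeasurable.

(** * Lebesgue spaces of vector-valued functions *)

Lemma poweR_le {R : realType} (r : R) (x y : \bar R) : 0 <= r ->
  (0 <= x)%E -> (x <= y)%E -> (x `^ r <= y `^ r)%E.
Proof.
move=> r0 x0 xy; apply: gt0_ler_poweR => //; rewrite in_itv/= leey andbT//.
exact: le_trans xy.
Qed.

Lemma limn_einf_le {R : realType} (u : nat -> \bar R) (c : \bar R) :
  (forall n, (u n <= c)%E) -> (limn_einf u <= c)%E.
Proof.
move=> uc; rewrite limn_einf_lim; apply: lime_le; first exact: is_cvg_einfs.
apply: nearW => n; rewrite (le_trans _ (uc n))//.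
by apply: ereal_inf_lbound; exists n => /=.
Qed.

Lemma cvgn_powR {R : realType} (r : R) (a_ : nat -> R) (a : R) : 0 < r ->
  (forall n, 0 <= a_ n) -> 0 <= a -> a_ n @[n --> \oo] --> a ->
  a_ n `^ r @[n --> \oo] --> a `^ r.
Proof.
move=> r0 an0; rewrite le_eqVlt => /orP[/eqP <- aa|a0 aa].
  rewrite powR0 ?gt_eqF//; apply/cvgrPdist_lt => e e0.
  have e'0 : 0 < e `^ r^-1 by rewrite powR_gt0.
  have /cvgrPdist_lt/(_ _ e'0)[N _ NP] := aa; exists N => // n /NP /=.
  rewrite !sub0r !normrN !ger0_norm ?powR_ge0// => an.
  have -> : e = (e `^ r^-1) `^ r by rewrite -powRrM mulVf ?powRr1 ?ltW// gt_eqF.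
  by rewrite gt0_ltr_powR// nnegrE ?powR_ge0.
have : {for a, continuous (fun x : R => x `^ r)}.
  apply/differentiable_continuous/derivable1_diffP/derivable_powR.
  by rewrite in_itv/= a0.
by move=> h; apply: (cvg_comp _ _ aa h).
Qed.

Section LpNorm.
Context {R : realType}.
Local Notation mu := (@lebesgue_measure R).
Implicit Types X Y Z : completeNormedModType R.
Variable p : R.
Hypothesis p_ge1 : 1 <= p.

Let p_gt0 : 0 < p. Proof. exact: lt_le_trans ltr01 p_ge1. Qed.
Let p_ge0 : 0 <= p. Proof. exact: ltW. Qed.
Let p_neq0 : p != 0. Proof. by rewrite gt_eqF. Qed.
Let pV_ge0 : 0 <= p^-1. Proof. by rewrite invr_ge0. Qed.

Lemma Lp_norm_ge0 X D (f : R -> X) : (0 <= Lp_norm p D f)%E.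
Proof. exact: poweR_ge0. Qed.

Lemma integral_powR_ge0 X D (f : R -> X) :
  (0 <= \int[mu]_(t in D) (`|f t| `^ p)%:E)%E.
Proof. by apply: integral_ge0 => t _; rewrite lee_fin powR_ge0. Qed.

Lemma le_Lp_norm X Y D (f : R -> X) (g : R -> Y) : measurable D ->
  {ae mu, forall t, D t -> `|f t| <= `|g t|} ->
  (Lp_norm p D f <= Lp_norm p D g)%E.
Proof.
move=> mD fg; apply: poweR_le; [exact: pV_ge0|exact: integral_powR_ge0|].
apply: ge0_le_integral_ae; [exact: mD|by move=> t _; rewrite lee_fin powR_ge0..|].
apply: aeS fg => t + Dt => /(_ Dt) fg.
by rewrite lee_fin ge0_ler_powR// nnegrE.
Qed.

Lemma eq_Lp_norm X D (f g : R -> X) : measurable D ->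
  {ae mu, forall t, D t -> f t = g t} -> Lp_norm p D f = Lp_norm p D g.
Proof.
move=> mD fg; apply/eqP; rewrite eq_le; apply/andP.
by split; apply: le_Lp_norm => //; apply: aeS fg => t + Dt => /(_ Dt) ->.
Qed.

Lemma Lp_normS X D E (f : R -> X) : measurable D -> E `<=` D ->
  (Lp_norm p E f <= Lp_norm p D f)%E.
Proof.
move=> mD ED; apply: poweR_le => //; first exact: integral_powR_ge0.
rewrite integral_mkcond [leRHS]integral_mkcond.
have h0 (A : set R) : forall t, setT t ->
    (0 <= ((fun t => (`|f t| `^ p)%:E) \_ A) t)%E.
  by move=> t _; rewrite patchE; case: ifP; rewrite // lee_fin powR_ge0.
apply: ge0_le_integral_ae => //; [exact: h0|exact: h0|].
apply: ae_all => t _; rewrite !patchE.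
case: ifPn => [/set_mem/ED Dt|_]; first by rewrite mem_set.
by case: ifP; rewrite // lee_fin powR_ge0.
Qed.

Lemma Lp_norm_if X D E (f : R -> X) : measurable D ->
  Lp_norm p D (fun t => if t \in E then f t else 0) = Lp_norm p (D `&` E) f.
Proof.
move=> mD; apply: (congr1 (fun z : \bar R => (z `^ p^-1)%E)).
rewrite integral_mkcond [RHS]integral_mkcond.
apply: eq_integral => t _; rewrite !patchE in_setI.
by case: (t \in D) => //=; case: (t \in E); rewrite // normr0 powR0.
Qed.

Lemma Lp_norm_null X D (f : R -> X) : measurable D -> mu D = 0%E ->
  Lp_norm p D f = 0%E.
Proof.
move=> mD D0; rewrite /Lp_norm.
rewrite (_ : (\int[mu]_(t in D) _)%E = 0%E) ?poweR0r ?invr_neq0//.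
rewrite -(integral0 mu D); apply: ge0_eq_integral_ae => //.
by exists D; split => // t /= h; apply: contrapT => Dt; apply: h => /Dt.
Qed.

Lemma Lp_norm_lee X D (f : R -> X) (c : R) : 0 <= c ->
  (Lp_norm p D f <= c%:E)%E = (\int[mu]_(t in D) (`|f t| `^ p)%:E <= (c `^ p)%:E)%E.
Proof.
move=> c0; apply/idP/idP => h.
  have := poweR_le p_ge0 (Lp_norm_ge0 D f) h.
  by rewrite /Lp_norm -poweRrM mulVf// poweRe1// integral_powR_ge0.
have := poweR_le pV_ge0 (integral_powR_ge0 D f) h.
by rewrite poweR_EFin -powRrM mulfV// powRr1.
Qed.

Lemma Lp_norm_Lnorm X D (f : R -> X) (G : R -> R) : measurable D ->
  (forall t, 0 <= G t) -> (forall t, ~ D t -> G t = 0) ->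
  {ae mu, forall t, D t -> `|f t| = G t} ->
  Lp_norm p D f = ('N[mu]_p%:E[EFin \o G])%E.
Proof.
move=> mD G0 GD fG; rewrite unlock; apply: (congr1 (fun z : \bar R => (z `^ p^-1)%E)).
rewrite (_ : (\int[mu]_(t in D) _)%E = (\int[mu]_(t in D) (G t `^ p)%:E)%E).
  rewrite [LHS]integral_mkcond; apply: eq_integral => t _.
  rewrite patchE /= ger0_norm//; case: ifPn => // /negP Dt.
  by rewrite GD ?powR0// => /mem_set.
apply: ge0_eq_integral_ae => //; try by move=> t _; rewrite lee_fin powR_ge0.
by apply: aeS fG => t + Dt => /(_ Dt) ->.
Qed.

Lemma Lp_normD X D (f g : R -> X) : measurable D ->
  strongly_measurable D f -> strongly_measurable D g ->
  (Lp_norm p D (f \+ g)%R <= Lp_norm p D f + Lp_norm p D g)%E.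
Proof.
move=> mD mf mg.
have [F [mF F0 FD fF]] := strongly_measurable_norm mD mf.
have [G [mG G0 GD gG]] := strongly_measurable_norm mD mg.
rewrite (Lp_norm_Lnorm mD F0 FD fF) (Lp_norm_Lnorm mD G0 GD gG).
have := minkowski_EFin mu mF mG p_ge1; apply: le_trans.
rewrite -(@Lp_norm_Lnorm R^o D (F \+ G) (F \+ G) mD).
- apply: (le_Lp_norm mD); apply: aeS (aeI fF gG) => t [+ +] Dt.
  move=> /(_ Dt) h1 /(_ Dt) h2; rewrite /= -h1 -h2 (le_trans (ler_normD _ _))//.
  by rewrite [leRHS]ger0_norm// addr_ge0.
- by move=> t; rewrite addr_ge0.
- by move=> t Dt; rewrite /= FD// GD// addr0.
- by apply: ae_all => t _; rewrite ger0_norm// addr_ge0.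
Qed.

Lemma le_Lp_normZ X Y D (c : R) (f : R -> X) (g : R -> Y) : measurable D ->
  0 <= c -> strongly_measurable D g ->
  {ae mu, forall t, D t -> `|f t| <= c * `|g t|} ->
  (Lp_norm p D f <= c%:E * Lp_norm p D g)%E.
Proof.
move=> mD c0 mg fg.
have [G [mG G0 GD gG]] := strongly_measurable_norm mD mg.
have hG : Lp_norm p D (fun t => (c * G t : R^o)) = (c%:E * Lp_norm p D g)%E.
  rewrite (Lp_norm_Lnorm mD G0 GD gG).
  rewrite (@Lp_norm_Lnorm R^o D _ (fun t => c * G t))//.
  - rewrite unlock.
    have e t : ((`|(EFin \o (fun t => (c * G t)%R)) t| `^ p)%E
       = ((c `^ p)%:E * (`|(EFin \o G) t| `^ p))%E).
      by rewrite /= !ger0_norm ?mulr_ge0// powRM// EFinM.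
    under eq_integral do rewrite e.
    rewrite ge0_integralZl//; last 3 first.
    + apply: (@measurableT_comp _ _ _ _ _ _ (fun x : \bar R => (x `^ p)%E)).
        exact: measurable_poweR.
      by apply: measurableT_comp => //; exact/measurable_EFinP.
    + by move=> t _; exact: poweR_ge0.
    + by rewrite lee_fin powR_ge0.
    rewrite poweRM ?lee_fin ?powR_ge0//; last first.
      by apply: integral_ge0 => t _; exact: poweR_ge0.
    by rewrite poweR_EFin -powRrM mulfV// powRr1.
  - by move=> t; rewrite mulr_ge0.
  - by move=> t Dt; rewrite GD// mulr0.
  - by apply: ae_all => t _; rewrite ger0_norm// mulr_ge0.
rewrite -hG; apply: le_Lp_norm => //; apply: aeS (aeI fg gG) => t [+ +] Dt.
by move=> /(_ Dt) h /(_ Dt) <-; rewrite [leRHS]ger0_norm// mulr_ge0.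
Qed.

Lemma Lp_norm_fatou X D (f_ : nat -> R -> X) (f : R -> X) (c : R) :
  measurable D -> 0 <= c -> (forall n, strongly_measurable D (f_ n)) ->
  {ae mu, forall t, D t -> f_ n t @[n --> \oo] --> f t} ->
  (forall n, (Lp_norm p D (f_ n) <= c%:E)%E) -> (Lp_norm p D f <= c%:E)%E.
Proof.
move=> mD c0 mf ff fc; rewrite Lp_norm_lee//.
have /choice[G GP] := fun n => strongly_measurable_norm mD (mf n).
have mG n : measurable_fun D (fun t => (G n t `^ p)%:E).
  apply/measurable_EFinP; apply: (@measurableT_comp _ _ _ _ _ _ (fun x => x `^ p)).
    exact: measurable_powR.
  by have [mG _ _ _] := GP n; exact: measurable_funS mG.
have G0 n t : D t -> (0 <= (G n t `^ p)%:E)%E by rewrite lee_fin powR_ge0.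
have Hae : {ae mu, forall t, (D t -> f_ n t @[n --> \oo] --> f t) /\
    forall n, D t -> `|f_ n t| = G n t}.
  by apply: aeI => //; apply/ae_foralln => n; have [] := GP n.
apply: (@le_trans _ _ (\int[mu]_(t in D) limn_einf (fun n => (G n t `^ p)%:E))%E).
  apply: ge0_le_integral_ae => //.
  - move=> t Dt; rewrite limn_einf_lim; apply: lime_ge; first exact: is_cvg_einfs.
    by apply: nearW => n; apply: le_ereal_inf_tmp => _ [k _ <-]; exact: G0.
  - apply: aeS Hae => t [+ h] Dt; move=> /(_ Dt) fft.
    rewrite (_ : (fun n => _) = (fun n => (`|f_ n t| `^ p)%:E)); last first.
      by apply/funext => n; rewrite h.
    suff /cvg_limn_einf_sup[-> _] :
      (fun n => (`|f_ n t| `^ p)%:E) @ \oo --> (`|f t| `^ p)%:E by [].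
    apply: cvg_EFin; first by apply: nearW.
    have : (`|f_ n t|) @[n --> \oo] --> `|f t| by exact: cvg_norm.
    exact: cvgn_powR.
have := fatou mu mD mG G0; move=> /le_trans; apply; apply: limn_einf_le => n.
have := fc n; rewrite (Lp_norm_lee _ _ c0); apply: le_trans.
apply: ge0_le_integral_ae; [exact: mD|exact: G0|by move=> t _; rewrite lee_fin powR_ge0|].
by apply: aeS Hae => t [_ h] Dt; rewrite h.
Qed.

End LpNorm.

(** The norm as a real number, so that estimates become real inequalities. An infinite norm is sent
    to 0 by [fine]; for this reason bounds on [Lpn] are stated together with membership in
    [in_Lp]. *)
HB.lock Definition Lpn {R : realType} {X : completeNormedModType R} (p : R)
  (D : set R) (f : R -> X) : R := fine (Lp_norm p D f).

Section LpSpace.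
Context {R : realType}.
Local Notation mu := (@lebesgue_measure R).
Implicit Types X Y Z : completeNormedModType R.
Variable p : R.
Hypothesis p_ge1 : 1 <= p.

Local Notation Lpn := (Lpn p).

Lemma Lpn_ge0 X D (f : R -> X) : 0 <= Lpn D f.
Proof. by rewrite Lpn.unlock; exact/fine_ge0/Lp_norm_ge0. Qed.

Lemma LpnE X D (f : R -> X) : in_Lp p D f -> Lp_norm p D f = (Lpn D f)%:E.
Proof.
by move=> [_ fo]; rewrite Lpn.unlock fineK// ge0_fin_numE// Lp_norm_ge0.
Qed.

Lemma in_Lp_lee X D (f : R -> X) (c : R) : strongly_measurable D f ->
  (Lp_norm p D f <= c%:E)%E -> in_Lp p D f /\ Lpn D f <= c.
Proof.
move=> mf fc; have fL : in_Lp p D f by split => //; rewrite (le_lt_trans fc)// ltry.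
by split => //; rewrite -lee_fin -LpnE.
Qed.

Lemma in_LpD X D (f g : R -> X) : measurable D ->
  in_Lp p D f -> in_Lp p D g ->
  in_Lp p D (f \+ g) /\ Lpn D (f \+ g) <= Lpn D f + Lpn D g.
Proof.
move=> mD fL gL; have [mf _] := fL; have [mg _] := gL.
apply: in_Lp_lee; first exact: strongly_measurableD.
by rewrite EFinD -!LpnE//; exact: Lp_normD.
Qed.

Lemma in_Lp_le1 X Y D (f : R -> X) (c : R) (g : R -> Y) : measurable D ->
  strongly_measurable D f -> 0 <= c -> in_Lp p D g ->
  {ae mu, forall t, D t -> `|f t| <= c * `|g t|} ->
  in_Lp p D f /\ Lpn D f <= c * Lpn D g.
Proof.
move=> mD mf c0 gL fg; apply: in_Lp_lee => //; rewrite EFinM -LpnE//.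
by apply: le_Lp_normZ => //; have [] := gL.
Qed.

Lemma in_Lp_norm X D (f : R -> X) : measurable D -> in_Lp p D f ->
  in_Lp p D (fun t => (`|f t| : R^o)) /\ Lpn D (fun t => (`|f t| : R^o)) <= Lpn D f.
Proof.
move=> mD fL; rewrite -[Lpn D f]mul1r; apply: in_Lp_le1 => //.
  apply: (@strongly_measurable_comp _ X R^o _ (fun x => `|x|)) => //.
    exact: norm_continuous.
  by have [] := fL.
by apply: ae_all => t _; rewrite normr_id mul1r.
Qed.

Lemma in_LpZ X D (c : R) (f : R -> X) : measurable D -> in_Lp p D f ->
  in_Lp p D (fun t => c *: f t) /\ Lpn D (fun t => c *: f t) <= `|c| * Lpn D f.
Proof.
move=> mD fL; apply: in_Lp_le1 => //.
  by apply: strongly_measurableZ; have [] := fL.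
by apply: ae_all => t _; rewrite normrZ.
Qed.

Lemma in_Lp_le2 X Y1 Y2 D (f : R -> X) (c1 c2 : R) (g1 : R -> Y1) (g2 : R -> Y2) :
  measurable D -> strongly_measurable D f -> 0 <= c1 -> 0 <= c2 ->
  in_Lp p D g1 -> in_Lp p D g2 ->
  {ae mu, forall t, D t -> `|f t| <= c1 * `|g1 t| + c2 * `|g2 t|} ->
  in_Lp p D f /\ Lpn D f <= c1 * Lpn D g1 + c2 * Lpn D g2.
Proof.
move=> mD mf c10 c20 g1L g2L fg.
have [n1 n1'] := in_Lp_norm mD g1L; have [n2 n2'] := in_Lp_norm mD g2L.
have [m1 m1'] := in_LpZ c1 mD n1; have [m2 m2'] := in_LpZ c2 mD n2.
have [s s'] := in_LpD mD m1 m2.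
have := in_Lp_le1 mD mf ler01 s; rewrite mul1r => -[].
  apply: aeS fg => t + Dt => /(_ Dt) fg; rewrite mul1r [leRHS]ger0_norm//.
  by rewrite addr_ge0// mulr_ge0.
move=> fL h; split => //; apply: le_trans h _; apply: le_trans s' _; apply: lerD.
  by rewrite (le_trans m1')// ger0_norm// ler_wpM2l.
by rewrite (le_trans m2')// ger0_norm// ler_wpM2l.
Qed.

Lemma in_Lp_le3 X Y1 Y2 Y3 D (f : R -> X) (c1 c2 c3 : R)
    (g1 : R -> Y1) (g2 : R -> Y2) (g3 : R -> Y3) :
  measurable D -> strongly_measurable D f -> 0 <= c1 -> 0 <= c2 -> 0 <= c3 ->
  in_Lp p D g1 -> in_Lp p D g2 -> in_Lp p D g3 ->
  {ae mu, forall t, D t -> `|f t| <= c1 * `|g1 t| + c2 * `|g2 t| + c3 * `|g3 t|} ->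
  in_Lp p D f /\ Lpn D f <= c1 * Lpn D g1 + c2 * Lpn D g2 + c3 * Lpn D g3.
Proof.
move=> mD mf c10 c20 c30 g1L g2L g3L fg.
have [n1 n1'] := in_Lp_norm mD g1L; have [n2 n2'] := in_Lp_norm mD g2L.
have [m1 m1'] := in_LpZ c1 mD n1; have [m2 m2'] := in_LpZ c2 mD n2.
have [s s'] := in_LpD mD m1 m2.
have := in_Lp_le2 mD mf ler01 c30 s g3L; rewrite mul1r => -[].
  apply: aeS fg => t + Dt => /(_ Dt) fg; rewrite mul1r (le_trans fg)// lerD2r.
  by rewrite [leRHS]ger0_norm// addr_ge0// mulr_ge0.
move=> fL h; split => //; apply: le_trans h _; rewrite lerD2r; apply: le_trans s' _; apply: lerD.
  by rewrite (le_trans m1')// ger0_norm// ler_wpM2l.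
by rewrite (le_trans m2')// ger0_norm// ler_wpM2l.
Qed.

Lemma in_LpB X D (f g : R -> X) : measurable D ->
  in_Lp p D f -> in_Lp p D g ->
  in_Lp p D (f \- g) /\ Lpn D (f \- g) <= Lpn D f + Lpn D g.
Proof.
move=> mD fL gL.
have := @in_Lp_le2 X X X D (f \- g) 1 1 f g mD; rewrite !mul1r; apply => //.
  by apply: strongly_measurableB; [have [] := fL|have [] := gL].
by apply: ae_all => t _; rewrite !mul1r ler_normB.
Qed.

Lemma in_Lp_linear X Y D (B : {linear X -> Y}) (c : R) (f : R -> X) :
  measurable D -> continuous B -> 0 <= c -> (forall x, `|B x| <= c * `|x|) ->
  in_Lp p D f -> in_Lp p D (B \o f) /\ Lpn D (B \o f) <= c * Lpn D f.
Proof.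
move=> mD Bc c0 Bn fL; apply: in_Lp_le1 => //.
  by apply: strongly_measurable_comp => //; have [] := fL.
by apply: ae_all => t _ /=.
Qed.

Lemma in_LpS X D E (f : R -> X) : measurable D -> E `<=` D ->
  in_Lp p D f -> in_Lp p E f /\ Lpn E f <= Lpn D f.
Proof.
move=> mD ED fL; apply: in_Lp_lee.
  by apply: strongly_measurableS ED _; have [] := fL.
by rewrite -LpnE//; exact: Lp_normS.
Qed.

Lemma in_Lp_ae X D (f g : R -> X) : measurable D ->
  {ae mu, forall t, D t -> f t = g t} -> in_Lp p D f ->
  in_Lp p D g /\ Lpn D g = Lpn D f.
Proof.
move=> mD fg [mf fo]; rewrite Lpn.unlock /= -(eq_Lp_norm p_ge1 mD fg); split; last by [].
split; first exact: strongly_measurable_ae fg mf.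
by rewrite -(eq_Lp_norm p_ge1 mD fg).
Qed.

Lemma in_Lp_if X D E (f : R -> X) : measurable D -> measurable E ->
  in_Lp p (D `&` E) f ->
  in_Lp p D (fun t => if t \in E then f t else 0) /\
  Lpn D (fun t => if t \in E then f t else 0) = Lpn (D `&` E) f.
Proof.
move=> mD mE [mf fo]; rewrite Lpn.unlock (Lp_norm_if p_ge1 _ _ mD); split; last by [].
split; last by rewrite (Lp_norm_if p_ge1 _ _ mD).
by apply: strongly_measurable_if => //; exact: strongly_measurable_cst.
Qed.

Lemma in_LpU X D E (f : R -> X) : measurable D -> measurable E ->
  in_Lp p D f -> in_Lp p E f ->
  in_Lp p (D `|` E) f /\ Lpn (D `|` E) f <= Lpn D f + Lpn E f.
Proof.
move=> mD mE fD fE; have mDE : measurable (D `|` E) by exact: measurableU.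
have [h1 h1'] : in_Lp p (D `|` E) (fun t => if t \in D then f t else 0) /\
    Lpn (D `|` E) (fun t => if t \in D then f t else 0) <= Lpn D f.
  have := @in_Lp_if X (D `|` E) D f mDE mD.
  rewrite (_ : (D `|` E) `&` D = D); first by move=> /(_ fD)[? ->].
  by apply/seteqP; split=> t; [case|split; [left|]].
have [h2 h2'] : in_Lp p (D `|` E) (fun t => if t \in E then f t else 0) /\
    Lpn (D `|` E) (fun t => if t \in E then f t else 0) <= Lpn E f.
  have := @in_Lp_if X (D `|` E) E f mDE mE.
  rewrite (_ : (D `|` E) `&` E = E); first by move=> /(_ fE)[? ->].
  by apply/seteqP; split=> t; [case|split; [right|]].
have mf : strongly_measurable (D `|` E) f.
  apply: (@strongly_measurable_bigcup _ _ _
    (fun j => if j is 0%N then D else if j is 1%N then E else set0)) => //.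
  - by case=> [|[|]].
  - by move=> t [Dt|Et]; [exists 0%N|exists 1%N].
  - case=> [|[|j]].
    + by apply: strongly_measurableS (proj1 fD) => t [].
    + by apply: strongly_measurableS (proj1 fE) => t [].
    + by apply: strongly_measurableS (proj1 fE) => t [].
have := @in_Lp_le2 _ _ _ _ f 1 1 _ _ mDE mf ler01 ler01 h1 h2; rewrite !mul1r.
case.
  apply: ae_all => t; rewrite !mul1r => -[Dt|Et].
    by rewrite (mem_set Dt) lerDl.
  by rewrite (mem_set Et) lerDr.
by move=> ? h; split => //; rewrite (le_trans h)// lerD.
Qed.

Lemma in_Lp_cst X (a b : R) (x : X) : in_Lp p `[a, b] (fun=> x).
Proof.
split; first exact: strongly_measurable_cst.
apply: poweR_lty; rewrite integral_cst//; apply: lte_mul_pinfty => //.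
by rewrite /= lebesgue_measure_itv; case: ifP => // _; rewrite ltry.
Qed.

Lemma in_Lp_cst0 X D (x : X) : in_Lp p D (fun=> 0 : X) /\ Lpn D (fun=> 0 : X) = 0.
Proof.
have h : Lp_norm p D (fun=> 0 : X) = 0%E.
  rewrite /Lp_norm integral0_eq ?poweR0r//.
    by rewrite invr_neq0// gt_eqF// (lt_le_trans _ p_ge1).
  by move=> t _; rewrite normr0 powR0// gt_eqF// (lt_le_trans _ p_ge1).
split; first by split; [exact: strongly_measurable_cst|rewrite h].
by rewrite Lpn.unlock h.
Qed.

Lemma in_Lp_sum X D (f_ : nat -> R -> X) n : measurable D ->
  (forall k, in_Lp p D (f_ k)) ->
  in_Lp p D (fun t => \sum_(k < n) f_ k t) /\
  Lpn D (fun t => \sum_(k < n) f_ k t) <= \sum_(k < n) Lpn D (f_ k).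
Proof.
move=> mD fL; elim: n => [|n [IH1 IH2]].
  have [h1 h2] := @in_Lp_cst0 X D 0.
  rewrite big_ord0; under [X in in_Lp _ _ X]eq_fun do rewrite big_ord0.
  by under [X in Lpn _ X]eq_fun do rewrite big_ord0; rewrite h2.
have [h1 h2] := in_LpD mD IH1 (fL n).
rewrite big_ord_recr/=; under [X in in_Lp _ _ X]eq_fun do rewrite big_ord_recr/=.
under [X in Lpn _ X]eq_fun do rewrite big_ord_recr/=.
by split => //; rewrite (le_trans h2)// lerD2r.
Qed.

Lemma in_Lp_fatou X D (f_ : nat -> R -> X) (f : R -> X) (c : R) :
  measurable D -> 0 <= c -> (forall n, in_Lp p D (f_ n)) ->
  {ae mu, forall t, D t -> f_ n t @[n --> \oo] --> f t} ->
  (forall n, Lpn D (f_ n) <= c) -> in_Lp p D f /\ Lpn D f <= c.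
Proof.
move=> mD c0 fL ff fc; apply: in_Lp_lee.
  by apply: strongly_measurable_lim ff => // k; have [] := fL k.
apply: Lp_norm_fatou ff _ => // n; first by have [] := fL n.
by rewrite LpnE// lee_fin.
Qed.

(** The Riesz-Fischer argument: the partial sums [S] of the norms increase, monotone convergence
    bounds the integral of the limit of their p-th powers by [C] to the power [p], so this limit is
    finite almost everywhere and the series converges absolutely there. *)
Lemma ae_cvg_series_Lp X D (f_ : nat -> R -> X) (C : R) : measurable D ->
  (forall k, in_Lp p D (f_ k)) -> (forall n, \sum_(k < n) Lpn D (f_ k) <= C) ->
  {ae mu, forall t, D t -> cvgn (series (f_ ^~ t))}.
Proof.
move=> mD fL fC; have C0 : 0 <= C by have := fC 0%N; rewrite big_ord0.
have p0 : 0 < p by exact: lt_le_trans ltr01 p_ge1.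
have /choice[G GP] := fun n => strongly_measurable_norm mD (proj1 (fL n)).
pose S n t := \sum_(k < n) G k t.
have G0 k t : 0 <= G k t by have [] := GP k.
have S0 n t : 0 <= S n t by exact: sumr_ge0.
have ndS t : nondecreasing_seq (S ^~ t).
  by apply/nondecreasing_seqP => n; rewrite /S big_ord_recr/= lerDl.
have mS n : measurable_fun setT (S n).
  by apply: measurable_sum => k; have [] := GP k.
have mSp n : measurable_fun D (fun t => (S n t `^ p)%:E).
  apply/measurable_EFinP; apply: (@measurableT_comp _ _ _ _ _ _ (fun x => x `^ p)).
    exact: measurable_powR.
  exact: measurable_funS (mS n).
have Sp0 n t : D t -> (0 <= (S n t `^ p)%:E)%E by rewrite lee_fin powR_ge0.
have ndSp t : D t -> nondecreasing_seq (fun n => (S n t `^ p)%:E).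
  by move=> _ m n mn; rewrite lee_fin; apply: ge0_ler_powR;
    rewrite ?nnegrE ?S0//; [exact: ltW|exact: ndS].
pose H t := limn (fun n => (S n t `^ p)%:E).
have SH t n : D t -> ((S n t `^ p)%:E <= H t)%E.
  move=> Dt; apply: lime_ge; first exact/ereal_nondecreasing_is_cvgn/ndSp.
  by exists n => // m nm; exact: ndSp.
have HC : (\int[mu]_(t in D) H t <= (C `^ p)%:E)%E.
  rewrite (monotone_convergence mu mD mSp Sp0 ndSp).
  apply: lime_le.
    apply: ereal_nondecreasing_is_cvgn => m n mn.
    apply: ge0_le_integral_ae; [exact: mD|exact: Sp0|exact: Sp0|].
    by apply: ae_all => t Dt; exact: ndSp.
  apply: nearW => n.
  have [h1 h2] := in_Lp_sum n mD (fun k => proj1 (in_Lp_norm mD (fL k))).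
  have h3 : Lpn D (fun t => \sum_(k < n) (`|f_ k t| : R^o)) <= C.
    rewrite (le_trans h2)// (le_trans _ (fC n))// ler_sum// => k _.
    exact: (proj2 (in_Lp_norm mD (fL k))).
  rewrite -lee_fin -(LpnE h1) (Lp_norm_lee p_ge1 _ _ C0) in h3.
  apply: le_trans h3; apply: ge0_le_integral_ae.
  - exact: mD.
  - exact: Sp0.
  - by move=> t _; rewrite lee_fin powR_ge0.
  - have : {ae mu, forall t, forall k, D t -> `|f_ k t| = G k t}.
      by apply/ae_foralln => k; have [] := GP k.
    apply: aeS => t h Dt; rewrite lee_fin.
    rewrite ger0_norm ?sumr_ge0// /S.
    by under [in leRHS]eq_bigr do rewrite h//.
have Hfin : {ae mu, forall t, D t -> H t \is a fin_num}.
  apply: integrable_ae => //; apply/integrableP; split.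
    apply: emeasurable_fun_cvg mSp _ => t Dt.
    exact/ereal_nondecreasing_is_cvgn/ndSp.
  under eq_integral => t /set_mem Dt.
    rewrite gee0_abs; last by rewrite (le_trans (Sp0 0%N t Dt))// SH.
    over.
  by rewrite (le_lt_trans HC)// ltry.
have : {ae mu, forall t, (D t -> H t \is a fin_num) /\
    forall k, D t -> `|f_ k t| = G k t}.
  by apply: aeI => //; apply/ae_foralln => k; have [] := GP k.
apply: aeS => t [+ h] Dt; move=> /(_ Dt) Ht.
apply: normed_cvg; rewrite (_ : [normed series _] = S ^~ t); last first.
  apply/funext => n; rewrite /S /normed_series_of seriesEord/=.
  by apply: eq_bigr => k _; rewrite h.
apply: nondecreasing_is_cvgn; first exact: ndS.
exists ((fine (H t)) `^ p^-1) => _ [n _ <-].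
rewrite -[leLHS](powRr1 (S0 n t)) -(mulfV (lt0r_neq0 p0)) powRrM.
apply: ge0_ler_powR; rewrite ?nnegrE ?powR_ge0 ?invr_ge0 ?(ltW p0)//.
  by rewrite -lee_fin fineK// (le_trans (Sp0 0%N t Dt))// SH.
by rewrite -lee_fin fineK// SH.
Qed.

Lemma in_Lp_series X D (f_ : nat -> R -> X) (c_ : nat -> R) : measurable D ->
  (forall k, in_Lp p D (f_ k)) -> (forall k, Lpn D (f_ k) <= c_ k) ->
  cvgn (series c_) ->
  exists f, [/\ in_Lp p D f,
    {ae mu, forall t, D t -> series (f_ ^~ t) @ \oo --> f t} &
    forall n, in_Lp p D (fun t => f t - \sum_(k < n) f_ k t) /\
     Lpn D (fun t => f t - \sum_(k < n) f_ k t) <= limn (series c_) - series c_ n].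
Proof.
move=> mD fL fc cc.
have c0 k : 0 <= c_ k by rewrite (le_trans (Lpn_ge0 _ _) (fc k)).
have sc n : series c_ n = \sum_(k < n) c_ k by rewrite /series/= big_mkord.
have ndc : nondecreasing_seq (series c_).
  by apply/nondecreasing_seqP => n; rewrite !sc big_ord_recr/= lerDl.
have scle n : series c_ n <= limn (series c_) by exact: nondecreasing_cvgn_le.
have ae_cvg : {ae mu, forall t, D t -> cvgn (series (f_ ^~ t))}.
  apply: (@ae_cvg_series_Lp _ _ _ (limn (series c_))) => // n.
  by rewrite (le_trans _ (scle n))// sc; apply: ler_sum.
pose f t := limn (series (f_ ^~ t)).
have ff : {ae mu, forall t, D t -> series (f_ ^~ t) @ \oo --> f t}.
  by apply: aeS ae_cvg => t h Dt; exact: h.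
have tail n : in_Lp p D (fun t => f t - \sum_(k < n) f_ k t) /\
     Lpn D (fun t => f t - \sum_(k < n) f_ k t) <= limn (series c_) - series c_ n.
  (* The remainder after [n] terms is the pointwise limit of the finite blocks starting at [n],
     whose norms are bounded by the remainder of the majorant series; Fatou passes this bound to the
     limit. *)
  apply: (@in_Lp_fatou _ _ (fun m t => \sum_(k < m) f_ (n + k)%N t)).
  - exact: mD.
  - by rewrite subr_ge0.
  - move=> m; by have [] := in_Lp_sum m mD (fun k => fL (n + k)%N).
  - apply: aeS ff => t + Dt => /(_ Dt) ff.
    rewrite (_ : (fun m => _) =
        (fun m => series (f_ ^~ t) (m + n)%N - \sum_(k < n) f_ k t)).
      apply: cvgB; last exact: cvg_cst.
      by rewrite (cvg_shiftn n (series (f_^~ t)) _).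
    apply/funext => m; rewrite /series/= big_mkord addnC big_split_ord/=.
    by rewrite addrAC subrr add0r.
  - move=> m; have [_ /le_trans] := in_Lp_sum m mD (fun k => fL (n + k)%N).
    apply; rewrite lerBrDr (le_trans _ (scle (n + m)%N))//.
    by rewrite !sc big_split_ord/= addrC; apply: lerD => //; apply: ler_sum.
exists f; split => //.
have [+ _] := tail 0%N; under eq_fun do rewrite big_ord0 subr0.
by [].
Qed.

End LpSpace.

(** * The Bochner integral *)

Lemma integralZ_indic {R : realType} (D E : set R) (c : R) : measurable D ->
  measurable E -> 0 <= c ->
  (\int[@lebesgue_measure R]_(t in D) (c * \1_E t)%:E =
   c%:E * @lebesgue_measure R (D `&` E))%E.
Proof.
move=> mD mE c0.
have mi : measurable_fun D (fun t => (\1_E t)%:E : \bar R).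
  apply/measurable_EFinP; exact: measurable_indic.
under eq_integral do rewrite EFinM.
rewrite ge0_integralZl//; congr (_ * _)%E.
by rewrite integral_indic; [rewrite setIC|exact: mD|exact: mE].
Qed.

Section SimpleIntegral.
Context {R : realType} {X : completeNormedModType R}.
Local Notation mu := (@lebesgue_measure R).
Implicit Types (D : set R) (s : R -> X).

(** The integral may be computed on any finite partition finer than that into level sets. Additivity
    then follows on the common refinement of two simple functions. Cells of infinite measure are
    allowed where [c] vanishes, since there the value given by [fine] is multiplied by 0. *)
Lemma simple_integral_comp (I : choiceType) D (sg : R -> I) (c : I -> X) :
  measurable D -> finite_set (range sg) ->
  (forall i, measurable (sg @^-1` [set i])) ->
  (forall i, c i != 0 -> (mu (D `&` sg @^-1` [set i]) < +oo)%E) ->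
  simple_integral D (c \o sg) =
  \sum_(i \in range sg) fine (mu (D `&` sg @^-1` [set i])) *: c i.
Proof.
move=> mD fsg msg fin; rewrite /simple_integral.
set A := range (c \o sg); set B := range sg.
have fA : finite_set A.
  rewrite (_ : A = c @` B); first exact: finite_image.
  by apply/seteqP; split=> [_ [t _ <-]|_ [_ [t _ <-] <-]]; [exists (sg t) => //|]; exists t.
transitivity (\sum_(x \in A) \sum_(i \in B)
    (if c i == x then fine (mu (D `&` sg @^-1` [set i])) *: c i else 0)).
  apply: eq_fsbigr => x _; have [->|x0] := eqVneq x 0.
    by rewrite scaler0 fsbig1// => i _; case: eqP => // ->; rewrite scaler0.
  have -> : mu (D `&` (c \o sg) @^-1` [set x]) =
      (\sum_(i \in B) (if c i == x then fine (mu (D `&` sg @^-1` [set i])) else 0))%:E.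
    rewrite -fsumEFin//.
    rewrite (_ : _ `&` _ = \bigcup_(i in B)
        (if c i == x then D `&` sg @^-1` [set i] else set0)); last first.
      apply/seteqP; split=> [t [Dt /= ct]|t [i _]].
        by exists (sg t); [exists t|rewrite ct eqxx].
      by case: eqP => // <- [Dt /= ->].
    rewrite measure_fin_bigcup//.
    - apply: eq_fsbigr => i _; case: eqP => [cx|_]; last exact: measure0.
      by rewrite fineK// ge0_fin_numE// fin// cx.
    - move=> i j _ _ [t []]; case: eqP => // _ [_ /= <-].
      by case: eqP => // _ [_ /= <-].
    - by move=> i _; case: eqP => _; [exact: (measurableI _ _ mD (msg i))|exact: measurable0].
  rewrite /= !fsbig_finite// scaler_suml; apply: eq_bigr => i _.
  by case: eqP => [->//|_]; rewrite scale0r.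
rewrite exchange_fsbig//; apply: eq_fsbigr => i /set_mem [t _ <-].
rewrite (fsbigD1 (c (sg t)))//=; last by exists t.
rewrite eqxx fsbig1 ?addr0// => x [_ /= xc].
by case: eqP => // cx; exfalso; apply: xc.
Qed.

(** Chebyshev's inequality: on the level set of [x] the integrand is the positive constant [|x|] to
    the power [p]. *)
Lemma simple_function_fin_measure (p : R) D s x : 1 <= p -> measurable D ->
  simple_function s -> in_Lp p D s -> x != 0 -> (mu (D `&` s @^-1` [set x]) < +oo)%E.
Proof.
move=> p_ge1 mD [fs ms] sL x0.
have n0 : 0 < `|x| `^ p by rewrite powR_gt0// normr_gt0.
have h : ((`|x| `^ p)%:E * mu (D `&` s @^-1` [set x]) < +oo)%E.
  rewrite -(integralZ_indic mD (ms x) (ltW n0)).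
  apply: (@le_lt_trans _ _ ((Lpn p D s) `^ p)%:E); last exact: ltry.
  apply: (@le_trans _ _ (\int[mu]_(t in D) (`|s t| `^ p)%:E)%E); last first.
    by rewrite -(Lp_norm_lee p_ge1 _ _ (Lpn_ge0 p D s)) LpnE.
  apply: ge0_le_integral_ae; [exact: mD| | |].
  - by move=> t _; rewrite lee_fin mulr_ge0// ltW.
  - by move=> t _; rewrite lee_fin powR_ge0.
  apply: ae_all => t _; rewrite lee_fin indicE.
  case: (boolP (t \in _)) => [/set_mem /= ->|_]; first by rewrite mulr1.
  by rewrite mulr0 powR_ge0.
rewrite ltNge leye_eq; apply/negP => /eqP muy.
by move: h; rewrite muy gt0_muley ?lte_fin// ltxx.
Qed.

Lemma Lp_norm1 D (f : R -> X) : Lp_norm 1 D f = (\int[mu]_(t in D) `|f t|%:E)%E.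
Proof.
rewrite /Lp_norm invr1 poweRe1 ?integral_powR_ge0//.
by apply: eq_integral => t _; rewrite powRr1.
Qed.

Lemma simple_integral_norm D s : measurable D -> simple_function s ->
  in_Lp 1 D s -> `|simple_integral D s| <= Lpn 1 D s.
Proof.
move=> mD ss sL; have [fs ms] := ss.
rewrite /simple_integral fsbig_finite//= (le_trans (ler_norm_sum _ _ _))//.
rewrite -lee_fin -LpnE// Lp_norm1.
have -> : (\int[mu]_(t in D) `|s t|%:E)%E =
    (\int[mu]_(t in D) \sum_(x \in range s) (`|x| * \1_(s @^-1` [set x]) t)%:E)%E.
  apply: eq_integral => t _; rewrite (fsbigD1 (s t))//=; last by exists t.
  rewrite indicE mem_set// mulr1 fsbig1 ?adde0// => x [_ /= xs].
  by rewrite indicE memNset ?mulr0// => /= h; apply: xs.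
rewrite ge0_integral_fsum//; last first.
  move=> x; apply/measurable_EFinP/measurable_funM; first exact: measurable_cst.
  apply: measurable_indic; exact: ms.
rewrite -fsbig_finite//= -fsumEFin//.
rewrite le_eqVlt; apply/orP; left; apply/eqP; apply: eq_fsbigr => x _.
rewrite (integralZ_indic mD (ms x) (normr_ge0 x)).
rewrite normrZ ger0_norm ?fine_ge0//.
have [->|x0] := eqVneq x 0; first by rewrite normr0 mulr0 mul0e.
by rewrite EFinM muleC fineK// ge0_fin_numE// (simple_function_fin_measure (lexx 1)).
Qed.

Lemma simple_integralD D s r : measurable D -> simple_function s ->
  simple_function r -> in_Lp 1 D s -> in_Lp 1 D r ->
  simple_integral D (s \+ r) = simple_integral D s + simple_integral D r.
Proof.
move=> mD ss sr sL rL; have [fs ms] := ss; have [fr mr] := sr.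
pose sg t := (s t, r t).
have fsg : finite_set (range sg).
  apply: (@sub_finite_set _ _ (range s `*` range r)); last exact: finite_setX.
  by move=> _ [t _ <-]; split; exists t.
have sgE i : sg @^-1` [set i] = s @^-1` [set i.1] `&` r @^-1` [set i.2].
  by case: i => x y; apply/seteqP; split=> [t [<- <-]|t [/= <- <-]].
have msg i : measurable (sg @^-1` [set i]) by rewrite sgE; exact: measurableI.
have fin1 i : i.1 != 0 -> (mu (D `&` sg @^-1` [set i]) < +oo)%E.
  move=> /(simple_function_fin_measure (lexx 1) mD ss sL); apply: le_lt_trans.
  apply: le_measure; rewrite ?inE; [exact: (measurableI _ _ mD (msg i))|
    exact: (measurableI _ _ mD (ms i.1))|by rewrite sgE => t [Dt []]].
have fin2 i : i.2 != 0 -> (mu (D `&` sg @^-1` [set i]) < +oo)%E.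
  move=> /(simple_function_fin_measure (lexx 1) mD sr rL); apply: le_lt_trans.
  apply: le_measure; rewrite ?inE; [exact: (measurableI _ _ mD (msg i))|
    exact: (measurableI _ _ mD (mr i.2))|by rewrite sgE => t [Dt []]].
rewrite (@simple_integral_comp _ _ sg (fun i => i.1 + i.2))//; last first.
  move=> i; have [->|/fin1//] := eqVneq i.1 0; rewrite add0r; exact: fin2.
rewrite (@simple_integral_comp _ _ sg fst)// (@simple_integral_comp _ _ sg snd)//.
rewrite !fsbig_finite//= -big_split/=.
by apply: eq_bigr => i _; rewrite scalerDr.
Qed.

Lemma simple_integralZ D (k : R) s : measurable D -> simple_function s ->
  in_Lp 1 D s ->
  simple_integral D (fun t => k *: s t) = k *: simple_integral D s.
Proof.
move=> mD ss sL; have [fs ms] := ss.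
rewrite (@simple_integral_comp _ _ s (fun x => k *: x))//.
  rewrite /simple_integral !fsbig_finite// scaler_sumr.
  by apply: eq_bigr => x _; rewrite !scalerA mulrC.
move=> x kx; apply: (simple_function_fin_measure (lexx 1)) => //.
by apply: contra_neq kx => ->; rewrite scaler0.
Qed.

Lemma simple_integral_if D E s : measurable E -> simple_function s ->
  simple_integral D (fun t => if t \in E then s t else 0) =
  simple_integral (D `&` E) s.
Proof.
move=> mE [fs ms]; rewrite /simple_integral.
set s' := (fun t => if _ then _ else _).
have hE x : x != 0 -> s' @^-1` [set x] = E `&` s @^-1` [set x].
  move=> x0; apply/seteqP; split=> t; rewrite /s' /=.
    case: ifPn => [/set_mem//|_ h]; by rewrite -h eqxx in x0.
  by move=> [Et <-]; rewrite mem_set.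
rewrite (@fsbig_widen _ _ _ _ (range s') (range s' `|` range s)) => //; last first.
  move=> x [_ /= nx]; have [->|x0] := eqVneq x 0; first by rewrite scaler0.
  rewrite (_ : _ @^-1` _ = set0) ?setI0 ?measure0 ?scale0r//.
  by apply/seteqP; split => // t /= h; apply: nx; exists t.
rewrite [RHS](@fsbig_widen _ _ _ _ _ (range s' `|` range s)) => //; last first.
  move=> x [_ /= nx]; have [->|x0] := eqVneq x 0; first by rewrite scaler0.
  rewrite (_ : s @^-1` _ = set0) ?setI0 ?measure0 ?scale0r//.
  by apply/seteqP; split => // t /= h; apply: nx; exists t.
apply: eq_fsbigr => x _; have [->|x0] := eqVneq x 0; first by rewrite !scaler0.
by rewrite hE// setIA.
Qed.

End SimpleIntegral.

Section LpApproximation.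
Context {R : realType}.
Local Notation mu := (@lebesgue_measure R).
Implicit Types X Y : completeNormedModType R.
Variable p : R.
Hypothesis p_ge1 : 1 <= p.
Local Notation Lpn := (Lpn p).

Lemma in_Lp_dominated_cvg X Y D (f_ : nat -> R -> X) (g : R -> Y) :
  measurable D -> (forall k, strongly_measurable D (f_ k)) -> in_Lp p D g ->
  {ae mu, forall t, D t -> forall k, `|f_ k t| <= `|g t|} ->
  {ae mu, forall t, D t -> f_ k t @[k --> \oo] --> (0 : X)} ->
  (forall k, in_Lp p D (f_ k)) /\ Lpn D (f_ k) @[k --> \oo] --> 0.
Proof.
move=> mD mf gL fg f0; have p0 : 0 < p by exact: lt_le_trans ltr01 p_ge1.
have fL k : in_Lp p D (f_ k).
  apply: (proj1 (in_Lp_le1 p_ge1 mD (mf k) ler01 gL _)).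
  by apply: aeS fg => t h Dt; rewrite mul1r h.
split => //.
have /choice[H HP] := fun n => strongly_measurable_norm mD (mf n).
have [G [mG G0 GD gG]] := strongly_measurable_norm mD (proj1 gL).
have mpow (h : R -> R) : measurable_fun setT h ->
    measurable_fun D (fun t => (h t `^ p)%:E).
  move=> mh; apply/measurable_EFinP.
  apply: (@measurableT_comp _ _ _ _ _ _ (fun x => x `^ p)).
    exact: measurable_powR.
  exact: measurable_funS mh.
have Hae : {ae mu, forall t, forall k, D t -> `|f_ k t| = H k t}.
  by apply/ae_foralln => k; have [] := HP k.
have H0 k t : 0 <= H k t by have [] := HP k.
have [|||||_ _] := @dominated_convergence _ _ R mu D mD
  (fun k t => (H k t `^ p)%:E) (fun=> 0%E) (fun t => (G t `^ p)%:E).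
- by move=> k; apply: mpow; have [] := HP k.
- exact: measurable_cst.
- apply: aeS (aeI Hae f0) => t [h +] Dt; move=> /(_ Dt) ft0.
  apply: cvg_EFin; first exact: nearW.
  rewrite (_ : (fine \o _) = (fun k => H k t `^ p)); last exact/funext.
  rewrite -[X in _ --> X](powR0 (lt0r_neq0 p0)); apply: cvgn_powR => //.
  rewrite (_ : (fun k => H k t) = (fun k => `|f_ k t|)).
    by rewrite -(@normr0 _ X); exact: cvg_norm.
  by apply/funext => k; rewrite h.
- apply/integrableP; split; first exact: mpow.
  under eq_integral do rewrite gee0_abs ?lee_fin ?powR_ge0//.
  have := proj2 gL; rewrite /Lp_norm => /(lty_poweRy _).
  rewrite invr_neq0 ?gt_eqF// => /(_ isT); apply: le_lt_trans.
  apply: ge0_le_integral_ae; [exact: mD|by move=> t _; rewrite lee_fin powR_ge0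
    |by move=> t _; rewrite lee_fin powR_ge0|]; apply: aeS gG => t + Dt => /(_ Dt) ->.
  exact: lexx.
- apply: aeS (aeI (aeI Hae gG) fg) => t [[h1 h2] h3] k Dt.
  rewrite gee0_abs ?lee_fin ?powR_ge0//; apply: ge0_ler_powR;
    rewrite ?nnegrE// ?(ltW p0)//.
  by rewrite -h1// -h2//; exact: h3.
move=> cv; have {}cv : (\int[mu]_(x in D) (H k x `^ p)%:E)%E @[k --> \oo] --> 0%E.
  by move: cv; rewrite integral0.
apply/cvgrPdist_le => e e0.
have /fine_cvgP[fin /cvgrPdist_le/(_ (e `^ p))] := cv.
rewrite powR_gt0// => /(_ isT) cv'.
near=> k; rewrite sub0r normrN (ger0_norm (Lpn_ge0 _ _ _)) -lee_fin -(LpnE (fL k)).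
rewrite (Lp_norm_lee p_ge1 _ _ (ltW e0)).
have -> : (\int[mu]_(t in D) (`|f_ k t| `^ p)%:E)%E =
    (\int[mu]_(x in D) (H k x `^ p)%:E)%E.
  apply: ge0_eq_integral_ae; [exact: mD|by move=> t _; rewrite lee_fin powR_ge0
    |by move=> t _; rewrite lee_fin powR_ge0|].
  by apply: aeS Hae => t h Dt; rewrite h.
have fink : (\int[mu]_(x in D) (H k x `^ p)%:E)%E \is a fin_num by near: k.
rewrite -(fineK fink) lee_fin.
have : `|0 - fine (\int[mu]_(x in D) (H k x `^ p)%:E)%E| <= e `^ p by near: k.
rewrite sub0r normrN ger0_norm// fine_ge0//; apply: integral_ge0 => t _.
by rewrite lee_fin powR_ge0.
Unshelve. all: by end_near. Qed.

(** Pointwise approximants are set to 0 where their norm exceeds twice that of [f]; the error is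
    then dominated by [3 * |f|]. Where [f] vanishes the truncation forces exact equality, elsewhere
    it is eventually inactive, so pointwise convergence survives. *)
Lemma Lp_simple_approx X D (f : R -> X) : measurable D -> in_Lp p D f ->
  exists s : nat -> R -> X, [/\ forall k, simple_function (s k),
    forall k, in_Lp p D (s k) & Lpn D (f \- s k) @[k --> \oo] --> 0].
Proof.
move=> mD fL; have [s [ss sf]] := proj1 fL.
have [G [mG G0 GD fG]] := strongly_measurable_norm mD (proj1 fL).
pose E k := [set t | `|s k t| <= 2 * G t].
have mE k : measurable (E k).
  rewrite -[X in measurable X]setTI.
  have : measurable_fun setT (fun t => `|s k t| <= 2 * G t).
    apply: measurable_fun_ler; last exact: measurable_funM.
    have [+ _] := simple_function_pettis (ss k) => /(_ 0).
    by under eq_fun do rewrite subr0.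
  by move=> /(_ measurableT [set true]); apply.
pose s' k t := if t \in E k then s k t else 0.
have ss' k : simple_function (s' k).
  by apply: simple_function_if => //; exact: simple_function_cst.
have s'G : {ae mu, forall t, D t -> forall k, `|s' k t| <= 2 * `|f t|}.
  apply: aeS fG => t h Dt k; rewrite /s'; case: ifPn => [/set_mem|_].
    by rewrite /E/= h.
  by rewrite normr0 mulr_ge0.
have s'L k : in_Lp p D (s' k).
  apply: (proj1 (in_Lp_le1 p_ge1 mD _ (ler0n R 2) fL _)).
    exact: simple_strongly_measurable.
  by apply: aeS s'G => t h Dt; exact: h.
exists s'; split => //.
have [f3 _] := in_LpZ p_ge1 3 mD fL.
apply: (proj2 (in_Lp_dominated_cvg mD _ f3 _ _)).
- move=> k; apply: strongly_measurableB (proj1 fL) _.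
  exact: simple_strongly_measurable.
- apply: aeS s'G => t h Dt k; rewrite normrZ (le_trans (ler_normB _ _))//.
  by rewrite (le_trans (lerD (lexx _) (h Dt k)))// ger0_norm//; lra.
- apply: aeS (aeI (aeI sf fG) s'G) => t [[h1 h2] h3] Dt.
  rewrite -(subrr (f t)); apply: cvgB; first exact: cvg_cst.
  have [ft0|ft0] := eqVneq (f t) 0.
    rewrite (_ : (fun k => s' k t) = (fun=> 0)) ?ft0; first exact: cvg_cst.
    apply/funext => k; apply/eqP; rewrite -normr_le0.
    by rewrite (le_trans (h3 Dt k))// ft0 normr0 mulr0.
  have n0 : 0 < `|f t| by rewrite normr_gt0.
  apply/cvgrPdist_lt => e e0.
  have /cvgrPdist_lt/(_ e e0)[N1 _ N1P] := h1 Dt.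
  have /cvgrPdist_lt/(_ _ n0)[N2 _ N2P] := h1 Dt.
  exists (maxn N1 N2) => // k /=; rewrite geq_max => /andP[k1 k2].
  rewrite /s' mem_set; first exact: N1P.
  rewrite /E/= -h2//; have := N2P k k2; rewrite distrC /= => lt1.
  rewrite mulrDl mul1r -lerBlDr (le_trans (lerB_dist _ _))//.
  exact: ltW.
Qed.

End LpApproximation.

Lemma cauchy_seq_cvgn {R : realType} {X : completeNormedModType R} (u : nat -> X) :
  (forall e, 0 < e -> exists N, forall k l, (N <= k)%N -> (N <= l)%N ->
    `|u k - u l| < e) -> cvgn u.
Proof.
move=> h; apply/cauchy_cvgP/cauchy_exP => e e0.
have [N NP] := h e e0; exists (u N), N => // k /= Nk.
by rewrite -ball_normE/=; apply: NP.
Qed.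

Section BochnerIntegral.
Context {R : realType} {X : completeNormedModType R}.
Local Notation mu := (@lebesgue_measure R).
Implicit Types (D E : set R) (f g : R -> X).

Let le11 : (1 : R) <= 1. Proof. exact: lexx. Qed.

(** The definition does not require the approximating simple functions to be integrable. All but
    finitely many are at finite L^1 distance from [f], hence integrable, and a shift of the index
    discards the others. *)
Lemma has_bochner_integralP D f x : measurable D ->
  has_bochner_integral D f x <-> in_Lp 1 D f /\
  exists s : nat -> R -> X, [/\ forall k, simple_function (s k),
    forall k, in_Lp 1 D (s k), Lpn 1 D (f \- s k) @[k --> \oo] --> 0 &
    simple_integral D (s k) @[k --> \oo] --> x].
Proof.
move=> mD; split.
  move=> [mf fo [s [ss sf sx]]].
  have fL : in_Lp 1 D f by split => //; rewrite Lp_norm1.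
  split => //.
  have /fine_cvgP[[N _ NP] sf'] := sf.
  have fsL k : in_Lp 1 D (f \- s (k + N)%N).
    split.
      by apply: strongly_measurableB => //; exact: simple_strongly_measurable.
    rewrite Lp_norm1 -ge0_fin_numE; first by apply: NP; exact: leq_addl.
    by apply: integral_ge0 => t _; rewrite lee_fin.
  exists (fun k => s (k + N)%N); split; first by move=> k; exact: ss.
  - move=> k; have [h _] := in_LpB le11 mD fL (fsL k).
    apply: (proj1 (in_Lp_ae le11 mD _ h)); apply: ae_all => t _ /=.
    by rewrite opprB addrC subrK.
  - move: sf'; rewrite -(cvg_shiftn N); apply: cvg_trans.
    apply: near_eq_cvg; apply: nearW => k /=.
    by rewrite Lpn.unlock Lp_norm1.
  - by move: sx; rewrite -(cvg_shiftn N).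
move=> [fL [s [ss sL sf sx]]]; split => //.
- by have [] := fL.
- by have [_] := fL; rewrite Lp_norm1.
exists s; split => //.
have -> : (fun k => \int[mu]_(t in D) (`|f t - s k t|)%:E)%E =
    (fun k => (Lpn 1 D (f \- s k))%:E).
  apply/funext => k; have [h _] := in_LpB le11 mD fL (sL k).
  by rewrite -(LpnE h) Lp_norm1.
by apply: cvg_EFin => //; exact: nearW.
Qed.

Lemma has_bochner_integral_exists D f : measurable D -> in_Lp 1 D f ->
  exists x, has_bochner_integral D f x.
Proof.
move=> mD fL; have [s [ss sL sf]] := Lp_simple_approx le11 mD fL.
have hB k l : `|simple_integral D (s k) - simple_integral D (s l)| <=
    Lpn 1 D (f \- s k) + Lpn 1 D (f \- s l).
  have [nL nn] := in_LpZ le11 (-1) mD (sL l).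
  have ns : simple_function (fun t => -1 *: s l t) by exact: simple_function1.
  have [aL _] := in_LpD le11 mD (sL k) nL.
  rewrite -scaleN1r -(simple_integralZ (-1) mD (ss l) (sL l)).
  rewrite -(simple_integralD mD (ss k) ns (sL k) nL).
  apply: le_trans (simple_integral_norm mD _ aL) _.
    exact: simple_function2.
  have [h1 _] := in_LpB le11 mD fL (sL k); have [h2 _] := in_LpB le11 mD fL (sL l).
  have [h3 h4] := in_LpB le11 mD h2 h1.
  rewrite [leRHS]addrC; apply: le_trans h4.
  rewrite (_ : _ \+ _ = f \- s l \- (f \- s k))//.
  by apply/funext => t /=; rewrite scaleN1r opprB [RHS]addrC addrA subrK.
have cv : cvgn (fun k => simple_integral D (s k)).
  apply: cauchy_seq_cvgn => e e0; have e20 : 0 < e / 2 by rewrite divr_gt0.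
  have /cvgrPdist_lt/(_ _ e20)[N _ NP] := sf; exists N => k l Nk Nl.
  rewrite (le_lt_trans (hB k l))// [e]splitr.
  have := NP k Nk; have := NP l Nl.
  by rewrite !sub0r !normrN !ger0_norm ?Lpn_ge0// => *; exact: ltrD.
exists (limn (fun k => simple_integral D (s k))).
by apply/(has_bochner_integralP _ _ mD); split => //; exists s.
Qed.

Lemma has_bochner_integral_norm D f x : measurable D ->
  has_bochner_integral D f x -> `|x| <= Lpn 1 D f.
Proof.
move=> mD /(has_bochner_integralP _ _ mD)[fL [s [ss sL sf sx]]].
apply/ler_addgt0Pr => e e0.
have e20 : 0 < e / 2 by rewrite divr_gt0.
have /cvgrPdist_lt/(_ _ e20)[N _ NP] := sf.
have /cvgrPdist_lt/(_ _ e20)[M _ MP] := sx.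
pose k := maxn N M.
have h1 := NP k (leq_maxl _ _); have h2 := MP k (leq_maxr _ _).
rewrite /= sub0r normrN ger0_norm ?Lpn_ge0// in h1.
have [fsL _] := in_LpB le11 mD fL (sL k).
have [sfL h3] := in_LpB le11 mD fL fsL.
have h4 := simple_integral_norm mD (ss k) (sL k).
rewrite (_ : f \- _ = s k) in h3; last first.
  by apply/funext => t /=; rewrite opprB addrC subrK.
have h5 : `|x| <= `|x - simple_integral D (s k)| + `|simple_integral D (s k)|.
  by rewrite -{1}[x](subrK (simple_integral D (s k))) ler_normD.
have /= := h2; lra.
Qed.

Lemma has_bochner_integralD D f g x y : measurable D ->
  has_bochner_integral D f x -> has_bochner_integral D g y ->
  has_bochner_integral D (f \+ g) (x + y).
Proof.
move=> mD /(has_bochner_integralP _ _ mD)[fL [s [ss sL sf sx]]].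
move=> /(has_bochner_integralP _ _ mD)[gL [r [sr rL rg ry]]].
apply/(has_bochner_integralP _ _ mD); split; first by have [] := in_LpD le11 mD fL gL.
exists (fun k => s k \+ r k); split.
- by move=> k; exact: simple_function2.
- by move=> k; have [] := in_LpD le11 mD (sL k) (rL k).
- apply: (@squeeze_cvgr _ _ _ _ (fun=> 0)
      (fun k => Lpn 1 D (f \- s k) + Lpn 1 D (g \- r k))).
  + apply: nearW => k; rewrite Lpn_ge0/=.
    have [h1 _] := in_LpB le11 mD fL (sL k); have [h2 _] := in_LpB le11 mD gL (rL k).
    have [_] := in_LpD le11 mD h1 h2; apply: le_trans.
    rewrite (_ : _ \- _ = (f \- s k) \+ (g \- r k))//.
    by apply/funext => t /=; rewrite opprD addrACA.
  + exact: cvg_cst.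
  + by rewrite -[X in _ --> X]addr0; exact: cvgD.
- under eq_fun => k do rewrite (simple_integralD mD (ss k) (sr k) (sL k) (rL k)).
  exact: cvgD.
Qed.

Lemma has_bochner_integralZ D (c : R) f x : measurable D ->
  has_bochner_integral D f x -> has_bochner_integral D (fun t => c *: f t) (c *: x).
Proof.
move=> mD /(has_bochner_integralP _ _ mD)[fL [s [ss sL sf sx]]].
apply/(has_bochner_integralP _ _ mD); split; first by have [] := in_LpZ le11 c mD fL.
exists (fun k t => c *: s k t); split.
- by move=> k; exact: simple_function1.
- by move=> k; have [] := in_LpZ le11 c mD (sL k).
- apply: (@squeeze_cvgr _ _ _ _ (fun=> 0) (fun k => `|c| * Lpn 1 D (f \- s k))).
  + apply: nearW => k; rewrite Lpn_ge0/=.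
    have [h1 _] := in_LpB le11 mD fL (sL k).
    have [_] := in_LpZ le11 c mD h1; apply: le_trans.
    rewrite (_ : _ \- _ = (fun t => c *: (f \- s k) t))//.
    by apply/funext => t /=; rewrite scalerBr.
  + exact: cvg_cst.
  + by rewrite -[X in _ --> X](mulr0 `|c|); apply: cvgM => //; exact: cvg_cst.
- under eq_fun => k do rewrite (simple_integralZ c mD (ss k) (sL k)).
  by apply: cvgZ => //; exact: cvg_cst.
Qed.

Lemma has_bochner_integral_in_L1 D f x : measurable D ->
  has_bochner_integral D f x -> in_Lp 1 D f.
Proof. by move=> mD /(has_bochner_integralP _ _ mD)[]. Qed.

Lemma has_bochner_integralB D f g x y : measurable D ->
  has_bochner_integral D f x -> has_bochner_integral D g y ->
  has_bochner_integral D (f \- g) (x - y).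
Proof.
move=> mD hf hg; have := has_bochner_integralD mD hf (has_bochner_integralZ (-1) mD hg).
rewrite scaleN1r (_ : _ \+ _ = f \- g)//.
by apply/funext => t /=; rewrite scaleN1r.
Qed.

Lemma has_bochner_integral_unique D f x y : measurable D ->
  has_bochner_integral D f x -> has_bochner_integral D f y -> x = y.
Proof.
move=> mD hx hy; apply/eqP; rewrite -subr_eq0 -normr_le0.
apply: le_trans (has_bochner_integral_norm mD (has_bochner_integralB mD hx hy)) _.
rewrite (_ : _ \- _ = fun=> 0); last by apply/funext => t /=; rewrite subrr.
by have [_ ->] := in_Lp_cst0 le11 D (0 : X).
Qed.

Lemma has_bochner_integral_ae D f g x : measurable D ->
  {ae mu, forall t, D t -> f t = g t} ->
  has_bochner_integral D f x -> has_bochner_integral D g x.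
Proof.
move=> mD fg /(has_bochner_integralP _ _ mD)[fL [s [ss sL sf sx]]].
apply/(has_bochner_integralP _ _ mD); split; first by have [] := in_Lp_ae le11 mD fg fL.
exists s; split => //; move: sf; apply: cvg_trans; apply: near_eq_cvg.
apply: nearW => k; have [h1 _] := in_LpB le11 mD fL (sL k).
have [] // := @in_Lp_ae _ _ le11 _ _ _ (g \- s k) mD _ h1.
by apply: aeS fg => t + Dt => /(_ Dt) /= ->.
Qed.

Lemma has_bochner_integral_if D E f x : measurable D -> measurable E ->
  has_bochner_integral (D `&` E) f x <->
  has_bochner_integral D (fun t => if t \in E then f t else 0) x.
Proof.
move=> mD mE; have mDE : measurable (D `&` E) by exact: measurableI.
have dir y : has_bochner_integral (D `&` E) f y ->
    has_bochner_integral D (fun t => if t \in E then f t else 0) y.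
  move=> /(has_bochner_integralP _ _ mDE)[fL [s [ss sL sf sx]]].
  apply/(has_bochner_integralP _ _ mD).
  split; first by have [] := in_Lp_if le11 mD mE fL.
  exists (fun k t => if t \in E then s k t else 0); split.
  - by move=> k; apply: simple_function_if => //; exact: simple_function_cst.
  - by move=> k; have [] := in_Lp_if le11 mD mE (sL k).
  - move: sf; apply: cvg_trans; apply: near_eq_cvg; apply: nearW => k.
    have [h1 _] := in_LpB le11 mDE fL (sL k).
    have [_ <-] := in_Lp_if le11 mD mE h1; congr Lpn.
    by apply/funext => t /=; case: ifP => _ //; rewrite subr0.
  - by under eq_fun do rewrite simple_integral_if//.
split; first exact: dir.
(* For the converse, the restriction has some integral [y] by existence; the direct implication and
   uniqueness give [y = x]. *)
move=> h; have fL : in_Lp 1 (D `&` E) f.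
  have [hL _] := in_LpS le11 mD (@subIsetl _ D E) (has_bochner_integral_in_L1 mD h).
  apply: (proj1 (in_Lp_ae le11 mDE _ hL)); apply: ae_all => t [_ Et].
  by rewrite mem_set.
have [y hy] := has_bochner_integral_exists mDE fL.
by have <- := has_bochner_integral_unique mD (dir y hy) h.
Qed.

End BochnerIntegral.

(** * Change of variables under measure-preserving maps, in particular translations and
    reflections *)

Section MeasurePreserving.
Context {R : realType}.
Local Notation mu := (@lebesgue_measure R).
Implicit Types (X : completeNormedModType R) (D : set R).
Variable T : R -> R.
Hypothesis mT : measurable_fun setT T.
Hypothesis muT : forall A : set R, measurable A -> mu (T @^-1` A) = mu A.
Hypothesis surjT : forall t, exists u, T u = t.

Let mpre (A : set R) : measurable A -> measurable (T @^-1` A).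
Proof. by move=> mA; rewrite -[_ @^-1` _]setTI; exact: mT. Qed.

Lemma ae_preserving (P : R -> Prop) :
  {ae mu, forall t, P t} -> {ae mu, forall t, P (T t)}.
Proof.
move=> [N [mN N0 badN]]; exists (T @^-1` N); split.
- exact: mpre.
- by rewrite muT.
- by move=> t /= h; exact: badN.
Qed.

Lemma simple_function_preserving X (s : R -> X) :
  simple_function s -> simple_function (s \o T).
Proof.
move=> [fs ms]; split; last by move=> x; rewrite comp_preimage; exact: mpre.
by apply: sub_finite_set fs => _ [t _ <-]; exists (T t).
Qed.

Lemma strongly_measurable_preserving X D (f : R -> X) :
  strongly_measurable D f -> strongly_measurable (T @^-1` D) (f \o T).
Proof.
move=> [s [ss sf]]; exists (fun k => s k \o T); split.
  by move=> k; exact: simple_function_preserving.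
exact: (ae_preserving sf).
Qed.

Lemma ge0_integral_preserving D (G : R -> \bar R) : measurable D ->
  measurable_fun setT G -> (forall t, 0 <= G t)%E ->
  (\int[mu]_(t in T @^-1` D) G (T t) = \int[mu]_(t in D) G t)%E.
Proof.
move=> mD mG G0.
have := @ge0_integral_pushforward _ _ (measurableTypeR R) (measurableTypeR R) R T mT
  lebesgue_measure D G mD (measurable_funS measurableT (@subsetT _ D) mG)
  (fun t _ => G0 t).
move=> <-; apply: eq_measure_integral => A mA _.
exact: muT.
Qed.

Lemma Lp_norm_preserving X (p : R) D (f : R -> X) : 1 <= p -> measurable D ->
  strongly_measurable D f -> Lp_norm p (T @^-1` D) (f \o T) = Lp_norm p D f.
Proof.
move=> p1 mD mf; have [G [mG G0 GD fG]] := strongly_measurable_norm mD mf.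
apply: (congr1 (fun z : \bar R => (z `^ p^-1)%E)).
transitivity (\int[mu]_(t in D) (G t `^ p)%:E)%E; last first.
  apply: ge0_eq_integral_ae; [exact: mD|by move=> t _; rewrite lee_fin powR_ge0
    |by move=> t _; rewrite lee_fin powR_ge0|].
  by apply: aeS fG => t + Dt => /(_ Dt) ->.
rewrite -(@ge0_integral_preserving D (fun t => (G t `^ p)%:E) mD); last first.
- by move=> t; rewrite lee_fin powR_ge0.
- apply/measurable_EFinP; apply: (@measurableT_comp _ _ _ _ _ _ (fun x => x `^ p)) => //.
apply: ge0_eq_integral_ae; [exact: mpre|by move=> t _; rewrite lee_fin powR_ge0
  |by move=> t _; rewrite lee_fin powR_ge0|].
by apply: aeS (ae_preserving fG) => t + Dt => /(_ Dt) /= ->.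
Qed.

Lemma in_Lp_preserving X (p : R) D (f : R -> X) : 1 <= p -> measurable D ->
  in_Lp p D f -> in_Lp p (T @^-1` D) (f \o T) /\
  Lpn p (T @^-1` D) (f \o T) = Lpn p D f.
Proof.
move=> p1 mD [mf fo]; split; last by rewrite Lpn.unlock Lp_norm_preserving.
by split; [exact: strongly_measurable_preserving|rewrite Lp_norm_preserving].
Qed.

Lemma simple_integral_preserving X D (s : R -> X) : measurable D ->
  simple_function s ->
  simple_integral (T @^-1` D) (s \o T) = simple_integral D s.
Proof.
move=> mD [fs ms]; rewrite /simple_integral (_ : range (s \o T) = range s).
  apply: eq_fsbigr => x _; congr (fine _ *: _).
  rewrite comp_preimage -preimage_setI; apply: muT.
  by apply: measurableI => //; exact: ms.
apply/seteqP; split=> _ [t _ <-]; first by exists (T t).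
by have [u <-] := surjT t; exists u.
Qed.

Lemma has_bochner_integral_preserving X D (f : R -> X) x : measurable D ->
  has_bochner_integral D f x -> has_bochner_integral (T @^-1` D) (f \o T) x.
Proof.
move=> mD /(has_bochner_integralP _ _ mD)[fL [s [ss sL sf sx]]].
apply/has_bochner_integralP; first exact: mpre.
have le11 : (1 : R) <= 1 by exact: lexx.
split; first by have [] := in_Lp_preserving le11 mD fL.
exists (fun k => s k \o T); split.
- by move=> k; exact: simple_function_preserving.
- by move=> k; have [] := in_Lp_preserving le11 mD (sL k).
- move: sf; apply: cvg_trans; apply: near_eq_cvg; apply: nearW => k.
  have [h1 _] := in_LpB le11 mD fL (sL k).
  by have [_ <-] := in_Lp_preserving le11 mD h1.
- by under eq_fun do rewrite simple_integral_preserving//.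
Qed.

End MeasurePreserving.

Section AffineMaps.
Context {R : realType}.
Local Notation mu := (@lebesgue_measure R).

Lemma lebesgue_measure_shift (c : R) (A : set R) : measurable A ->
  mu ((fun t => c + t) @^-1` A) = mu A.
Proof.
move=> mA.
have mT : measurable_fun setT ((fun t => c + t) : measurableTypeR R -> measurableTypeR R).
  by apply: measurable_funD => //; exact: measurable_cst.
suff : pushforward mu ((fun t => c + t) : measurableTypeR R -> measurableTypeR R) A = mu A by [].
apply/esym/lebesgue_measure_unique => //= _ [[a b]] _ <-.
rewrite /pushforward (_ : _ @^-1` _ = `](a - c), (b - c)]%classic).
  rewrite !lebesgue_measure_itv/= !lte_fin ltrD2r; case: ifP => // _.
  by rewrite !EFinD; congr (_%:E); ring.
by apply/seteqP; split=> t /=; rewrite !in_itv/= ltrBlDl lerBrDl.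
Qed.

Lemma lebesgue_measure_reflect (c : R) (A : set R) : measurable A ->
  mu ((fun t => c - t) @^-1` A) = mu A.
Proof.
move=> mA; have mB : measurable ((fun t => c + t) @^-1` A).
  rewrite -[X in measurable X]setTI.
  by apply: (measurable_funD (measurable_cst c) (@measurable_id _ _ setT)).
rewrite -[RHS](lebesgue_measure_shift c mA) -[RHS](lebesgue_measureN mB).
by [].
Qed.

End AffineMaps.

(** * Comparison with the Lebesgue integral of real functions *)

Section RealValued.
Context {R : realType}.
Local Notation mu := (@lebesgue_measure R).
Import HBSimple HBNNSimple.

Lemma sfun_simple_function (s : {sfun R >-> R}) : simple_function (s : R -> R^o).
Proof. by split; [exact: fimfunP|move=> x; exact: measurable_sfunP]. Qed.

Lemma measurable_strongly_measurable (D : set R) (h : R -> R) :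
  measurable_fun setT h -> strongly_measurable D (h : R -> R^o).
Proof.
move=> mh; have mh' : measurable_fun setT (EFin \o h) by exact/measurable_EFinP.
have [g gh] := approximation_sfun measurableT mh'.
exists (fun k => (g k : R -> R^o)); split; first by move=> k; exact: sfun_simple_function.
by apply: ae_all => t _; have /fine_cvgP[_] := gh t I.
Qed.

Lemma continuous_strongly_measurable (D : set R) (h : R -> R) :
  continuous h -> strongly_measurable D (h : R -> R^o).
Proof.
move=> ch; apply: measurable_strongly_measurable.
exact: continuous_measurable_fun.
Qed.

Lemma simple_integral_ge0 (D : set R) (s : R -> R^o) : measurable D ->
  simple_function s -> (forall t, 0 <= (s t : R)) -> in_Lp 1 D s ->
  (simple_integral D s)%:E = (\int[mu]_(t in D) (s t : R)%:E)%E.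
Proof.
move=> mD ss s0 sL; have [fs ms] := ss.
have -> : (\int[mu]_(t in D) (s t : R)%:E)%E =
    (\int[mu]_(t in D) \sum_(x \in range s) ((x : R) * \1_(s @^-1` [set x]) t)%:E)%E.
  apply: eq_integral => t _; rewrite (fsbigD1 (s t))//=; last by exists t.
  rewrite indicE mem_set// mulr1 fsbig1 ?adde0// => x [_ /= xs].
  by rewrite indicE memNset ?mulr0// => /= h; apply: xs.
have -> : (\int[mu]_(t in D) \sum_(x \in range s) ((x : R) * \1_(s @^-1` [set x]) t)%:E)%E
  = (\int[mu]_(t in D) \sum_(x \in range s) (`|x : R| * \1_(s @^-1` [set x]) t)%:E)%E.
  apply: eq_integral => t _; apply: eq_fsbigr => _ /set_mem [u _ <-].
  by rewrite ger0_norm.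
rewrite ge0_integral_fsum//; last first.
  move=> x; apply/measurable_EFinP/measurable_funM; first exact: measurable_cst.
  apply: measurable_indic; exact: ms.
rewrite /simple_integral -fsumEFin//; apply: eq_fsbigr => x xs.
rewrite (integralZ_indic mD (ms x) (normr_ge0 _)).
have [->|x0] := eqVneq x 0; first by rewrite normr0 scaler0 mul0e.
rewrite -[fine _ *: x]/(fine _ * x) EFinM muleC fineK; last first.
  by rewrite ge0_fin_numE// (simple_function_fin_measure (lexx 1)).
by rewrite ger0_norm//; have /set_mem[u _ <-] := xs.
Qed.

Lemma has_bochner_integral_ge0 (D : set R) (h : R -> R) : measurable D ->
  measurable_fun setT h -> (forall t, 0 <= h t) -> in_Lp 1 D (h : R -> R^o) ->
  has_bochner_integral D (h : R -> R^o) (fine (\int[mu]_(t in D) (h t)%:E)%E).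
Proof.
move=> mD mh h0 hL; have mh' : measurable_fun setT (EFin \o h) by exact/measurable_EFinP.
have h0' : forall t, setT t -> (0 <= (EFin \o h) t)%E by move=> t _; rewrite lee_fin.
pose s k : {nnsfun R >-> R} := nnsfun_approx measurableT mh' k.
have sh t : s k t @[k --> \oo] --> h t.
  by have := cvg_nnsfun_approx measurableT mh' h0' (I : setT t); move=> /fine_cvgP[_].
have nds t : nondecreasing_seq (fun k => s k t).
  by move=> m n mn; exact/lefP/nd_nnsfun_approx.
have s_le k t : s k t <= h t.
  have := nondecreasing_cvgn_le (nds t); rewrite (cvg_lim _ (sh t))//; apply.
  exact: sh.
have s0 k t : 0 <= s k t by [].
have le11 : (1 : R) <= 1 by exact: lexx.
have ss k : simple_function (s k : R -> R^o).
  by split; [exact: fimfunP|move=> x; exact: measurable_sfunP].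
have sL k : in_Lp 1 D (s k : R -> R^o).
  apply: (proj1 (in_Lp_le1 le11 mD _ ler01 hL _)).
    exact: simple_strongly_measurable.
  by apply: ae_all => t _; rewrite mul1r !ger0_norm.
have msD k : measurable_fun D (fun t => (s k t)%:E : \bar R).
  by apply/measurable_EFinP; apply: (measurable_funS measurableT).
have sint k : (simple_integral D (s k : R -> R^o))%:E = (\int[mu]_(t in D) (s k t)%:E)%E.
  exact: (simple_integral_ge0 mD (ss k) (s0 k) (sL k)).
apply/(has_bochner_integralP _ _ mD); split; first exact: hL.
exists (fun k => (s k : R -> R^o)).
split => //.
- apply: (proj2 (in_Lp_dominated_cvg le11 mD _ hL _ _)).
  + move=> k; apply: strongly_measurableB; first by have [] := hL.
    by have [] := sL k.
  + apply: ae_all => t _ k; rewrite [leRHS]ger0_norm// ger0_norm ?subr_ge0//.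
    by rewrite lerBlDl lerDr.
  + apply: ae_all => t _; rewrite -(subrr (h t : R^o)).
    by apply: cvgB; [exact: cvg_cst|exact: sh].
- have hfin : (\int[mu]_(t in D) (h t)%:E)%E \is a fin_num.
    rewrite ge0_fin_numE; last by apply: integral_ge0 => t _; rewrite lee_fin.
    have := proj2 hL; rewrite Lp_norm1; congr (_ < _)%E.
    by apply: eq_integral => t _; rewrite ger0_norm.
  have : (\int[mu]_(t in D) (s k t)%:E)%E @[k --> \oo] --> (\int[mu]_(t in D) (h t)%:E)%E.
    have := @cvg_monotone_convergence _ _ R mu D mD (fun k t => (s k t)%:E).
    have -> : (\int[mu]_(x in D) limn (fun k => (s k x)%:E))%E = (\int[mu]_(t in D) (h t)%:E)%E.
      apply: eq_integral => t _; apply: cvg_lim => //.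
      exact: cvg_nnsfun_approx.
    apply.
    + exact: msD.
    + by move=> k t _; rewrite lee_fin.
    + by move=> t _ m n mn; rewrite lee_fin; exact: nds.
  rewrite -{1}(fineK hfin) => /fine_cvgP[_]; apply: cvg_trans.
  by apply: near_eq_cvg; apply: nearW => k /=; rewrite -sint.
Qed.

(** Identifies the Bochner integral of a real function with its Lebesgue integral, for which the
    fundamental theorem of calculus is available. Positive and negative parts are treated
    separately, each by increasing simple functions. *)
Lemma has_bochner_integral_real (D : set R) (h : R -> R) : measurable D ->
  measurable_fun setT h -> in_Lp 1 D (h : R -> R^o) ->
  has_bochner_integral D (h : R -> R^o) (fine (\int[mu]_(t in D) (h t)%:E)%E).
Proof.
move=> mD mh hL; have le11 : (1 : R) <= 1 by exact: lexx.
have mp : measurable_fun setT (h^\+) by exact: measurable_funrpos.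
have mn : measurable_fun setT (h^\-) by exact: measurable_funrneg.
have pL : in_Lp 1 D (h^\+ : R -> R^o).
  apply: (proj1 (in_Lp_le1 le11 mD _ ler01 hL _)).
    exact: measurable_strongly_measurable.
  apply: ae_all => t _; rewrite mul1r ger0_norm ?funrpos_ge0//.
  by rewrite /funrpos ge_max ler_norm normr_ge0.
have nL : in_Lp 1 D (h^\- : R -> R^o).
  apply: (proj1 (in_Lp_le1 le11 mD _ ler01 hL _)).
    exact: measurable_strongly_measurable.
  apply: ae_all => t _; rewrite mul1r ger0_norm ?funrneg_ge0//.
  by rewrite /funrneg ge_max -normrN ler_norm normr_ge0.
have fin (k : R -> R) : (forall t, 0 <= k t) -> in_Lp 1 D (k : R -> R^o) ->
    (\int[mu]_(t in D) (k t)%:E)%E \is a fin_num.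
  move=> k0 kL; rewrite ge0_fin_numE; last by apply: integral_ge0 => t _; rewrite lee_fin.
  have := proj2 kL; rewrite Lp_norm1; congr (_ < _)%E.
  by apply: eq_integral => t _; rewrite ger0_norm.
have := has_bochner_integralB mD
  (has_bochner_integral_ge0 mD mp (fun t => funrpos_ge0 _ t) pL)
  (has_bochner_integral_ge0 mD mn (fun t => funrneg_ge0 _ t) nL).
rewrite -fineB ?fin//; try by move=> t; rewrite ?funrpos_ge0 ?funrneg_ge0.
rewrite (_ : (_ - _)%E = (\int[mu]_(t in D) (h t)%:E)%E); last first.
  rewrite [RHS]integralE; congr (_ - _)%E; apply: eq_integral => t _.
    by rewrite funeposE /funrpos EFin_max.
  by rewrite funenegE /funrneg EFin_max.
by rewrite (_ : (_ \- _) = h)//; exact: (funrposBneg h).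
Qed.

Lemma has_bochner_integral_scaler {X : completeNormedModType R} (D : set R)
    (h : R -> R^o) (y : R) (x : X) : measurable D ->
  has_bochner_integral D h (y : R^o) ->
  has_bochner_integral D (fun t => (h t : R) *: x) (y *: x).
Proof.
move=> mD /(has_bochner_integralP _ _ mD)[fL [s [ss sL sf sx]]].
have le11 : (1 : R) <= 1 by exact: lexx.
have lift (k : R -> R^o) : in_Lp 1 D k -> in_Lp 1 D (fun t => (k t : R) *: x) /\
    Lpn 1 D (fun t => (k t : R) *: x) <= `|x| * Lpn 1 D k.
  move=> kL; apply: in_Lp_le1 => //.
    apply: strongly_measurable_scale; first by have [] := kL.
    exact: strongly_measurable_cst.
  by apply: ae_all => t _; rewrite normrZ mulrC.
apply/(has_bochner_integralP _ _ mD); split; first by have [] := lift _ fL.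
exists (fun k t => (s k t : R) *: x); split.
- by move=> k; exact: (simple_function1 (fun z : R^o => (z : R) *: x)).
- by move=> k; have [] := lift _ (sL k).
- apply: (@squeeze_cvgr _ _ _ _ (fun=> 0) (fun k => `|x| * Lpn 1 D (h \- s k))).
  + apply: nearW => k; rewrite Lpn_ge0/=.
    have [h1 _] := in_LpB le11 mD fL (sL k).
    have [_] := lift _ h1; apply: le_trans.
    rewrite (_ : _ \- _ = (fun t => ((h \- s k) t : R) *: x))//.
    by apply/funext => t /=; rewrite scalerBl.
  + exact: cvg_cst.
  + by rewrite -[X in _ --> X](mulr0 `|x|); apply: cvgM => //; exact: cvg_cst.
- have -> : (fun k => simple_integral D (fun t => (s k t : R) *: x)) =
      (fun k => (simple_integral D (s k) : R) *: x).
    apply/funext => k; have [fs ms] := ss k.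
    rewrite (@simple_integral_comp _ _ _ _ (s k) (fun z => (z : R) *: x))//.
      rewrite /simple_integral !fsbig_finite// scaler_suml.
      by apply: eq_bigr => z _; rewrite scalerA.
    move=> z zx; apply: (simple_function_fin_measure (lexx 1) mD (ss k) (sL k)).
    by apply: contra_neq zx => ->; rewrite scale0r.
  by apply: cvgZ => //; exact: cvg_cst.
Qed.

(** In place of Hölder's inequality: [|g| <= 1 + |g|^p] pointwise, which for [g] of norm at most 1
    gives an integral of at most [m + 1]; the general case follows by scaling. Hence the constant
    [m + 1]. *)
Lemma in_Lp_in_L1 {X : completeNormedModType R} (p m : R) (D : set R) (f : R -> X) :
  1 <= p -> measurable D -> 0 <= m -> (mu D <= m%:E)%E -> in_Lp p D f ->
  in_Lp 1 D f /\ Lpn 1 D f <= (m + 1) * Lpn p D f.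
Proof.
move=> p1 mD m0 muD fL; have le11 : (1 : R) <= 1 by exact: lexx.
have p0 : 0 < p by exact: lt_le_trans ltr01 p1.
have m10 : 0 < m + 1 by exact: ltr_pwDr.
have unit (g : R -> X) : in_Lp p D g -> Lpn p D g <= 1 -> in_Lp 1 D g /\ Lpn 1 D g <= m + 1.
  move=> gL g1; apply: in_Lp_lee; first by have [] := gL.
  have [G [mG G0 GD gG]] := strongly_measurable_norm mD (proj1 gL).
  have mGp : measurable_fun D (fun t => (G t `^ p)%:E).
    apply/measurable_EFinP; apply: (@measurableT_comp _ _ _ _ _ _ (fun x => x `^ p)).
      exact: measurable_powR.
    exact: measurable_funS mG.
  rewrite Lp_norm1; apply: (@le_trans _ _ (\int[mu]_(t in D) (1 + (G t `^ p)%:E))%E).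
    apply: ge0_le_integral_ae => //.
      by move=> t _; rewrite adde_ge0// lee_fin powR_ge0.
    apply: aeS gG => t + Dt => /(_ Dt) ->; rewrite -EFinD lee_fin.
    have [Gt|Gt] := leP (G t) 1; first by rewrite (le_trans Gt)// lerDl powR_ge0.
    by rewrite (le_trans (le1r_powR (ltW Gt) p1))// lerDr.
  rewrite ge0_integralD//; last by move=> t _; rewrite lee_fin powR_ge0.
  rewrite integral_cst// mul1e EFinD leeD//.
  rewrite -lee_fin -LpnE// Lp_norm_lee// powR1 in g1; apply: le_trans g1.
  apply: ge0_le_integral_ae; [exact: mD|by move=> t _; rewrite lee_fin powR_ge0
    |by move=> t _; rewrite lee_fin powR_ge0|].
  by apply: aeS gG => t + Dt => /(_ Dt) ->.
(* Scaling by a strict upper bound [l] of the norm rather than by the norm itself includes the case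
   of norm 0. *)
have main (l : R) : Lpn p D f < l -> in_Lp 1 D f /\ Lpn 1 D f <= (m + 1) * l.
  move=> fl; have l0 : 0 < l by exact: le_lt_trans (Lpn_ge0 _ _ _) fl.
  have [gL g1] := in_LpZ p1 l^-1 mD fL.
  have [|hL h1] := unit _ gL.
    rewrite (le_trans g1)// ger0_norm ?invr_ge0 ?(ltW l0)//.
    by rewrite ler_pdivrMl// mulr1 ltW.
  have [kL k1] := in_LpZ le11 l mD hL.
  rewrite (_ : (fun t => l *: (l^-1 *: f t)) = f) in kL k1; last first.
    by apply/funext => t; rewrite scalerA mulfV ?scale1r// gt_eqF.
  split => //; rewrite (le_trans k1)// (gtr0_norm l0) mulrC.
  by rewrite ler_wpM2r// (ltW l0).
split.
  by have [] // := main (Lpn p D f + 1); rewrite ltrDl.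
apply/ler_addgt0Pr => e e0.
have e'0 : 0 < e / (m + 1) by rewrite divr_gt0.
have [|_] := main (Lpn p D f + e / (m + 1)); first by rewrite ltrDl.
by rewrite mulrDr mulrCA mulfV ?mulr1// gt_eqF.
Qed.

End RealValued.

(** * Weak derivatives *)

Section TestFunctions.
Context {R : realType}.
Local Notation mu := (@lebesgue_measure R).
Implicit Types (I J : set R) (phi : R -> R).

(** Both integrals equal the one over the whole line. This moves integrals of functions multiplied
    by a test function from one interval to another. *)
Lemma has_bochner_integral_support {X : completeNormedModType R} (D E : set R)
    (f : R -> X) (x : X) : measurable D -> measurable E ->
  (forall t, f t != 0 -> D t /\ E t) ->
  has_bochner_integral D f x -> has_bochner_integral E f x.
Proof.
move=> mD mE fDE.
have restr (A : set R) : (forall t, f t != 0 -> A t) ->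
    (fun t => if t \in A then f t else 0) = f.
  move=> fA; apply/funext => t; case: ifPn => // /negP tA.
  have [->//|/fA At] := eqVneq (f t) 0.
  by exfalso; apply: tA; exact/mem_set.
have hD := has_bochner_integral_if f x measurableT mD.
have hE := has_bochner_integral_if f x measurableT mE.
rewrite setTI restr in hD; last by move=> t /fDE[].
rewrite setTI restr in hE; last by move=> t /fDE[].
by move=> /hD/hE.
Qed.

Lemma test_functionS I J phi : I `<=` J -> test_function I phi -> test_function J phi.
Proof.
by move=> IJ [h1 h2 h3 h4]; split => //; apply: subset_trans h4 (interiorS IJ).
Qed.

Lemma test_function_continuous I phi : test_function I phi -> continuous phi.
Proof.
move=> [h _ _ _] t; apply/differentiable_continuous.
by apply/derivable1_diffP; exact: h.
Qed.

Lemma derive1_out phi t : ~ closure [set t | phi t != 0] t ->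
  phi t = 0 /\ derive1 phi t = 0.
Proof.
move=> nt; split.
  by apply: contrapT => h; apply/nt/subset_closure => /=; exact/eqP.
have : open (~` closure [set t | phi t != 0]).
  by apply: closed_openC; exact: closed_closure.
rewrite openE => /(_ t nt) nb.
rewrite derive1E; transitivity ('D_1 (cst (0 : R)) t); last exact: derive_cst.
apply: near_eq_derive; apply: filterS nb => s ns.
by apply: contrapT => h; apply/ns/subset_closure => /=; exact/eqP.
Qed.

Lemma test_function_out I phi t : test_function I phi -> ~ I t ->
  phi t = 0 /\ derive1 phi t = 0.
Proof. by move=> [h1 h2 h3 h4] It; apply: derive1_out => /h4/interior_subset. Qed.

Lemma test_function_bounded I phi : test_function I phi ->
  exists N C : R, [/\ 0 < N, 0 <= C,
    forall t, N < `|t| -> phi t = 0 /\ derive1 phi t = 0 &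
    forall t, `|phi t| <= C /\ `|derive1 phi t| <= C].
Proof.
move=> tf; have [h1 h2 h3 h4] := tf; have h5 := test_function_continuous tf.
have /compact_bounded := h3.
move=> /pinfty_ex_gt0[N N0 NP].
have out t : N < `|t| -> phi t = 0 /\ derive1 phi t = 0.
  by move=> Nt; apply: derive1_out => /NP /=; rewrite leNgt Nt.
have bnd (h : R -> R) : continuous h -> exists C, forall t, t \in `[(- N), N] -> `|h t| <= C.
  move=> hc; have [] := @EVT_max R (fun t => `|h t|) (- N) N.
  - by lra.
  - apply: continuous_subspaceT => t.
    by apply: continuous_comp; [exact: hc|exact: norm_continuous].
  - by move=> c _ cP; exists `|h c|.
have [C1 C1P] := bnd _ h5; have [C2 C2P] := bnd _ h2.
exists N, (Num.max 0 (Num.max C1 C2)); split => //.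
- by rewrite le_max lexx.
- move=> t; have [/out[-> ->]|tN] := ltP N `|t|.
    by rewrite normr0 le_max lexx.
  have tN' : t \in `[(- N), N] by rewrite in_itv/= -ler_norml.
  by rewrite !le_max (C1P _ tN') (C2P _ tN') !orbT.
Qed.

(** The test function vanishes at both ends of [[-(N + 1), N + 1]], so its derivative has integral
    0. Consequently a constant may be subtracted from [u] in a pairing with [phi']. *)
Lemma has_bochner_integral_derive1 {X : completeNormedModType R} I phi (x : X) :
  measurable I -> test_function I phi ->
  has_bochner_integral I (fun t => derive1 phi t *: x) 0.
Proof.
move=> mI tf; have [h1 h2 h3 h4] := tf; have h5 := test_function_continuous tf.
have [N [C [N0 C0 out bnd]]] := test_function_bounded tf.
pose J := `[(- (N + 1)), N + 1]%classic : set R.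
have mJ : measurable J by exact: measurable_itv.
have le11 : (1 : R) <= 1 by exact: lexx.
have L1 : in_Lp 1 J (derive1 phi : R -> R^o).
  have c1 : in_Lp 1 J ((fun=> 1) : R -> R^o) by exact: in_Lp_cst.
  apply: (proj1 (@in_Lp_le1 R 1 le11 R^o R^o J (derive1 phi : R -> R^o) C _ mJ _ C0 c1 _)).
    exact: continuous_strongly_measurable.
  by apply: ae_all => t _; rewrite normr1 mulr1; have [_] := bnd t.
have := has_bochner_integral_real mJ (continuous_measurable_fun h2) L1.
rewrite (@continuous_FTC2 _ _ phi); first last.
- by [].
- have cN : {within `[(- (N + 1)), N + 1], continuous phi}.
    exact: continuous_subspaceT.
  have /continuous_within_itvP [|_ hr hl] := cN; first by lra.
  split => //= t _; exact: h1.
- exact: continuous_subspaceT.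
- by lra.
have [-> _] : phi (N + 1) = 0 /\ derive1 phi (N + 1) = 0.
  by apply: out; rewrite ger0_norm; lra.
have [-> _] : phi (- (N + 1)) = 0 /\ derive1 phi (- (N + 1)) = 0.
  by apply: out; rewrite normrN ger0_norm; lra.
rewrite subee//= => /(has_bochner_integral_scaler x mJ); rewrite scale0r.
apply: has_bochner_integral_support => // t ht; split.
  rewrite /J /= in_itv/= -ler_norml; apply: contrapT => /negP.
  rewrite -ltNge => tN; move: ht.
  by have [|_ ->] := out t; rewrite ?scale0r ?eqxx//; lra.
apply: contrapT => /(test_function_out tf)[_ h]; move: ht.
by rewrite h scale0r eqxx.
Qed.

Lemma in_L1_scale_bounded {X : completeNormedModType R} (p : R) I (N C : R)
    (h : R -> R) (u : R -> X) : 1 <= p -> measurable I -> 0 < N -> 0 <= C ->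
  continuous h -> (forall t, N < `|t| -> h t = 0) -> (forall t, `|h t| <= C) ->
  in_Lp p I u -> in_Lp 1 I (fun t => h t *: u t) /\
  Lpn 1 I (fun t => h t *: u t) <= C * (2 * N + 1) * Lpn p I u.
Proof.
move=> p1 mI N0 C0 hc hN hC uL; have le11 : (1 : R) <= 1 by exact: lexx.
pose J := `[(- N), N]%classic : set R.
have mJ : measurable J by exact: measurable_itv.
have mIJ : measurable (I `&` J) by exact: measurableI.
have [uL' u1] := in_LpS p1 mI (@subIsetl _ I J) uL.
have muIJ : (mu (I `&` J) <= (2 * N)%:E)%E.
  apply: (@le_trans _ _ (mu J)).
    by apply: le_measure; rewrite ?inE//; exact: subIsetr.
  rewrite /J lebesgue_measure_itv/= lte_fin ifT; last by lra.
  by rewrite lee_fin; lra.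
have [vL v1] := in_Lp_in_L1 p1 mIJ (mulr_ge0 (ler0n R 2) (ltW N0)) muIJ uL'.
have [wL w1] := in_Lp_if le11 mI mJ vL.
have [kL k1] : in_Lp 1 I (fun t => h t *: u t) /\
    Lpn 1 I (fun t => h t *: u t) <= C * Lpn 1 I (fun t => if t \in J then u t else 0).
  apply: in_Lp_le1 => //.
    apply: strongly_measurable_scale; last by have [] := uL.
    exact: continuous_strongly_measurable.
  apply: ae_all => t _; case: ifPn => [_|/negP tJ].
    by rewrite normrZ ler_wpM2r.
  rewrite hN ?scale0r ?normr0 ?mulr0//; rewrite ltNge; apply/negP => tN.
  by apply: tJ; rewrite inE /J/= in_itv/= -ler_norml.
split => //; rewrite (le_trans k1)// -mulrA ler_wpM2l// w1 (le_trans v1)//.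
by rewrite ler_wpM2l//; lra.
Qed.

End TestFunctions.

Section WeakDerivative.
Context {R : realType} {X : completeNormedModType R}.
Variable p : R.
Hypothesis p_ge1 : 1 <= p.
Implicit Types (I J : set R) (phi : R -> R) (u g : R -> X).

(** For [u] and [g] in L^p, being a weak derivative means that this integrand has integral 0 for
    every test function. One integral, jointly linear in [(u, g)], replaces the two integrals with a
    common value [x] in the definition. *)
Definition weak_pairing phi u g (t : R) : X := derive1 phi t *: u t + phi t *: g t.

Lemma weak_pairing_L1 I phi : measurable I -> test_function I phi ->
  exists2 C, 0 <= C & forall u g, in_Lp p I u -> in_Lp p I g ->
    in_Lp 1 I (weak_pairing phi u g) /\
    Lpn 1 I (weak_pairing phi u g) <= C * (Lpn p I u + Lpn p I g).
Proof.
move=> mI tf; have [N [C [N0 C0 out bnd]]] := test_function_bounded tf.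
have [_ h2 _ _] := tf; have h5 := test_function_continuous tf.
exists (C * (2 * N + 1)); first by rewrite mulr_ge0//; lra.
move=> u g uL gL.
have [uL1 u1] : in_Lp 1 I (fun t => derive1 phi t *: u t) /\
  Lpn 1 I (fun t => derive1 phi t *: u t) <= C * (2 * N + 1) * Lpn p I u.
  apply: in_L1_scale_bounded => // t; first by move=> /out[].
  by have [] := bnd t.
have [gL1 g1] : in_Lp 1 I (fun t => phi t *: g t) /\
  Lpn 1 I (fun t => phi t *: g t) <= C * (2 * N + 1) * Lpn p I g.
  apply: in_L1_scale_bounded => // t; first by move=> /out[].
  by have [] := bnd t.
have [sL s1] := in_LpD (lexx _) mI uL1 gL1.
split => //; rewrite mulrDr; apply: le_trans s1 _; exact: lerD.
Qed.

Lemma is_weak_derivativeP I u g : measurable I -> in_Lp p I u -> in_Lp p I g ->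
  is_weak_derivative I u g <->
  forall phi, test_function I phi -> has_bochner_integral I (weak_pairing phi u g) 0.
Proof.
move=> mI uL gL; split=> [h phi tf|h phi tf].
  by have [x hx hg] := h phi tf; rewrite -(subrr x); exact: has_bochner_integralD.
have hK := h phi tf.
have [N [C [N0 C0 out bnd]]] := test_function_bounded tf.
have [_ h2 _ _] := tf; have h5 := test_function_continuous tf.
have [uL1 _] : in_Lp 1 I (fun t => derive1 phi t *: u t) /\
  Lpn 1 I (fun t => derive1 phi t *: u t) <= C * (2 * N + 1) * Lpn p I u.
  apply: in_L1_scale_bounded => // t; first by move=> /out[].
  by have [] := bnd t.
have [x hx] := has_bochner_integral_exists mI uL1.
exists x => //; have := has_bochner_integralB mI hK hx.
rewrite sub0r; congr has_bochner_integral; apply/funext => t /=.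
by rewrite /weak_pairing addrC addKr.
Qed.

End WeakDerivative.

(** * Cutoff functions of class C^1 *)

Section Cutoff.
Context {R : realType}.
Implicit Types (s e t : R).

(** A remainder bounded by a multiple of [h ^ 2] for all [h] gives the derivative. For piecewise
    quadratic functions this avoids matching one-sided derivatives at the nodes. *)
Lemma is_derive_quadratic (f : R -> R) (x l C : R) :
  (forall h, `|f (h + x) - f x - h * l| <= C * h ^+ 2) -> is_derive x 1 f l.
Proof.
move=> hf.
have cv : h^-1 *: (f (h *: 1 + x) - f x) @[h --> 0^'] --> l.
  apply/cvgrPdist_le => e e0; have C10 : 0 < `|C| + 1 by rewrite ltr_wpDl.
  have e'0 : 0 < e / (`|C| + 1) by rewrite divr_gt0.
  near=> h.
  have h0 : h != 0 by near: h; exact: nbhs_dnbhs_neq.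
  have he : `|h| < e / (`|C| + 1).
    near: h; apply: dnbhs0_lt; exact: e'0.
  rewrite -[h *: 1]/(h * 1) mulr1 -[_ *: _]/(_ * _) distrC.
  have -> : h^-1 * (f (h + x) - f x) - l = h^-1 * (f (h + x) - f x - h * l).
    by field.
  rewrite normrM normfV ler_pdivrMl ?normr_gt0//.
  rewrite (le_trans (hf h))// -[h ^+ 2]real_normK ?num_real//.
  rewrite (@le_trans _ _ (`|C| * `|h| ^+ 2))//; first by rewrite ler_wpM2r// ler_norm.
  rewrite expr2 mulrCA ler_wpM2l//.
  rewrite ltr_pdivlMr// in he; apply: le_trans (ltW he).
  by rewrite mulrC ler_wpM2l// lerDl.
split; first by apply/cvg_ex; exists l.
by rewrite /derive; apply: cvg_lim.
Unshelve. all: by end_near. Qed.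

(** The truncated square, of class C^1: normalised second differences of it are cutoffs with exactly
    the smoothness required of test functions. *)
Definition sqpos (x : R) : R := Num.max 0 x ^+ 2.

Lemma sqpos_le0 x : x <= 0 -> sqpos x = 0.
Proof. by move=> x0; rewrite /sqpos max_l// expr0n. Qed.

Lemma sqpos_ge0 x : 0 <= x -> sqpos x = x ^+ 2.
Proof. by move=> x0; rewrite /sqpos max_r. Qed.

Lemma is_derive_sqpos (x : R) : is_derive x 1 sqpos (2 * Num.max 0 x).
Proof.
apply: (@is_derive_quadratic _ _ _ 1) => h; rewrite mul1r.
have sq : 0 <= h ^+ 2 by exact: sqr_ge0.
have [x0|x0] := leP 0 x; have [y0|y0] := leP 0 (h + x).
- rewrite (sqpos_ge0 x0) (sqpos_ge0 y0) ler_norml.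
  by apply/andP; split; nra.
- rewrite (sqpos_ge0 x0) (sqpos_le0 (ltW y0)) ler_norml.
  by apply/andP; split; nra.
- rewrite (sqpos_le0 (ltW x0)) (sqpos_ge0 y0) ler_norml.
  by apply/andP; split; nra.
- rewrite (sqpos_le0 (ltW x0)) (sqpos_le0 (ltW y0)) ler_norml.
  by apply/andP; split; nra.
Qed.

(* [cutoff s e] is 0 before [s - e] and 1 after [s + e]: the primitive of the
   hat function of mass 1 supported on [s - e, s + e]. *)
Definition cutoff s e t : R :=
  (sqpos (t - s + e) - 2 * sqpos (t - s) + sqpos (t - s - e)) / (2 * e ^+ 2).

Definition hat s e t : R :=
  (Num.max 0 (t - s + e) - 2 * Num.max 0 (t - s) + Num.max 0 (t - s - e)) / e ^+ 2.

Lemma is_derive_cutoff s e t : 0 < e -> is_derive t 1 (cutoff s e) (hat s e t).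
Proof.
move=> e0; have en0 : e != 0 by rewrite gt_eqF.
have dq c : is_derive t 1 (fun t => sqpos (t - s + c)) (2 * Num.max 0 (t - s + c)).
  apply: (@is_derive_quadratic _ _ _ 1) => h; rewrite mul1r.
  have := is_derive_sqpos (t - s + c).
  have sq : 0 <= h ^+ 2 by exact: sqr_ge0.
  rewrite (_ : h + t - s + c = h + (t - s + c)); last by ring.
  move: (t - s + c) => x _.
  have [x0|x0] := leP 0 x; have [y0|y0] := leP 0 (h + x).
  - rewrite (sqpos_ge0 x0) (sqpos_ge0 y0) ler_norml.
    by apply/andP; split; nra.
  - rewrite (sqpos_ge0 x0) (sqpos_le0 (ltW y0)) ler_norml.
    by apply/andP; split; nra.
  - rewrite (sqpos_le0 (ltW x0)) (sqpos_ge0 y0) ler_norml.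
    by apply/andP; split; nra.
  - rewrite (sqpos_le0 (ltW x0)) (sqpos_le0 (ltW y0)) ler_norml.
    by apply/andP; split; nra.
have d0 := dq 0; have d1 := dq e; have d2 := dq (- e).
have -> : cutoff s e = (2 * e ^+ 2)^-1 *: ((fun t => sqpos (t - s + e)) -
    2 *: (fun t => sqpos (t - s + 0)) + (fun t => sqpos (t - s - e))).
  apply/funext => x; transitivity ((2 * e ^+ 2)^-1 *
    (sqpos (x - s + e) - 2 * sqpos (x - s + 0) + sqpos (x - s - e))) => //.
  by rewrite addr0 mulrC.
apply: is_derive_eq; rewrite /hat /GRing.scale/= addr0; field.
by rewrite en0.
Qed.

Lemma cutoff_lt s e t : 0 < e -> t <= s - e -> cutoff s e t = 0.
Proof.
by move=> e0 ts; rewrite /cutoff !sqpos_le0; lra.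
Qed.

Lemma cutoff_gt s e t : 0 < e -> s + e <= t -> cutoff s e t = 1.
Proof.
move=> e0 ts; have en0 : e != 0 by rewrite gt_eqF.
by rewrite /cutoff !sqpos_ge0; [field; rewrite en0|lra|lra|lra].
Qed.

Lemma hat_ge0 s e t : 0 < e -> 0 <= hat s e t.
Proof.
move=> e0; rewrite /hat divr_ge0 ?sqr_ge0//.
by rewrite /Num.max; do 3 case: ifPn; rewrite -?leNgt; lra.
Qed.

Lemma hat_le s e t : 0 < e -> hat s e t <= e^-1.
Proof.
move=> e0; have en0 : e != 0 by rewrite gt_eqF.
rewrite /hat ler_pdivrMr ?exprn_gt0// expr2 mulKf//.
by rewrite /Num.max; do 3 case: ifPn; rewrite -?leNgt; lra.
Qed.

Lemma hat_out s e t : 0 < e -> e <= `|t - s| -> hat s e t = 0.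
Proof.
move=> e0; rewrite /hat; have [ts|ts] := leP 0 (t - s) => h.
  rewrite ger0_norm// in h.
  rewrite (_ : Num.max 0 (t - s + e) = t - s + e); last by rewrite max_r//; lra.
  rewrite (_ : Num.max 0 (t - s - e) = t - s - e); last by rewrite max_r//; lra.
  by rewrite (_ : _ + _ = 0) ?mul0r//; ring.
rewrite ltr0_norm// in h.
rewrite (_ : Num.max 0 (t - s + e) = 0); last by rewrite max_l//; lra.
rewrite (_ : Num.max 0 (t - s - e) = 0); last by rewrite max_l//; lra.
by rewrite (_ : _ + _ = 0) ?mul0r//; ring.
Qed.

Lemma cutoff_nondecreasing s e : 0 < e -> {homo cutoff s e : x y / x <= y}.
Proof.
move=> e0 x y xy.
have d t : derivable (cutoff s e) t 1 by have [] := is_derive_cutoff s t e0.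
apply: (@ger0_derive1_le_cc R (cutoff s e) x y) => //.
- move=> t _; rewrite derive1E (@derive_val _ _ _ _ _ _ _ (is_derive_cutoff s t e0)).
  exact: hat_ge0.
- by apply: continuous_subspaceT => t; apply/differentiable_continuous/derivable1_diffP.
- by rewrite in_itv/= lexx xy.
- by rewrite in_itv/= lexx xy.
Qed.

Lemma cutoff_itv s e t : 0 < e -> 0 <= cutoff s e t <= 1.
Proof.
move=> e0; apply/andP; split.
  rewrite -(@cutoff_lt s e (Num.min t (s - e))) ?ge_min ?lexx ?orbT//.
  by apply: cutoff_nondecreasing => //; rewrite ge_min lexx.
rewrite -(@cutoff_gt s e (Num.max t (s + e))) ?le_max ?lexx ?orbT//.
by apply: cutoff_nondecreasing => //; rewrite le_max lexx.
Qed.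

Lemma continuous_hat s e : continuous (hat s e).
Proof.
have c (k : R) : continuous (fun t => Num.max 0 (t - s + k)).
  move=> t; apply: (@continuous_max _ _ (fun=> 0) (fun t => t - s + k)); first exact: cvg_cst.
  by apply: cvgD; [apply: cvgB; [exact: cvg_id|exact: cvg_cst]|exact: cvg_cst].
have c0 : continuous (fun t => Num.max 0 (t - s)).
  rewrite (_ : (fun t => _) = (fun t => Num.max 0 (t - s + 0))); first exact: c.
  by apply/funext => t; rewrite addr0.
move=> t; apply: cvgM; last exact: cvg_cst.
apply: cvgD; last exact: (c (- e)).
apply: cvgB; first exact: (c e).
by apply: cvgM; [exact: cvg_cst|exact: c0].
Qed.

End Cutoff.

Section WithinContinuity.
Context {R : realType} {X : normedModType R}.

Lemma within_continuous_epsdelta (I : set R) (u : R -> X) :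
  {within I, continuous u} <-> forall t, I t -> forall e, 0 < e ->
    exists2 d, 0 < d & forall s, I s -> `|s - t| < d -> `|u s - u t| < e.
Proof.
split=> [/subspace_continuousP h t It e e0|h].
  have /cvgrPdist_lt/(_ e e0) := h t It.
  rewrite near_withinE => /nbhs_ballP[d d0 dP]; exists d => // s Is st.
  by rewrite distrC; apply: dP => //; rewrite -ball_normE/= distrC.
apply/subspace_continuousP => t It; apply/cvgrPdist_lt => e e0.
have [d d0 dP] := h t It e e0.
rewrite near_withinE; apply/nbhs_ballP; exists d => // s.
by rewrite -ball_normE/= distrC => st Is; rewrite distrC; exact: dP.
Qed.

End WithinContinuity.

Section WeakDerivativeLocal.
Context {R : realType} {X : completeNormedModType R}.
Local Notation mu := (@lebesgue_measure R).
Variable p : R.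
Hypothesis p_ge1 : 1 <= p.
Implicit Types (I J : set R) (phi chi : R -> R) (u g : R -> X).

Lemma test_function_mul I J (F : set R) phi chi : test_function I phi ->
  (forall t, derivable chi t 1) -> continuous (derive1 chi) -> closed F ->
  (forall t, chi t != 0 -> F t) -> (forall t, I^° t -> F t -> J^° t) ->
  test_function J (fun t => phi t * chi t) /\
  derive1 (fun t => phi t * chi t) =
    (fun t => derive1 phi t * chi t + phi t * derive1 chi t).
Proof.
move=> tf dchi cchi cF chiF IFJ; have [h1 h2 h3 h4] := tf.
have chic : continuous chi.
  by move=> t; apply/differentiable_continuous/derivable1_diffP.
have phic := test_function_continuous tf.
have dE : derive1 (fun t => phi t * chi t) =
    (fun t => derive1 phi t * chi t + phi t * derive1 chi t).
  apply/funext => t; rewrite !derive1E.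
  have := @deriveM _ _ phi chi t 1 (h1 t) (dchi t).
  rewrite (_ : phi * chi = fun t => phi t * chi t)// => ->.
  by rewrite /GRing.scale/= addrC [chi t * _]mulrC.
split; last exact: dE.
have cl : closure [set t | phi t * chi t != 0] `<=`
    closure [set t | phi t != 0] `&` F.
  have cB : closed (closure [set t | phi t != 0] `&` F).
    by apply: closedI => //; exact: closed_closure.
  rewrite [X in _ `<=` X]((closure_id _).1 cB); apply: closureS => t /=.
  rewrite mulf_eq0 negb_or => /andP[pt ct]; split; last exact: chiF.
  exact: subset_closure.
split.
- move=> t; exact: derivableM.
- rewrite dE => t; apply: cvgD; apply: cvgM; [exact: h2|exact: chic|exact: phic|exact: cchi].
- apply: (subclosed_compact _ h3); first exact: closed_closure.
  by move=> t /cl[].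
- by move=> t /cl[/h4 It Ft]; exact: IFJ.
Qed.


Lemma derivable_cutoff s e t : 0 < e -> derivable (cutoff s e : R -> R) t 1.
Proof. by move=> e0; have [] := is_derive_cutoff s t e0. Qed.

Lemma derive1_cutoff s e : 0 < e -> derive1 (cutoff s e : R -> R) = hat s e.
Proof.
move=> e0; apply/funext => t.
by rewrite derive1E (@derive_val _ _ _ _ _ _ _ (is_derive_cutoff s t e0)).
Qed.

Lemma continuous_cutoff s e : 0 < e -> continuous (cutoff s e : R -> R).
Proof.
by move=> e0 t; apply/differentiable_continuous/derivable1_diffP/derivable_cutoff.
Qed.

Lemma has_bochner_integral_hat a b s e (x : X) : 0 < e -> a <= s - e -> s + e <= b ->
  has_bochner_integral `[a, b] (fun t => hat s e t *: x) x /\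
  in_Lp 1 `[a, b] (hat s e : R -> R^o) /\ Lpn 1 `[a, b] (hat s e : R -> R^o) <= 1.
Proof.
move=> e0 as_ sb; have le11 : (1 : R) <= 1 by exact: lexx.
have ab : a < b by lra.
have hc := @continuous_hat R s e.
have hL : in_Lp 1 `[a, b] (hat s e : R -> R^o).
  have c1 : in_Lp 1 `[a, b] ((fun=> 1) : R -> R^o) by exact: in_Lp_cst.
  have ei0 : 0 <= e^-1 by rewrite invr_ge0 ltW.
  apply: (proj1 (@in_Lp_le1 R 1 le11 R^o R^o _ (hat s e : R -> R^o) e^-1 _ _ _ ei0 c1 _)) => //.
    exact: continuous_strongly_measurable.
  apply: ae_all => t _; rewrite normr1 mulr1 ger0_norm ?hat_ge0//.
  exact: hat_le.
have int1 : (\int[mu]_(t in `[a, b]) (hat s e t)%:E)%E = 1%E.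
  rewrite (@continuous_FTC2 _ _ (cutoff s e))//.
  - by rewrite (cutoff_gt e0 sb) (cutoff_lt e0 as_) sube0.
  - exact: continuous_subspaceT.
  - have cN : {within `[a, b], continuous (cutoff s e)}.
      by apply: continuous_subspaceT; exact: continuous_cutoff.
    have /continuous_within_itvP [//|_ hr hl] := cN.
    by split => //= t _; exact: derivable_cutoff.
  - by move=> t _; rewrite derive1_cutoff.
split; last first.
  split => //; rewrite -lee_fin -LpnE// Lp_norm1 -int1 le_eqVlt.
  apply/orP; left; apply/eqP; apply: eq_integral => t _.
  by rewrite ger0_norm// hat_ge0.
have := has_bochner_integral_real (measurable_itv `[a, b]) (continuous_measurable_fun hc) hL.
by rewrite int1 => /(has_bochner_integral_scaler x (measurable_itv _)); rewrite scale1r.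
Qed.

Lemma derive1_cutoffB (s t e : R) : 0 < e ->
  derive1 (fun r => cutoff s e r - cutoff t e r) = (fun r => hat s e r - hat t e r).
Proof.
move=> e0; apply/funext => r.
rewrite -(derive1_cutoff s e0) -(derive1_cutoff t e0) !derive1E.
have := deriveB (@derivable_cutoff s e r e0) (@derivable_cutoff t e r e0).
by [].
Qed.

Lemma test_function_cutoffB (a b s t e : R) : 0 < e -> a < s - e -> s <= t -> t + e < b ->
  test_function `[a, b] (fun r => cutoff s e r - cutoff t e r).
Proof.
move=> e0 as_ st tb.
have dE := derive1_cutoffB s t e0.
have cl : closure [set r | cutoff s e r - cutoff t e r != 0] `<=` `[(s - e), (t + e)]%classic.
  have cJ : closed (`[(s - e), (t + e)]%classic : set R) by exact: interval_closed.
  rewrite [X in _ `<=` X]((closure_id _).1 cJ).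
  apply: closureS => r /=; apply: contraNP => /negP; rewrite in_itv/= negb_and -!ltNge.
  move=> /orP[rs|rt]; first by rewrite !cutoff_lt ?subrr//; lra.
  by rewrite !cutoff_gt ?subrr//; lra.
split.
- move=> r; apply: derivableB; exact: derivable_cutoff.
- by rewrite dE => r; apply: cvgB; exact: continuous_hat.
- by apply: subclosed_compact cl; [exact: closed_closure|exact: segment_compact].
- move=> r /cl; rewrite /= interior_itv_bnd/= in_itv/= => /andP[h1 h2].
  by rewrite in_itv/=; apply/andP; split; lra.
Qed.

(** The weak derivative is tested with a difference of cutoffs at [s] and [t]. Its derivative is a
    difference of two hats of mass 1, which average [u] near [s] and near [t], while the function
    itself is bounded by 1; continuity of [u] replaces the averages by the values. *)
Lemma weak_derivative_increment a b u g : a < b -> {within `[a, b], continuous u} ->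
  in_Lp p `[a, b] u -> in_Lp p `[a, b] g -> is_weak_derivative `[a, b] u g ->
  in_Lp 1 `[a, b] g /\
  forall s t, s \in `[a, b] -> t \in `[a, b] -> `|u t - u s| <= Lpn 1 `[a, b] g.
Proof.
move=> ab uc uL gL /(is_weak_derivativeP p_ge1 (measurable_itv _) uL gL) hw.
have le11 : (1 : R) <= 1 by exact: lexx.
have mJ : measurable (`[a, b]%classic : set R) by exact: measurable_itv.
have [gL1 _] : in_Lp 1 `[a, b] g /\ Lpn 1 `[a, b] g <= ((b - a) + 1) * Lpn p `[a, b] g.
  apply: in_Lp_in_L1 => //; first by rewrite subr_ge0 ltW.
  by rewrite lebesgue_measure_itv/= lte_fin ab lee_fin.
have [uL1 _] : in_Lp 1 `[a, b] u /\ Lpn 1 `[a, b] u <= ((b - a) + 1) * Lpn p `[a, b] u.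
  apply: in_Lp_in_L1 => //; first by rewrite subr_ge0 ltW.
  by rewrite lebesgue_measure_itv/= lte_fin ab lee_fin.
split => //.
have ued := (within_continuous_epsdelta _ _).1 uc.
have ar1 (s t e : R) : e <= (s - a) / 2 -> a < s -> s <= t -> e <= (b - t) / 2 -> t < b ->
    [/\ a <= s - e, s + e <= b, a <= t - e & t + e <= b] by split; lra.
have ar2 (x y : R) : 0 <= x -> x <= 1 -> 0 <= y -> y <= 1 -> - 1 <= x - y <= 1.
  by move=> *; apply/andP; split; lra.
have ar3 (x y z N eta : R) : x <= eta / 2 -> y <= eta / 2 -> z <= N -> x + y + z <= N + eta.
  by lra.
have ar4 (l x : R) : 0 < l -> l <= 1 / 2 -> a <= x -> x <= b -> a < x + l * ((a + b) / 2 - x) < b.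
  by move=> *; apply/andP; split; nra.
have ar5 (l x y : R) : 0 < l -> l <= 1 / 2 -> x <= y ->
    x + l * ((a + b) / 2 - x) <= y + l * ((a + b) / 2 - y) by move=> *; nra.
have ar6 (l x d : R) : 0 < l -> l * (b - a) <= d -> a <= x -> x <= b -> 0 < d ->
    - d < l * ((a + b) / 2 - x) < d.
  by move=> *; apply/andP; split; nra.
have ar7 (x y z N eta w : R) : x <= z + y -> z <= N -> y < eta / 2 -> w < eta / 2 ->
    x + w <= N + eta by lra.
(* Interior points come first, because the supports of both hats must fit strictly inside the
   interval. *)
have step s t : a < s -> s <= t -> t < b -> `|u t - u s| <= Lpn 1 `[a, b] g.
  move=> as_ st tb; apply/ler_addgt0Pr => eta eta0.
  have eta20 : 0 < eta / 2 by rewrite divr_gt0.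
  have [] := ued s _ _ eta20; first by rewrite /= in_itv/=; apply/andP; split; lra.
  move=> d1 d10 d1P.
  have [] := ued t _ _ eta20; first by rewrite /= in_itv/=; apply/andP; split; lra.
  move=> d2 d20 d2P.
  pose e := Num.min (Num.min d1 d2) (Num.min ((s - a) / 2) ((b - t) / 2)).
  have e0 : 0 < e by rewrite !lt_min d10 d20 !divr_gt0// subr_gt0.
  have [e1 e2 e3 e4] : [/\ e <= d1, e <= d2, e <= (s - a) / 2 & e <= (b - t) / 2].
    by rewrite /e !ge_min !lexx !orbT.
  have [as1 sb1 at1 tb1] := ar1 _ _ _ e3 as_ st e4 tb.
  have tf : test_function `[a, b] (fun r => cutoff s e r - cutoff t e r).
    by apply: test_function_cutoffB => //; lra.
  have dE := derive1_cutoffB s t e0.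
  have loc r d : a <= r - e -> r + e <= b -> e <= d ->
      (forall q, `[a, b]%classic q -> `|q - r| < d -> `|u q - u r| < eta / 2) ->
      exists2 x, has_bochner_integral `[a, b] (fun q => hat r e q *: (u q - u r)) x &
        `|x| <= eta / 2.
    move=> ar rb ed dP; have [_ [hL h1]] := has_bochner_integral_hat (0 : X) e0 ar rb.
    have [kL k1] : in_Lp 1 `[a, b] (fun q => hat r e q *: (u q - u r)) /\
        Lpn 1 `[a, b] (fun q => hat r e q *: (u q - u r)) <=
        eta / 2 * Lpn 1 `[a, b] (hat r e : R -> R^o).
      apply: in_Lp_le1 => //; [|exact: ltW|].
        apply: strongly_measurable_scale; first by have [] := hL.
        apply: strongly_measurableB; first by have [] := uL.
        exact: strongly_measurable_cst.
      apply: ae_all => q Jq; rewrite normrZ mulrC.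
      have [qr|qr] := ltP `|q - r| e; last by rewrite hat_out// normr0 !mulr0.
      by rewrite ler_wpM2r// ltW// dP// (lt_le_trans qr).
    have [x hx] := has_bochner_integral_exists mJ kL.
    exists x => //; apply: le_trans (has_bochner_integral_norm mJ hx) _.
    by apply: le_trans k1 _; rewrite -[leRHS]mulr1 ler_wpM2l// ltW.
  have [x1 hx1 nx1] := loc s d1 as1 sb1 e1 d1P.
  have [x2 hx2 nx2] := loc t d2 at1 tb1 e2 d2P.
  have [hs _] := has_bochner_integral_hat (u s) e0 as1 sb1.
  have [ht _] := has_bochner_integral_hat (u t) e0 at1 tb1.
  have hK := hw _ tf.
  have cu r : continuous (cutoff r e : R -> R) by exact: continuous_cutoff.
  have cut1 r : `|cutoff s e r - cutoff t e r| <= 1.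
    have /andP[q1 q2] := @cutoff_itv R s e r e0; have /andP[q3 q4] := @cutoff_itv R t e r e0.
    by rewrite ler_norml ar2.
  have [phL ph1] : in_Lp 1 `[a, b] (fun r => (cutoff s e r - cutoff t e r) *: g r) /\
      Lpn 1 `[a, b] (fun r => (cutoff s e r - cutoff t e r) *: g r) <= 1 * Lpn 1 `[a, b] g.
    apply: in_Lp_le1 => //.
      apply: strongly_measurable_scale; last by have [] := gL.
      apply: continuous_strongly_measurable => r.
      by apply: cvgB; exact: cu.
    by apply: ae_all => r _; rewrite normrZ ler_wpM2r.
  have [x3 hx3] := has_bochner_integral_exists mJ phL.
  have := has_bochner_integralD mJ (has_bochner_integralD mJ
     (has_bochner_integralB mJ hx1 hx2) (has_bochner_integralB mJ hs ht)) hx3.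
  rewrite (_ : _ \+ _ = weak_pairing (fun r => cutoff s e r - cutoff t e r) u g); last first.
    apply/funext => r; rewrite /weak_pairing dE /=; congr (_ + _).
    by rewrite addrACA -opprD -!scalerDr !subrK scalerBl.
  move=> /(has_bochner_integral_unique mJ hK) /eqP.
  have nx3 : `|x3| <= Lpn 1 `[a, b] g.
    by rewrite (le_trans (has_bochner_integral_norm mJ hx3))// (le_trans ph1)// mul1r.
  rewrite eq_sym addrAC addr_eq0 => /eqP E.
  have -> : `|u t - u s| = `|x1 - x2 + x3| by rewrite E normrN distrC.
  rewrite (le_trans (ler_normD _ _))// (le_trans (lerD (ler_normB _ _) (lexx _)))//.
  exact: ar3.
move=> s t sJ tJ.
wlog st : s t sJ tJ / s <= t.
  move=> H; have [st|/ltW ts] := leP s t; first exact: H.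
  by rewrite distrC; exact: H.
apply/ler_addgt0Pr => eta eta0.
have eta20 : 0 < eta / 2 by rewrite divr_gt0.
have [d1 d10 d1P] := ued s sJ _ eta20; have [d2 d20 d2P] := ued t tJ _ eta20.
move: sJ tJ; rewrite !in_itv/= => /andP[as_ sb] /andP[at_ tb].
(* General points are pulled towards the midpoint by the factor [l]. The pull preserves their order,
   makes them interior, and displaces them by less than the moduli of continuity [d1] and [d2]. *)
pose l := Num.min (1 / 2) (Num.min (d1 / (b - a)) (d2 / (b - a))).
have ba0 : 0 < b - a by rewrite subr_gt0.
have l0 : 0 < l by rewrite !lt_min !divr_gt0.
have [l1 l2 l3] : [/\ l <= 1 / 2, l <= d1 / (b - a) & l <= d2 / (b - a)].
  by rewrite /l !ge_min !lexx !orbT.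
rewrite ler_pdivlMr// in l2; rewrite ler_pdivlMr// in l3.
pose m := (a + b) / 2; pose s' := s + l * (m - s); pose t' := t + l * (m - t).
have /andP[s'1 s'2] := ar4 _ _ l0 l1 as_ sb; rewrite -/m -/s' in s'1 s'2.
have /andP[t'1 t'2] := ar4 _ _ l0 l1 at_ tb; rewrite -/m -/t' in t'1 t'2.
have s't' : s' <= t' by exact: ar5.
have h := step s' t' s'1 s't' t'2.
have k1 : `|u s' - u s| < eta / 2.
  apply: d1P; first by rewrite /= in_itv/= (ltW s'1) (ltW s'2).
  by rewrite /s' addrC addKr ltr_norml; exact: ar6.
have k2 : `|u t' - u t| < eta / 2.
  apply: d2P; first by rewrite /= in_itv/= (ltW t'1) (ltW t'2).
  by rewrite /t' addrC addKr ltr_norml; exact: ar6.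
have -> : u t - u s = (u t' - u s') - (u t' - u t) + (u s' - u s).
  by rewrite opprB (addrC (u t' - u s')) !addrA !subrK.
rewrite (le_trans (ler_normD _ _))//.
exact: (ar7 _ _ _ _ _ _ (ler_normB _ _) h k2 k1).
Qed.

End WeakDerivativeLocal.

Section LpSmall.
Context {R : realType} {X : completeNormedModType R}.
Local Notation mu := (@lebesgue_measure R).
Variable p : R.
Hypothesis p_ge1 : 1 <= p.
Implicit Types (I D : set R) (u g f : R -> X).

(** Dominated convergence: the restrictions of [f] to shrinking windows tend to 0 except possibly at
    the single point [b]. *)
Lemma Lpn_small D (b : R) f : measurable D -> in_Lp p D f ->
  forall e, 0 < e -> exists2 d, 0 < d & Lpn p (D `&` `[b - d, b + d]) f < e.
Proof.
move=> mD fL e e0.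
pose E (k : nat) := `[b - k.+1%:R^-1, b + k.+1%:R^-1]%classic : set R.
have mE k : measurable (E k) by exact: measurable_itv.
have fE k : in_Lp p (D `&` E k) f by have [] := in_LpS p_ge1 mD (@subIsetl _ D (E k)) fL.
have [||_ /cvgrPdist_lt/(_ e e0)[N _ NP]] := @in_Lp_dominated_cvg _ p p_ge1 X X D
  (fun k t => if t \in E k then f t else 0) f mD
  (fun k => proj1 (proj1 (in_Lp_if p_ge1 mD (mE k) (fE k)))) fL.
- by apply: ae_all => t _ k; case: ifP => // _; rewrite normr0.
- exists [set b]; split; [exact: measurable_set1|exact: lebesgue_measure_set1|].
  move=> t /= nt; apply: contrapT => tb; apply: nt => Dt.
  have tb0 : 0 < `|t - b| by rewrite normr_gt0 subr_eq0; apply/eqP.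
  apply/cvgrPdist_lt => e' e'0.
  have /cvgrPdist_lt/(_ _ tb0)[N _ NP] := @cvg_harmonic R.
  exists N => // k /NP /=; rewrite sub0r normrN ger0_norm ?harmonic_ge0//= => kt.
  rewrite memNset ?subrr ?normr0//.
  rewrite /E/= in_itv/= -ler_distl => h.
  by have := lt_le_trans kt h; rewrite ltxx.
exists N.+1%:R^-1; first by rewrite invr_gt0.
have [_ <-] := in_Lp_if p_ge1 mD (mE N) (fE N).
by have := NP N (leqnn _); rewrite /= sub0r normrN ger0_norm ?Lpn_ge0.
Qed.

End LpSmall.

(** * Gluing of weak derivatives at a point *)

Lemma scaler_split3 {R : realType} {V : lmodType R} (x y z : V)
    (D D1 D2 D3 P P1 P2 P3 : R) : D = D1 + D2 + D3 -> P = P1 + P2 + P3 ->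
  (D *: x + P *: z) - (D1 *: x + P1 *: z) - (D2 *: x + P2 *: z + D3 *: y) =
  D3 *: (x - y) + P3 *: z.
Proof.
move=> -> ->; rewrite !scalerDl scalerBr.
rewrite addrACA [X in X + _ - _ - _]addrACA.
set A := D1 *: x + P1 *: z; set B := D2 *: x + P2 *: z.
by rewrite -(addrA A) (addrC A) addrK opprD addrACA subrr add0r addrAC.
Qed.

Lemma inside_near {R : realFieldType} (b e d1 d2 t : R) :
  0 < e -> e <= 1 -> e <= d1 / 4 -> e <= d2 / 3 -> b - 3 * e <= t -> t <= b + 3 * e ->
  [/\ b - 3 <= t <= b + 3, b - d2 <= t <= b + d2 & `|t - b| < d1].
Proof.
by move=> *; split; rewrite ?ltr_norml; apply/andP; split; lra.
Qed.

Lemma norm_subr_unit {R : realFieldType} (x y : R) :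
  0 <= x <= 1 -> 0 <= y <= 1 -> `|x - y| <= 1.
Proof. by rewrite ler_norml => /andP[? ?] /andP[? ?]; apply/andP; split; lra. Qed.

Lemma outside_far {R : realFieldType} (b e t : R) : 0 < e -> ~ `[b - 3 * e, b + 3 * e]%classic t ->
  ((t <= b - 2 * e - e /\ t <= b + 2 * e - e) \/ (b - 2 * e + e <= t /\ b + 2 * e + e <= t)) /\
  (e <= `|t - (b - 2 * e)| /\ e <= `|t - (b + 2 * e)|).
Proof.
move=> e0; rewrite /= in_itv/= => /negP; rewrite negb_and -!ltNge => /orP[h|h].
  by split; [left; lra|rewrite !ler0_norm; lra].
by split; [right; lra|rewrite !ger0_norm; lra].
Qed.

Section Gluing.
Context {R : realType} {X : completeNormedModType R}.
Local Notation mu := (@lebesgue_measure R).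
Variable p : R.
Hypothesis p_ge1 : 1 <= p.
Implicit Types (I D : set R) (u g f : R -> X).

(** Partition of unity [1 = c1 + c2 + c3], with [c1] supported left of [b], [c2] right of [b], and
    [c3] in a window of width [6 * e] around [b]. The first two parts pair to 0 by hypothesis. In
    the third the derivative is of order [1 / e], but it multiplies [u - u b], small by continuity,
    on a window of length of order [e]. This is where continuity across [b] enters. *)
Lemma weak_derivative_glue I b u g : measurable I -> I b ->
  {within I, continuous u} -> in_Lp p I u -> in_Lp p I g ->
  is_weak_derivative (I `&` `]-oo, b]) u g ->
  is_weak_derivative (I `&` `[b, +oo[) u g -> is_weak_derivative I u g.
Proof.
move=> mI Ib uc uL gL hl hr.
have mIl : measurable (I `&` `]-oo, b]) by apply: measurableI => //; exact: measurable_itv.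
have mIr : measurable (I `&` `[b, +oo[) by apply: measurableI => //; exact: measurable_itv.
have sub A : I `&` A `<=` I by exact: subIsetl.
have {}hl := (is_weak_derivativeP p_ge1 mIl (proj1 (in_LpS p_ge1 mI (sub _) uL))
  (proj1 (in_LpS p_ge1 mI (sub _) gL))).1 hl.
have {}hr := (is_weak_derivativeP p_ge1 mIr (proj1 (in_LpS p_ge1 mI (sub _) uL))
  (proj1 (in_LpS p_ge1 mI (sub _) gL))).1 hr.
apply/(is_weak_derivativeP p_ge1 mI uL gL) => phi tf.
have [N [C [N0 C0 out bnd]]] := test_function_bounded tf.
have phic := test_function_continuous tf; have [dphi cphi _ _] := tf.
have [CK CK0 hCK] := @weak_pairing_L1 R X p p_ge1 I phi mI tf.
have [x hx] := has_bochner_integral_exists mI (proj1 (hCK u g uL gL)).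
suff : `|x| <= 0 by rewrite normr_le0 => /eqP <-.
have le11 : (1 : R) <= 1 by exact: lexx.
have gN : in_Lp 1 (I `&` `[b - 3, b + 3]) g.
  have mIb : measurable (I `&` `[b - 3, b + 3]).
    by apply: measurableI => //; exact: measurable_itv.
  apply: (proj1 (@in_Lp_in_L1 R X p 6 _ g p_ge1 mIb (ler0n _ 6) _ _)).
    apply: (@le_trans _ _ (mu `[b - 3, b + 3])).
      apply: le_measure; rewrite ?inE; [exact: mIb|exact: measurable_itv|exact: subIsetr].
    rewrite lebesgue_measure_itv/= lte_fin ifT; last by lra.
    by rewrite -EFinD lee_fin; lra.
  exact: (proj1 (in_LpS p_ge1 mI (sub `[b - 3, b + 3]%classic) gL)).
apply/ler_addgt0Pr => eta eta0; rewrite add0r.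
have C10 : 0 < C + 1 by rewrite ltr_wpDl.
(* [eta1] bounds the integral of [|g|] over the window and [eta2] the oscillation of [u]; the final
   bound [18 * C * eta2 + C * eta1] is at most [eta]. *)
pose eta1 := eta / (4 * (C + 1)).
have eta10 : 0 < eta1 by rewrite divr_gt0// mulr_gt0.
pose eta2 := eta / (24 * (C + 1)).
have eta20 : 0 < eta2 by rewrite divr_gt0// mulr_gt0.
have [d1 d10 d1P] := (within_continuous_epsdelta _ _).1 uc b Ib eta2 eta20.
have mIb : measurable (I `&` `[b - 3, b + 3]).
  by apply: measurableI => //; exact: measurable_itv.
have [d2 d20 d2P] := Lpn_small le11 b mIb gN eta10.
(* The window reaches [3 * e] to each side: it must stay in the interval of radius 3 on which [g] is
   integrable, strictly within [d1], and within [d2]. *)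
pose e := Num.min 1 (Num.min (d1 / 4) (d2 / 3)).
have e0 : 0 < e by rewrite !lt_min !divr_gt0// ltr01.
have [e1 e2 e3] : [/\ e <= 1, e <= d1 / 4 & e <= d2 / 3].
  by rewrite /e !ge_min !lexx !orbT.
pose c1 : R -> R := fun t => 1 - cutoff (b - 2 * e) e t.
pose c2 : R -> R := cutoff (b + 2 * e) e.
pose c3 : R -> R := fun t => cutoff (b - 2 * e) e t - cutoff (b + 2 * e) e t.
have dc1 t : derivable c1 t 1.
  by apply: derivableB; [exact: derivable_cst|exact: derivable_cutoff].
have dc2 t : derivable c2 t 1 by exact: derivable_cutoff.
have dc3 t : derivable c3 t 1 by apply: derivableB; exact: derivable_cutoff.
have c1' : derive1 c1 = (fun t => - hat (b - 2 * e) e t).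
  apply/funext => t; rewrite -derive1_cutoff// !derive1E.
  have := deriveB (derivable_cst (1 : R) t 1) (@derivable_cutoff _ (b - 2 * e) e t e0).
  by rewrite derive_cst sub0r.
have c2' : derive1 c2 = hat (b + 2 * e) e by exact: derive1_cutoff.
have c3' := derive1_cutoffB (b - 2 * e) (b + 2 * e) e0.
have hatc s : continuous (hat s e) by exact: continuous_hat.
have [||||tf1 dphi1] := @test_function_mul R I (I `&` `]-oo, b]) `]-oo, (b - e)]%classic
  phi c1 tf dc1.
- by rewrite c1' => t; apply: cvgN; exact: hatc.
- exact: interval_closed.
- move=> t; apply: contraNP => /negP; rewrite /= in_itv/= -ltNge => h.
  by rewrite /c1 cutoff_gt ?subrr//; lra.
- move=> t It; rewrite /= in_itv/= => h; rewrite interiorI; split => //.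
  by rewrite interior_itv_Nybnd/= in_itv/=; lra.
have [||||tf2 dphi2] := @test_function_mul R I (I `&` `[b, +oo[) `[(b + e), +oo[%classic
  phi c2 tf dc2.
- by rewrite c2'; exact: hatc.
- exact: interval_closed.
- move=> t; apply: contraNP => /negP; rewrite /= in_itv/= andbT -ltNge => h.
  by rewrite /c2 cutoff_lt//; lra.
- move=> t It; rewrite /= in_itv/= andbT => h; rewrite interiorI; split => //.
  by rewrite interior_itv_bndy/= in_itv/= andbT; lra.
have [||||tf3 dphi3] := @test_function_mul R I I setT phi c3 tf dc3.
- by rewrite c3' => t; apply: cvgB; exact: hatc.
- exact: closedT.
- by [].
- by [].
have hK1 : has_bochner_integral I (weak_pairing (fun t => phi t * c1 t) u g) 0.
  apply: has_bochner_integral_support (hl _ tf1) => // t h.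
  suff : (I `&` `]-oo, b]) t by move=> It; split => //; case: It.
  apply: contrapT => /(test_function_out tf1)[h1 h2]; move: h.
  by rewrite /weak_pairing h1 h2 !scale0r addr0 eqxx.
have hK2 : has_bochner_integral I (weak_pairing (fun t => phi t * c2 t) u g) 0.
  apply: has_bochner_integral_support (hr _ tf2) => // t h.
  suff : (I `&` `[b, +oo[) t by move=> It; split => //; case: It.
  apply: contrapT => /(test_function_out tf2)[h1 h2]; move: h.
  by rewrite /weak_pairing h1 h2 !scale0r addr0 eqxx.
(* Subtracting this vanishing integral replaces [u] by [u - u b] in the middle part. *)
have hub := has_bochner_integral_derive1 (u b) mI tf3.
have := has_bochner_integralB mI (has_bochner_integralB mI hx hK1)
  (has_bochner_integralD mI hK2 hub).
rewrite !addr0 !subr0; set Q := _ \- _ => hQ.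
have QE t : Q t = derive1 (fun t => phi t * c3 t) t *: (u t - u b) + (phi t * c3 t) *: g t.
  rewrite /Q/= /weak_pairing; apply: scaler_split3.
    by rewrite dphi1 dphi2 dphi3 c1' c2' c3' /c1 /c2 /c3; ring.
  by rewrite /c1 /c2 /c3; ring.
pose W := `[b - 3 * e, b + 3 * e]%classic : set R.
have mW : measurable W by exact: measurable_itv.
have mIW : measurable (I `&` W) by exact: measurableI.
have [oneL one1] : in_Lp 1 (I `&` W) ((fun=> 1) : R -> R^o) /\
    Lpn 1 (I `&` W) ((fun=> 1) : R -> R^o) <= 6 * e.
  apply: in_Lp_lee; first exact: strongly_measurable_cst.
  rewrite Lp_norm1 normr1 integral_cst// mul1e.
  apply: (@le_trans _ _ (mu W)).
    by apply: le_measure; rewrite ?inE; [exact: mIW|exact: mW|exact: subIsetr].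
  rewrite /W lebesgue_measure_itv/= lte_fin ifT; last by lra.
  by rewrite -EFinD lee_fin; lra.
have [gWL gW1] : in_Lp 1 (I `&` W) g /\ Lpn 1 (I `&` W) g <= eta1.
  have h : I `&` W `<=` (I `&` `[b - 3, b + 3]) `&` `[b - d2, b + d2].
    move=> t [It]; rewrite /W/= in_itv/= => /andP[h1 h2].
    have [k1 k2 _] := inside_near e0 e1 e2 e3 h1 h2.
    by rewrite !in_itv/=; split; [split|].
  have mB : measurable ((I `&` `[b - 3, b + 3]) `&` `[b - d2, b + d2]).
    by apply: measurableI => //; exact: measurable_itv.
  have [k1 k2] := in_LpS le11 mIb (@subIsetl _ _ `[b - d2, b + d2]) gN.
  have [k3 k4] := in_LpS le11 mB h k1.
  by split => //; rewrite (le_trans k4)// ltW.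
have [oL o1] := in_Lp_if le11 mI mW oneL.
have [gL' g1] := in_Lp_if le11 mI mW gWL.
have Qsm := proj1 (has_bochner_integral_in_L1 mI hQ).
(* [3 * C / e] bounds the derivative of [phi * c3]: [C] from [phi' * c3], at most [C / e] as
   [e <= 1], and [2 * C / e] from the two hats. *)
have cc0 : 0 <= 3 * C / e * eta2.
  apply: mulr_ge0; last exact: ltW.
  by apply: mulr_ge0; [exact: mulr_ge0|rewrite invr_ge0 ltW].
have [|_ Q1] := in_Lp_le2 le11 mI Qsm cc0 C0 oL gL'; last first.
  apply: le_trans (has_bochner_integral_norm mI hQ) _.
  apply: le_trans Q1 _; rewrite o1 g1.
  apply: (@le_trans _ _ (3 * C / e * eta2 * (6 * e) + C * eta1)).
    by apply: lerD; apply: ler_wpM2l.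
  have -> : 3 * C / e * eta2 * (6 * e) = 18 * C * eta2.
    by field; rewrite gt_eqF.
  have -> : 18 * C * eta2 + C * eta1 = C / (C + 1) * eta.
    by rewrite /eta1 /eta2; field; rewrite gt_eqF.
  rewrite -[leRHS]mul1r ler_wpM2r// ?(ltW eta0)// ler_pdivrMr// mul1r.
  by rewrite lerDl.
apply: ae_all => t It; rewrite QE.
have hat0 s : t \notin W -> (s = b - 2 * e) \/ (s = b + 2 * e) -> hat s e t = 0.
  rewrite notin_setE => /(outside_far e0) tW hs.
  by apply: hat_out => //; case: hs => ->; [exact: tW.2.1|exact: tW.2.2].
case: ifPn => tW; last first.
  have c30 : c3 t = 0.
    move: tW; rewrite notin_setE => /(outside_far e0)[+ _]; rewrite /c3 => -[[h1 h2]|[h1 h2]].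
      by rewrite !cutoff_lt ?subrr.
    by rewrite !cutoff_gt ?subrr.
  rewrite dphi3 c30 c3' hat0//; last by left.
  rewrite hat0//; last by right.
  by rewrite subrr !mulr0 addr0 !scale0r addr0 !normr0 !mulr0 addr0.
have c31 : `|c3 t| <= 1.
  by apply: norm_subr_unit; exact: cutoff_itv.
have c31' : `|derive1 c3 t| <= 2 / e.
  rewrite c3' (le_trans (ler_normB _ _))//.
  rewrite !ger0_norm ?hat_ge0//.
  have := @hat_le R (b - 2 * e) e t e0; have := @hat_le R (b + 2 * e) e t e0.
  by rewrite [2 / e]mulrDl mul1r => *; exact: lerD.
have [B1 B2] := bnd t.
rewrite (le_trans (ler_normD _ _))// lerD//; last first.
  rewrite normrZ ler_wpM2r// normrM -[leRHS]mulr1 ler_pM//.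
rewrite normrZ normr1 mulr1; apply: ler_pM => //; last first.
  rewrite ltW// d1P//.
  move: tW; rewrite inE /W/= in_itv/= => /andP[h1 h2].
  by have [] := inside_near e0 e1 e2 e3 h1 h2.
rewrite dphi3 (le_trans (ler_normD _ _))// !normrM.
have h1 : `|derive1 phi t| * `|c3 t| <= C * e^-1.
  apply: ler_pM => //; rewrite (le_trans c31)//.
  by rewrite -invr1 lef_pV2 ?posrE.
have h2 : `|phi t| * `|derive1 c3 t| <= C * (2 / e) by apply: ler_pM.
rewrite (le_trans (lerD h1 h2))// le_eqVlt; apply/orP; left; apply/eqP.
by field; rewrite gt_eqF.
Qed.

End Gluing.

(** * The space E_1 *)

Lemma continuous_linear_bound {R : realType} {V W : normedModType R}
    (B : {linear V -> W}) : continuous B ->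
  exists2 c : R, 0 <= c & forall x, `|B x| <= c * `|x|.
Proof.
move=> /linear_bounded_continuous/linear_boundedP/pinfty_ex_gt0[c c0 cP].
by exists c; [exact: ltW|exact: cP].
Qed.

Section AffineWeak.
Context {R : realType} {X : completeNormedModType R}.
Variable p : R.
Hypothesis p_ge1 : 1 <= p.
Implicit Types (I D : set R) (u g f : R -> X).
Variables (c s : R).
Hypothesis s_pm1 : s = 1 \/ s = -1.
Let T (t : R) := c + s * t.
Let S (t : R) := s * (t - c).

Let ss1 : s * s = 1.
Proof. by case: s_pm1 => ->; rewrite ?mulr1// mulrN1 opprK. Qed.

Let TS t : T (S t) = t.
Proof. by rewrite /T /S mulrA ss1 mul1r addrC subrK. Qed.

Let ST t : S (T t) = t.
Proof. by rewrite /T /S addrC addKr mulrA ss1 mul1r. Qed.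

(** With [s = 1] or [s = -1] the map [T] covers translations, used to restart extensions at a later
    time, and reflections, used to run paths backwards. *)
Lemma affine_preserving : [/\ measurable_fun setT T,
  forall A : set R, measurable A ->
    @lebesgue_measure R (T @^-1` A) = @lebesgue_measure R A &
  forall t, exists r, T r = t].
Proof.
split; last by move=> t; exists (S t).
- apply: measurable_funD; first exact: measurable_cst.
  by apply: measurable_funM; [exact: measurable_cst|exact: measurable_id].
- move=> A mA; case: s_pm1 => s1.
    rewrite -(lebesgue_measure_shift c mA); congr (lebesgue_measure _).
    by apply/seteqP; split=> t; rewrite /T s1 /= mul1r.
  rewrite -(lebesgue_measure_reflect c mA); congr (lebesgue_measure _).
  by apply/seteqP; split=> t; rewrite /T s1 /= mulN1r.
Qed.

Let Tc : continuous T.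
Proof.
move=> t; apply: cvgD; first exact: cvg_cst.
by apply: cvgM; [exact: cvg_cst|exact: cvg_id].
Qed.

Let Sc : continuous S.
Proof.
move=> t; apply: cvgM; first exact: cvg_cst.
by apply: cvgB; [exact: cvg_id|exact: cvg_cst].
Qed.

Let dS (t : R) : is_derive t 1 (S : R -> R) s.
Proof.
apply: (@is_derive_quadratic _ _ _ _ 0) => h.
rewrite (_ : _ - _ = 0) ?normr0 ?mul0r// /S; ring.
Qed.

Lemma test_function_affine I phi : test_function (T @^-1` I) phi ->
  test_function I (phi \o S) /\ derive1 (phi \o S) = (fun t => s * derive1 phi (S t)).
Proof.
move=> tf; have [h1 h2 h3 h4] := tf; have phic := test_function_continuous tf.
have dSt t : derivable S t 1 by have [] := dS t.
have dE : derive1 (phi \o S) = (fun t => s * derive1 phi (S t)).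
  apply/funext => t; rewrite derive1_comp// mulrC; congr (_ * _).
  by rewrite derive1E (@derive_val _ _ _ _ _ _ _ (dS t)).
have cl : closure [set t | (phi \o S) t != 0] `<=` S @^-1` (closure [set t | phi t != 0]).
  have cB : closed (S @^-1` (closure [set t | phi t != 0])).
    by apply: closed_comp; [move=> t _; exact: Sc|exact: closed_closure].
  rewrite [X in _ `<=` X]((closure_id _).1 cB); apply: closureS => t /= h.
  exact: subset_closure.
split; last exact: dE.
split.
- move=> t; apply/derivable1_diffP; apply: differentiable_comp.
    exact/derivable1_diffP.
  exact/derivable1_diffP.
- rewrite dE => t; apply: cvgM; first exact: cvg_cst.
  by apply: continuous_comp; [exact: Sc|exact: h2].
- have cT : compact (T @` (closure [set t | phi t != 0])).
    by apply: continuous_compact => //; apply: continuous_subspaceT.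
  apply: subclosed_compact cT _; first exact: closed_closure.
  by move=> t /cl h; exists (S t).
- move=> t /cl /h4; rewrite /interior => nb.
  have : nbhs t (S @^-1` (T @^-1` I)) by exact: Sc.
  by apply: filterS => r /=; rewrite TS.
Qed.

Lemma weak_derivative_affine I u g : measurable I -> in_Lp p I u -> in_Lp p I g ->
  is_weak_derivative I u g ->
  is_weak_derivative (T @^-1` I) (u \o T) (fun t => s *: g (T t)).
Proof.
move=> mI uL gL /(is_weak_derivativeP p_ge1 mI uL gL) hw.
have [mT muT sT] := affine_preserving.
have mTI : measurable (T @^-1` I) by rewrite -[_ @^-1` _]setTI; exact: mT.
have [uL' _] := in_Lp_preserving mT muT p_ge1 mI uL.
have [gL' _] := in_Lp_preserving mT muT p_ge1 mI gL.
have [gL'' _] := in_LpZ p_ge1 s mTI gL'.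
apply/(is_weak_derivativeP p_ge1 mTI uL' gL'') => phi tf.
have [tf' dE] := test_function_affine tf.
have := has_bochner_integral_preserving mT muT sT mI (hw _ tf').
move=> /(has_bochner_integralZ s mTI); rewrite scaler0.
congr has_bochner_integral; apply/funext => t /=.
rewrite /weak_pairing dE /= ST scalerDr !scalerA mulrA ss1 mul1r.
by rewrite [s * _]mulrC.
Qed.

End AffineWeak.

Section E1.
Context {R : realType} {X0 X1 : completeNormedModType R}.
Local Notation mu := (@lebesgue_measure R).
Variables (p : R) (i : {linear X1 -> X0}).
Hypothesis p_gt1 : 1 < p.
Hypothesis ic : continuous i.
Implicit Types (I J : set R) (u g : R -> X0) (v : R -> X1).
Let p1 : 1 <= p := ltW p_gt1.

(** Membership of [u] in L^p follows from that of its lift [v], since [i] is bounded. *)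
Lemma E1_data_intro I u v g : measurable I -> {within I, continuous u} ->
  in_Lp p I g -> is_weak_derivative I u g -> in_Lp p I v ->
  {ae mu, forall t, I t -> u t = i (v t)} -> E1_data p i I u v g.
Proof.
move=> mI uc gL wd vL uv; split; [exact: uc| |by []|by []].
have [c c0 cP] := continuous_linear_bound ic.
apply: (proj1 (in_Lp_ae p1 mI _ (proj1 (in_Lp_linear p1 mI ic c0 cP vL)))).
by apply: aeS uv => t + It => /(_ It) ->.
Qed.

Lemma E1_data_lin I u1 v1 g1 u2 v2 g2 (c : R) : measurable I ->
  E1_data p i I u1 v1 g1 -> E1_data p i I u2 v2 g2 ->
  E1_data p i I (fun t => u1 t + c *: u2 t) (fun t => v1 t + c *: v2 t)
    (fun t => g1 t + c *: g2 t).
Proof.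
move=> mI [uc1 uL1 [gL1 w1] [vL1 uv1]] [uc2 uL2 [gL2 w2] [vL2 uv2]].
have [cg2 _] := in_LpZ p1 c mI gL2; have [gL _] := in_LpD p1 mI gL1 cg2.
have [cv2 _] := in_LpZ p1 c mI vL2; have [vL _] := in_LpD p1 mI vL1 cv2.
have [cu2 _] := in_LpZ p1 c mI uL2; have [uL _] := in_LpD p1 mI uL1 cu2.
apply: E1_data_intro; [exact: mI| |exact: gL| |exact: vL|].
- move=> t; apply: cvgD; first exact: uc1.
  by apply: cvgZ; [exact: cvg_cst|exact: uc2].
- apply/(is_weak_derivativeP p1 mI uL gL) => phi tf.
  have h1 := (is_weak_derivativeP p1 mI uL1 gL1).1 w1 phi tf.
  have h2 := (is_weak_derivativeP p1 mI uL2 gL2).1 w2 phi tf.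
  have := has_bochner_integralD mI h1 (has_bochner_integralZ c mI h2).
  rewrite scaler0 addr0; congr has_bochner_integral; apply/funext => t.
  rewrite /weak_pairing /= !scalerDr !scalerA ![c * _]mulrC addrACA.
  by rewrite ![_ * c]mulrC.
- by apply: aeS (aeI uv1 uv2) => t [+ +] It; rewrite linearD linearZ => /(_ It) -> /(_ It) ->.
Qed.

Lemma E1_dataB I u1 v1 g1 u2 v2 g2 : measurable I ->
  E1_data p i I u1 v1 g1 -> E1_data p i I u2 v2 g2 ->
  E1_data p i I (u1 \- u2) (v1 \- v2) (g1 \- g2).
Proof.
move=> mI h1 h2; have := E1_data_lin (-1) mI h1 h2.
rewrite (_ : (fun t => u1 t + _) = u1 \- u2); last by apply/funext => t /=; rewrite scaleN1r.
rewrite (_ : (fun t => v1 t + _) = v1 \- v2); last by apply/funext => t /=; rewrite scaleN1r.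
by rewrite (_ : (fun t => g1 t + _) = g1 \- g2)//; apply/funext => t /=; rewrite scaleN1r.
Qed.

Lemma E1_dataD I u1 v1 g1 u2 v2 g2 : measurable I ->
  E1_data p i I u1 v1 g1 -> E1_data p i I u2 v2 g2 ->
  E1_data p i I (u1 \+ u2) (v1 \+ v2) (g1 \+ g2).
Proof.
move=> mI h1 h2; have := E1_data_lin 1 mI h1 h2.
rewrite (_ : (fun t => u1 t + _) = u1 \+ u2); last by apply/funext => t /=; rewrite scale1r.
rewrite (_ : (fun t => v1 t + _) = v1 \+ v2); last by apply/funext => t /=; rewrite scale1r.
by rewrite (_ : (fun t => g1 t + _) = g1 \+ g2)//; apply/funext => t /=; rewrite scale1r.
Qed.

Lemma E1_data0 I : measurable I -> E1_data p i I (fun=> 0) (fun=> 0) (fun=> 0).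
Proof.
move=> mI; apply: E1_data_intro; [exact: mI| ..].
- by move=> t; exact: cvg_cst.
- by have [] := in_Lp_cst0 p1 I (0 : X0).
- apply/(is_weak_derivativeP p1 mI (proj1 (in_Lp_cst0 p1 I (0 : X0)))
    (proj1 (in_Lp_cst0 p1 I (0 : X0)))) => phi tf.
  have := has_bochner_integral_derive1 (0 : X0) mI tf; congr has_bochner_integral.
  by apply/funext => t; rewrite /weak_pairing !scaler0 addr0.
- by have [] := in_Lp_cst0 p1 I (0 : X1).
- by apply: ae_all => t _; rewrite linear0.
Qed.

Lemma E1_dataS I J u v g : measurable I -> measurable J -> J `<=` I ->
  E1_data p i I u v g -> E1_data p i J u v g.
Proof.
move=> mI mJ JI [uc uL [gL wd] [vL uv]].
have [uL' _] := in_LpS p1 mI JI uL; have [gL' _] := in_LpS p1 mI JI gL.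
apply: E1_data_intro; [exact: mJ| |exact: gL'| | |].
- exact: continuous_subspaceW JI uc.
- apply/(is_weak_derivativeP p1 mJ uL' gL') => phi tf.
  have tf' := test_functionS JI tf.
  apply: has_bochner_integral_support ((is_weak_derivativeP p1 mI uL gL).1 wd phi tf') => // t h.
  suff Jt : J t by split => //; exact: JI.
  apply: contrapT => /(test_function_out tf)[h1 h2]; move: h.
  by rewrite /weak_pairing h1 h2 !scale0r addr0 eqxx.
- by have [] := in_LpS p1 mI JI vL.
- by apply: aeS uv => t + /JI.
Qed.

Lemma E1_data_ae I u v g v' g' : measurable I -> E1_data p i I u v g ->
  {ae mu, forall t, I t -> v t = v' t} -> {ae mu, forall t, I t -> g t = g' t} ->
  E1_data p i I u v' g'.
Proof.
move=> mI [uc uL [gL wd] [vL uv]] vv gg.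
have [gL' _] := in_Lp_ae p1 mI gg gL.
apply: E1_data_intro; [exact: mI|exact: uc|exact: gL'| | |].
- apply/(is_weak_derivativeP p1 mI uL gL') => phi tf.
  apply: has_bochner_integral_ae ((is_weak_derivativeP p1 mI uL gL).1 wd phi tf) => //.
  by apply: aeS gg => t + It => /(_ It); rewrite /weak_pairing => ->.
- by have [] := in_Lp_ae p1 mI vv vL.
- by apply: aeS (aeI uv vv) => t [+ +] It => /(_ It) -> /(_ It) ->.
Qed.

Lemma E1_data_eq I u v g u' : measurable I -> {in I, u =1 u'} ->
  E1_data p i I u v g -> E1_data p i I u' v g.
Proof.
move=> mI uu [uc uL [gL wd] [vL uv]].
have [uL' _] : in_Lp p I u' /\ Lpn p I u' = Lpn p I u.
  by apply: in_Lp_ae uL => //; apply: ae_all => t It; rewrite uu// inE.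
apply: E1_data_intro; [exact: mI| |exact: gL| |exact: vL|].
- apply: subspace_eq_continuous uc => t It; exact: uu.
- apply/(is_weak_derivativeP p1 mI uL' gL) => phi tf.
  apply: has_bochner_integral_ae ((is_weak_derivativeP p1 mI uL gL).1 wd phi tf) => //.
  by apply: ae_all => t It; rewrite /weak_pairing uu// inE.
- by apply: aeS uv => t + It => /(_ It) <-; rewrite uu// inE.
Qed.

Lemma E1_data_congr I u v g u' v' g' : measurable I -> E1_data p i I u v g ->
  {in I, u =1 u'} -> {ae mu, forall t, I t -> v t = v' t} ->
  {ae mu, forall t, I t -> g t = g' t} -> E1_data p i I u' v' g'.
Proof. by move=> mI h uu vv gg; exact: (E1_data_ae mI (E1_data_eq mI uu h)). Qed.

Lemma E1_data_glue I (b : R) u v g : measurable I -> I b ->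
  E1_data p i (I `&` `]-oo, b]) u v g -> E1_data p i (I `&` `[b, +oo[) u v g ->
  E1_data p i I u v g.
Proof.
move=> mI Ib [uc1 uL1 [gL1 w1] [vL1 uv1]] [uc2 uL2 [gL2 w2] [vL2 uv2]].
have mIl : measurable (I `&` `]-oo, b]) by apply: measurableI => //; exact: measurable_itv.
have mIr : measurable (I `&` `[b, +oo[) by apply: measurableI => //; exact: measurable_itv.
have IE : I = (I `&` `]-oo, b]) `|` (I `&` `[b, +oo[).
  apply/seteqP; split=> [t It|t [[]|[]]//].
  by have [h|h] := leP t b; [left|right]; split => //; rewrite /= in_itv/= ?andbT// ltW.
have uc : {within I, continuous u}.
  apply/within_continuous_epsdelta => t It e e0.
  have [h1|h1] := leP t b; have [h2|h2] := leP b t.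
  - have tb : t = b by apply/eqP; rewrite eq_le h1 h2.
    have [|d1 d10 d1P] := (within_continuous_epsdelta _ _).1 uc1 t _ e e0.
      by split => //; rewrite /= in_itv.
    have [|d2 d20 d2P] := (within_continuous_epsdelta _ _).1 uc2 t _ e e0.
      by split => //; rewrite /= in_itv/= h2.
    exists (Num.min d1 d2); first by rewrite lt_min d10 d20.
    move=> r Ir; rewrite lt_min => /andP[r1 r2].
    have [rb|rb] := leP r b; first by apply: d1P => //; split => //; rewrite /= in_itv.
    by apply: d2P => //; split => //; rewrite /= in_itv/= ltW.
  - have [|d1 d10 d1P] := (within_continuous_epsdelta _ _).1 uc1 t _ e e0.
      by split => //; rewrite /= in_itv.
    exists (Num.min d1 (b - t)); first by rewrite lt_min d10 subr_gt0.
    move=> r Ir; rewrite lt_min => /andP[r1 r2].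
    apply: d1P => //; split => //; rewrite /= in_itv/=.
    by move: r2; rewrite ltr_norml => /andP[_]; lra.
  - have [|d1 d10 d1P] := (within_continuous_epsdelta _ _).1 uc2 t _ e e0.
      by split => //; rewrite /= in_itv/= h2.
    exists (Num.min d1 (t - b)); first by rewrite lt_min d10 subr_gt0.
    move=> r Ir; rewrite lt_min => /andP[r1 r2].
    apply: d1P => //; split => //; rewrite /= in_itv/= andbT.
    by move: r2; rewrite ltr_norml => /andP[]; lra.
  - by have := lt_trans h1 h2; rewrite ltxx.
have [gL _] := in_LpU p1 mIl mIr gL1 gL2; rewrite -IE in gL.
have [vL _] := in_LpU p1 mIl mIr vL1 vL2; rewrite -IE in vL.
have [uL _] := in_LpU p1 mIl mIr uL1 uL2; rewrite -IE in uL.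
apply: E1_data_intro; [exact: mI|exact: uc|exact: gL|
  exact: (weak_derivative_glue p1 mI Ib uc uL gL w1 w2)|exact: vL|].
apply: aeS (aeI uv1 uv2) => t [h1 h2] It.
by have [tb|/ltW tb] := leP t b; [apply: h1|apply: h2]; split => //=; rewrite in_itv/= ?andbT.
Qed.

Lemma E1_data_affine I u v g (c s : R) : measurable I -> s = 1 \/ s = -1 ->
  E1_data p i I u v g ->
  E1_data p i ((fun t => c + s * t) @^-1` I) (fun t => u (c + s * t))
    (fun t => v (c + s * t)) (fun t => s *: g (c + s * t)).
Proof.
move=> mI s1 [uc uL [gL wd] [vL uv]].
have [mT muT sT] := affine_preserving c s1.
have mTI : measurable ((fun t => c + s * t) @^-1` I) by rewrite -[_ @^-1` _]setTI; exact: mT.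
have [gL' _] := in_Lp_preserving mT muT p1 mI gL.
apply: E1_data_intro; [exact: mTI| ..].
- apply/within_continuous_epsdelta => t It e e0.
  have [d d0 dP] := (within_continuous_epsdelta _ _).1 uc (c + s * t) It e e0.
  exists d => // r Ir rt; apply: dP => //.
  rewrite opprD addrACA subrr add0r -mulrBr normrM.
  by case: s1 => ->; rewrite ?normrN normr1 mul1r.
- by have [] := in_LpZ p1 s mTI gL'.
- exact: (weak_derivative_affine p1 s1 mI uL gL wd).
- by have [] := in_Lp_preserving mT muT p1 mI vL.
- exact: (ae_preserving mT muT uv).
Qed.

End E1.

Lemma small_factor {R : realFieldType} (C e : R) : 0 < e ->
  exists2 d, 0 < d & C * d <= e.
Proof.
move=> e0; have C0 := normr_ge0 C; exists (e / (`|C| + 1)).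
  by rewrite divr_gt0//; lra.
rewrite mulrA ler_pdivrMr; last by lra.
have := ler_norm C; nra.
Qed.

Lemma series_tail_bound {R : realType} {X : completeNormedModType R}
    (x_ : nat -> X) (c_ : nat -> R) : (forall k, `|x_ k| <= c_ k) ->
  cvgn (series c_) -> cvgn (series x_) /\
  forall n, `|limn (series x_) - series x_ n| <= limn (series c_) - series c_ n.
Proof.
move=> xc cc; have c0 k : 0 <= c_ k by exact: le_trans (xc k).
have cx : cvgn (series x_).
  by apply: normed_cvg; apply: series_le_cvg cc => n //=; exact: xc.
split => // n.
have h : (`|series x_ m - series x_ n| @[m --> \oo] --> `|limn (series x_) - series x_ n|).
  by apply: cvg_norm; apply: cvgB; [exact: cx|exact: cvg_cst].
rewrite -(cvg_lim (@Rhausdorff R) h); apply: limr_le; first by apply/cvg_ex; eexists; exact: h.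
exists n => // m /= nm.
rewrite /series/= -(subnKC nm) !big_mkord big_split_ord/= addrAC subrr add0r.
apply: (le_trans (ler_norm_sum _ _ _)).
have ndc : nondecreasing_seq (series c_).
  by apply/nondecreasing_seqP => k; rewrite seriesSr lerDl.
rewrite lerBrDr (le_trans _ (nondecreasing_cvgn_le ndc cc m))//.
rewrite [leRHS](_ : _ = series c_ (n + (m - n))%N); last by rewrite subnKC.
by rewrite /series/= big_mkord big_split_ord/= [leLHS]addrC lerD2l; apply: ler_sum.
Qed.

Section E1Norm.
Context {R : realType} {X0 X1 : completeNormedModType R}.
Local Notation mu := (@lebesgue_measure R).
Variables (p : R) (i : {linear X1 -> X0}).
Hypothesis p_gt1 : 1 < p.
Hypothesis ic : continuous i.
Implicit Types (I J : set R) (u g : R -> X0) (v : R -> X1).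
Let p1 : 1 <= p := ltW p_gt1.

(** The norm read off from explicit data, a real upper bound for [E1_norm]; working with it avoids
    the infimum. *)
Definition E1n I u v g : R := Lpn p I u + Lpn p I g + Lpn p I v.

Lemma E1n_ge0 I u v g : 0 <= E1n I u v g.
Proof. by rewrite /E1n !addr_ge0// Lpn_ge0. Qed.

Lemma E1_norm_le I u v g : E1_data p i I u v g -> (E1_norm p i I u <= (E1n I u v g)%:E)%E.
Proof.
move=> h; have [_ uL [gL _] [vL _]] := h.
apply: ereal_inf_lbound; exists v, g; split => //.
by rewrite (LpnE uL) (LpnE gL) (LpnE vL).
Qed.

Lemma E1n_lin I u1 v1 g1 u2 v2 g2 (c : R) : measurable I ->
  E1_data p i I u1 v1 g1 -> E1_data p i I u2 v2 g2 ->
  E1n I (fun t => u1 t + c *: u2 t) (fun t => v1 t + c *: v2 t)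
    (fun t => g1 t + c *: g2 t) <= E1n I u1 v1 g1 + `|c| * E1n I u2 v2 g2.
Proof.
move=> mI [_ u1L [g1L _] [v1L _]] [_ u2L [g2L _] [v2L _]].
have [cuL cu] := in_LpZ p1 c mI u2L; have [_ hu] := in_LpD p1 mI u1L cuL.
have [cvL cv] := in_LpZ p1 c mI v2L; have [_ hv] := in_LpD p1 mI v1L cvL.
have [cgL cg] := in_LpZ p1 c mI g2L; have [_ hg] := in_LpD p1 mI g1L cgL.
rewrite /E1n; lra.
Qed.

Lemma E1nB I u1 v1 g1 u2 v2 g2 : measurable I ->
  E1_data p i I u1 v1 g1 -> E1_data p i I u2 v2 g2 ->
  E1n I (u1 \- u2) (v1 \- v2) (g1 \- g2) <= E1n I u1 v1 g1 + E1n I u2 v2 g2.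
Proof.
move=> mI [_ u1L [g1L _] [v1L _]] [_ u2L [g2L _] [v2L _]].
have [_ hu] := in_LpB p1 mI u1L u2L; have [_ hv] := in_LpB p1 mI v1L v2L.
have [_ hg] := in_LpB p1 mI g1L g2L; rewrite /E1n; lra.
Qed.

Lemma E1nD I u1 v1 g1 u2 v2 g2 : measurable I ->
  E1_data p i I u1 v1 g1 -> E1_data p i I u2 v2 g2 ->
  E1n I (u1 \+ u2) (v1 \+ v2) (g1 \+ g2) <= E1n I u1 v1 g1 + E1n I u2 v2 g2.
Proof.
move=> mI [_ u1L [g1L _] [v1L _]] [_ u2L [g2L _] [v2L _]].
have [_ hu] := in_LpD p1 mI u1L u2L; have [_ hv] := in_LpD p1 mI v1L v2L.
have [_ hg] := in_LpD p1 mI g1L g2L; rewrite /E1n; lra.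
Qed.

Lemma E1nS I J u v g : measurable I -> J `<=` I ->
  E1_data p i I u v g -> E1n J u v g <= E1n I u v g.
Proof.
move=> mI JI [_ uL [gL _] [vL _]].
have [_ hu] := in_LpS p1 mI JI uL; have [_ hv] := in_LpS p1 mI JI vL.
have [_ hg] := in_LpS p1 mI JI gL; rewrite /E1n; lra.
Qed.

Lemma E1nU I J u v g : measurable I -> measurable J ->
  E1_data p i I u v g -> E1_data p i J u v g ->
  E1n (I `|` J) u v g <= E1n I u v g + E1n J u v g.
Proof.
move=> mI mJ [_ uL [gL _] [vL _]] [_ uL' [gL' _] [vL' _]].
have [_ hu] := in_LpU p1 mI mJ uL uL'; have [_ hv] := in_LpU p1 mI mJ vL vL'.
have [_ hg] := in_LpU p1 mI mJ gL gL'; rewrite /E1n; lra.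
Qed.

Lemma E1n_ae I u v g u' v' g' : measurable I -> E1_data p i I u v g ->
  {ae mu, forall t, I t -> u t = u' t} ->
  {ae mu, forall t, I t -> v t = v' t} -> {ae mu, forall t, I t -> g t = g' t} ->
  E1n I u' v' g' = E1n I u v g.
Proof.
move=> mI [_ uL [gL _] [vL _]] uu vv gg.
have [_ hu] := in_Lp_ae p1 mI uu uL; have [_ hv] := in_Lp_ae p1 mI vv vL.
by have [_ hg] := in_Lp_ae p1 mI gg gL; rewrite /E1n hu hv hg.
Qed.

Lemma E1n_affine I u v g (c s : R) : measurable I -> s = 1 \/ s = -1 ->
  E1_data p i I u v g ->
  E1n ((fun t => c + s * t) @^-1` I) (fun t => u (c + s * t))
    (fun t => v (c + s * t)) (fun t => s *: g (c + s * t)) <= E1n I u v g.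
Proof.
move=> mI s1 [_ uL [gL _] [vL _]].
have [mT muT sT] := affine_preserving c s1.
have mTI : measurable ((fun t => c + s * t) @^-1` I) by rewrite -[_ @^-1` _]setTI; exact: mT.
have [uL' hu] := in_Lp_preserving mT muT p1 mI uL.
have [gL' hg] := in_Lp_preserving mT muT p1 mI gL.
have [vL' hv] := in_Lp_preserving mT muT p1 mI vL.
have [_ hg'] := in_LpZ p1 s mTI gL'.
have ns : `|s| = 1 by case: s1 => ->; rewrite ?normrN normr1.
rewrite ns mul1r in hg'.
by rewrite /E1n; apply: lerD; [apply: lerD|];
  [rewrite -hu lexx|rewrite -hg|rewrite -hv lexx].
Qed.

Lemma E1_data_sum I (u_ g_ : nat -> R -> X0) (v_ : nat -> R -> X1) n : measurable I ->
  (forall k, E1_data p i I (u_ k) (v_ k) (g_ k)) ->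
  E1_data p i I (fun t => \sum_(k < n) u_ k t) (fun t => \sum_(k < n) v_ k t)
    (fun t => \sum_(k < n) g_ k t).
Proof.
move=> mI h; elim: n => [|n IH].
  under eq_fun do rewrite big_ord0; under [X in E1_data _ _ _ _ X _]eq_fun do rewrite big_ord0.
  by under [X in E1_data _ _ _ _ _ X]eq_fun do rewrite big_ord0; exact: E1_data0.
under eq_fun do rewrite big_ord_recr/=; under [X in E1_data _ _ _ _ X _]eq_fun do rewrite big_ord_recr/=.
by under [X in E1_data _ _ _ _ _ X]eq_fun do rewrite big_ord_recr/=; exact: E1_dataD.
Qed.

(** Completeness of the paths vanishing at [a], in series form. Convergence in L^p alone would only
    give a class of functions; the continuous representative is the pointwise sum, which converges
    uniformly. The factor 3 comes from bounding the three terms of [E1n] separately by the same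
    remainder. *)
Lemma E1_series a b (u_ g_ : nat -> R -> X0) (v_ : nat -> R -> X1) (c_ : nat -> R) :
  a < b -> (forall k, E1_data p i `[a, b] (u_ k) (v_ k) (g_ k)) ->
  (forall k, u_ k a = 0) -> (forall k, E1n `[a, b] (u_ k) (v_ k) (g_ k) <= c_ k) ->
  cvgn (series c_) -> exists u v g, [/\ E1_data p i `[a, b] u v g, u a = 0,
    {ae mu, forall t, `[a, b]%classic t -> series (v_ ^~ t) @ \oo --> v t},
    {ae mu, forall t, `[a, b]%classic t -> series (g_ ^~ t) @ \oo --> g t} &
    forall n, E1n `[a, b] (fun t => u t - \sum_(k < n) u_ k t)
      (fun t => v t - \sum_(k < n) v_ k t) (fun t => g t - \sum_(k < n) g_ k t) <=
      3 * (limn (series c_) - series c_ n)].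
Proof.
move=> ab du u0 dc cc.
have mI : measurable (`[a, b] : set R) by exact: measurable_itv.
have uL k : in_Lp p `[a, b] (u_ k) by have [] := du k.
have gL k : in_Lp p `[a, b] (g_ k) by have [_ _ []] := du k.
have vL k : in_Lp p `[a, b] (v_ k) by have [_ _ _ []] := du k.
have uc k : Lpn p `[a, b] (u_ k) <= c_ k.
  apply: le_trans (dc k); have := Lpn_ge0 p `[a, b] (v_ k).
  by have := Lpn_ge0 p `[a, b] (g_ k); rewrite /E1n; lra.
have gc k : Lpn p `[a, b] (g_ k) <= c_ k.
  apply: le_trans (dc k); have := Lpn_ge0 p `[a, b] (v_ k).
  by have := Lpn_ge0 p `[a, b] (u_ k); rewrite /E1n; lra.
have vc k : Lpn p `[a, b] (v_ k) <= c_ k.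
  apply: le_trans (dc k); have := Lpn_ge0 p `[a, b] (u_ k).
  by have := Lpn_ge0 p `[a, b] (g_ k); rewrite /E1n; lra.
have [u' [u'L u'c u't]] := in_Lp_series p1 mI uL uc cc.
have [v [v'L v'c v't]] := in_Lp_series p1 mI vL vc cc.
have [g [g'L g'c g't]] := in_Lp_series p1 mI gL gc cc.
have [m m0 mP] : exists2 m, 0 <= m & forall k t, t \in `[a, b] -> `|u_ k t| <= m * c_ k.
  exists (b - a + 1); first by lra.
  move=> k t tab; have [uck _ [_ wk] _] := du k.
  have [_ h] := weak_derivative_increment p1 ab uck (uL k) (gL k) wk.
  have aab : a \in `[a, b] by rewrite in_itv/= lexx ltW.
  rewrite -[u_ k t]subr0 -(u0 k) (le_trans (h _ _ aab tab))//.
  have ba0 : 0 <= b - a by lra.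
  have [|_ /le_trans] := in_Lp_in_L1 p1 mI ba0 _ (gL k).
    by rewrite lebesgue_measure_itv/= lte_fin ab.
  by apply; apply: ler_wpM2l; [lra|exact: gc].
have cmc : cvgn (series (fun k => m * c_ k)).
  by apply: (@is_cvg_seriesZ _ c_ m).
have pt t : t \in `[a, b] -> cvgn (series (u_ ^~ t)) /\ forall n,
  `|limn (series (u_ ^~ t)) - series (u_ ^~ t) n| <=
     limn (series (fun k => m * c_ k)) - series (fun k => m * c_ k) n.
  by move=> tab; apply: series_tail_bound => // k; exact: mP.
pose u t := limn (series (u_ ^~ t)).
have uu' : {ae mu, forall t, `[a, b]%classic t -> u' t = u t}.
  apply: aeS u'c => t + tab => /(_ tab) h.
  by apply/esym; apply: (cvg_lim _ h); exact: norm_hausdorff.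
have [uLp _] := in_Lp_ae p1 mI uu' u'L.
have uv : {ae mu, forall t, `[a, b]%classic t -> u t = i (v t)}.
  have : {ae mu, forall t, forall k, `[a, b]%classic t -> u_ k t = i (v_ k t)}.
    by apply/ae_foralln => k; have [_ _ _ []] := du k.
  move=> h; apply: aeS (aeI h v'c) => t [h1 h2] tab.
  rewrite /u (_ : series (u_ ^~ t) = i \o series (v_ ^~ t)); last first.
    by apply/funext => n; rewrite /series/= linear_sum; apply: eq_bigr => k _; exact: h1.
  apply: cvg_lim; first exact: norm_hausdorff.
  by apply: cvg_comp; [exact: (h2 tab)|exact: ic].
have uct : {within `[a, b], continuous u}.
  apply/within_continuous_epsdelta => t tab e e0.
  have e30 : 0 < e / 3 by lra.
  have /cvgrPdist_lt/(_ _ e30)[N _ /(_ _ (leqnn N)) NP] := cmc.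
  have duN := E1_data_sum N mI du; have [uN _ _ _] := duN.
  have [d d0 dP] := (within_continuous_epsdelta _ _).1 uN t tab _ e30.
  exists d => // s sab st; have h3 := dP s sab st.
  have [_ /(_ N) h1] := pt t tab; have [_ /(_ N) h2] := pt s sab.
  move: NP; rewrite ger0_norm ?(le_trans _ h1)// => NP.
  move: h1 h2; rewrite /series/= !big_mkord => h1 h2.
  rewrite (_ : u s - u t = (u s - \sum_(k < N) u_ k s)
     + ((\sum_(k < N) u_ k s - \sum_(k < N) u_ k t) - (u t - \sum_(k < N) u_ k t))); last first.
    by rewrite opprB !addrA !subrK.
  apply: (le_lt_trans (ler_normD _ _)).
  have h4 := ler_normB (\sum_(k < N) u_ k s - \sum_(k < N) u_ k t) (u t - \sum_(k < N) u_ k t).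
  by move: NP; rewrite /series/= big_mkord => NP; rewrite /u in h4 *; lra.
have tail n : E1n `[a, b] (fun t => u t - \sum_(k < n) u_ k t)
      (fun t => v t - \sum_(k < n) v_ k t) (fun t => g t - \sum_(k < n) g_ k t) <=
      3 * (limn (series c_) - series c_ n).
  have [uL1 h1] := u't n; have [_ h2] := v't n; have [_ h3] := g't n.
  have [|_ h4] := @in_Lp_ae _ _ p1 _ _ _ (fun t => u t - \sum_(k < n) u_ k t) mI _ uL1.
    by apply: aeS uu' => t + tab => /(_ tab) ->.
  by rewrite /E1n h4; lra.
exists u, v, g; split => //; last first.
  have u00 : series (u_ ^~ a) = fun=> 0.
    by apply/funext => n; rewrite /series/= big1// => k _; exact: u0.
  rewrite /u u00; apply: (@cvg_lim X0); first exact: norm_hausdorff.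
  exact: cvg_cst.
apply: E1_data_intro; [exact: p_gt1|exact: ic|exact: mI|exact: uct|exact: g'L| |exact: v'L|exact: uv].
(* The pairing with a fixed [phi] is bounded from L^p data to L^1; it vanishes on the partial sums,
   and the remainders tend to 0. *)
apply/(is_weak_derivativeP p1 mI uLp g'L) => phi tf.
have [C C0 CP] := @weak_pairing_L1 R X0 p p1 _ phi mI tf.
have [pL _] := CP _ _ uLp g'L.
have [x hx] := has_bochner_integral_exists mI pL.
suff -> : 0 = x by [].
apply/esym/eqP; rewrite -normr_eq0 eq_le normr_ge0 andbT; apply/ler_addgt0Pr => e e0.
have [e' e'0 ee'] := small_factor (C * 3) e0; rewrite -mulrA in ee'.
have /cvgrPdist_lt/(_ _ e'0)[N _ /(_ _ (leqnn N)) NP] := cc.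
have [_ SuL [SgL Sw] _] := E1_data_sum N mI du.
have hS := (is_weak_derivativeP p1 mI SuL SgL).1 Sw phi tf.
have := has_bochner_integralB mI hx hS; rewrite subr0 add0r.
rewrite (_ : _ \- _ = weak_pairing phi (fun t => u t - \sum_(k < N) u_ k t)
   (fun t => g t - \sum_(k < N) g_ k t)); last first.
  by apply/funext => t; rewrite /weak_pairing /= !scalerBr opprD addrACA.
move=> /(has_bochner_integral_norm mI) /le_trans; apply.
have [uBL _] := in_LpB p1 mI uLp SuL; have [gBL _] := in_LpB p1 mI g'L SgL.
have [_ /le_trans] := CP _ _ uBL gBL; apply.
apply: le_trans ee'; apply: ler_wpM2l => //.
apply: (le_trans _ (le_trans (tail N) _)).
  by rewrite /E1n lerDl Lpn_ge0.
by apply: ler_wpM2l => //; apply: ltW; apply: le_lt_trans NP; exact: ler_norm.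
Qed.

End E1Norm.

(** * The trace space X_p *)

Section TraceSpace.
Context {R : realType} {X0 X1 : completeNormedModType R}.
Local Notation mu := (@lebesgue_measure R).
Variables (p : R) (i : {linear X1 -> X0}).
Hypothesis p_gt1 : 1 < p.
Hypothesis ic : continuous i.
Implicit Types (I J : set R) (u g : R -> X0) (v : R -> X1) (x y : X0).
Let p1 : 1 <= p := ltW p_gt1.
Local Notation En := (@E1n R X0 X1 p).
Local Notation ray := (`[(0 : R), +oo[%classic).

Let mray : measurable ray. Proof. exact: measurable_itv. Qed.

Definition Xpn x : R := fine (Xp_norm p i x).

Lemma E1_norm_ge0 I u : (0 <= E1_norm p i I u)%E.
Proof.
apply: le_ereal_inf_tmp => _ [v [g [_ ->]]].
by rewrite !adde_ge0// Lp_norm_ge0.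
Qed.

Lemma Xp_norm_ge0 x : (0 <= Xp_norm p i x)%E.
Proof. by apply: le_ereal_inf_tmp => _ [F _ <-]; exact: E1_norm_ge0. Qed.

Lemma Xpn_ge0 x : 0 <= Xpn x.
Proof. exact/fine_ge0/Xp_norm_ge0. Qed.

Lemma XpnE x : Xp p i x -> Xp_norm p i x = (Xpn x)%:E.
Proof.
move=> [F [v [g h]] F0]; rewrite fineK// ge0_fin_numE ?Xp_norm_ge0//.
apply: (@le_lt_trans _ _ (En ray F v g)%:E); last exact: ltry.
apply: le_trans (E1_norm_le h); apply: ereal_inf_lbound; exists F => //.
by split => //; exists v, g.
Qed.

Lemma Xpn_le u v g : E1_data p i ray u v g ->
  Xp p i (u 0) /\ Xpn (u 0) <= En ray u v g.
Proof.
move=> h; have xu : Xp p i (u 0) by exists u => //; exists v, g.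
split => //; rewrite -lee_fin -XpnE//.
apply: le_trans (E1_norm_le h); apply: ereal_inf_lbound; exists u => //.
by split => //; exists v, g.
Qed.

Lemma Xp_extension x e : Xp p i x -> 0 < e -> exists u v g,
  [/\ E1_data p i ray u v g, u 0 = x & En ray u v g < Xpn x + e].
Proof.
move=> xx e0.
have /ereal_inf_lt[_ [F [_ F0] <-]] : (Xp_norm p i x < (Xpn x + e)%:E)%E.
  by rewrite XpnE// lte_fin ltrDl.
move=> /ereal_inf_lt[_ [v [g [h ->]]]] hN; exists F, v, g; split => //.
have [_ uL [gL _] [vL _]] := h.
by move: hN; rewrite (LpnE uL) (LpnE gL) (LpnE vL) -!EFinD lte_fin.
Qed.

Lemma Xp_lin x y (c : R) : Xp p i x -> Xp p i y ->
  Xp p i (x + c *: y) /\ Xpn (x + c *: y) <= Xpn x + `|c| * Xpn y.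
Proof.
move=> xx yy.
have key e : 0 < e -> Xp p i (x + c *: y) /\
    Xpn (x + c *: y) <= (Xpn x + `|c| * Xpn y) + (1 + `|c|) * e.
  move=> e0; have [u [v [g [h hx hn]]]] := Xp_extension xx e0.
  have [u' [v' [g' [h' hy hn']]]] := Xp_extension yy e0.
  have [hX /le_trans] := Xpn_le (E1_data_lin p_gt1 ic c mray h h').
  move: hX; rewrite hx hy => hX hl; split => //; apply: hl.
  apply: le_trans (E1n_lin p_gt1 c mray h h') _.
  have := ler_wpM2l (normr_ge0 c) (ltW hn'); lra.
split; first by have [] := key 1 ltr01.
apply/ler_addgt0Pr => e e0; have [d d0 dP] := small_factor (1 + `|c|) e0.
by have [_ /le_trans] := key _ d0; apply; rewrite lerD2l.
Qed.

Lemma Xp0 : Xp p i 0 /\ Xpn 0 = 0.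
Proof.
have [h1 h2] := Xpn_le (E1_data0 p_gt1 ic mray); split => //.
apply/eqP; rewrite eq_le Xpn_ge0 andbT (le_trans h2)//.
by rewrite /E1n (proj2 (in_Lp_cst0 p1 _ (0 : X0))) (proj2 (in_Lp_cst0 p1 _ (0 : X1))) !addr0.
Qed.

Lemma XpD x y : Xp p i x -> Xp p i y -> Xp p i (x + y) /\ Xpn (x + y) <= Xpn x + Xpn y.
Proof. by move=> xx yy; have := Xp_lin 1 xx yy; rewrite scale1r normr1 mul1r. Qed.

Lemma XpB x y : Xp p i x -> Xp p i y -> Xp p i (x - y) /\ Xpn (x - y) <= Xpn x + Xpn y.
Proof. by move=> xx yy; have := Xp_lin (-1) xx yy; rewrite scaleN1r normrN1 mul1r. Qed.

Lemma XpnC x y : Xp p i x -> Xp p i y -> Xpn (x - y) = Xpn (y - x).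
Proof.
have half a b : Xp p i a -> Xp p i b -> Xpn (a - b) <= Xpn (b - a).
  move=> xa xb; have [x0 n0] := Xp0; have [xba _] := XpB xb xa.
  by have [_] := XpB x0 xba; rewrite sub0r opprB n0 add0r.
by move=> xx yy; apply/eqP; rewrite eq_le !half.
Qed.

Lemma Xpn_triangle x y z : Xp p i x -> Xp p i y -> Xp p i z ->
  Xpn (x - z) <= Xpn (x - y) + Xpn (y - z).
Proof.
move=> xx yy zz; have [xy _] := XpB xx yy; have [yz _] := XpB yy zz.
by have [_] := XpD xy yz; rewrite addrA subrK.
Qed.

Lemma Xpn_leB x y : Xp p i x -> Xp p i y -> Xpn x <= Xpn y + Xpn (x - y).
Proof.
move=> xx yy; have [xy _] := XpB xx yy.
by have [_] := XpD yy xy; rewrite addrC subrK.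
Qed.

Let affine_data I J u v g (c s : R) : measurable I -> s = 1 \/ s = -1 ->
  (fun t => c + s * t) @^-1` I = J ->
  E1_data p i I u v g ->
  E1_data p i J (fun t => u (c + s * t)) (fun t => v (c + s * t)) (fun t => s *: g (c + s * t)) /\
  En J (fun t => u (c + s * t)) (fun t => v (c + s * t))
    (fun t => s *: g (c + s * t)) <= En I u v g.
Proof.
by move=> mI s1 <- h; split; [exact: E1_data_affine|exact: (E1n_affine p_gt1 c mI s1 h)].
Qed.

Lemma E1_shift u v g (a : R) : E1_data p i ray u v g ->
  E1_data p i `[a, +oo[ (fun t => u (t - a)) (fun t => v (t - a)) (fun t => g (t - a)) /\
  En `[a, +oo[ (fun t => u (t - a)) (fun t => v (t - a)) (fun t => g (t - a)) <= En ray u v g.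
Proof.
move=> h.
have E : (fun t => - a + 1 * t) @^-1` ray = `[a, +oo[%classic.
  by apply/seteqP; split=> t; rewrite /= !in_itv/= !andbT mul1r addrC subr_ge0.
have := affine_data mray (or_introl erefl) E h.
have aE Z (F : R -> Z) : (fun t => F (- a + 1 * t)) = (fun t => F (t - a)).
  by apply/funext => t; rewrite mul1r addrC.
by rewrite (aE _ u) (aE _ v) (aE _ (fun t => 1 *: g t)); under [X in E1_data _ _ _ _ _ X]eq_fun do rewrite scale1r;
  under [X in En _ _ _ X]eq_fun do rewrite scale1r.
Qed.

(* The path u followed backwards from u(t) to u(a), and continued by an
   extension of u(a), is an admissible extension of u(t). *)
Lemma trace_bound a t u v g : a <= t -> E1_data p i `[a, t] u v g -> Xp p i (u a) ->
  Xp p i (u t) /\ Xpn (u t) <= En `[a, t] u v g + Xpn (u a).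
Proof.
move=> at_ h xa.
have key e : 0 < e -> Xp p i (u t) /\ Xpn (u t) <= (En `[a, t] u v g + Xpn (u a)) + e.
  move=> e0; have [W [vW [gW [hW W0 nW]]]] := Xp_extension xa e0.
  (* The reversed path occupies [[0, t - a]]; the extension of [u a] takes over from [t - a] on. *)
  have E1 : (fun r => t + -1 * r) @^-1` `[a, t] = ray `&` `]-oo, t - a].
    apply/seteqP; split=> r /=; rewrite !in_itv/= !andbT mulN1r; first by move=> /andP[]; split; lra.
    by move=> [r0 rta]; apply/andP; split; lra.
  have [h1 n1] := affine_data (measurable_itv _) (or_intror erefl) E1 h.
  have [h2 n2] := E1_shift (t - a) hW.
  have E2 : ray `&` `[t - a, +oo[ = `[t - a, +oo[%classic.
    by apply/seteqP; split=> r /=; rewrite !in_itv/= !andbT; [case|split => //; lra].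
  pose glue Z (F G : R -> Z) r := if r <= t - a then F r else G r.
  pose u1 := glue _ (fun r => u (t + -1 * r)) (fun r => W (r - (t - a))).
  pose v1 := glue _ (fun r => v (t + -1 * r)) (fun r => vW (r - (t - a))).
  pose g1 := glue _ (fun r => -1 *: g (t + -1 * r)) (fun r => gW (r - (t - a))).
  have m1 : measurable (ray `&` `]-oo, t - a]) by apply: measurableI => //; exact: measurable_itv.
  have m2 : measurable (ray `&` `[t - a, +oo[) by rewrite E2; exact: measurable_itv.
  have gl1 Z (F G : R -> Z) r : (ray `&` `]-oo, t - a]) r -> F r = glue _ F G r.
    by move=> [_]; rewrite /= in_itv/= /glue => ->.
  have gl2 Z (F G : R -> Z) : {ae mu, forall r, (ray `&` `[t - a, +oo[) r -> G r = glue _ F G r}.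
    have : {ae mu, forall r, r != t - a}.
      by exists [set t - a]; split => //; [exact: lebesgue_measure_set1|
        move=> r /= /negP; rewrite negbK => /eqP].
    apply: aeS => r rn [_]; rewrite /= in_itv/= andbT /glue => tr.
    by rewrite leNgt lt_neqAle eq_sym rn tr.
  have H1 : E1_data p i (ray `&` `]-oo, t - a]) u1 v1 g1.
    apply: (E1_data_congr p_gt1 ic m1 h1).
    - by move=> r /set_mem rr; exact: gl1.
    - by apply: ae_all => r; exact: gl1.
    - by apply: ae_all => r; exact: gl1.
  have H2 : E1_data p i (ray `&` `[t - a, +oo[) u1 v1 g1.
    rewrite -E2 in h2.
    apply: (E1_data_congr p_gt1 ic m2 h2); [|exact: gl2|exact: gl2].
    (* At the junction [t - a] the value comes from the reversed path; it agrees with that of the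
       extension because [W 0 = u a]. The lifts and derivatives need only agree almost
       everywhere. *)
    move=> r /set_mem [_]; rewrite /= in_itv/= andbT => rr.
    rewrite /u1 /glue; case: ifPn => // rr'.
    have -> : r = t - a by apply/eqP; rewrite eq_le rr rr'.
    by rewrite subrr W0 mulN1r opprB addrC subrK.
  have ta : ray (t - a) by rewrite /= in_itv/= andbT subr_ge0.
  have H := E1_data_glue p_gt1 ic mray ta H1 H2.
  have := Xpn_le H; rewrite /u1 /glue subr_ge0 at_ mulr0 addr0 => -[hX hn]; split => //.
  apply: (le_trans hn).
  have rayE : ray = (ray `&` `]-oo, t - a]) `|` (ray `&` `[t - a, +oo[).
    rewrite -setIUr; apply/seteqP; split=> [r r0|r []//]; split => //=.
    by rewrite !in_itv/= andbT; case: (leP r (t - a)) => [|/ltW]; [left|right].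
  rewrite [in leLHS]rayE; apply: (le_trans (E1nU p_gt1 m1 m2 H1 H2)).
  rewrite (E1n_ae p_gt1 m1 h1); last 3 first.
  - by apply: ae_all => r; exact: gl1.
  - by apply: ae_all => r; exact: gl1.
  - by apply: ae_all => r; exact: gl1.
  rewrite -E2 in h2 n2.
  rewrite (E1n_ae p_gt1 m2 h2); last 3 first.
  - exact: gl2.
  - exact: gl2.
  - exact: gl2.
  lra.
split; first by have [] := key 1 ltr01.
by apply/ler_addgt0Pr => e /key[].
Qed.

Lemma trace_bound_itv a b t u v g : a <= t <= b -> E1_data p i `[a, b] u v g -> Xp p i (u a) ->
  Xp p i (u t) /\ Xpn (u t) <= En `[a, b] u v g + Xpn (u a).
Proof.
move=> /andP[at_ tb] h xa.
have mI : measurable (`[a, b] : set R) by exact: measurable_itv.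
have sub : `[a, t] `<=` (`[a, b] : set R).
  by move=> r /=; rewrite !in_itv/= => /andP[-> /le_trans]; exact.
have h1 : E1_data p i `[a, t] u v g.
  exact: (E1_dataS p_gt1 ic mI (measurable_itv _) sub h).
have [xt h'] := trace_bound at_ h1 xa.
split => //; apply: (le_trans h'); rewrite lerD2r.
exact: (E1nS p_gt1 mI sub h).
Qed.

End TraceSpace.

(** * Continuity of translations in L^p and of paths in X_p *)

Lemma compact_shift_open {R : realType} (K U : set R) : compact K -> open U ->
  K `<=` U -> exists2 d : R, 0 < d & forall t h, K t -> `|h| < d -> U (t + h).
Proof.
move=> cK oU KU.
have /compact_near_coveringP := cK.
move=> /(_ R (nbhs (0 : R)) (fun h t => U (t + h)) _) [].
  move=> t Kt; have UT : nbhs (t + 0) U by rewrite addr0; exact/open_nbhs_nbhs/(conj oU)/KU.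
  have := @add_continuous R^o (t, 0); move=> /(_ U UT) [[A B] /= [nA nB] AB].
  by exists (A, B) => // -[x h] /= [Ax Bh]; exact: (AB (x, h)).
move=> d d0 dP; exists d => // t h Kt hd; apply: dP => //=.
by rewrite sub0r normrN.
Qed.

Section TranslationContinuity.
Context {R : realType} {X : completeNormedModType R}.
Local Notation mu := (@lebesgue_measure R).
Variable p : R.
Hypothesis p_ge1 : 1 <= p.
Implicit Types (f : R -> X) (B : set R).

Let sp (h : R) : [/\ measurable_fun setT (fun t : R => t + h),
  forall A : set R, measurable A -> mu ((fun t => t + h) @^-1` A) = mu A
  & forall t : R, exists r, r + h = t].
Proof.
have := affine_preserving h (or_introl (erefl (1 : R))).
by rewrite (_ : (fun t => h + 1 * t) = (fun t => t + h))//;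
  [move=> -[? ? s]; split => // t; have [r rt] := s t; exists r; rewrite -rt mul1r addrC
  |apply/funext => t; rewrite mul1r addrC].
Qed.

Definition translation_continuous f := in_Lp p setT f /\ forall e, 0 < e ->
  exists2 d, 0 < d & forall h, `|h| < d -> Lpn p setT (fun t => f (t + h) - f t) < e.

Let in_Lp_shift f h : in_Lp p setT f -> in_Lp p setT (fun t => f (t + h)) /\
  Lpn p setT (fun t => f (t + h)) = Lpn p setT f.
Proof.
by move=> fL; have [m1 m2 m3] := sp h; have := in_Lp_preserving m1 m2 p_ge1 measurableT fL.
Qed.

Lemma translation_continuous0 : translation_continuous (fun=> 0).
Proof.
have [h1 h2] := in_Lp_cst0 p_ge1 setT (0 : X); split => // e e0.
by exists 1 => // h _; under [X in Lpn _ _ X]eq_fun do rewrite subr0; rewrite h2.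
Qed.

Lemma translation_continuousD f g : translation_continuous f ->
  translation_continuous g -> translation_continuous (f \+ g).
Proof.
move=> [fL fT] [gL gT]; have [fgL _] := in_LpD p_ge1 measurableT fL gL; split => // e e0.
have e2 : 0 < e / 2 by rewrite divr_gt0.
have [d1 d10 d1P] := fT _ e2; have [d2 d20 d2P] := gT _ e2.
exists (Num.min d1 d2); first by rewrite lt_min d10.
move=> h; rewrite lt_min => /andP[/d1P h1 /d2P h2].
have [fBL _] := in_LpB p_ge1 measurableT (proj1 (in_Lp_shift h fL)) fL.
have [gBL _] := in_LpB p_ge1 measurableT (proj1 (in_Lp_shift h gL)) gL.
have [_] := in_LpD p_ge1 measurableT fBL gBL.
rewrite (_ : (fun t => _) \- f \+ _ = (fun t => (f \+ g) (t + h) - (f \+ g) t)).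
  by move=> /le_lt_trans; apply; rewrite [e]splitr; exact: ltrD.
by apply/funext => t /=; rewrite opprD addrACA.
Qed.

Lemma Lpn_indic B (x : X) (c : R) : measurable B -> 0 <= c ->
  (mu B <= c%:E)%E -> in_Lp p setT (fun t => if t \in B then x else 0) /\
  Lpn p setT (fun t => if t \in B then x else 0) <= `|x| * c `^ p^-1.
Proof.
move=> mB c0 mc; have p0 : 0 < p by exact: lt_le_trans ltr01 p_ge1.
have [||] := @in_Lp_lee R p X B (fun=> x) (`|x| * c `^ p^-1).
- exact: strongly_measurable_cst.
- rewrite /Lp_norm integral_cst//.
  apply: (@le_trans _ _ (((`|x| `^ p * c)%:E) `^ p^-1)%E).
    apply: poweR_le; rewrite ?invr_ge0 ?(ltW p0)// ?mule_ge0// ?lee_fin ?powR_ge0//.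
    by rewrite EFinM lee_pmul// lee_fin powR_ge0.
  rewrite poweR_EFin lee_fin powRM ?powR_ge0// -powRrM mulfV ?gt_eqF// powRr1//.
move=> xL xn.
have := @in_Lp_if R p p_ge1 X setT B (fun=> x) measurableT mB; rewrite setTI => /(_ xL)[h1 h2].
by split => //; rewrite h2.
Qed.

(** Regularity of Lebesgue measure gives [K] compact and [U] open with [K] inside [B] inside [U] and
    [U \ K] of small measure. A shift too short to carry [K] out of [U] can change membership in [B]
    only at points [t] for which [t] or [t + h] lies in [U \ K]. *)
Lemma translation_continuous_indic B (x : X) : measurable B -> (mu B < +oo)%E ->
  translation_continuous (fun t => if t \in B then x else 0).
Proof.
move=> mB fB; have p0 : 0 < p by exact: lt_le_trans ltr01 p_ge1.
split.
  have := @Lpn_indic B x (fine (mu B)) mB (fine_ge0 (measure_ge0 _ _)) _.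
  by rewrite fineK ?ge0_fin_numE// lexx => /(_ isT)[].
move=> e e0; have [e' e'0 ee'] := small_factor (`|x| + 1) e0.
(* The exceptional set consists of two copies of [U \ K], each of measure at most [c / 2]; an
   indicator of a set of measure [c] has L^p norm [e']. *)
pose c := e' `^ p; have c0 : 0 < c by rewrite powR_gt0.
have c4 : 0 < c / 4 by rewrite divr_gt0.
have [U [oU BU mU]] := lebesgue_regularity_outer mB fB c4.
have [K [cK KB mK]] := lebesgue_regularity_inner mB fB c4.
have [d d0 dP] := compact_shift_open cK oU (subset_trans KB BU).
have mUm : measurable U by exact: open_measurable.
have mKm : measurable K by apply: closed_measurable; exact: compact_closed.
have mUK : measurable (U `\` K) by exact: measurableD.
have sUK : (mu (U `\` K) <= (c / 2)%:E)%E.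
  have -> : U `\` K = (U `\` B) `|` (B `\` K).
    apply/seteqP; split=> [t [Ut Kt]|t [[Ut Bt]|[Bt Kt]]].
    - by have [Bt|Bt] := pselect (B t); [right|left].
    - by split => // /KB.
    - by split => //; exact: BU.
  apply: (le_trans (measureU2 _ _ _)); [exact: measurableD|exact: measurableD|].
  rewrite [leRHS](_ : _ = (c / 4)%:E + (c / 4)%:E)%E; last by rewrite -EFinD; congr EFin; field.
  by apply: leeD; exact: ltW.
exists d => // h hd; have [m1 m2 m3] := sp h.
have mS : measurable ((fun t => t + h) @^-1` (U `\` K)) by rewrite -[_ @^-1` _]setTI; exact: m1.
pose E := (U `\` K) `|` ((fun t => t + h) @^-1` (U `\` K)).
have mE : measurable E by exact: measurableU.
have sE : (mu E <= c%:E)%E.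
  apply: (le_trans (measureU2 _ _ _)) => //.
  by rewrite [c]splitr EFinD; apply: leeD; [exact: sUK|apply: le_trans sUK; rewrite le_eqVlt; apply/orP; left; apply/eqP; exact: m2].
have [EL En] := @Lpn_indic E x c mE (ltW c0) sE.
have ce : c `^ p^-1 = e' by rewrite -powRrM mulfV ?gt_eqF// powRr1// ltW.
rewrite ce in En.
suff h2 : Lpn p setT (fun t => (if t + h \in B then x else 0) - (if t \in B then x else 0))
    <= 1 * Lpn p setT (fun t => if t \in E then x else 0).
  apply: (le_lt_trans h2); rewrite mul1r; apply: (le_lt_trans En).
  by apply: lt_le_trans ee'; rewrite mulrDl mul1r ltrDl.
apply: (proj2 (in_Lp_le1 p_ge1 measurableT _ _ EL _)); [|by []|].
  apply: strongly_measurableB.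
    apply: (@strongly_measurable_if _ _ _ ((fun t => t + h) @^-1` B) (fun=> x) (fun=> 0));
      rewrite ?inE; first by rewrite -[_ @^-1` _]setTI; exact: m1.
    - exact: strongly_measurable_cst.
    - exact: strongly_measurable_cst.
  by apply: strongly_measurable_if => //; exact: strongly_measurable_cst.
apply: ae_all => t _; rewrite mul1r.
have [tB|tB] := boolP (t \in B); have [thB|thB] := boolP (t + h \in B).
- by rewrite subrr normr0.
- rewrite sub0r normrN (_ : t \in E = true)//; apply/mem_set.
  have tB' := set_mem tB; have [Kt|Kt] := pselect (K t).
    right; split => /=; first exact: dP.
    by move=> /KB/mem_set; rewrite (negbTE thB).
  by left; split => //; exact: BU.
- rewrite subr0 (_ : t \in E = true)//; apply/mem_set.
  have thB' := set_mem thB; have [Kt|Kt] := pselect (K (t + h)).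
    left; split => /=; first by have := dP (t + h) (- h) Kt; rewrite normrN addrK; exact.
    by move=> /KB/mem_set; rewrite (negbTE tB).
  by right; split => //; exact: BU.
- by rewrite subr0 normr0.
Qed.

Lemma translation_continuous_lim f (s : nat -> R -> X) : in_Lp p setT f ->
  (forall k, translation_continuous (s k)) ->
  Lpn p setT (f \- s k) @[k --> \oo] --> 0 -> translation_continuous f.
Proof.
move=> fL sT sf; split => // e e0.
have e3 : 0 < e / 3 by lra.
have /cvgrPdist_lt/(_ _ e3)[N _ /(_ _ (leqnn N)) NP] := sf.
move: NP; rewrite sub0r normrN ger0_norm ?Lpn_ge0// => NP.
have [sL /(_ _ e3)[d d0 dP]] := sT N; exists d => // h /dP hd.
have [rL _] := in_LpB p_ge1 measurableT fL sL.
have [rhL rhn] := in_Lp_shift h rL.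
have [dL dn] := in_LpB p_ge1 measurableT rhL rL.
have [shL _] := in_LpB p_ge1 measurableT (proj1 (in_Lp_shift h sL)) sL.
have [_] := in_LpD p_ge1 measurableT dL shL.
rewrite (_ : _ \+ _ = (fun t => f (t + h) - f t)); last first.
  by apply/funext => t /=; rewrite addrACA subrK -opprD subrK.
by rewrite rhn in dn; move=> /le_lt_trans; apply; lra.
Qed.

Lemma Lp_translation_continuous f : in_Lp p setT f -> translation_continuous f.
Proof.
move=> fL; have [s [ss sL sf]] := Lp_simple_approx p_ge1 measurableT fL.
apply: translation_continuous_lim fL _ sf => k.
have [fin ms] := ss k.
have /finite_seqP[r rE] := fin.
have sE : s k = fun t => \sum_(x <- undup r) (if t \in s k @^-1` [set x] then x else 0).
  apply/funext => t; have sin : s k t \in undup r.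
    by rewrite mem_undup; have : range (s k) (s k t) by [exists t]; rewrite rE.
  rewrite (bigD1_seq (s k t)) ?undup_uniq//= (_ : t \in _ = true); last exact/mem_set.
  rewrite big1 ?addr0// => x xs.
  by case: ifPn => // /set_mem /= /eqP; rewrite eq_sym (negbTE xs).
rewrite sE; elim: (undup r) => [|x r' IH].
  by under eq_fun do rewrite big_nil; exact: translation_continuous0.
under eq_fun do rewrite big_cons; apply: (translation_continuousD _ IH).
(* The value 0 is set apart because its level set may have infinite measure. *)
have [->|x0] := eqVneq x 0.
  by under eq_fun do rewrite if_same; exact: translation_continuous0.
apply: translation_continuous_indic; first exact: ms.
by rewrite -[X in mu X]setTI; exact: (simple_function_fin_measure p_ge1 measurableT (ss k) (sL k) x0).
Qed.

End TranslationContinuity.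

Section TraceContinuity.
Context {R : realType} {X0 X1 : completeNormedModType R}.
Local Notation mu := (@lebesgue_measure R).
Variables (p : R) (i : {linear X1 -> X0}).
Hypothesis p_gt1 : 1 < p.
Hypothesis ic : continuous i.
Implicit Types (I J : set R) (u g : R -> X0) (v : R -> X1) (x y : X0).
Let p1 : 1 <= p := ltW p_gt1.
Local Notation En := (@E1n R X0 X1 p).
Local Notation xpn := (Xpn p i).
Local Notation ray := (`[(0 : R), +oo[%classic).

(** After extension by 0 to the line, shifts to the right in the argument keep the ray inside
    itself, so the jump of the extension at 0 is not seen on the ray. *)
Lemma Lp_right_translation {X : completeNormedModType R} (f : R -> X) :
  in_Lp p ray f -> forall e, 0 < e -> exists2 d, 0 < d &
    forall h, 0 <= h < d -> Lpn p ray (fun t => f (t + h) - f t) < e.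
Proof.
move=> fL e e0; have mray : measurable ray by exact: measurable_itv.
have [|FL _] := @in_Lp_if R p p1 X setT ray f measurableT mray; first by rewrite setTI.
have [_ /(_ e e0)[d d0 dP]] := Lp_translation_continuous p1 FL.
exists d => // h /andP[h0 hd]; have [m1 m2 m3] := affine_preserving h (or_introl (erefl (1 : R))).
have [FhL _] := in_Lp_preserving m1 m2 p1 measurableT FL.
have [FBL _] := in_LpB p1 measurableT FhL FL.
have [FBr /le_lt_trans hF] := in_LpS p1 measurableT (@subsetT _ ray) FBL.
have hE : (fun t => (if t + h \in ray then f (t + h) else 0) - (if t \in ray then f t else 0))
    = ((fun t => if t \in ray then f t else 0) \o (fun t => h + 1 * t))
       \- (fun t => if t \in ray then f t else 0).
  by apply/funext => t /=; rewrite mul1r [h + t]addrC.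
have hd' : `|h| < d by rewrite ger0_norm.
have [|_ ->] := @in_Lp_ae R p p1 X ray _ (fun t => f (t + h) - f t) mray _ FBr.
  apply: ae_all => t; rewrite -hE /= in_itv/= andbT => t0.
  by rewrite !mem_set//= in_itv/= andbT ?addr_ge0.
by apply: hF; rewrite -hE; exact: dP.
Qed.

Lemma E1n_small I u v g t e : measurable I -> E1_data p i I u v g -> 0 < e ->
  exists2 d, 0 < d & En (I `&` `[t - d, t + d]) u v g < e.
Proof.
move=> mI [_ uL [gL _] [vL _]] e0; have e3 : 0 < e / 3 by lra.
have [d1 d10 h1] := Lpn_small p1 t mI uL e3.
have [d2 d20 h2] := Lpn_small p1 t mI gL e3.
have [d3 d30 h3] := Lpn_small p1 t mI vL e3.
pose d := Num.min d1 (Num.min d2 d3).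
have dd : d <= d1 /\ d <= d2 /\ d <= d3 by rewrite /d !ge_min !lexx !orbT.
exists d; first by rewrite /d !lt_min d10 d20.
have sub d' : d <= d' -> (I `&` `[t - d, t + d]) `<=` (I `&` `[t - d', t + d']).
  by move=> h r [Ir]; rewrite /= !in_itv/= => /andP[? ?]; split => //; apply/andP; split; lra.
have mm d' : measurable (I `&` `[t - d', t + d']) by apply: measurableI => //; exact: measurable_itv.
have ii d' : (I `&` `[t - d', t + d']) `<=` I by move=> r [].
have [_ k1] := in_LpS p1 (mm d1) (sub _ dd.1) (proj1 (in_LpS p1 mI (@ii d1) uL)).
have [_ k2] := in_LpS p1 (mm d2) (sub _ dd.2.1) (proj1 (in_LpS p1 mI (@ii d2) gL)).
have [_ k3] := in_LpS p1 (mm d3) (sub _ dd.2.2) (proj1 (in_LpS p1 mI (@ii d3) vL)).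
rewrite /E1n; lra.
Qed.

(** [u h - u 0] is the trace at 0 of the path [u (t + h) - u t], whose E_1 norm is small by
    continuity of translations applied to [u], [g] and [v]. *)
Lemma Xpn_right_continuous0 u v g e : E1_data p i ray u v g -> 0 < e ->
  exists2 d, 0 < d & forall h, 0 <= h < d -> Xp p i (u h) /\ xpn (u h - u 0) < e.
Proof.
move=> hd e0; have [_ uL [gL _] [vL _]] := hd; have e3 : 0 < e / 3 by lra.
have [d1 d10 h1] := Lp_right_translation uL e3.
have [d2 d20 h2] := Lp_right_translation gL e3.
have [d3 d30 h3] := Lp_right_translation vL e3.
exists (Num.min d1 (Num.min d2 d3)); first by rewrite !lt_min d10 d20.
move=> h /andP[h0]; rewrite !lt_min => /and3P[k1 k2 k3].
have mray : measurable ray by exact: measurable_itv.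
have [hs _] := E1_shift p_gt1 ic (- h) hd.
have hs' : E1_data p i ray (fun t => u (t + h)) (fun t => v (t + h)) (fun t => g (t + h)).
  rewrite opprK in hs; apply: (E1_dataS p_gt1 ic _ mray _ hs); first exact: measurable_itv.
  by move=> r; rewrite /= !in_itv/= !andbT; lra.
have [+ _] := Xpn_le hs'; rewrite add0r => xh; split => //.
have := Xpn_le (E1_dataB p_gt1 ic mray hs' hd); rewrite /= add0r => -[_ /le_lt_trans]; apply.
rewrite /E1n; have := h1 h; have := h2 h; have := h3 h; rewrite h0 k1 k2 k3 /=.
by move=> /(_ isT) ? /(_ isT) ? /(_ isT) ?; rewrite [e](_ : _ = e / 3 + e / 3 + e / 3);
  [apply: ltrD => //; exact: ltrD|field].
Qed.

(** On [[t, s]] the path is compared with an extension [W] of [u t], restarted at [t]. The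
    difference vanishes at [t], so its trace at [s] is at most its E_1 norm on [[t, s]], which
    shrinks with the interval; [W] itself is right continuous at 0. *)
Lemma Xpn_right_continuous a b t u v g e : E1_data p i `[a, b] u v g -> Xp p i (u a) ->
  t \in `[a, b] -> 0 < e -> exists2 d, 0 < d & forall s, s \in `[a, b] -> t <= s < t + d ->
    xpn (u s - u t) < e.
Proof.
move=> h xa tab e0; have mI : measurable (`[a, b] : set R) by exact: measurable_itv.
have tab' : a <= t <= b by move: tab; rewrite in_itv.
have [xt _] := trace_bound_itv p_gt1 ic tab' h xa.
have e4 : 0 < e / 4 by lra.
have [W [vW [gW [hW W0 _]]]] := Xp_extension xt e4.
have [hWt _] := E1_shift p_gt1 ic t hW.
have [d1 d10 h1] := E1n_small t mI h e4.
have [d2 d20 h2] := E1n_small t (measurable_itv _) hWt e4.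
have [d3 d30 h3] := Xpn_right_continuous0 hW e4.
exists (Num.min d1 (Num.min d2 d3)); first by rewrite !lt_min d10 d20.
move=> s sab; have := sab; rewrite in_itv/= => /andP[as_ sb].
rewrite -ltrBlDl !lt_min => /andP[ts /and3P[s1 s2 s3]].
have tab2 := tab'; move/andP: tab2 => [at_ tb].
have mts : measurable (`[t, s] : set R) by exact: measurable_itv.
have sub1 : `[t, s] `<=` (`[a, b] `&` `[t - d1, t + d1] : set R).
  by move=> r /=; rewrite !in_itv/= => /andP[? ?]; split; apply/andP; split; lra.
have sub2 : `[t, s] `<=` (`[t, +oo[ `&` `[t - d2, t + d2] : set R).
  by move=> r /=; rewrite !in_itv/= andbT => /andP[? ?]; split => //; apply/andP; split; lra.
have m1 : measurable (`[a, b] `&` `[t - d1, t + d1] : set R) by apply: measurableI; exact: measurable_itv.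
have m2 : measurable (`[t, +oo[ `&` `[t - d2, t + d2] : set R) by apply: measurableI; exact: measurable_itv.
have H1 := E1_dataS p_gt1 ic mI m1 (@subIsetl _ _ _) h.
have H2 := E1_dataS p_gt1 ic (measurable_itv _) m2 (@subIsetl _ _ _) hWt.
have n1 := E1nS p_gt1 m1 sub1 H1; have n2 := E1nS p_gt1 m2 sub2 H2.
have H1' := E1_dataS p_gt1 ic m1 mts sub1 H1.
have H2' := E1_dataS p_gt1 ic m2 mts sub2 H2.
have H := E1_dataB p_gt1 ic mts H1' H2'.
have n := E1nB p_gt1 mts H1' H2'.
have [x0 xn0] := Xp0 p_gt1 ic.
have := trace_bound p_gt1 ic ts H; rewrite /= subrr W0 subrr xn0 addr0 => /(_ x0)[xd nd].
have hs : 0 <= s - t < d3 by rewrite subr_ge0 ts.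
have [xW] := h3 (s - t) hs; rewrite W0 => nW.
have sab' : a <= s <= b by rewrite as_.
have [xs _] := trace_bound_itv p_gt1 ic sab' h xa.
have := Xpn_triangle p_gt1 ic xs xW xt; lra.
Qed.

(** Left continuity is right continuity of the reflected path, whose initial value [u b] is in X_p
    by the trace estimate. *)
Lemma Xpn_continuous a b t u v g e : E1_data p i `[a, b] u v g -> Xp p i (u a) ->
  t \in `[a, b] -> 0 < e -> exists2 d, 0 < d & forall s, s \in `[a, b] -> `|s - t| < d ->
    xpn (u s - u t) < e.
Proof.
move=> h xa tab e0; have mI : measurable (`[a, b] : set R) by exact: measurable_itv.
have [d1 d10 h1] := Xpn_right_continuous h xa tab e0.
have ab : a <= b <= b by rewrite lexx andbT; move: tab; rewrite in_itv/= => /andP[/le_trans]; exact.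
have [xb _] := trace_bound_itv p_gt1 ic ab h xa.
have hr := E1_data_affine p_gt1 ic 0 mI (or_intror (erefl (-1 : R))) h.
have E : (fun t => 0 + -1 * t) @^-1` `[a, b] = `[- b, - a]%classic.
  by apply/seteqP; split=> r /=; rewrite !in_itv/= add0r mulN1r => /andP[? ?]; apply/andP; split; lra.
rewrite E in hr.
have ntab : - t \in `[- b, - a] by move: tab; rewrite !in_itv/= !lerN2 andbC.
have xb' : Xp p i (u (0 + -1 * - b)) by rewrite add0r mulN1r opprK.
have [d2 d20 h2] := Xpn_right_continuous hr xb' ntab e0.
exists (Num.min d1 d2); first by rewrite lt_min d10.
move=> s sab; rewrite lt_min => /andP[k1 k2].
have [ts|/ltW st] := leP t s.
  apply: h1 => //; rewrite ts /=; move: k1; rewrite ltr_norml => /andP[_]; lra.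
have := h2 (- s); rewrite !add0r !mulN1r !opprK; apply.
  by move: sab; rewrite !in_itv/= !lerN2 andbC.
by rewrite lerN2 st /=; move: k2; rewrite ltr_norml => /andP[]; lra.
Qed.

End TraceContinuity.

(** * Maximal regularity *)

(* Zabreiko's lemma, phrased for a relation [Q x m] (think of it as "q x <= m"
   for a countably subadditive seminorm q on a complete seminormed space). *)
Section Zabreiko.
Context {R : realType} {V : lmodType R}.
Variables (L : V -> Prop) (nr : V -> R) (Q : V -> R -> Prop).
Hypothesis L0 : L 0.
Hypothesis L_lin : forall x y (c : R), L x -> L y -> L (x + c *: y).
Hypothesis nr_lin : forall x y (c : R), L x -> L y ->
  nr (x + c *: y) <= nr x + `|c| * nr y.
Hypothesis nr0 : nr 0 = 0.
Hypothesis L_complete : forall (z_ : nat -> V) (C : R), (forall k, L (z_ k)) ->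
  (forall k, nr (z_ k) <= C * 2^-1 ^+ k) ->
  exists2 x, L x & forall n, nr (x - \sum_(k < n) z_ k) <= 2 * C * 2^-1 ^+ n.
Hypothesis Q_le : forall x m m', Q x m -> m <= m' -> Q x m'.
Hypothesis Q_total : forall x, L x -> exists m, Q x m.
Hypothesis Q0 : Q 0 0.
Hypothesis Q_lin : forall x y (c m m' : R), Q x m -> Q y m' -> Q (x + c *: y) (m + `|c| * m').
Variable c0 : R.
Hypothesis Q_series : forall (z_ : nat -> V) (C D : R) x, (forall k, L (z_ k)) ->
  (forall k, nr (z_ k) <= C * 2^-1 ^+ k) -> (forall k, Q (z_ k) (D * 2^-1 ^+ k)) ->
  L x -> (forall n, nr (x - \sum_(k < n) z_ k) <= 2 * C * 2^-1 ^+ n) -> Q x (c0 * D).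

Let LB x y : L x -> L y -> L (x - y).
Proof. by move=> Lx Ly; have := L_lin (-1) Lx Ly; rewrite scaleN1r. Qed.

Let LD x y : L x -> L y -> L (x + y).
Proof. by move=> Lx Ly; have := L_lin 1 Lx Ly; rewrite scale1r. Qed.

Let LZ (c : R) x : L x -> L (c *: x).
Proof. by move=> Lx; have := L_lin c L0 Lx; rewrite add0r. Qed.

Let nrB x y : L x -> L y -> nr (x - y) <= nr x + nr y.
Proof. by move=> Lx Ly; have := nr_lin (-1) Lx Ly; rewrite scaleN1r normrN1 mul1r. Qed.

Let nrD x y : L x -> L y -> nr (x + y) <= nr x + nr y.
Proof. by move=> Lx Ly; have := nr_lin 1 Lx Ly; rewrite scale1r normr1 mul1r. Qed.

Let nrZ (c : R) x : L x -> nr (c *: x) <= `|c| * nr x.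
Proof. by move=> Lx; have := nr_lin c L0 Lx; rewrite add0r nr0 add0r. Qed.

Let nrC x y : L x -> L y -> nr (x - y) = nr (y - x).
Proof.
have half a b : L a -> L b -> nr (a - b) <= nr (b - a).
  by move=> La Lb; have := nrB L0 (LB Lb La); rewrite sub0r opprB nr0 add0r.
by move=> Lx Ly; apply/eqP; rewrite eq_le !half.
Qed.

Let QZ (c : R) x m : Q x m -> Q (c *: x) (`|c| * m).
Proof. by move=> Qx; have := Q_lin c Q0 Qx; rewrite !add0r. Qed.

(* Otherwise nested balls would produce a point outside every level set of Q. *)
Let level_set_somewhere_dense : exists (m : nat) x0 (r : R), [/\ L x0, 0 < r &
  forall y, L y -> nr (y - x0) <= r -> forall d, 0 < d ->
    exists z, [/\ L z, Q z m%:R & nr (y - z) <= d]].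
Proof.
apply: contrapT => hn.
(* A pair is a ball, centre and radius. The new ball misses the level set of [m]; its centre moves
   by at most a quarter of the old radius and its own radius is at most half of it, so it lies
   inside the old ball. *)
have step (m : nat) (s : V * R) : exists s' : V * R, L s.1 -> 0 < s.2 ->
   [/\ L s'.1, 0 < s'.2, s'.2 <= s.2 / 2, nr (s'.1 - s.1) <= s.2 / 4 &
      forall w, L w -> nr (w - s'.1) <= s'.2 -> ~ Q w m%:R].
  have [[Ls s0]|ns] := pselect (L s.1 /\ 0 < s.2); last first.
    by exists s => Ls s0; case: ns.
  have [y [Ly ny [d d0 dP]]] : exists y, [/\ L y, nr (y - s.1) <= s.2 / 4 &
      exists2 d, 0 < d & forall z, L z -> Q z m%:R -> d < nr (y - z)].
    apply: contrapT => hy; apply: hn; exists m, s.1, (s.2 / 4).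
    split => //; first by rewrite divr_gt0.
    move=> y Ly ny d d0; apply: contrapT => hz; apply: hy; exists y; split => //.
    exists d => // z Lz Qz; rewrite ltNge; apply/negP => nyz.
    by apply: hz; exists z.
  exists (y, Num.min (s.2 / 2) d) => _ _ /=; split => //.
  - by rewrite lt_min d0 divr_gt0.
  - by rewrite ge_min lexx.
  - move=> w Lw; rewrite le_min => /andP[_ wd] Qw.
    by have := dP w Lw Qw; rewrite nrC// ltNge wd.
have [F FP] := choice (fun ms : nat * (V * R) => step ms.1 ms.2).
pose s := fix s (n : nat) : V * R := if n is k.+1 then F (k, s k) else (0, 1).
have sL n : L (s n).1 /\ 0 < (s n).2.
  elim: n => [|n [h1 h2]]; first by split => //=; exact: ltr01.
  by have [] := FP (n, s n) h1 h2.
have sP n := FP (n, s n) (sL n).1 (sL n).2.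
have rho n : (s n).2 <= 2^-1 ^+ n.
  elim: n => [|n IH]; first by rewrite expr0.
  have [_ _ /le_trans h _ _] := sP n; apply: h => /=.
  by rewrite exprS mulrC ler_wpM2l// invr_ge0.
have [w Lw wP] : exists2 w, L w & forall n, nr (w - (s n).1) <= 2 * (1 / 4) * 2^-1 ^+ n.
  have [||w Lw wP] := @L_complete (fun k => (s k.+1).1 - (s k).1) (1 / 4).
  - by move=> k; apply: LB; exact: (sL _).1.
  - by move=> k; have [_ _ _ + _] := sP k; move=> /le_trans; apply => /=;
      have := rho k; lra.
  exists w => // n; have := wP n.
  have -> : \sum_(k < n) ((s k.+1).1 - (s k).1) = (s n).1.
    elim: n => [|n IH]; first by rewrite big_ord0.
    by rewrite big_ord_recr IH /= addrC subrK.
  by [].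
have chain n j : nr ((s (n + j)%N).1 - (s n).1) <= (s n).2 / 2 - (s (n + j)%N).2 / 2.
  elim: j => [|j IH]; first by rewrite addn0 !subrr nr0.
  have [_ _ h1 h2 _] := sP (n + j)%N; rewrite addnS.
  have Lk k := (sL k).1.
  have := nrD (LB (Lk (n + j).+1) (Lk (n + j)%N)) (LB (Lk (n + j)%N) (Lk n)).
  rewrite addrA subrK; move: h1 h2 IH => /=; lra.
have wb n : nr (w - (s n).1) <= (s n).2.
  apply/ler_addgt0Pr => e e0.
  have : (2^-1 : R) ^+ k @[k --> \oo] --> 0 by apply: cvg_expr; rewrite ger0_norm//; lra.
  move=> /cvgrPdist_lt/(_ e e0)[N _ /(_ (n + N)%N (leq_addl _ _))].
  rewrite sub0r normrN ger0_norm ?exprn_ge0// => he.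
  have Lk k := (sL k).1.
  have := nrD (LB Lw (Lk (n + N)%N)) (LB (Lk (n + N)%N) (Lk n)); rewrite addrA subrK.
  have := wP (n + N)%N; have := chain n N; have := (sL (n + N)%N).2; have := (sL n).2.
  lra.
(* The limit [w] of the centres has some level [m], yet it lies in the ball chosen to miss the level
   set of an integer [k >= m]. *)
have [m Qm] := Q_total Lw.
have [k mk] : exists k : nat, m <= k%:R.
  by exists (Num.truncn `|m|).+1; rewrite ltW// (le_lt_trans (ler_norm m))// truncnS_gt.
have [_ _ _ _ /(_ w Lw)] := sP k.
by apply; [exact: (wb k.+1)|exact: (Q_le Qm)].
Qed.

(** Differences carry the density of a level set from a ball around [x0] to a ball around 0, at the
    price of doubling the level; scaling gives the same on every smaller ball. A small [y] is then
    exhausted by successive approximation, each residual being half the size of the previous bound,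
    and [Q_series] sums the levels. *)
Lemma zabreiko : exists2 M, 0 <= M & forall x r, L x -> 0 < r -> nr x <= r -> Q x (M * r).
Proof.
have [m [x0 [rho [Lx0 rho0 dense0]]]] := level_set_somewhere_dense.
have centre y d : L y -> nr y <= rho -> 0 < d ->
    exists z, [/\ L z, Q z (2 * m%:R) & nr (y - z) <= d].
  move=> Ly ny d0; have d2 : 0 < d / 2 by lra.
  have [||z1 [Lz1 Qz1 n1]] := dense0 (x0 + y) _ _ _ d2; first exact: LD.
    by rewrite addrC addKr.
  have [|z2 [Lz2 Qz2 n2]] := dense0 x0 Lx0 _ _ d2; first by rewrite subrr nr0 ltW.
  exists (z1 - z2); split; first exact: LB.
    by have := Q_lin (-1) Qz1 Qz2; rewrite scaleN1r normrN1 mul1r -mulr2n mulr_natl.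
  have := nrB (LB (LD Lx0 Ly) Lz1) (LB Lx0 Lz2).
  rewrite (_ : _ - _ - _ = y - (z1 - z2)); first by lra.
  by rewrite [x0 + y]addrC -!addrA; congr (_ + _); rewrite !opprB addrC -addrA subrK addrC.
have scaled k y : L y -> nr y <= rho * 2^-1 ^+ k ->
    exists z, [/\ L z, Q z (2 * m%:R * 2^-1 ^+ k) & nr (y - z) <= rho * 2^-1 ^+ k.+1].
  move=> Ly ny; have q0 : 0 < (2^-1 : R) ^+ k by rewrite exprn_gt0.
  have rho2 : 0 < rho / 2 by lra.
  have [||z [Lz Qz nz]] := @centre ((2^-1 ^+ k)^-1 *: y) _ _ _ rho2; first exact: LZ.
    rewrite (le_trans (nrZ _ Ly))// ger0_norm ?invr_ge0 ?(ltW q0)//.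
    by rewrite ler_pdivrMl// mulrC.
  exists (2^-1 ^+ k *: z); split; first exact: LZ.
    by have := QZ (2^-1 ^+ k) Qz; rewrite ger0_norm ?(ltW q0)// mulrC.
  have := nrZ (2^-1 ^+ k) (LB (LZ (2^-1 ^+ k)^-1 Ly) Lz).
  rewrite scalerBr scalerA mulfV ?gt_eqF// scale1r ger0_norm ?(ltW q0)// => /le_trans; apply.
  by rewrite exprS mulrA [leRHS]mulrC ler_wpM2l ?(ltW q0).
have small y : L y -> nr y <= rho -> Q y (c0 * (2 * m%:R)).
  move=> Ly ny.
  have step (ky : nat * V) : exists z, L ky.2 -> nr ky.2 <= rho * 2^-1 ^+ ky.1 ->
     [/\ L z, Q z (2 * m%:R * 2^-1 ^+ ky.1) & nr (ky.2 - z) <= rho * 2^-1 ^+ ky.1.+1].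
    have [[L1 n1]|n1] := pselect (L ky.2 /\ nr ky.2 <= rho * 2^-1 ^+ ky.1).
      by have [z hz] := scaled _ _ L1 n1; exists z.
    by exists 0 => L1 n2; case: n1.
  have [F FP] := choice step.
  pose y_ := fix y_ (n : nat) : V := if n is k.+1 then y_ k - F (k, y_ k) else y.
  pose z_ n := F (n, y_ n).
  have yL n : L (y_ n) /\ nr (y_ n) <= rho * 2^-1 ^+ n.
    elim: n => [|n [h1 h2]]; first by rewrite expr0 mulr1.
    by have [Lz _ nz] := FP (n, y_ n) h1 h2; split => //=; exact: LB.
  have zP n := FP (n, y_ n) (yL n).1 (yL n).2.
  have sumz n : y - \sum_(k < n) z_ k = y_ n.
    by elim: n => [|n IH]; rewrite ?big_ord0 ?subr0// big_ord_recr/= opprD addrA IH.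
  (* The constant [2 * rho] arises because each term is the difference of two consecutive residuals,
     of sizes at most [rho * 2^-k] and half of that. *)
  apply: (@Q_series z_ (2 * rho)) => //.
  - by move=> k; have [] := zP k.
  - move=> k; have [Lz _ _] := zP k.
    have := nrB (yL k).1 (yL k.+1).1; rewrite [y_ k.+1]/= opprB addrC subrK.
    have := (yL k).2; have := (yL k.+1).2; rewrite exprS.
    have : 0 <= rho * 2^-1 ^+ k by rewrite mulr_ge0 ?exprn_ge0// ltW.
    move=> ? h1 h2 h3; rewrite /z_; lra.
  - by move=> k; have [] := zP k.
  - move=> n; rewrite sumz; apply: (le_trans (yL n).2).
    have : 0 <= rho * 2^-1 ^+ n by rewrite mulr_ge0 ?exprn_ge0// ltW.
    lra.
exists (`|c0| * (2 * m%:R) / rho).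
  by rewrite !mulr_ge0// invr_ge0 ltW.
move=> x r Lx r0 nx.
have h0 : 0 < r / rho by rewrite divr_gt0.
have h1 : 0 < rho / r by rewrite divr_gt0.
have := @small ((rho / r) *: x) (LZ _ Lx) _.
move=> /(_ _) /(QZ (r / rho)); rewrite scalerA ger0_norm ?(ltW h0)//.
rewrite (_ : r / rho * (rho / r) = 1) ?scale1r; last first.
  by field; rewrite !gt_eqF.
move=> h; apply: (Q_le (h _)).
  rewrite (le_trans (nrZ _ Lx))// ger0_norm ?(ltW h1)//.
  by rewrite mulrAC ler_pdivrMr// ler_wpM2l// ltW.
rewrite [leRHS](_ : _ = r / rho * (`|c0| * (2 * m%:R))); last by ring.
by rewrite ler_wpM2l ?(ltW h0)// ler_wpM2r ?mulr_ge0// ler_norm.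
Qed.

End Zabreiko.

Lemma series_half {R : realType} (C : R) : cvgn (series (fun k => C * 2^-1 ^+ k)) /\ forall n,
  limn (series (fun k => C * 2^-1 ^+ k)) - series (fun k => C * 2^-1 ^+ k) n = 2 * C * 2^-1 ^+ n.
Proof.
have sE n : series (fun k => C * 2^-1 ^+ k) n = 2 * C - 2 * C * 2^-1 ^+ n.
  elim: n => [|n IH]; first by rewrite /series/= big_geq// expr0 mulr1 subrr.
  by rewrite seriesSr IH exprS; field.
have cv : series (fun k => C * 2^-1 ^+ k) @ \oo --> 2 * C - 2 * C * 0.
  rewrite (_ : series _ = fun n => 2 * C - 2 * C * 2^-1 ^+ n); last exact/funext.
  apply: cvgB; first exact: cvg_cst.
  apply: cvgM; first exact: cvg_cst.
  by apply: cvg_expr; rewrite ger0_norm; lra.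
split; first by apply/cvg_ex; eexists; exact: cv.
by move=> n; rewrite (cvg_lim (@Rhausdorff R) cv) sE; ring.
Qed.

Lemma Lpn_le_ae {R : realType} {X : completeNormedModType R} (p : R) (D : set R)
    (f g : R -> X) : 1 <= p -> measurable D -> in_Lp p D f ->
  {ae @lebesgue_measure R, forall t, D t -> f t = g t} -> Lpn p D g <= Lpn p D f.
Proof. by move=> p1 mD fL fg; have [_ ->] := in_Lp_ae p1 mD fg fL. Qed.

Lemma Lpn_eq0 {R : realType} {X : completeNormedModType R} (p : R) (D : set R) (f : R -> X) :
  1 <= p -> measurable D -> in_Lp p D f -> Lpn p D f = 0 ->
  {ae @lebesgue_measure R, forall t, D t -> f t = 0}.
Proof.
move=> p_ge1 mD fL f0; have p0 : 0 < p by exact: lt_le_trans ltr01 p_ge1.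
have [G [mG G0 _ fG]] := strongly_measurable_norm mD (proj1 fL).
have mGp : measurable_fun D (fun t => (G t `^ p)%:E).
  apply/measurable_EFinP; apply: (@measurableT_comp _ _ _ _ _ _ (fun x => x `^ p)).
    exact: measurable_powR.
  exact: measurable_funS mG.
have I0 : (\int[@lebesgue_measure R]_(t in D) `|(G t `^ p)%:E| = 0)%E.
  apply/eqP; rewrite eq_le integral_ge0 ?andbT; last by move=> t _; exact: abse_ge0.
  have : (Lp_norm p D f <= 0%:E)%E by rewrite (LpnE fL) f0.
  rewrite Lp_norm_lee// powR0 ?gt_eqF//; apply: le_trans.
  apply: ge0_le_integral_ae; [exact: mD|by move=> t _; exact: abse_ge0|
    by move=> t _; rewrite lee_fin powR_ge0|].
  by apply: aeS fG => t + Dt => /(_ Dt) ->; rewrite abse_EFin ger0_norm ?powR_ge0.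
have h := (ae_eq_integral_abs (@lebesgue_measure R) mD mGp).1 I0.
 apply: aeS (aeI h fG) => t [h1 h2] Dt.
have [/powR_eq0_eq0 Gt] := h1 Dt.
by apply/eqP; rewrite -normr_eq0 h2// Gt.
Qed.

Section MaximalRegularity.
Context {R : realType} {X0 X1 : completeNormedModType R}.
Local Notation mu := (@lebesgue_measure R).
Variables (p : R) (i : {linear X1 -> X0}).
Hypothesis p_gt1 : 1 < p.
Hypothesis ic : continuous i.
Variable A : {linear X1 -> X0}.
Hypothesis Ac : continuous A.
Implicit Types (I J : set R) (u g h : R -> X0) (v : R -> X1) (x y : X0).
Let p1 : 1 <= p := ltW p_gt1.
Local Notation En := (@E1n R X0 X1 p).

Definition linear_solution a b h u v g : Prop := [/\ E1_data p i `[a, b] u v g, u a = 0 &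
  {ae mu, forall t, `[a, b]%classic t -> g t + A (v t) = h t}].

Lemma in_Lp_rhs I u v g : measurable I -> E1_data p i I u v g ->
  exists2 c, 0 <= c & in_Lp p I (fun t => g t + A (v t)) /\
    Lpn p I (fun t => g t + A (v t)) <= c * En I u v g.
Proof.
move=> mI [_ uL [gL _] [vL _]]; have [c c0 cP] := continuous_linear_bound Ac.
have [AvL hA] := in_Lp_linear p1 mI Ac c0 cP vL.
have [hL hn] := in_LpD p1 mI gL AvL.
exists (c + 1); [lra|split; [exact: hL|]].
apply: (le_trans hn); have := Lpn_ge0 p I u; have := Lpn_ge0 p I g; have := Lpn_ge0 p I v.
by rewrite /E1n; nra.
Qed.

Lemma linear_solution_exists a b h : maximal_regularity p i a b A ->
  in_Lp p `[a, b] h -> exists u v g, linear_solution a b h u v g.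
Proof. by move=> mr /mr [u [[v [g [hd he]] ua] _]]; exists u, v, g. Qed.

(** Maximal regularity identifies the paths; injectivity of [i] then identifies the lifts, and the
    equation the derivatives. *)
Lemma linear_solution_unique a b h u v g u' v' g' : injective i ->
  maximal_regularity p i a b A ->
  linear_solution a b h u v g -> linear_solution a b h u' v' g' ->
  [/\ {in `[a, b], u =1 u'}, {ae mu, forall t, `[a, b]%classic t -> v t = v' t} &
      {ae mu, forall t, `[a, b]%classic t -> g t = g' t}].
Proof.
move=> inji mr [hd ua he] [hd' ua' he'].
have mI : measurable (`[a, b] : set R) by exact: measurable_itv.
have [_ _ [hL _]] := in_Lp_rhs mI hd.
have [hL' _] := in_Lp_ae p1 mI he hL.
have [w _ wP] := mr h hL'.
have uw : {in `[a, b], u =1 w} by apply: wP; split => //; exists v, g.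
have uw' : {in `[a, b], u' =1 w} by apply: wP; split => //; exists v', g'.
have uu : {in `[a, b], u =1 u'} by move=> t tab; rewrite uw// uw'.
have vv : {ae mu, forall t, `[a, b]%classic t -> v t = v' t}.
  have [_ _ _ [_ uv]] := hd; have [_ _ _ [_ uv']] := hd'.
  by apply: aeS (aeI uv uv') => t [h1 h2] tab; apply: inji; rewrite -h1// -h2// uu.
split => //; apply: aeS (aeI vv (aeI he he')) => t [h1 [h2 h3]] tab.
by apply: (addIr (A (v t))); rewrite h2// [in RHS]h1// h3.
Qed.

(** A closed graph theorem for the solution map. In [zabreiko], [Q h m] says that some solution with
    right-hand side [h] has norm at most [m]; solvability makes [Q] total, and completeness of E_1
    makes it countably subadditive. *)
Lemma linear_solution_bound a b : a < b -> maximal_regularity p i a b A ->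
  exists2 M, 0 <= M & forall h r, in_Lp p `[a, b] h -> 0 < r -> Lpn p `[a, b] h <= r ->
    exists u v g, linear_solution a b h u v g /\ En `[a, b] u v g <= M * r.
Proof.
move=> ab mr; have mI : measurable (`[a, b] : set R) by exact: measurable_itv.
(* The constant 6: bounds [D * 2^-k] add up to [2 * D], and [E1_series] contributes a factor 3. *)
have := @zabreiko R (R -> X0) (in_Lp p `[a, b]) (Lpn p `[a, b])
  (fun h m => exists u v g, linear_solution a b h u v g /\ En `[a, b] u v g <= m) _ _ _ _ _ _ _ _ _ 6.
apply.
- by have [] := in_Lp_cst0 p1 `[a, b] (0 : X0).
- move=> x y c xL yL; have [cL _] := in_LpZ p1 c mI yL.
  by have [] := in_LpD p1 mI xL cL.
- move=> x y c xL yL; have [cL cn] := in_LpZ p1 c mI yL.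
  have [_ n] := in_LpD p1 mI xL cL; apply: (le_trans n); by rewrite lerD2l.
- by have [] := in_Lp_cst0 p1 `[a, b] (0 : X0).
- move=> z_ C zL zn; have [cc ct] := series_half C.
  have [f [fL _ ft]] := in_Lp_series p1 mI zL zn cc.
  exists f => // n; have [_] := ft n; rewrite ct.
  by congr (_ <= _); congr Lpn; apply/funext => t; rewrite /= fctE fct_sumE.
- by move=> x m m' [u [v [g [h1 h2]]]] mm; exists u, v, g; split => //; exact: le_trans mm.
- move=> h hL; have [u [v [g hs]]] := linear_solution_exists mr hL.
  by exists (En `[a, b] u v g), u, v, g.
- exists (fun=> 0), (fun=> 0), (fun=> 0); split.
    split => //; first exact: E1_data0.
    by apply: ae_all => t _; rewrite linear0 addr0.
  by rewrite /E1n (proj2 (in_Lp_cst0 p1 _ (0 : X0))) (proj2 (in_Lp_cst0 p1 _ (0 : X1))) !addr0.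
- move=> x y c m m' [u [v [g [[hd ua he] hn]]]] [u' [v' [g' [[hd' ua' he'] hn']]]].
  exists (fun t => u t + c *: u' t), (fun t => v t + c *: v' t), (fun t => g t + c *: g' t).
  split; first split.
  + exact: E1_data_lin.
  + by rewrite ua ua' scaler0 addr0.
  + apply: aeS (aeI he he') => t [h1 h2] tab; rewrite linearD linearZ addrACA -scalerDr h1// h2//.
  + apply: (le_trans (E1n_lin p_gt1 c mI hd hd')); apply: lerD => //.
    by rewrite ler_wpM2l.
- move=> z_ C D x zL zn zs xL xt.
  have [cC ctC] := series_half C; have [cD ctD] := series_half D.
  have /choice[F FP] : forall k, exists uvg : (R -> X0) * (R -> X1) * (R -> X0),
     linear_solution a b (z_ k) uvg.1.1 uvg.1.2 uvg.2 /\
     En `[a, b] uvg.1.1 uvg.1.2 uvg.2 <= D * 2^-1 ^+ k.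
    by move=> k; have [u [v [g h]]] := zs k; exists (u, v, g).
  have [||||u [v [g [hd ua vE gE ut]]]] := @E1_series R X0 X1 p i p_gt1 ic a b
     (fun k => (F k).1.1) (fun k => (F k).2) (fun k => (F k).1.2) (fun k => D * 2^-1 ^+ k) ab.
  + by move=> k; have [[]] := FP k.
  + by move=> k; have [[]] := FP k.
  + by move=> k; have [] := FP k.
  + exact: cD.
  exists u, v, g; split; last first.
    have := ut 0%N; rewrite ctD expr0 mulr1.
    rewrite (_ : (fun t => u t - _) = u); last by apply/funext => t; rewrite big_ord0 subr0.
    rewrite (_ : (fun t => v t - _) = v); last by apply/funext => t; rewrite big_ord0 subr0.
    rewrite (_ : (fun t => g t - _) = g); last by apply/funext => t; rewrite big_ord0 subr0.
    lra.
  split => //.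
  have [f [fL fE ft]] := in_Lp_series p1 mI zL zn cC.
  (* The given limit [x] and the almost everywhere sum [f] of the series are both within
     [2 * C * 2^-n] in norm of the n-th partial sum, hence equal almost everywhere. *)
  have xf : {ae mu, forall t, `[a, b]%classic t -> (x \- f) t = 0}.
    have [xfL _] := in_LpB p1 mI xL fL.
    apply: (Lpn_eq0 p1 mI xfL); apply/eqP; rewrite eq_le Lpn_ge0 andbT.
    apply/ler_addgt0Pr => e e0.
    have [e' e'0 ee] := small_factor (4 * C) e0.
    have : (2^-1 : R) ^+ k @[k --> \oo] --> 0 by apply: cvg_expr; rewrite ger0_norm//; lra.
    move=> /cvgrPdist_lt/(_ e' e'0)[n _ /(_ n (leqnn _))].
    rewrite sub0r normrN ger0_norm ?exprn_ge0// => he.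
    have [ftL ftn] := ft n; rewrite ctC in ftn.
    have xn := xt n.
    have SL := proj1 (in_Lp_sum p1 n mI zL).
    have [xSL _] := in_LpB p1 mI xL SL.
    have [_] := in_LpB p1 mI xSL ftL.
    rewrite (_ : (x \- _) \- _ = x \- f); last first.
      by apply/funext => t /=; rewrite opprB addrA subrK.
    rewrite (_ : x \- (fun t => \sum_(k < n) z_ k t) = x - \sum_(k < n) z_ k); last first.
      by apply/funext => t /=; rewrite fctE fct_sumE.
    have C0 : 0 <= C by have := zn 0%N; rewrite expr0 mulr1; apply: le_trans; exact: Lpn_ge0.
    move=> /le_trans; apply; rewrite add0r; apply: le_trans ee.
    have : C * 2^-1 ^+ n <= C * e' by rewrite ler_wpM2l// ltW.
    lra.
  have zE : {ae mu, forall t, forall k, `[a, b]%classic t ->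
     (F k).2 t + A ((F k).1.2 t) = z_ k t}.
    by apply/ae_foralln => k; have [[]] := FP k.
  apply: aeS (aeI zE (aeI vE (aeI gE (aeI fE xf)))) => t [h1 [h2 [h3 [h4 h5]]]] tab.
  have -> : x t = f t by apply/eqP; rewrite -subr_eq0; apply/eqP; exact: h5.
  suff h6 : series (z_ ^~ t) @ \oo --> g t + A (v t).
    by rewrite -(cvg_lim (@norm_hausdorff _ _) h6) -(cvg_lim (@norm_hausdorff _ _) (h4 tab)).
  rewrite (_ : series (z_ ^~ t) = (fun n => series (fun k => (F k).2 t) n +
     A (series (fun k => (F k).1.2 t) n))); last first.
    apply/funext => n; rewrite /series/= linear_sum -big_split/=.
    by apply: eq_bigr => k _; rewrite h1.
  apply: cvgD; first exact: h3.
  by apply: cvg_comp; [exact: (h2 tab)|exact: Ac].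
Qed.

End MaximalRegularity.

Section UniformMaximalRegularity.
Context {R : realType} {X0 X1 : completeNormedModType R}.
Local Notation mu := (@lebesgue_measure R).
Variables (p : R) (i : {linear X1 -> X0}).
Hypothesis p_gt1 : 1 < p.
Hypothesis ic : continuous i.
Hypothesis inji : injective i.
Variable A : {linear X1 -> X0}.
Hypothesis Ac : continuous A.
Hypothesis A_mr : forall a b, a < b -> maximal_regularity p i a b A.
Implicit Types (I J : set R) (u g h : R -> X0) (v : R -> X1) (x y : X0).
Let p1 : 1 <= p := ltW p_gt1.
Local Notation En := (@E1n R X0 X1 p).
Local Notation xpn := (Xpn p i).
Local Notation lin_sol := (linear_solution p i A).
Let mitv (a b : R) : measurable (`[a, b] : set R). Proof. exact: measurable_itv. Qed.

Lemma sub_itvcc (a b c d : R) : a <= c -> d <= b -> `[c, d]%classic `<=` `[a, b]%classic.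
Proof. by move=> ac db t /=; rewrite !in_itv/= => /andP[? ?]; apply/andP; split; lra. Qed.

(* Extending the right-hand side by 0 makes the constant of the large interval
   serve for all its subintervals. *)
Lemma linear_solution_uniform a b : a < b -> exists2 M, 0 <= M &
  forall a' b' u v g h, a <= a' -> a' < b' -> b' <= b -> lin_sol a' b' h u v g ->
    En `[a', b'] u v g <= M * Lpn p `[a', b'] h.
Proof.
move=> ab; have [M M0 MP] := linear_solution_bound p_gt1 ic Ac ab (A_mr ab).
exists M => // a' b' u v g h aa' ab' bb' sol; have [hd ua he] := sol.
have [_ _ [hL0 _]] := in_Lp_rhs p_gt1 Ac (mitv a' b') hd.
have [hL _] := in_Lp_ae p1 (mitv a' b') he hL0.
have sub : `[a', b'] `<=` (`[a, b] : set R) by exact: sub_itvcc.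
pose ht t := if t \in `[a', b']%classic then h t else 0.
have [htL htn] : in_Lp p `[a, b] ht /\ Lpn p `[a, b] ht = Lpn p `[a', b'] h.
  have := @in_Lp_if R p p1 X0 `[a, b] `[a', b'] h (mitv a b) (mitv a' b').
  by rewrite (setIidr sub); exact.
(* A strict upper bound [r] is positive, as the bound on the large interval requires, even if [h]
   has norm 0. *)
suff key r : Lpn p `[a', b'] h < r -> En `[a', b'] u v g <= M * r.
  apply/ler_addgt0Pr => e e0; have [d d0 dP] := small_factor M e0.
  have := key (Lpn p `[a', b'] h + d); rewrite ltrDl => /(_ d0); rewrite mulrDr; lra.
move=> hr; have r0 : 0 < r by apply: le_lt_trans hr; exact: Lpn_ge0.
have [|u1 [v1 [g1 [[hd1 ua1 he1] n1]]]] := MP ht r htL r0; first by rewrite htn ltW.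
(* The extended right-hand side vanishes before [a'], so uniqueness on [[a, a']] makes the large
   solution vanish there. *)
have ua'0 : u1 a' = 0.
  have [aE|aN] := eqVneq a a'; first by rewrite -aE.
  have aa : a < a' by rewrite lt_neqAle aN.
  have sub1 : `[a, a'] `<=` (`[a, b] : set R) by apply: sub_itvcc => //; lra.
  have s1 : lin_sol a a' (fun=> 0) u1 v1 g1.
    split; [exact: (E1_dataS p_gt1 ic (mitv _ _) (mitv _ _) sub1 hd1)|exact: ua1|].
    have ne : {ae mu, forall t, t != a'}.
      by exists [set a']; split => //; [exact: lebesgue_measure_set1|
        move=> t /= /negP; rewrite negbK => /eqP].
    apply: aeS (aeI he1 ne) => t [h1 tn] taa; rewrite h1; last exact: sub1.
    rewrite /ht; case: ifPn => // /set_mem; rewrite /= in_itv/= => /andP[a't _].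
    by move: taa; rewrite /= in_itv/= => /andP[_ ta']; move: tn; rewrite eq_le ta' a't.
  have s0 : lin_sol a a' (fun=> 0) (fun=> 0) (fun=> 0) (fun=> 0).
    split; [exact: E1_data0|by []|].
    by apply: ae_all => t _; rewrite linear0 addr0.
  have [h1 _ _] := linear_solution_unique p_gt1 Ac inji (A_mr aa) s1 s0.
  by apply: h1; rewrite in_itv/= lexx andbT ltW.
have s1 : lin_sol a' b' h u1 v1 g1.
  split; [exact: (E1_dataS p_gt1 ic (mitv _ _) (mitv _ _) sub hd1)|exact: ua'0|].
  by apply: aeS he1 => t h1 tt; rewrite h1; [rewrite /ht mem_set|exact: sub].
have [e1 e2 e3] := linear_solution_unique p_gt1 Ac inji (A_mr ab') s1 sol.
have [hd1' _ _] := s1.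
rewrite (E1n_ae p_gt1 (mitv _ _) hd1' _ e2 e3); last by apply: ae_all => t /e1.
exact: le_trans (E1nS p_gt1 (mitv _ _) sub hd1) n1.
Qed.

Lemma E1_shift_itv u v g a b : E1_data p i `[0, +oo[ u v g ->
  E1_data p i `[a, b] (fun t => u (t - a)) (fun t => v (t - a)) (fun t => g (t - a)) /\
  En `[a, b] (fun t => u (t - a)) (fun t => v (t - a)) (fun t => g (t - a)) <= En `[0, +oo[ u v g.
Proof.
move=> h; have [h1 n1] := E1_shift p_gt1 ic a h.
have sub : `[a, b] `<=` (`[a, +oo[ : set R) by move=> t /=; rewrite !in_itv/= andbT => /andP[].
split; first exact: (E1_dataS p_gt1 ic (measurable_itv _) (mitv _ _) sub h1).
exact: le_trans (E1nS p_gt1 (measurable_itv _) sub h1) n1.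
Qed.

(** A nearly optimal extension of the initial value is subtracted, leaving a problem with zero
    initial value. The extension enters once in the norm of the solution and once, through [c + 1],
    in the right-hand side. *)
Lemma linear_estimate a b : a < b -> exists2 C, 0 <= C &
  forall a' b' u v g, a <= a' -> a' < b' -> b' <= b -> E1_data p i `[a', b'] u v g ->
    Xp p i (u a') ->
    En `[a', b'] u v g <= C * (Lpn p `[a', b'] (fun t => g t + A (v t)) + xpn (u a')).
Proof.
move=> ab; have [M M0 MP] := linear_solution_uniform ab.
have [c c0 cP] := continuous_linear_bound Ac.
exists (M + M * (c + 1) + 1); first by rewrite !addr_ge0// mulr_ge0//; lra.
move=> a' b' u v g aa' ab' bb' hd xu.
set H := fun t => g t + A (v t); set N := Lpn p `[a', b'] H.
have H0 : 0 <= N by exact: Lpn_ge0.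
have X00 := Xpn_ge0 p i (u a').
suff key e : 0 < e -> En `[a', b'] u v g <= M * (N + (c + 1) * (xpn (u a') + e)) + (xpn (u a') + e).
  apply/ler_addgt0Pr => e e0; have [d d0 dP] := small_factor (M * (c + 1) + 1) e0.
  have := key d d0; have : 0 <= M * xpn (u a') by exact: mulr_ge0.
  have : 0 <= M * (c + 1) * N by rewrite !mulr_ge0//; lra.
  nra.
move=> e0; have [W [vW [gW [hW W0 nW]]]] := Xp_extension xu e0.
have [hW' nW'] := E1_shift_itv a' b' hW.
have hz := E1_dataB p_gt1 ic (mitv a' b') hd hW'.
have sol : lin_sol a' b' (fun t => H t - (gW (t - a') + A (vW (t - a'))))
    (u \- (fun t => W (t - a'))) (v \- (fun t => vW (t - a'))) (g \- (fun t => gW (t - a'))).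
  split; [exact: hz|by rewrite /= subrr W0 subrr|].
  by apply: ae_all => t _ /=; rewrite linearB /H opprD addrACA.
have n1 := MP _ _ _ _ _ _ aa' ab' bb' sol.
have [_ _ [gL _] [vL _]] := hd; have [_ uWL [gWL _] [vWL _]] := hW'.
have [AvL _] := in_Lp_linear p1 (mitv a' b') Ac c0 cP vL.
have [AWL AWn] := in_Lp_linear p1 (mitv a' b') Ac c0 cP vWL.
have [HL _] := in_LpD p1 (mitv a' b') gL AvL.
have [HWL HWn] := in_LpD p1 (mitv a' b') gWL AWL.
have [_ n2] := in_LpB p1 (mitv a' b') HL HWL.
have n3 := E1nD p_gt1 (mitv a' b') hz hW'.
rewrite (_ : _ \- _ \+ _ = u) in n3; last by apply/funext => t /=; rewrite subrK.
rewrite (_ : _ \- _ \+ _ = v) in n3; last by apply/funext => t /=; rewrite subrK.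
rewrite (_ : _ \- _ \+ _ = g) in n3; last by apply/funext => t /=; rewrite subrK.
have n4 : Lpn p `[a', b'] (fun t => gW (t - a') + A (vW (t - a'))) <=
   (c + 1) * En `[a', b'] (fun t => W (t - a')) (fun t => vW (t - a')) (fun t => gW (t - a')).
  apply: (le_trans HWn); have := Lpn_ge0 p `[a', b'] (fun t => W (t - a')).
  have := Lpn_ge0 p `[a', b'] (fun t => gW (t - a')).
  by have := Lpn_ge0 p `[a', b'] (fun t => vW (t - a')); rewrite /E1n; nra.
set EW := En `[a', b'] _ _ _ in n3 n4 nW'.
have EW' : EW <= xpn (u a') + e by exact: le_trans nW' (ltW nW).
apply: (le_trans n3); apply: lerD => //; apply: (le_trans n1); apply: ler_wpM2l => //.
apply: (le_trans n2); apply: lerD => //; apply: (le_trans n4); apply: ler_wpM2l => //; lra.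
Qed.

(** Instead of integrating [g] up to [b], the linear problem with right-hand side [g + A v] and
    initial value [u a] is solved on the whole interval; uniqueness on each [[a, r]] identifies its
    solution with [u]. [A] is only an auxiliary operator, unrelated to any equation for [u]. *)
Lemma E1_data_extend a b u v g : a < b ->
  (forall r, a < r < b -> E1_data p i `[a, r] u v g) -> Xp p i (u a) ->
  in_Lp p `[a, b] v -> in_Lp p `[a, b] g ->
  exists2 w, E1_data p i `[a, b] w v g & forall t, a <= t < b -> w t = u t.
Proof.
move=> ab hr xu vL gL; have [c c0 cP] := continuous_linear_bound Ac.
have [W [vW [gW [hW W0 _]]]] := Xp_extension xu ltr01.
have [hW' _] := E1_shift_itv a b hW.
have [_ _ [gWL _] [vWL _]] := hW'.
have [AvL _] := in_Lp_linear p1 (mitv a b) Ac c0 cP vL.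
have [AWL _] := in_Lp_linear p1 (mitv a b) Ac c0 cP vWL.
have [HL _] := in_LpD p1 (mitv a b) gL AvL.
have [HWL _] := in_LpD p1 (mitv a b) gWL AWL.
have [DL _] := in_LpB p1 (mitv a b) HL HWL.
have [z [vz [gz [hz za ez]]]] := linear_solution_exists (A_mr ab) DL.
have hw := E1_dataD p_gt1 ic (mitv a b) hz hW'.
have agree r : a < r < b -> [/\ {in `[a, r], z \+ (fun t => W (t - a)) =1 u},
    {ae mu, forall t, `[a, r]%classic t -> vz t + vW (t - a) = v t} &
    {ae mu, forall t, `[a, r]%classic t -> gz t + gW (t - a) = g t}].
  move=> arb; have /andP[ar rb] := arb.
  have sub : `[a, r] `<=` (`[a, b] : set R) by apply: sub_itvcc => //; exact: ltW.
  have s1 : lin_sol a r (fun t => g t + A (v t) - (gW (t - a) + A (vW (t - a)))) z vz gz.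
    split; [exact: (E1_dataS p_gt1 ic (mitv _ _) (mitv _ _) sub hz)|exact: za|].
    by apply: aeS ez => t h /sub /h.
  have s2 : lin_sol a r (fun t => g t + A (v t) - (gW (t - a) + A (vW (t - a))))
      (u \- (fun t => W (t - a))) (v \- (fun t => vW (t - a))) (g \- (fun t => gW (t - a))).
    split.
    - apply: (E1_dataB p_gt1 ic (mitv a r) (hr r arb)).
      exact: (E1_dataS p_gt1 ic (mitv _ _) (mitv _ _) sub hW').
    - by rewrite /= subrr W0 subrr.
    - by apply: ae_all => t _ /=; rewrite linearB opprD addrACA.
  have [e1 e2 e3] := linear_solution_unique p_gt1 Ac inji (A_mr ar) s1 s2.
  split; [by move=> t tt; rewrite /= e1//= subrK| |].
  - by apply: aeS e2 => t + tt => /(_ tt) ->; rewrite /= subrK.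
  - by apply: aeS e3 => t + tt => /(_ tt) ->; rewrite /= subrK.
pose r_ (k : nat) := b - (b - a) / k.+2%:R.
have r_P k : a < r_ k < b.
  rewrite /r_; have k2 : (1 : R) < k.+2%:R by rewrite ltr1n.
  have k0 : (0 : R) < k.+2%:R by lra.
  apply/andP; split; last by rewrite ltrBlDr ltrDl divr_gt0// subr_gt0.
  by rewrite ltrBrDl addrC -ltrBrDl ltr_pdivrMr//; nra.
have r_ex t : t < b -> exists k, t <= r_ k.
  move=> tb; have tb0 : 0 < b - t by lra.
  exists (Num.truncn ((b - a) / (b - t))).
  have := truncnS_gt ((b - a) / (b - t)); rewrite ltr_pdivrMr// => hk.
  rewrite /r_ lerBrDr -lerBrDl ler_pdivrMr ?ltr0n//.
  set k := Num.truncn _ in hk *.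
  have : (k.+1%:R : R) <= k.+2%:R by rewrite ler_nat.
  by nra.
have ne : {ae mu, forall t, t != b}.
  by exists [set b]; split => //; [exact: lebesgue_measure_set1|
    move=> t /= /negP; rewrite negbK => /eqP].
have glob Z (F G : R -> Z) : (forall k, {ae mu, forall t, `[a, r_ k]%classic t -> F t = G t}) ->
    {ae mu, forall t, `[a, b]%classic t -> F t = G t}.
  move=> /ae_foralln h; apply: aeS (aeI h ne) => t [h1 tn]; rewrite /= in_itv/= => /andP[at_ tb].
  have [|k kP] := r_ex t; first by rewrite lt_neqAle tn.
  by apply: (h1 k); rewrite /= in_itv/= at_.
exists (z \+ (fun t => W (t - a))); last first.
  move=> t /andP[at_ tb]; have [k kP] := r_ex t tb.
  by have [h _ _] := agree _ (r_P k); apply: h; rewrite in_itv/= at_.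
apply: (E1_data_ae p_gt1 ic (mitv a b) hw).
- by apply: glob => k; have [] := agree _ (r_P k).
- by apply: glob => k; have [] := agree _ (r_P k).
Qed.

End UniformMaximalRegularity.

(** * Local existence for the quasilinear equation *)

Lemma op_norm_lt {R : realType} {X0 X1 : completeNormedModType R}
    (B1 B2 : {linear X1 -> X0}) (e : R) : (op_norm (B1 \- B2)%R < e%:E)%E ->
  forall v, `|B1 v - B2 v| <= e * `|v|.
Proof.
move=> h v; have [->|v0] := eqVneq v 0; first by rewrite (linear0 B1) (linear0 B2) subr0 !normr0 mulr0.
have nv : 0 < `|v| by rewrite normr_gt0.
have : ((`|B1 (`|v|^-1 *: v) - B2 (`|v|^-1 *: v)|)%:E <= op_norm (B1 \- B2)%R)%E.
  apply: ereal_sup_ubound; exists (`|v|^-1 *: v) => //=.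
  by rewrite normrZ ger0_norm ?invr_ge0// mulVf// gt_eqF.
move=> /le_lt_trans/(_ h); rewrite lte_fin (linearZZ B1) (linearZZ B2) -scalerBr normrZ ger0_norm ?invr_ge0//.
by rewrite mulrC ltr_pdivrMr// => /ltW.
Qed.

Section Nonlinearity.
Context {R : realType} {X0 X1 : completeNormedModType R}.
Local Notation mu := (@lebesgue_measure R).
Variables (p : R) (i : {linear X1 -> X0}).
Hypothesis p_gt1 : 1 < p.
Hypothesis ic : continuous i.
Variables (t0 : R) (A : R -> X0 -> {linear X1 -> X0}) (f : R -> X0 -> X0).
Hypothesis Af : standing_assumptions p i t0 A f.
Implicit Types (I J : set R) (u g h : R -> X0) (v w : R -> X1) (x y : X0).
Let p1 : 1 <= p := ltW p_gt1.
Local Notation En := (@E1n R X0 X1 p).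
Local Notation xpn := (Xpn p i).
Let mitv (a b : R) : measurable (`[a, b] : set R). Proof. exact: measurable_itv. Qed.

Lemma A_modulus t x e : t0 <= t -> Xp p i x -> 0 < e ->
  exists2 d, 0 < d & forall s y, t0 <= s -> Xp p i y -> `|s - t| < d -> xpn (y - x) < d ->
    forall z : X1, `|A s y z - A t x z| <= e * `|z|.
Proof.
move=> t0t xx e0; have [d d0 dP] := A_continuous Af t0t xx e0; exists d => // s y t0s yy st yx.
apply: op_norm_lt; apply: dP => //; rewrite XpnE ?lte_fin//.
by have [] := XpB p_gt1 ic yy xx.
Qed.

Lemma f_modulus : {ae mu, forall t, t0 <= t -> forall x, Xp p i x -> forall e, 0 < e ->
  exists2 d, 0 < d & forall y, Xp p i y -> xpn (y - x) < d -> `|f t y - f t x| < e}.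
Proof.
apply: aeS (f_continuous Af) => t h t0t x xx e e0.
have [d d0 dP] := h t0t x xx e e0; exists d => // y yy yx; apply: dP => //.
by rewrite XpnE ?lte_fin//; have [] := XpB p_gt1 ic yy xx.
Qed.

Definition A_lip_cst (r L : R) := forall x y (z : X1) t, Xp p i x -> Xp p i y ->
  xpn x <= r -> xpn y <= r -> t0 <= t <= t0 + r ->
  `|A t x z - A t y z| <= L * xpn (x - y) * `|z|.

Lemma A_lip_cst_exists r : 0 < r -> exists2 L, 0 < L & A_lip_cst r L.
Proof.
move=> r0; have [L L0 LP] := A_lipschitz Af r0; exists L => // x y v t xx yy xr yr tr.
have [xy _] := XpB p_gt1 ic xx yy.
have := LP x y xx yy; rewrite (XpnE xx) (XpnE yy) (XpnE xy) !lee_fin.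
by move=> /(_ xr yr v t tr); rewrite -!EFinM lee_fin.
Qed.

Definition f_lip_fun (r : R) (Psi : R -> R^o) := in_Lp_loc p t0 Psi /\
  forall x y, Xp p i x -> Xp p i y -> xpn x <= r -> xpn y <= r ->
  {ae mu, forall t, t0 <= t -> `|f t x - f t y| <= `|Psi t| * xpn (x - y)}.

Lemma f_lip_fun_exists r : 0 < r -> exists Psi, f_lip_fun r Psi.
Proof.
move=> r0; have [Psi PL PP] := f_lipschitz Af r0; exists Psi; split => // x y xx yy xr yr.
have [xy _] := XpB p_gt1 ic xx yy.
have := PP x y xx yy; rewrite (XpnE xx) (XpnE yy) !lee_fin => /(_ xr yr).
apply: aeS => t + t0t => /(_ t0t); rewrite (XpnE xy) -EFinM lee_fin => /le_trans; apply.
by rewrite ler_wpM2r ?Xpn_ge0// ler_norm.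
Qed.

Lemma Xp_path a b u v g t : E1_data p i `[a, b] u v g -> Xp p i (u a) ->
  t \in `[a, b] -> Xp p i (u t).
Proof.
by move=> hd xu; rewrite in_itv => tab; have [] := trace_bound_itv p_gt1 ic tab hd xu.
Qed.

(** Time and state of the operator are frozen together at [s], which leaves one bounded operator
    applied to a measurable function; joint continuity of [A] gives the convergence on the
    diagonal. *)
Lemma A_path_measurable a b u v g w : t0 <= a -> E1_data p i `[a, b] u v g -> Xp p i (u a) ->
  strongly_measurable `[a, b] w -> strongly_measurable `[a, b] (fun t => A t (u t) (w t)).
Proof.
move=> t0a hd xu wm.
apply: (@strongly_measurable_diag _ _ a b (fun t s => A s (u s) (w t))) => [s sab|].
  have t0s : t0 <= s by move: sab; rewrite in_itv/= => /andP[]; lra.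
  by apply: strongly_measurable_comp wm; apply: (A_bounded Af t0s); exact: Xp_path hd xu sab.
apply: ae_all => t tab s_ sab st.
have t0s s : s \in `[a, b] -> t0 <= s by rewrite in_itv/= => /andP[]; lra.
have xs s : s \in `[a, b] -> Xp p i (u s) by exact: Xp_path hd xu.
apply/cvgrPdist_lt => e e0.
have [e' e'0 ee'] := small_factor (`|w t| + 1) e0.
have [d d0 dP] := A_modulus (t0s _ tab) (xs _ tab) e'0.
have [d' d'0 d'P] := Xpn_continuous p_gt1 ic hd xu tab d0.
have dd0 : 0 < Num.min d d' by rewrite lt_min d0.
move/cvgrPdist_lt : st => /(_ _ dd0); apply: filterS => k.
rewrite lt_min distrC => /andP[k1 k2].
have := dP _ _ (t0s _ (sab k)) (xs _ (sab k)) k1 (d'P _ (sab k) k2) (w t).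
rewrite distrC => /le_lt_trans; apply; apply: lt_le_trans ee'.
by rewrite mulrDl mul1r mulrC ltrDl.
Qed.

(** Only the state is frozen, since [f] is merely measurable in time. The null set of [f_modulus]
    serves all states at once. *)
Lemma f_path_measurable a b u v g : t0 <= a -> E1_data p i `[a, b] u v g -> Xp p i (u a) ->
  strongly_measurable `[a, b] (fun t => f t (u t)).
Proof.
move=> t0a hd xu.
have t0s s : s \in `[a, b] -> t0 <= s by rewrite in_itv/= => /andP[]; lra.
have xs s : s \in `[a, b] -> Xp p i (u s) by exact: Xp_path hd xu.
apply: (@strongly_measurable_diag _ _ a b (fun t s => f t (u s))) => [s sab|].
  apply: strongly_measurableS (f_measurable Af (xs _ sab)) => t /t0s.
  by rewrite /= in_itv/= andbT.
apply: aeS f_modulus => t h tab s_ sab st.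
apply/cvgrPdist_lt => e e0.
have [d d0 dP] := h (t0s _ tab) _ (xs _ tab) e e0.
have [d' d'0 d'P] := Xpn_continuous p_gt1 ic hd xu tab d0.
move/cvgrPdist_lt : st => /(_ _ d'0); apply: filterS => k; rewrite distrC => kd.
by rewrite distrC; apply: dP; [exact: xs|exact: d'P].
Qed.

(* The exceptional set of the Lipschitz bound depends on the pair of points;
   rational times and continuity give one null set for the two paths. *)
Lemma f_path_lipschitz a b r Psi u v g u' v' g' : t0 <= a -> a < b -> f_lip_fun r Psi ->
  E1_data p i `[a, b] u v g -> Xp p i (u a) -> E1_data p i `[a, b] u' v' g' -> Xp p i (u' a) ->
  {in `[a, b], forall t, xpn (u t) <= r} -> {in `[a, b], forall t, xpn (u' t) <= r} ->
  {ae mu, forall t, `[a, b]%classic t ->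
    `|f t (u t) - f t (u' t)| <= `|Psi t| * xpn (u t - u' t)}.
Proof.
move=> t0a ab [PL PP] hd xu hd' xu' ur ur'.
have t0s s : s \in `[a, b] -> t0 <= s by rewrite in_itv/= => /andP[]; lra.
have xs s : s \in `[a, b] -> Xp p i (u s) by exact: Xp_path hd xu.
have xs' s : s \in `[a, b] -> Xp p i (u' s) by exact: Xp_path hd' xu'.
pose q (n : nat) : R := ratr (odflt (0 : rat) (unpickle n)).
have qP : {ae mu, forall t, forall n, q n \in `[a, b] -> t0 <= t ->
    `|f t (u (q n)) - f t (u' (q n))| <= `|Psi t| * xpn (u (q n) - u' (q n))}.
  apply/ae_foralln => n; have [qab|qab] := boolP (q n \in `[a, b]); last by apply: ae_all.
  by apply: aeS (PP _ _ (xs _ qab) (xs' _ qab) (ur _ qab) (ur' _ qab)) => t h _.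
apply: aeS (aeI qP f_modulus) => t [h1 h2] tab.
have t0t := t0s _ tab.
apply/ler_addgt0Pr => e e0.
have [e' e'0 ee'] := small_factor (2 + 2 * `|Psi t|) e0.
have [d1 d10 d1P] := h2 t0t _ (xs _ tab) _ e'0.
have [d2 d20 d2P] := h2 t0t _ (xs' _ tab) _ e'0.
have m1 : 0 < Num.min d1 e' by rewrite lt_min d10.
have m2 : 0 < Num.min d2 e' by rewrite lt_min d20.
have [c1 c10 c1P] := Xpn_continuous p_gt1 ic hd xu tab m1.
have [c2 c20 c2P] := Xpn_continuous p_gt1 ic hd' xu' tab m2.
(* The rational is sought in an open interval inside [[a, b]] that is nonempty because [a < b], also
   when [t] is an end point. *)
have [n qab qt] : exists2 n, q n \in `[a, b] & `|q n - t| < Num.min c1 c2.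
  have c0 : 0 < Num.min c1 c2 by rewrite lt_min c10.
  have tab' : a <= t <= b by move: tab; rewrite /= in_itv.
  have lo : Num.max a (t - Num.min c1 c2) < Num.min b (t + Num.min c1 c2).
    by rewrite lt_min !gt_max; lra.
  have [s] := rat_in_itvoo lo; rewrite in_itv/= lt_min gt_max => /andP[/andP[s1 s2] /andP[s3 s4]].
  exists (pickle s); rewrite /q pickleK/=; first by rewrite in_itv/= !ltW.
  by rewrite ltr_norml; lra.
move: qt; rewrite lt_min => /andP[q1 q2].
have := c1P _ qab q1; rewrite lt_min => /andP[k1 k1'].
have := c2P _ qab q2; rewrite lt_min => /andP[k2 k2'].
have f1 := d1P _ (xs _ qab) k1; have f2 := d2P _ (xs' _ qab) k2.
have f3 := h1 n qab t0t.
have [xd _] := XpB p_gt1 ic (xs _ qab) (xs' _ qab).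
have x1 : xpn (u (q n) - u' (q n)) <= xpn (u t - u' t) + 2 * e'.
  have := Xpn_triangle p_gt1 ic (xs _ qab) (xs _ tab) (xs' _ qab).
  have := Xpn_triangle p_gt1 ic (xs _ tab) (xs' _ tab) (xs' _ qab).
  rewrite [xpn (u' t - _)](XpnC p_gt1 ic (xs' _ tab) (xs' _ qab)); lra.
have x2 : `|Psi t| * xpn (u (q n) - u' (q n)) <= `|Psi t| * (xpn (u t - u' t) + 2 * e').
  by rewrite ler_wpM2l.
have -> : f t (u t) - f t (u' t) = (f t (u (q n)) - f t (u' (q n))) -
    ((f t (u (q n)) - f t (u t)) - (f t (u' (q n)) - f t (u' t))).
  rewrite -[LHS](subKr (f t (u (q n)) - f t (u' (q n)))); congr (_ - _).
  by rewrite !opprD addrACA.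
have := ler_normB (f t (u (q n)) - f t (u' (q n)))
  ((f t (u (q n)) - f t (u t)) - (f t (u' (q n)) - f t (u' t))).
have := ler_normB (f t (u (q n)) - f t (u t)) (f t (u' (q n)) - f t (u' t)).
lra.
Qed.

End Nonlinearity.

Section Picard.
Context {R : realType} {X0 X1 : completeNormedModType R}.
Local Notation mu := (@lebesgue_measure R).
Variables (p : R) (i : {linear X1 -> X0}).
Hypothesis p_gt1 : 1 < p.
Hypothesis ic : continuous i.
Local Notation En := (@E1n R X0 X1 p).
Let p1 : 1 <= p := ltW p_gt1.
Let mitv (a b : R) : measurable (`[a, b] : set R). Proof. exact: measurable_itv. Qed.

(** Each iterate solves the linear problem whose right-hand side is [H] at the previous one, and
    increments halve. No fixed point equation is concluded: nothing is assumed about pointwise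
    limits of [H], so the iterates are returned with their convergence, and the caller passes to the
    limit in the equation. *)
Lemma linear_picard (As : {linear X1 -> X0}) (a b C rho : R)
    (H : (R -> X0) * (R -> X1) * (R -> X0) -> R -> X0) :
  let adm z := [/\ E1_data p i `[a, b] z.1.1 z.1.2 z.2, z.1.1 a = 0 &
    En `[a, b] z.1.1 z.1.2 z.2 <= rho] in
  a < b -> 0 < rho -> 0 <= C -> continuous As -> maximal_regularity p i a b As ->
  (forall u v g, E1_data p i `[a, b] u v g -> u a = 0 ->
     En `[a, b] u v g <= C * Lpn p `[a, b] (fun t => g t + As (v t))) ->
  (forall z, adm z -> in_Lp p `[a, b] (H z)) ->
  C * Lpn p `[a, b] (H (fun=> 0, fun=> 0, fun=> 0)) <= rho / 2 ->
  (forall z z', adm z -> adm z' -> C * Lpn p `[a, b] (H z \- H z') <=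
     En `[a, b] (z.1.1 \- z'.1.1) (z.1.2 \- z'.1.2) (z.2 \- z'.2) / 2) ->
  exists u v g (zs : nat -> (R -> X0) * (R -> X1) * (R -> X0)),
    [/\ E1_data p i `[a, b] u v g, u a = 0, forall n, adm (zs n) &
     [/\ forall n, En `[a, b] (u \- (zs n).1.1) (v \- (zs n).1.2) (g \- (zs n).2) <=
           3 * rho * 2^-1 ^+ n,
        {ae mu, forall t, `[a, b]%classic t -> (zs n).1.2 t @[n --> \oo] --> v t},
        {ae mu, forall t, `[a, b]%classic t -> (zs n).2 t @[n --> \oo] --> g t} &
        {ae mu, forall t, forall n, `[a, b]%classic t ->
          (zs n.+1).2 t + As ((zs n.+1).1.2 t) = H (zs n) t}]].
Proof.
move=> adm ab rho0 C0 Asc mr est HL H0 Hc.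
have mI := mitv a b.
have step z : exists z' : (R -> X0) * (R -> X1) * (R -> X0),
    adm z -> linear_solution p i As a b (H z) z'.1.1 z'.1.2 z'.2.
  have [az|naz] := pselect (adm z); last by exists z => /naz.
  have [u [v [g h]]] := linear_solution_exists mr (HL z az).
  by exists (u, v, g).
have [S SP] := choice step.
pose zs := fix zs (n : nat) : (R -> X0) * (R -> X1) * (R -> X0) :=
  if n is k.+1 then S (zs k) else (fun=> 0, fun=> 0, fun=> 0).
pose ds n : (R -> X0) * (R -> X1) * (R -> X0) := ((zs n.+1).1.1 \- (zs n).1.1,
  (zs n.+1).1.2 \- (zs n).1.2, (zs n.+1).2 \- (zs n).2).
(* Increments of size [rho / 2 * 2^-n] add up to [rho - rho * 2^-n], so the iterates stay in the
   ball where [H] is controlled. *)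
have main n : [/\ E1_data p i `[a, b] (zs n).1.1 (zs n).1.2 (zs n).2, (zs n).1.1 a = 0,
    En `[a, b] (zs n).1.1 (zs n).1.2 (zs n).2 <= rho - rho * 2^-1 ^+ n &
    En `[a, b] (ds n).1.1 (ds n).1.2 (ds n).2 <= rho / 2 * 2^-1 ^+ n].
  elim: n => [|n [h1 h2 h3 h4]].
    have d0 : E1_data p i `[a, b] (zs 0%N).1.1 (zs 0%N).1.2 (zs 0%N).2 by exact: E1_data0.
    have n0 : En `[a, b] (zs 0%N).1.1 (zs 0%N).1.2 (zs 0%N).2 = 0.
      rewrite /E1n (proj2 (in_Lp_cst0 p1 _ (0 : X0))) (proj2 (in_Lp_cst0 p1 _ (0 : X1))).
      by rewrite !addr0.
    split; [exact: d0|by []|by rewrite n0 expr0 mulr1 subrr|].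
    have az : adm (zs 0%N) by split; [exact: d0|by []|rewrite n0 ltW].
    have [hd ua he] := SP _ az.
    have := E1_dataB p_gt1 ic mI hd d0 => hB.
    have := est _ _ _ hB; rewrite /= subr0 => /(_ ua) /le_trans; rewrite expr0 mulr1; apply.
    apply: le_trans H0; apply: ler_wpM2l => //.
    apply: (Lpn_le_ae p1 mI (HL _ az)).
    by apply: aeS he => t h tab; rewrite /= !subr0 h.
  have q0 : 0 <= rho * 2^-1 ^+ n by rewrite mulr_ge0 ?exprn_ge0// ltW.
  have azn : adm (zs n) by split; [exact: h1|exact: h2|lra].
  have [hd ua he] := SP _ azn; rewrite -/(zs n.+1) in hd ua he.
  have hds := E1_dataB p_gt1 ic mI hd h1.
  have n1 : En `[a, b] (zs n.+1).1.1 (zs n.+1).1.2 (zs n.+1).2 <= rho - rho * 2^-1 ^+ n.+1.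
    have := E1nD p_gt1 mI hds h1.
    rewrite (_ : _ \- _ \+ _ = (zs n.+1).1.1); last by apply/funext => t; rewrite /= subrK.
    rewrite (_ : _ \- _ \+ _ = (zs n.+1).1.2); last by apply/funext => t; rewrite /= subrK.
    rewrite (_ : _ \- _ \+ _ = (zs n.+1).2); last by apply/funext => t; rewrite /= subrK.
    move=> /le_trans; apply; rewrite /ds/= in h4; rewrite exprS; lra.
  have q1 : 0 <= rho * 2^-1 ^+ n.+1 by rewrite mulr_ge0 ?exprn_ge0// ltW.
  have azn1 : adm (zs n.+1) by split; [exact: hd|exact: ua|lra].
  have [hd' ua' he'] := SP _ azn1; rewrite -/(zs n.+2) in hd' ua' he'.
  split; [exact: hd|exact: ua|exact: n1|].
  have hds' := E1_dataB p_gt1 ic mI hd' hd.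
  have := est _ _ _ hds'; rewrite /= -/(zs n.+1) -/(zs n.+2) ua ua' subr0 => /(_ erefl) /le_trans; apply.
  have [BL _] := in_LpB p1 mI (HL _ azn1) (HL _ azn).
  apply: (@le_trans _ _ (C * Lpn p `[a, b] (H (zs n.+1) \- H (zs n)))).
    apply: ler_wpM2l => //; apply: (Lpn_le_ae p1 mI BL).
    apply: aeS (aeI he he') => t [e1 e2] tab.
    by rewrite /= -/(zs n.+1) -/(zs n.+2) -e1// -e2// linearB opprD addrACA.
  apply: (le_trans (Hc _ _ azn1 azn)); rewrite /ds in h4; rewrite /= -/(zs n.+1) in h4 *.
  rewrite exprS; move: h4; lra.
have adm_zs n : adm (zs n).
  have [h1 h2 h3 _] := main n; split; [exact: h1|exact: h2|].
  have : 0 <= rho * 2^-1 ^+ n by rewrite mulr_ge0 ?exprn_ge0// ltW.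
  lra.
have [cc ct] := series_half (rho / 2).
have hds n : E1_data p i `[a, b] (ds n).1.1 (ds n).1.2 (ds n).2.
  have [h1 _ _ _] := main n; have [h2 _ _ _] := main n.+1.
  exact: (E1_dataB p_gt1 ic mI h2 h1).
have [|||u [v [g [hd ua vE gE ut]]]] := @E1_series R X0 X1 p i p_gt1 ic a b
   (fun k => (ds k).1.1) (fun k => (ds k).2) (fun k => (ds k).1.2) (fun k => rho / 2 * 2^-1 ^+ k) ab hds.
- by move=> k; rewrite /ds /=; have [_ -> _ _] := main k; have [_ + _ _] := main k.+1;
    rewrite /= => ->; rewrite subr0.
- by move=> k; have [] := main k.
- exact: cc.
have tel (Z : zmodType) (F : nat -> Z) n : F 0%N = 0 -> \sum_(k < n) (F k.+1 - F k) = F n.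
  move=> F0; elim: n => [|n IH]; first by rewrite big_ord0 F0.
  by rewrite big_ord_recr/= IH addrC subrK.
exists u, v, g, zs; split; [exact: hd|exact: ua|exact: adm_zs|]; split.
- move=> n; have := ut n; rewrite ct.
  rewrite (_ : (fun t => u t - _) = u \- (zs n).1.1); last first.
    by apply/funext => t; rewrite /= (tel _ (fun n => (zs n).1.1 t)).
  rewrite (_ : (fun t => v t - _) = v \- (zs n).1.2); last first.
    by apply/funext => t; rewrite /= (tel _ (fun n => (zs n).1.2 t)).
  rewrite (_ : (fun t => g t - _) = g \- (zs n).2); last first.
    by apply/funext => t; rewrite /= (tel _ (fun n => (zs n).2 t)).
  lra.
- apply: aeS vE => t + tab => /(_ tab).
  rewrite (_ : series _ = (fun n => (zs n).1.2 t))//; apply/funext => n.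
  by rewrite /series/= big_mkord (tel _ (fun n => (zs n).1.2 t)).
- apply: aeS gE => t + tab => /(_ tab).
  rewrite (_ : series _ = (fun n => (zs n).2 t))//; apply/funext => n.
  by rewrite /series/= big_mkord (tel _ (fun n => (zs n).2 t)).
- by apply/ae_foralln => n; have [_ _] := SP _ (adm_zs n).
Qed.

End Picard.

Lemma cvg_half_expr {R : realType} : (2^-1 : R) ^+ n @[n --> \oo] --> 0.
Proof. by apply: cvg_expr; rewrite ger0_norm; lra. Qed.

Lemma norm_le_near {R : realType} {X : normedModType R} (x y : X) :
  `|x - y| < 1 -> `|y| <= `|x| + 1.
Proof. by move=> h; have := ler_normB x (x - y); rewrite subKr; lra. Qed.

Lemma Lpn_initial {R : realType} {X : completeNormedModType R} (p a d1 d2 d e : R) (F : R -> X) :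
  1 <= p -> in_Lp p `[a, a + d1] F -> d <= d1 -> d <= d2 ->
  Lpn p (`[a, a + d1] `&` `[a - d2, a + d2]) F < e -> Lpn p `[a, a + d] F <= e.
Proof.
move=> p1 FL dd1 dd2 hF; apply: ltW; apply: le_lt_trans hF.
have m1 : measurable (`[a, a + d1] : set R) by exact: measurable_itv.
have mm : measurable (`[a, a + d1] `&` `[a - d2, a + d2] : set R).
  by apply: measurableI; exact: measurable_itv.
have [FL' _] := in_LpS p1 m1 (@subIsetl _ _ `[a - d2, a + d2]) FL.
have [] := @in_LpS R p p1 X _ `[a, a + d] F mm _ FL'; last by [].
move=> t /=; rewrite !in_itv/= => /andP[? ?].
by split; apply/andP; split; lra.
Qed.

(** The three terms cost [q * E], [2 * q * E] and [q * E]; with [C * q <= 1 / 8] their sum times [C]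
    is at most [E / 2]. *)
Lemma contraction_constant {R : realFieldType} (C q L e rho E N1 N2 N3 : R) :
  0 <= C -> C * q <= 1 / 8 -> 0 <= q -> 0 <= L -> L * e <= q -> L * rho <= q -> 0 <= E ->
  N1 <= E -> N2 <= e + rho -> N3 <= q ->
  C * (q * N1 + L * E * N2 + E * N3) <= E / 2.
Proof.
move=> C0 Cq q0 L0 Le Lrho E0 n1 n2 n3.
have k1 : q * N1 <= q * E by apply: ler_wpM2l.
have k2 : L * E * N2 <= E * (q + q).
  rewrite [L * E]mulrC -mulrA; apply: ler_wpM2l => //.
  by apply: (@le_trans _ _ (L * (e + rho))); [exact: ler_wpM2l|rewrite mulrDr lerD].
have k3 : E * N3 <= E * q by apply: ler_wpM2l.
apply: (@le_trans _ _ (C * (4 * q * E))); first by apply: ler_wpM2l => //; lra.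
rewrite (_ : C * (4 * q * E) = 4 * (C * q) * E); last by ring.
by apply: (@le_trans _ _ (4 * (1 / 8) * E)); [apply: ler_wpM2r => //; lra|lra].
Qed.

Section LocalExistence.
Context {R : realType} {X0 X1 : completeNormedModType R}.
Local Notation mu := (@lebesgue_measure R).
Variables (p : R) (i : {linear X1 -> X0}).
Hypothesis p_gt1 : 1 < p.
Hypothesis ic : continuous i.
Hypothesis inji : injective i.
Variables (t0 : R) (A : R -> X0 -> {linear X1 -> X0}) (f : R -> X0 -> X0).
Hypothesis Af : standing_assumptions p i t0 A f.
Implicit Types (I J : set R) (u g h : R -> X0) (v w : R -> X1) (x y : X0).
Let p1 : 1 <= p := ltW p_gt1.
Local Notation En := (@E1n R X0 X1 p).
Local Notation xpn := (Xpn p i).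
Let mitv (a b : R) : measurable (`[a, b] : set R). Proof. exact: measurable_itv. Qed.

(* The quasilinear equation with a frozen operator [As] reads
   [g t + As (v t) = frozen_rhs As u v t]. *)
Definition frozen_rhs (As : {linear X1 -> X0}) u v t : X0 :=
  As (v t) - A t (u t) (v t) + f t (u t).

(** The difference is split so that [A] at [u] minus [As] acts on [v - v'], while the Lipschitz
    difference of [A] acts on [v'], the lift of the second path. Thus [A] has to be close to [As]
    only along the first path, and only the second lift has to be small in applications. *)
Lemma frozen_rhs_diff (As : {linear X1 -> X0}) a b r L (Psi : R -> R^o) eps om
    u v g u' v' g' : continuous As ->
  t0 <= a -> a < b -> b <= t0 + r -> A_lip_cst p i t0 A r L -> f_lip_fun p i t0 f r Psi -> 0 <= L ->
  E1_data p i `[a, b] u v g -> Xp p i (u a) -> E1_data p i `[a, b] u' v' g' -> Xp p i (u' a) ->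
  {in `[a, b], forall t, xpn (u t) <= r} -> {in `[a, b], forall t, xpn (u' t) <= r} ->
  {in `[a, b], forall t, xpn (u t - u' t) <= om} -> 0 <= eps -> 0 <= om ->
  {in `[a, b], forall t, forall z : X1, `|A t (u t) z - As z| <= eps * `|z|} ->
  in_Lp p `[a, b] (frozen_rhs As u v \- frozen_rhs As u' v') /\
  Lpn p `[a, b] (frozen_rhs As u v \- frozen_rhs As u' v') <=
    eps * Lpn p `[a, b] (v \- v') + L * om * Lpn p `[a, b] v' + om * Lpn p `[a, b] Psi.
Proof.
move=> Asc t0a ab br lipA lipf L0 hd xu hd' xu' ur ur' uu eps0 om0 clA.
have mI := mitv a b.
have [_ _ _ [vL _]] := hd; have [_ _ _ [vL' _]] := hd'.
have [vB _] := in_LpB p1 mI vL vL'.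
have PL : in_Lp p `[a, b] Psi by case: lipf => h _; exact: h.
apply: in_Lp_le3; [exact: p1|exact: mI| |exact: eps0| |exact: om0|exact: vB|exact: vL'|exact: PL|].
- apply: strongly_measurableB; apply: strongly_measurableD.
  + apply: strongly_measurableB; first exact: (strongly_measurable_comp Asc (proj1 vL)).
    exact: (A_path_measurable p_gt1 ic Af t0a hd xu (proj1 vL)).
  + exact: (f_path_measurable p_gt1 ic Af t0a hd xu).
  + apply: strongly_measurableB; first exact: (strongly_measurable_comp Asc (proj1 vL')).
    exact: (A_path_measurable p_gt1 ic Af t0a hd' xu' (proj1 vL')).
  + exact: (f_path_measurable p_gt1 ic Af t0a hd' xu').
- exact: mulr_ge0.
have fl := f_path_lipschitz p_gt1 ic Af t0a ab lipf hd xu hd' xu' ur ur'.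
apply: aeS fl => t /[swap] tab /(_ tab) hf.
have tr : t0 <= t <= t0 + r by move: tab; rewrite /= in_itv/= => /andP[]; lra.
have xt := Xp_path p_gt1 ic hd xu tab; have xt' := Xp_path p_gt1 ic hd' xu' tab.
have hA := lipA _ _ (v' t) _ xt xt' (ur _ tab) (ur' _ tab) tr.
have hc := clA _ tab (v t - v' t).
rewrite (_ : (frozen_rhs As u v \- frozen_rhs As u' v') t =
    - (A t (u t) (v t - v' t) - As (v t - v' t)) - (A t (u t) (v' t) - A t (u' t) (v' t))
    + (f t (u t) - f t (u' t))); last first.
  rewrite /frozen_rhs /= (linearB (A t (u t))) (linearB As) opprD addrACA; congr (_ + _).
  rewrite -[RHS]opprD [X in _ = - X]addrAC [X in _ = - (X - _)]addrA subrK [RHS]opprB.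
  by rewrite !opprD addrACA.
apply: (le_trans (ler_normD _ _)); apply: lerD.
  apply: (le_trans (ler_normB _ _)); rewrite normrN; apply: lerD => //=.
  apply: (le_trans hA); rewrite ler_wpM2r// ler_wpM2l//; exact: uu.
apply: (le_trans hf); rewrite mulrC ler_wpM2r//; exact: uu.
Qed.

(** Comparison with the zero path, whose frozen right-hand side is [f t 0]. *)
Lemma frozen_rhs_in_Lp (As : {linear X1 -> X0}) a b r eps u v g : continuous As ->
  t0 <= a -> a < b -> b <= t0 + r -> 0 < r ->
  E1_data p i `[a, b] u v g -> Xp p i (u a) ->
  {in `[a, b], forall t, xpn (u t) <= r} -> 0 <= eps ->
  {in `[a, b], forall t, forall z : X1, `|A t (u t) z - As z| <= eps * `|z|} ->
  in_Lp p `[a, b] (frozen_rhs As u v).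
Proof.
move=> Asc t0a ab br r0 hd xu ur eps0 clA; have mI := mitv a b.
have [L L0 lipA] := A_lip_cst_exists p_gt1 ic Af r0.
have [Psi lipf] := f_lip_fun_exists p_gt1 ic Af r0.
have [x0 n0] := Xp0 p_gt1 ic.
have [||dL _] := @frozen_rhs_diff As a b r L Psi eps r u v g (fun=> 0) (fun=> 0) (fun=> 0)
  Asc t0a ab br lipA lipf (ltW L0) hd xu (E1_data0 p_gt1 ic mI) x0 ur _ _ eps0 (ltW r0) clA.
- by move=> t _; rewrite n0 ltW.
- by move=> t tab; rewrite subr0; exact: ur.
have fL := f_zero_Lp_loc Af b t0a.
have [h _] := in_LpD p1 mI dL fL.
rewrite (_ : _ \+ _ = frozen_rhs As u v) in h => //.
by apply/funext => t; rewrite /frozen_rhs /= (linear0 As) (linear0 (A t 0)) subr0 add0r subrK.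
Qed.

(** The solution is sought as [Wt + z], with [Wt] an extension of [x] restarted at [tau] and [z]
    vanishing at [tau]; then [z] solves the linear problem with right-hand side [H z]. Shrinking the
    interval makes the fixed functions [H 0], [vWt] and [Psi] small, while the ball radius [rho]
    makes [z] small. *)
Lemma local_existence tau x : t0 <= tau -> Xp p i x -> exists2 d, 0 < d &
  exists u v g, [/\ E1_data p i `[tau, tau + d] u v g, u tau = x &
    {ae mu, forall t, `[tau, tau + d]%classic t -> g t + A t (u t) (v t) = f t (u t)}].
Proof.
move=> t0tau xx.
have ar1 (xn e b : R) : 0 <= xn -> e <= 1 -> b <= tau + e -> b <= t0 + (xn + 2 + (tau - t0) + 1).
  by lra.
have ar2 (e e' t b : R) : 0 < e -> e' <= e / 2 -> b <= tau + e' -> tau <= t -> t <= b ->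
    0 <= t - tau < e by move=> *; apply/andP; split; lra.
have ar3 (e m k l n o : R) : m <= k + l -> k < e / 2 -> k < 1 -> l <= n -> n <= o ->
    o <= e / 2 -> o <= 1 -> m < e /\ m <= 2 by split; lra.
have ar4 (xn m n : R) : m <= xn + n -> n <= 2 -> m <= xn + 2 + (tau - t0) + 1 by lra.
pose As := A tau x; have Asc : continuous As := A_bounded Af t0tau xx.
have Amr a b : a < b -> maximal_regularity p i a b As by exact: (A_maximal_regularity Af t0tau xx).
have tau1 : tau < tau + 1 by lra.
have [C C0 CP] := linear_estimate p_gt1 ic inji Asc Amr tau1.
(* One radius for two purposes: it bounds the X_p norms of all paths at distance at most 2 from [x],
   and [t0 + r] lies beyond the time interval, as the Lipschitz condition on [A] couples both. *)
pose r := xpn x + 2 + (tau - t0) + 1.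
have xn0 := Xpn_ge0 p i x.
have r0 : 0 < r by rewrite /r; lra.
have [L L0 lipA] := A_lip_cst_exists p_gt1 ic Af r0.
have [Psi lipf] := f_lip_fun_exists p_gt1 ic Af r0.
pose q := (8 * (C + 1))^-1.
have q0 : 0 < q by rewrite invr_gt0; lra.
have Cq : C * q <= 1 / 8.
  rewrite /q ler_pdivrMr; [|lra]; lra.
have [d1 d10 d1P] := A_modulus p_gt1 ic Af t0tau xx q0.
have [rho' rho'0 Lrho'] := small_factor L q0.
pose rho := Num.min rho' (Num.min (d1 / 2) 1).
have rho0 : 0 < rho by rewrite /rho !lt_min rho'0 ltr01 andbT divr_gt0.
have [rh1 [rh2 rh3]] : rho <= rho' /\ rho <= d1 / 2 /\ rho <= 1.
  by rewrite /rho !ge_min !lexx !orbT.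
have Lrho : L * rho <= q by apply: le_trans Lrho'; rewrite ler_wpM2l// ltW.
have [W [vW [gW [hW W0 _]]]] := Xp_extension xx ltr01.
have m0 : 0 < Num.min (d1 / 2) 1 by rewrite lt_min ltr01 divr_gt0.
have [d2 d20 d2P] := Xpn_right_continuous0 p_gt1 ic hW m0.
(* first reduction of the interval: the frozen operator is close to A along
   every path that is close to the extension of x *)
pose d3 := Num.min (d1 / 2) (Num.min (d2 / 2) 1).
have d30 : 0 < d3 by rewrite /d3 !lt_min ltr01 !divr_gt0.
have [d31 [d32 d33]] : d3 <= d1 / 2 /\ d3 <= d2 / 2 /\ d3 <= 1.
  by rewrite /d3 !ge_min !lexx !orbT.
clearbody d3.
pose Wt t := W (t - tau); pose vWt t := vW (t - tau); pose gWt t := gW (t - tau).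
have hWt b : E1_data p i `[tau, b] Wt vWt gWt by have [] := E1_shift_itv p_gt1 ic tau b hW.
have Wtau : Wt tau = x by rewrite /Wt subrr W0.
have br b : b <= tau + d3 -> b <= t0 + r by exact: ar1.
have near_W u v g b : tau < b -> b <= tau + d3 -> E1_data p i `[tau, b] u v g -> u tau = 0 ->
    En `[tau, b] u v g <= rho ->
    [/\ {in `[tau, b], forall t, xpn ((Wt \+ u) t) <= r},
        {in `[tau, b], forall t, forall z : X1, `|A t ((Wt \+ u) t) z - As z| <= q * `|z|} &
        {in `[tau, b], forall t, xpn (u t) <= En `[tau, b] u v g}].
  move=> tb bd hd ua un; have [x0 xpn0] := Xp0 p_gt1 ic.
  have xu : Xp p i (u tau) by rewrite ua.
  have ub t : t \in `[tau, b] -> Xp p i (u t) /\ xpn (u t) <= En `[tau, b] u v g.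
    rewrite in_itv/= => tt; have := trace_bound_itv p_gt1 ic tt hd xu.
    by rewrite ua xpn0 addr0.
  have key t : t \in `[tau, b] -> [/\ Xp p i ((Wt \+ u) t), xpn ((Wt \+ u) t - x) < d1 &
      xpn ((Wt \+ u) t - x) <= 2].
    move=> tt; have [xut nut] := ub t tt; have /andP[t1 t2] : tau <= t <= b by move: tt; rewrite in_itv.
    have [|xW nW] := d2P (t - tau); first exact: (ar2 _ _ _ _ d20 d32 bd t1 t2).
    rewrite W0 lt_min in nW; case/andP: nW => nW1 nW2.
    have [xWx _] := XpB p_gt1 ic xW xx.
    have [xs _] := XpD p_gt1 ic xW xut.
    have [_] := XpD p_gt1 ic xWx xut; rewrite addrAC -/(Wt t) => n.
    by have [n1 n2] := ar3 _ _ _ _ _ _ n nW1 nW2 nut un rh2 rh3; split.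
  split.
  - move=> t tt; have [xs _ n2] := key t tt.
    exact: (ar4 _ _ _ (Xpn_leB p_gt1 ic xs xx) n2).
  - move=> t tt z; have [xs n1 _] := key t tt; apply: d1P => //; move: tt; rewrite in_itv/= => /andP[].
      lra.
    move=> k1 k2; have /andP[k3 k4] := ar2 _ _ _ _ d10 d31 bd k1 k2.
    by rewrite ger0_norm.
  - by move=> t /ub[].
have [x0 xpn0] := Xp0 p_gt1 ic.
pose H (z : (R -> X0) * (R -> X1) * (R -> X0)) t :=
  frozen_rhs As (Wt \+ z.1.1) (vWt \+ z.1.2) t - (gWt t + As (vWt t)).
have rhsW b : in_Lp p `[tau, b] (fun t => gWt t + As (vWt t)).
  by have [c c0 []] := in_Lp_rhs p_gt1 Asc (mitv tau b) (hWt b).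
have H_Lp b z : tau < b -> b <= tau + d3 -> E1_data p i `[tau, b] z.1.1 z.1.2 z.2 -> z.1.1 tau = 0 ->
    En `[tau, b] z.1.1 z.1.2 z.2 <= rho -> in_Lp p `[tau, b] (H z).
  move=> tb bd hd ua un; have [n1 n2 n3] := near_W _ _ _ _ tb bd hd ua un.
  have hs := E1_dataD p_gt1 ic (mitv tau b) (hWt b) hd.
  have xs : Xp p i ((Wt \+ z.1.1) tau) by rewrite /= ua addr0 Wtau.
  have fL := frozen_rhs_in_Lp Asc t0tau tb (br _ bd) r0 hs xs n1 (ltW q0) n2.
  by have [] := in_LpB p1 (mitv tau b) fL (rhsW b).
have zero_data b := @E1_data0 R X0 X1 p i p_gt1 ic `[tau, b] (mitv tau b).
have zero_n b : En `[tau, b] (fun=> 0) (fun=> 0) (fun=> 0) = 0.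
  by rewrite /E1n (proj2 (in_Lp_cst0 p1 _ (0 : X0))) (proj2 (in_Lp_cst0 p1 _ (0 : X1))) !addr0.
pose H0 := H (fun=> 0, fun=> 0, fun=> 0).
have H0L : in_Lp p `[tau, tau + d3] H0.
  by apply: H_Lp; rewrite ?zero_n ?(ltW rho0) ?ltrDl ?lexx//=; exact: zero_data.
(* second reduction of the interval: the fixed functions have small norm *)
have [e4 e40 Ce4] := small_factor C (divr_gt0 rho0 (ltr0n R 2)).
have [d4 d40 d4P] := Lpn_small p1 tau (mitv tau (tau + d3)) H0L e40.
have vWL : in_Lp p `[tau, tau + d3] vWt by have [_ _ _ []] := hWt (tau + d3).
have [e5 e50 Le5] := small_factor L q0.
have [d5 d50 d5P] := Lpn_small p1 tau (mitv tau (tau + d3)) vWL e50.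
have PsiL : in_Lp p `[tau, tau + d3] Psi by case: lipf => h _; exact: h.
have [d6 d60 d6P] := Lpn_small p1 tau (mitv tau (tau + d3)) PsiL q0.
pose d := Num.min d3 (Num.min d4 (Num.min d5 d6)).
have d0 : 0 < d by rewrite /d !lt_min d30 d40 d50.
have [dd3 [dd4 [dd5 dd6]]] : d <= d3 /\ d <= d4 /\ d <= d5 /\ d <= d6.
  by rewrite /d !ge_min !lexx !orbT.
clearbody d.
have sH0 := Lpn_initial p1 H0L dd3 dd4 d4P.
have sW := Lpn_initial p1 vWL dd3 dd5 d5P.
have sP := Lpn_initial p1 PsiL dd3 dd6 d6P.
pose b := tau + d; have tb : tau < b by rewrite /b ltrDl.
have bd : b <= tau + d3 by rewrite /b lerD2l.
exists d => //; rewrite -/b.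
have [||||u [v [g [zs [hd ua azs [cvn vE gE eqn]]]]]] :=
  @linear_picard R X0 X1 p i p_gt1 ic As tau b C rho H tb rho0 C0 Asc (Amr _ _ tb).
- move=> u v g hd ua; have := CP tau b u v g (lexx _) tb _ hd; rewrite ua xpn0 addr0.
  by apply => //; rewrite /b lerD2l (le_trans dd3).
- by move=> z [h1 h2 h3]; exact: H_Lp.
- apply: le_trans Ce4; exact: ler_wpM2l.
- move=> z z' [h1 h2 h3] [h1' h2' h3'].
  have [n1 n2 n3] := near_W _ _ _ _ tb bd h1 h2 h3.
  have [n1' n2' n3'] := near_W _ _ _ _ tb bd h1' h2' h3'.
  have hs := E1_dataD p_gt1 ic (mitv tau b) (hWt b) h1.
  have hs' := E1_dataD p_gt1 ic (mitv tau b) (hWt b) h1'.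
  have xs : Xp p i ((Wt \+ z.1.1) tau) by rewrite /= h2 addr0 Wtau.
  have xs' : Xp p i ((Wt \+ z'.1.1) tau) by rewrite /= h2' addr0 Wtau.
  have hB := E1_dataB p_gt1 ic (mitv tau b) h1 h1'.
  set EB := En _ _ _ _; have EB0 : 0 <= EB by exact: E1n_ge0.
  have uB : {in `[tau, b], forall t, xpn ((Wt \+ z.1.1) t - (Wt \+ z'.1.1) t) <= EB}.
    move=> t tt; rewrite /= opprD addrACA subrr add0r.
    have tt' : tau <= t <= b by move: tt; rewrite in_itv.
    have := trace_bound_itv p_gt1 ic tt' hB; rewrite /= h2 h2' subrr xpn0 addr0.
    by move=> /(_ x0)[].
  have [fL fn] := frozen_rhs_diff Asc t0tau tb (br _ bd) lipA lipf (ltW L0) hs xs hs' xs' n1 n1' uB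
    (ltW q0) EB0 n2.
  rewrite (_ : H z \- H z' = frozen_rhs As (Wt \+ z.1.1) (vWt \+ z.1.2) \-
     frozen_rhs As (Wt \+ z'.1.1) (vWt \+ z'.1.2)); last first.
    by apply/funext => t; rewrite /H /= opprB addrA subrK.
  have vB : Lpn p `[tau, b] ((vWt \+ z.1.2) \- (vWt \+ z'.1.2)) <= EB.
    rewrite (_ : _ \- _ = z.1.2 \- z'.1.2); last first.
      by apply/funext => t; rewrite /= opprD addrACA subrr add0r.
    by rewrite /EB /E1n lerDr addr_ge0// Lpn_ge0.
  have vz' : Lpn p `[tau, b] (vWt \+ z'.1.2) <= e5 + rho.
    have [_ _ _ [vWb _]] := hWt b; have [_ _ _ [vz _]] := h1'.
    have [_ /le_trans] := in_LpD p1 (mitv tau b) vWb vz; apply; apply: lerD => //.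
    apply: le_trans h3'; by rewrite /E1n lerDr addr_ge0// Lpn_ge0.
  apply: le_trans (contraction_constant C0 Cq (ltW q0) (ltW L0) Le5 Lrho EB0 vB vz' sP).
  exact: ler_wpM2l.
exists (Wt \+ u), (vWt \+ v), (gWt \+ g); split.
- exact: (E1_dataD p_gt1 ic (mitv tau b) (hWt b) hd).
- by rewrite /= ua addr0 Wtau.
have hs := E1_dataD p_gt1 ic (mitv tau b) (hWt b) hd.
have xs : Xp p i ((Wt \+ u) tau) by rewrite /= ua addr0 Wtau.
apply: aeS (aeI vE (aeI gE (aeI eqn (f_modulus p_gt1 ic Af)))) => t [h1 [h2 [h3 h4]]] tab.
have t0t : t0 <= t.
  by move: tab; rewrite /= in_itv/= => /andP[/(le_trans t0tau)].
have xt := Xp_path p_gt1 ic hs xs tab.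
(* The differences vanish at [tau], so the trace estimate turns E_1 convergence into X_p convergence
   at each [t], which is the topology in which [A] and [f] are continuous. *)
have cu : xpn ((Wt \+ (zs n).1.1) t - (Wt \+ u) t) @[n --> \oo] --> 0.
  apply: (@squeeze_cvgr _ _ _ _ (fun=> 0) (fun n => 3 * rho * 2^-1 ^+ n)).
  - apply: nearW => n; rewrite Xpn_ge0 /=.
    rewrite opprD addrACA subrr add0r.
    have [k1 k2 _] := azs n; have hB := E1_dataB p_gt1 ic (mitv tau b) hd k1.
    have tt : tau <= t <= b by move: tab; rewrite /= in_itv.
    have xb : Xp p i (((u \- (zs n).1.1)) tau) by rewrite /= ua k2 subrr.
    have [_] := trace_bound_itv p_gt1 ic tt hB xb; rewrite /= ua k2 subrr xpn0 addr0.
    have x1 : Xp p i (u t) by apply: (Xp_path p_gt1 ic hd _ tab); rewrite ua.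
    have x2 : Xp p i ((zs n).1.1 t) by apply: (Xp_path p_gt1 ic k1 _ tab); rewrite k2.
    by rewrite (XpnC p_gt1 ic x1 x2) => /le_trans; apply; exact: cvn.
  - exact: cvg_cst.
  - rewrite -[X in _ --> X](mulr0 (3 * rho)); apply: cvgM; first exact: cvg_cst.
    exact: cvg_half_expr.
have xzt n : Xp p i ((Wt \+ (zs n).1.1) t).
  have [k1 k2 _] := azs n; apply: (Xp_path p_gt1 ic (E1_dataD p_gt1 ic (mitv tau b) (hWt b) k1) _ tab).
  by rewrite /= k2 addr0 Wtau.
have vcv : (vWt \+ (zs n).1.2) t @[n --> \oo] --> (vWt \+ v) t.
  by apply: cvgD; [exact: cvg_cst|exact: h1].
have fcv : f t ((Wt \+ (zs n).1.1) t) @[n --> \oo] --> f t ((Wt \+ u) t).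
  apply/cvgrPdist_lt => e e0; have [c c0 cP] := h4 t0t _ xt e e0.
  move/cvgrPdist_lt : cu => /(_ c c0); apply: filterS => n; rewrite sub0r normrN.
  by move=> /(le_lt_trans (ler_norm _)) /cP; rewrite distrC; apply; exact: xzt.
have Acv : A t ((Wt \+ (zs n).1.1) t) ((vWt \+ (zs n).1.2) t) @[n --> \oo] -->
    A t ((Wt \+ u) t) ((vWt \+ v) t).
  have Ac := A_bounded Af t0t xt.
  have c1 : A t ((Wt \+ u) t) ((vWt \+ (zs n).1.2) t) @[n --> \oo] --> A t ((Wt \+ u) t) ((vWt \+ v) t).
    by apply: cvg_comp; [exact: vcv|exact: Ac].
  apply/cvgrPdist_lt => e e0; have e2 : 0 < e / 2 by rewrite divr_gt0.
  have [e' e'0 ee'] := small_factor (`|(vWt \+ v) t| + 1) e2.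
  have [c c0 cP] := A_modulus p_gt1 ic Af t0t xt e'0.
  move/cvgrPdist_lt : cu => /(_ c c0); move/cvgrPdist_lt : c1 => /(_ _ e2).
  move/cvgrPdist_lt : vcv => /(_ _ ltr01).
  apply: filterS3 => n n1 n2; rewrite sub0r normrN => /(le_lt_trans (ler_norm _)) n3.
  have tt : `|t - t| < c by rewrite subrr normr0.
  have n4 := cP t _ t0t (xzt n) tt n3 ((vWt \+ (zs n).1.2) t).
  have n5 := norm_le_near n1.
  have n6 : e' * `|(vWt \+ (zs n).1.2) t| <= e' * (`|(vWt \+ v) t| + 1).
    by rewrite ler_wpM2l// ltW.
  rewrite -(subrKA (A t ((Wt \+ u) t) ((vWt \+ (zs n).1.2) t))).
  apply: (le_lt_trans (ler_normD _ _)); rewrite [e]splitr; apply: ltr_leD => //.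
  by rewrite distrC (le_trans n4)// (le_trans n6)// mulrC.
have Ascv (y : X1) : (fun n => (zs n).1.2 t) @ \oo --> y -> As ((zs n).1.2 t) @[n --> \oo] --> As y.
  by move=> hy; apply: cvg_comp; [exact: hy|exact: Asc].
have AsV : As ((vWt \+ (zs n).1.2) t) @[n --> \oo] --> As ((vWt \+ v) t).
  by apply: cvg_comp; [exact: vcv|exact: Asc].
(* The iterate on the left is one step ahead of the one inside [H]; both sequences have the same
   limit. *)
have lhs : (zs n.+1).2 t + As ((zs n.+1).1.2 t) @[n --> \oo] --> g t + As (v t).
  rewrite (cvg_shiftS (fun n => (zs n).2 t + As ((zs n).1.2 t)) _).
  by apply: cvgD; [exact: h2|exact: Ascv (h1 tab)].
have rhs : H (zs n) t @[n --> \oo] --> frozen_rhs As (Wt \+ u) (vWt \+ v) t - (gWt t + As (vWt t)).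
  apply: cvgB; last exact: cvg_cst.
  by apply: cvgD; [apply: cvgB; [exact: AsV|exact: Acv]|exact: fcv].
have eqt : g t + As (v t) = frozen_rhs As (Wt \+ u) (vWt \+ v) t - (gWt t + As (vWt t)).
  rewrite -(cvg_lim (@norm_hausdorff _ _) lhs) -(cvg_lim (@norm_hausdorff _ _) rhs).
  have -> : (fun n => H (zs n) t) = (fun n => (zs n.+1).2 t + As ((zs n.+1).1.2 t)).
    by apply/funext => n; rewrite h3.
  by [].
move/eqP: eqt; rewrite eq_sym subr_eq /frozen_rhs /= (linearD As) => /eqP.
rewrite [RHS]addrACA -[LHS]addrA [RHS]addrC [As (v t) + _]addrC => /addrI h.
by rewrite /= [gWt t + g t]addrC -h [LHS]addrC addNKr.
Qed.

End LocalExistence.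

(** * Maximal solutions *)

(** The local hypothesis allows passage across [s] from any earlier point within [d], so it yields
    both attainment of the supremum and progress beyond it; no separate closedness of [P] is
    needed. *)
Lemma real_induction {R : realType} (a b : R) (P : R -> Prop) : a <= b -> P a ->
  (forall s, s \in `[a, b] -> exists2 d, 0 < d & forall s1 s2, s1 \in `[a, b] ->
     s2 \in `[a, b] -> s - d <= s1 -> s1 <= s2 -> s2 <= s + d -> P s1 -> P s2) -> P b.
Proof.
move=> ab Pa hP; pose S := [set t | t \in `[a, b] /\ P t].
have Sa : S a by split => //; rewrite in_itv/= lexx.
have hS : has_sup S by split; [exists a|exists b => t [+ _]; rewrite in_itv/= => /andP[]].
have cS t : S t -> t <= sup S by exact: ub_le_sup hS.2 _ .
have cab : sup S \in `[a, b].
  rewrite in_itv/= cS//=; apply: ge_sup; first by exists a.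
  by move=> t [+ _]; rewrite in_itv/= => /andP[].
have [d d0 dP] := hP _ cab.
have [s1 [s1ab Ps1] hs1] := sup_adherent d0 hS.
have s1c := cS s1 (conj s1ab Ps1).
move: (cab) (s1ab); rewrite !in_itv/= => /andP[c1 c2] /andP[c3 c4].
have [bd|bd] := leP b (sup S + d).
  by apply: (dP s1 b) => //; rewrite ?in_itv/= ?ab ?lexx//; exact: ltW.
suff : sup S + d <= sup S by rewrite gerDl leNgt d0.
have cd : sup S + d \in `[a, b] by rewrite in_itv/=; apply/andP; split; lra.
apply: cS; split => //; apply: (dP s1) => //; [exact: ltW|lra].
Qed.

(** The gap between the assumed bound [2 * m] and the obtained bound [m] exceeds the variation of
    [F] on a short interval, so the bound [m] up to [s1] gives [2 * m] a little further, hence [m]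
    again. *)
Lemma continuity_bootstrap {R : realType} (a b m : R) (F : R -> R) : a <= b -> 0 < m ->
  (forall t, t \in `[a, b] -> forall e, 0 < e -> exists2 d, 0 < d &
     forall s, s \in `[a, b] -> `|s - t| < d -> `|F s - F t| < e) ->
  F a <= m ->
  (forall t, a < t <= b -> (forall s, a <= s <= t -> F s <= 2 * m) -> F t <= m) ->
  forall t, a <= t <= b -> F t <= m.
Proof.
move=> ab m0 Fc Fa Fstep.
apply: (@real_induction R a b (fun c => forall t, a <= t <= c -> F t <= m)) => //.
  by move=> t; rewrite -eq_le => /eqP <-.
move=> s sab; have m2 : 0 < m / 2 by rewrite divr_gt0.
have [d d0 dP] := Fc s sab _ m2; have d2 : 0 < d / 2 by rewrite divr_gt0.
exists (d / 2) => // s1 s2; rewrite !in_itv/= => /andP[a1 b1] /andP[a2 b2] k1 k2 k3 Ps1.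
have near t : s1 <= t <= s2 -> F t <= 2 * m.
  move=> /andP[t1 t2]; have ht : `|F t - F s| < m / 2.
    apply: dP; first by rewrite in_itv/=; apply/andP; split; lra.
    by rewrite ltr_norml; lra.
  have hs1 : `|F s1 - F s| < m / 2.
    apply: dP; first by rewrite in_itv/= a1.
    by rewrite ltr_norml; lra.
  have := Ps1 s1; rewrite a1 lexx => /(_ isT) => k.
  by move: ht hs1; rewrite !ltr_norml; lra.
move=> t /andP[at_ ts2].
have [<-|aN] := eqVneq a t; first exact: Fa.
apply: Fstep; first by rewrite lt_neqAle aN at_/=; lra.
move=> t' /andP[a' t'2]; have [t's1|s1t'] := leP t' s1.
  by have := Ps1 t'; rewrite a' t's1 => /(_ isT); lra.
by apply: near; rewrite ltW//=; lra.
Qed.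

(** Fatou's lemma for the restrictions to [[a, r_ k]], with [r_ k] increasing to [b]; only the point
    [b] is missed. *)
Lemma in_Lp_exhaust {R : realType} {X : completeNormedModType R} (p a b B : R) (f : R -> X) :
  1 <= p -> a < b -> 0 <= B ->
  (forall r, a < r < b -> in_Lp p `[a, r] f /\ Lpn p `[a, r] f <= B) -> in_Lp p `[a, b] f.
Proof.
move=> p1 ab B0 h.
have mitv (c d : R) : measurable (`[c, d] : set R) by exact: measurable_itv.
pose r_ (k : nat) := b - (b - a) / k.+2%:R.
have r_P k : a < r_ k < b.
  rewrite /r_; have k2 : (1 : R) < k.+2%:R by rewrite ltr1n.
  have k0 : (0 : R) < k.+2%:R by lra.
  apply/andP; split; last by rewrite ltrBlDr ltrDl divr_gt0// subr_gt0.
  by rewrite ltrBrDl addrC -ltrBrDl ltr_pdivrMr//; nra.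
have ne : {ae @lebesgue_measure R, forall t, t != b}.
  by exists [set b]; split => //; [exact: lebesgue_measure_set1|
    move=> t /= /negP; rewrite negbK => /eqP].
have sub k : `[a, b] `&` `[a, r_ k] = `[a, r_ k]%classic.
  have /andP[_ rb] := r_P k.
  apply/seteqP; split=> [t []//|t tt]; split => //.
  by move: tt; rewrite /= !in_itv/= => /andP[-> ]; lra.
have part k := @in_Lp_if R p p1 X `[a, b] `[a, r_ k] f (mitv a b) (mitv a (r_ k)).
apply: (proj1 (@in_Lp_fatou R p p1 X `[a, b] (fun k t => if t \in `[a, r_ k]%classic then f t else 0)
   f B (mitv a b) B0 _ _ _)).
- by move=> k; have := part k; rewrite sub => /(_ (h _ (r_P k)).1)[].
- apply: aeS ne => t tn; rewrite /= in_itv/= => /andP[at_ tb].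
  have tb0 : 0 < b - t by rewrite subr_gt0 lt_neqAle tn.
  apply: cvg_near_cst; exists (Num.truncn ((b - a) / (b - t))) => // k /= hk.
  rewrite mem_set//= in_itv/= at_/=.
  have := truncnS_gt ((b - a) / (b - t)); rewrite ltr_pdivrMr// => hk'.
  rewrite /r_ lerBrDr -lerBrDl ler_pdivrMr ?ltr0n//.
  have : ((Num.truncn ((b - a) / (b - t))).+1%:R : R) <= k.+2%:R.
    by rewrite ler_nat ltnS (leq_trans hk).
  by nra.
- by move=> k; have := part k; rewrite sub => /(_ (h _ (r_P k)).1)[_ ->]; exact: (h _ (r_P k)).2.
Qed.

Section Solutions.
Context {R : realType} {X0 X1 : completeNormedModType R}.
Local Notation mu := (@lebesgue_measure R).
Variables (p : R) (i : {linear X1 -> X0}).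
Hypothesis p_gt1 : 1 < p.
Hypothesis ic : continuous i.
Hypothesis inji : injective i.
Variables (t0 : R) (A : R -> X0 -> {linear X1 -> X0}) (f : R -> X0 -> X0).
Hypothesis Af : standing_assumptions p i t0 A f.
Implicit Types (I J : set R) (u g h : R -> X0) (v w : R -> X1) (x y : X0).
Let p1 : 1 <= p := ltW p_gt1.
Local Notation En := (@E1n R X0 X1 p).
Local Notation xpn := (Xpn p i).
Let mitv (a b : R) : measurable (`[a, b] : set R). Proof. exact: measurable_itv. Qed.

(* Injectivity of the embedding makes these the data of every restriction of a
   solution at once. *)
Definition path_lift (u : R -> X0) (t : R) : X1 := xget 0 [set y | u t = i y].

Definition path_speed (u : R -> X0) (t : R) : X0 :=
  f t (u t) - A t (u t) (path_lift u t).

Lemma path_speedE u t : path_speed u t + A t (u t) (path_lift u t) = f t (u t).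
Proof. by rewrite subrK. Qed.

Lemma solution_data (u0 : X0) T u b : solution p i t0 A f u0 T u -> t0 < b ->
  (b%:E < t0%:E + T)%E -> E1_data p i `[t0, b] u (path_lift u) (path_speed u).
Proof.
move=> [_ hs] tb bT; have [v [g [hd he]]] := hs t0 b (lexx _) tb bT.
have [_ _ _ [_ uv]] := hd.
have vE : {ae mu, forall t, `[t0, b]%classic t -> v t = path_lift u t}.
  apply: aeS uv => t + tt => /(_ tt) h; apply: inji; rewrite -h.
  by rewrite /path_lift; case: xgetP => [y _ //|/(_ (v t) h)].
apply: (E1_data_ae p_gt1 ic (mitv _ _) hd vE).
apply: aeS (aeI he vE) => t [h1 h2] tt.
by rewrite /path_speed -h2// -h1// addrK.
Qed.

(** Integrability of the lift and of the derivative up to a finite final time already contradicts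
    maximality: it gives a final value in X_p from which the equation can be restarted. *)
Lemma blow_up (u0 : X0) (T : R) u : Xp p i u0 -> maximal_solution p i t0 A f u0 T%:E u ->
  in_Lp p `[t0, t0 + T] (path_lift u) -> in_Lp p `[t0, t0 + T] (path_speed u) -> False.
Proof.
move=> xu0 [T0 sol mx] vL gL; have [u00 _] := sol.
rewrite lte_fin in T0; set tau := t0 + T in vL gL.
have ttau : t0 < tau by rewrite /tau ltrDl.
(* The extension to the final time needs some operator with maximal regularity; the one at the
   initial value serves, however far the solution has moved. *)
have Asc : continuous (A t0 u0) := A_bounded Af (lexx _) xu0.
have Amr a b : a < b -> maximal_regularity p i a b (A t0 u0).
  exact: (A_maximal_regularity Af (lexx _) xu0).
have hr r : t0 < r < tau -> E1_data p i `[t0, r] u (path_lift u) (path_speed u).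
  by move=> /andP[r1 r2]; apply: (solution_data sol r1); rewrite -EFinD lte_fin.
have xu : Xp p i (u t0) by rewrite u00.
have [w hw wu] := E1_data_extend p_gt1 ic inji Asc Amr ttau hr xu vL gL.
have wt0 : w t0 = u0 by rewrite wu ?lexx.
have tt : t0 <= tau <= tau by rewrite lexx ltW.
have xw0 : Xp p i (w t0) by rewrite wt0.
have [xtau _] := trace_bound_itv p_gt1 ic tt hw xw0.
have [d d0 [u1 [v1 [g1 [hd1 u1tau he1]]]]] := local_existence p_gt1 ic inji Af (ltW ttau) xtau.
have taud : tau < tau + d by lra.
pose glue Z (F G : R -> Z) t := if t <= tau then F t else G t.
pose psi := glue _ w u1; pose vp := glue _ (path_lift u) v1; pose gp := glue _ (path_speed u) g1.
have ne : {ae mu, forall t, t != tau}.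
  by exists [set tau]; split => //; [exact: lebesgue_measure_set1|
    move=> t /= /negP; rewrite negbK => /eqP].
have gl1 Z (F G : R -> Z) t : t <= tau -> F t = glue _ F G t by rewrite /glue => ->.
have gl2 Z (F G : R -> Z) t : tau < t -> G t = glue _ F G t by rewrite /glue leNgt => ->.
have E1 : `[t0, tau + d] `&` `]-oo, tau] = `[t0, tau]%classic.
  apply/seteqP; split=> t /=; rewrite !in_itv/=; first by move=> [/andP[? ?] ?]; apply/andP.
  by move=> /andP[? ?]; split => //; apply/andP; split; lra.
have E2 : `[t0, tau + d] `&` `[tau, +oo[ = `[tau, tau + d]%classic.
  apply/seteqP; split=> t /=; rewrite !in_itv/= ?andbT; first by move=> [/andP[? ?] ?]; apply/andP.
  by move=> /andP[? ?]; split => //; apply/andP; split; lra.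
have H1 : E1_data p i `[t0, tau] psi vp gp.
  have le t : `[t0, tau]%classic t -> t <= tau by rewrite /= in_itv/= => /andP[].
  apply: (E1_data_congr p_gt1 ic (mitv _ _) hw).
  - by move=> t /set_mem/le; exact: gl1.
  - by apply: ae_all => t /le; exact: gl1.
  - by apply: ae_all => t /le; exact: gl1.
have H2 : E1_data p i `[tau, tau + d] psi vp gp.
  have le t : `[tau, tau + d]%classic t -> t != tau -> tau < t.
    by rewrite /= in_itv/= => /andP[h _] tn; rewrite lt_neqAle eq_sym tn.
  apply: (E1_data_congr p_gt1 ic (mitv _ _) hd1).
  - move=> t /set_mem tt'; have [->|/(le t tt')] := eqVneq t tau; last exact: gl2.
    by rewrite u1tau /psi /glue lexx.
  - by apply: aeS ne => t tn tt'; apply: gl2; exact: le.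
  - by apply: aeS ne => t tn tt'; apply: gl2; exact: le.
have Itau : `[t0, tau + d]%classic tau by rewrite /= in_itv/= (ltW ttau) (ltW taud).
have H : E1_data p i `[t0, tau + d] psi vp gp.
  by apply: (E1_data_glue p_gt1 ic (mitv _ _) Itau); rewrite ?E1 ?E2.
have eqn : {ae mu, forall t, `[t0, tau + d]%classic t -> gp t + A t (psi t) (vp t) = f t (psi t)}.
  apply: aeS (aeI he1 ne) => t [h1 tn]; rewrite /= in_itv/= => /andP[k1 k2].
  have [tl|tg] := leP t tau.
    have tl' : t < tau by rewrite lt_neqAle tn.
    by rewrite /gp /psi /vp /glue tl wu ?k1// path_speedE.
  rewrite /gp /psi /vp /glue leNgt tg /=; apply: h1.
  by rewrite /= in_itv/= k2 andbT ltW.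
have solp : solution p i t0 A f u0 (T + d)%:E psi.
  split; first by rewrite /psi /glue ltW.
  move=> a b ta ab; rewrite -EFinD lte_fin addrA -/tau => bd.
  have sub : `[a, b] `<=` (`[t0, tau + d] : set R) by apply: sub_itvcc => //; exact: ltW.
  exists vp, gp; split; first exact: (E1_dataS p_gt1 ic (mitv _ _) (mitv _ _) sub H).
  by apply: aeS eqn => t + /sub.
have TT : (T%:E <= (T + d)%:E)%E by rewrite lee_fin lerDl ltW.
have agree t : t0 <= t -> (t%:E < t0%:E + T%:E)%E -> psi t = u t.
  move=> k1; rewrite -EFinD lte_fin -/tau => k2.
  by rewrite /psi /glue ltW// wu// k1.
have [/eqP] := mx (T + d)%:E psi TT solp agree.
by rewrite -subr_eq0 addrC addKr gt_eqF.
Qed.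

End Solutions.

(** * Stability *)

(** The terms containing [E] add up to at most [4 * q * E], and [C * q <= 1 / 8] makes [C] times
    this at most [E / 2], which is absorbed on the left. What remains is linear in [e] and [om]. *)
Lemma stability_constant {R : realFieldType} (C q L E Ev N1 N2 V Vb P K V' e om : R) :
  0 <= C -> C * q <= 1 / 8 -> 0 <= q -> q <= 1 / 8 -> 0 <= L -> 0 <= E -> 0 <= om ->
  0 <= Vb -> 0 <= K -> 0 <= e -> e <= q -> Ev <= E -> L * V <= q -> P <= q ->
  N1 <= q * Ev + L * (E + om) * V + (E + om) * P ->
  N2 <= e * V' + e * K -> V' <= Ev + Vb ->
  E <= C * (N1 + N2 + om) -> E <= 4 * C * (1 + Vb + K) * (e + om).
Proof.
move=> C0 Cq q0 q8 L0 E0 om0 Vb0 K0 e0 eq_ EvE LV Pq n1 n2 v' h.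
have k1 : q * Ev <= q * E by exact: ler_wpM2l.
have k2 : L * (E + om) * V <= (E + om) * q.
  by rewrite [L * _]mulrC -mulrA ler_wpM2l// addr_ge0.
have k3 : (E + om) * P <= (E + om) * q by rewrite ler_wpM2l// addr_ge0.
have k4 : e * V' <= e * (E + Vb) by rewrite ler_wpM2l//; lra.
have k5 : e * E <= q * E by exact: ler_wpM2r.
have k6 : q * om <= 1 / 8 * om by exact: ler_wpM2r.
have k7 : N1 + N2 + om <= 4 * q * E + 2 * om + e * (Vb + K).
  by move: om0 k1 k2 k3 k4 k5 k6 n1 n2 v'; clear; lra.
have k8 : C * (N1 + N2 + om) <= C * (4 * q * E + 2 * om + e * (Vb + K)) by exact: ler_wpM2l.
have k9 : C * q * E <= 1 / 8 * E by exact: ler_wpM2r.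
have k10 : E <= 2 * (C * (2 * om + e * (Vb + K))).
  by have := le_trans h k8; move: k9; clear; lra.
apply: (le_trans k10).
rewrite [leRHS](_ : _ = 2 * (C * (2 * om + 2 * e + 2 * om * (Vb + K) + 2 * (e * (Vb + K))))); last by ring.
rewrite ler_wpM2l// ler_wpM2l//.
have : 0 <= om * (Vb + K) by rewrite mulr_ge0// addr_ge0.
have : 0 <= e * (Vb + K) by rewrite mulr_ge0// addr_ge0.
by move: e0; clear; lra.
Qed.

Lemma residual_identity {V : zmodType} (G' G S' S B' F' X' Y : V) :
  (G' - G) + (S' - S) - ((S' - B' + F') - (S - Y + (G + Y))) = (G' + X' - F') - (X' - B').
Proof.
have -> : S - Y + (G + Y) = S + G by rewrite [G + Y]addrC addrA subrK.
have -> : G' + X' - F' - (X' - B') = G' - F' + B'.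
  by rewrite [G' + X' - F']addrAC opprB addrA addrAC addrK.
rewrite [G' - G + _]addrACA -opprD opprB [S + G]addrC addrA subrK.
by rewrite -[S' - B' + F']addrA opprD addrA addrK opprD opprK addrA addrAC.
Qed.

Section Stability.
Context {R : realType} {X0 X1 : completeNormedModType R}.
Local Notation mu := (@lebesgue_measure R).
Variables (p : R) (i : {linear X1 -> X0}).
Hypothesis p_gt1 : 1 < p.
Hypothesis ic : continuous i.
Hypothesis inji : injective i.
Variables (t0 : R) (A : R -> X0 -> {linear X1 -> X0}) (f : R -> X0 -> X0).
Hypothesis Af : standing_assumptions p i t0 A f.
Let p1 : 1 <= p := ltW p_gt1.
Local Notation En := (@E1n R X0 X1 p).
Local Notation xpn := (Xpn p i).
Let mitv (a b : R) : measurable (`[a, b] : set R). Proof. exact: measurable_itv. Qed.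

Variables (b r : R) (u g : R -> X0) (v : R -> X1).
Hypothesis t0b : t0 < b.
Hypothesis br : b <= t0 + r.
Hypothesis hd : E1_data p i `[t0, b] u v g.
Hypothesis xu : Xp p i (u t0).
Hypothesis ur : {in `[t0, b], forall t, xpn (u t) <= r - 1}.
Hypothesis eqn : {ae mu, forall t, `[t0, b]%classic t -> g t + A t (u t) (v t) = f t (u t)}.

(** Closeness is required on the ball of radius [r], one more than the bound on the reference path,
    so that it covers every path within X_p-distance 1 of it. *)
Definition perturbation (A' : R -> X0 -> {linear X1 -> X0}) (f' : R -> X0 -> X0) (e : R) :=
  forall t y, t \in `[t0, b] -> Xp p i y -> xpn y <= r ->
    (forall z : X1, `|A' t y z - A t y z| <= e * `|z|) /\ `|f' t y - f t y| <= e.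

(** All constants depend on [s] and the reference solution only, not on the perturbed problem, its
    solution or the subinterval. The X_p-closeness [th] is still a hypothesis here. *)
Lemma perturbation_estimate s : s \in `[t0, b] -> exists d C th : R,
  [/\ 0 < d, 0 <= C, 0 < th <= 1 & exists2 q : R, 0 < q &
  forall s1 r1 (A' : R -> X0 -> {linear X1 -> X0}) f' (u' g' : R -> X0) (v' : R -> X1) e,
    t0 <= s1 -> s - d <= s1 -> s1 < r1 -> r1 <= b -> r1 <= s + d ->
    E1_data p i `[s1, r1] u' v' g' -> Xp p i (u' s1) ->
    {ae mu, forall t, `[s1, r1]%classic t -> g' t + A' t (u' t) (v' t) = f' t (u' t)} ->
    0 <= e <= q -> perturbation A' f' e ->
    (forall t, s1 <= t <= r1 -> xpn (u' t - u t) <= th) ->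
    En `[s1, r1] (u' \- u) (v' \- v) (g' \- g) <= C * (e + xpn (u' s1 - u s1))].
Proof.
have ar3 (m n l e : R) : m <= n + l -> n <= r - 1 -> l <= e -> e <= 1 -> m <= r by lra.
have ar4 (m n e k : R) : m < k / 2 -> n <= e -> e <= k / 2 -> n + m < k by lra.
move=> sb; have t0s : t0 <= s by move: sb; rewrite in_itv/= => /andP[].
have xs : Xp p i (u s) by exact: (Xp_path p_gt1 ic hd xu sb).
pose As := A s (u s); have Asc : continuous As := A_bounded Af t0s xs.
have Amr a c : a < c -> maximal_regularity p i a c As by exact: (A_maximal_regularity Af t0s xs).
have [C C0 CP] := linear_estimate p_gt1 ic inji Asc Amr t0b.
have r0 : 0 < r.
  have := ur (_ : t0 \in `[t0, b]); rewrite in_itv/= lexx ltW// => /(_ isT).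
  by have := Xpn_ge0 p i (u t0); lra.
have [L L0 lipA] := A_lip_cst_exists p_gt1 ic Af r0.
have [Psi lipf] := f_lip_fun_exists p_gt1 ic Af r0.
have PsiL : in_Lp p `[t0, b] Psi by case: lipf => h _; exact: h.
have [_ _ [gL _] [vL _]] := hd.
pose q := (8 * (C + 1))^-1.
have q0 : 0 < q by rewrite invr_gt0; lra.
have Cq : C * q <= 1 / 8 by rewrite /q ler_pdivrMr; lra.
have q8 : q <= 1 / 8 by rewrite /q -[leRHS]/(1 / 8) div1r lef_pV2 ?posrE; lra.
have [k k0 kP] := A_modulus p_gt1 ic Af t0s xs q0.
have k2 : 0 < k / 2 by rewrite divr_gt0.
have [d1 d10 d1P] := Xpn_continuous p_gt1 ic hd xu sb k2.
have [e2 e20 Le2] := small_factor L q0.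
have [d2 d20 d2P] := Lpn_small p1 s (mitv t0 b) vL e20.
have [d3 d30 d3P] := Lpn_small p1 s (mitv t0 b) PsiL q0.
have [d [d0 [dk [dd1 [dd2 dd3]]]]] : exists d, 0 < d /\ d < k /\ d < d1 /\ d <= d2 /\ d <= d3.
  exists (Num.min (k / 2) (Num.min (d1 / 2) (Num.min d2 d3))); split.
    by rewrite !lt_min k2 d20 d30 divr_gt0.
  have [h1 [h2 [h3 h4]]] : Num.min (k / 2) (Num.min (d1 / 2) (Num.min d2 d3)) <= k / 2 /\
    Num.min (k / 2) (Num.min (d1 / 2) (Num.min d2 d3)) <= d1 / 2 /\
    Num.min (k / 2) (Num.min (d1 / 2) (Num.min d2 d3)) <= d2 /\
    Num.min (k / 2) (Num.min (d1 / 2) (Num.min d2 d3)) <= d3.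
    by rewrite !ge_min !lexx !orbT.
  split; first by apply: (le_lt_trans h1); lra.
  by split; first by apply: (le_lt_trans h2); lra.
pose Vb := Lpn p `[t0, b] v; pose K := Lpn p `[t0, b] (fun=> (1 : R^o)).
(* [th <= 1] keeps [u'] in the ball of radius [r]; [th <= k / 2], with the continuity of [u] at [s],
   keeps [A t (u' t)] within [q] of [As]. *)
have [th [th0 th1 thk]] : exists th, [/\ 0 < th, th <= 1 & th <= k / 2].
  by exists (Num.min (k / 2) 1); rewrite lt_min ltr01 k2 !ge_min !lexx orbT.
exists d, (4 * C * (1 + Vb + K)), th; split => //.
- by rewrite !mulr_ge0// !addr_ge0// Lpn_ge0.
- by rewrite th0.
exists q => // s1 r1 A' f' u' g' v' e t0s1 sd s1r1 r1b r1d hd' xu' eqn' /andP[e0 eq_] pert uu.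
have ar1 (t : R) : s1 <= t -> t <= r1 -> t0 <= t /\ t <= b.
  by move=> h1 h2; split; [exact: le_trans h1|exact: le_trans r1b].
have ar2 (t : R) : s1 <= t -> t <= r1 -> `|t - s| <= d.
  by move=> h1 h2; rewrite ler_distl (le_trans sd h1) (le_trans h2 r1d).
have sub : `[s1, r1] `<=` (`[t0, b] : set R) by exact: sub_itvcc.
have hdr := E1_dataS p_gt1 ic (mitv t0 b) (mitv s1 r1) sub hd.
have s1b : s1 \in `[t0, b] by rewrite in_itv/= t0s1 (le_trans (ltW s1r1)).
have xus : Xp p i (u s1) by exact: (Xp_path p_gt1 ic hd xu s1b).
have hB := E1_dataB p_gt1 ic (mitv s1 r1) hd' hdr.
have [xB _] := XpB p_gt1 ic xu' xus.
set E := En _ _ _ _; set om := xpn _.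
have E0 : 0 <= E by exact: E1n_ge0.
have om0 : 0 <= om by exact: Xpn_ge0.
have in01 t : t \in `[s1, r1] -> t \in `[t0, b].
  by rewrite !in_itv/= => /andP[h1 h2]; have [-> ->] := ar1 _ h1 h2.
have up t : t \in `[s1, r1] -> [/\ Xp p i (u t), Xp p i (u' t), xpn (u' t) <= r,
    xpn (u t) <= r & xpn (u' t - u t) <= E + om].
  move=> tt; have tt' : s1 <= t <= r1 by move: tt; rewrite in_itv.
  have h1 : Xp p i (u t) by exact: (Xp_path p_gt1 ic hd xu (in01 _ tt)).
  have h2 : Xp p i (u' t) by exact: (Xp_path p_gt1 ic hd' xu' tt).
  have h3 := ur (in01 _ tt); have h4 := uu _ tt'.
  have h5 := Xpn_leB p_gt1 ic h2 h1.
  have [_ h6] := trace_bound_itv p_gt1 ic tt' hB xB.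
  split => //; first exact: (ar3 _ _ _ _ h5 h3 h4 th1).
  by apply: (le_trans h3); rewrite gerBl.
have clA : {in `[s1, r1], forall t, forall z : X1, `|A t (u' t) z - As z| <= q * `|z|}.
  move=> t tt z; have [h1 h2 _ _ _] := up t tt.
  have /andP[h3 h4] : s1 <= t <= r1 by move: tt; rewrite in_itv.
  have [t0t _] := ar1 _ h3 h4.
  have h5 : `|t - s| < d1 by apply: le_lt_trans dd1; exact: ar2.
  have h6 : `|t - s| < k by apply: le_lt_trans dk; exact: ar2.
  apply: kP => //; have h7 := d1P _ (in01 _ tt) h5.
  apply: (le_lt_trans (Xpn_triangle p_gt1 ic h2 h1 xs)).
  have := uu t; rewrite h3 h4 => /(_ isT) h8.
  exact: (ar4 _ _ _ _ h7 h8 thk).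
have r1r : r1 <= t0 + r by exact: le_trans br.
(* The reference path is put second, so the Lipschitz term carries its lift [v], small on the short
   interval. The distance of the paths is bounded by [E + om] through the trace estimate. *)
have [D1L D1n] := frozen_rhs_diff p_gt1 ic Af Asc t0s1 s1r1 r1r lipA lipf (ltW L0)
  hd' xu' hdr xus (fun t tt => let: And5 _ _ h _ _ := up t tt in h)
  (fun t tt => let: And5 _ _ _ h _ := up t tt in h)
  (fun t tt => let: And5 _ _ _ _ h := up t tt in h) (ltW q0) (addr_ge0 E0 om0) clA.
have hB' := hB; have [_ _ [gBL _] [vBL _]] := hB'.
have [c c0 [NL _]] := in_Lp_rhs p_gt1 Asc (mitv s1 r1) hB.
set N : R -> X0 := (fun t => (g' \- g) t + As ((v' \- v) t)) in NL.
have [D2L _] := in_LpB p1 (mitv s1 r1) NL D1L.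
have [_ _ _ [vL' _]] := hd'; have [_ _ _ [vLr _]] := hdr.
have oneL : in_Lp p `[s1, r1] (fun=> (1 : R^o)) by exact: in_Lp_cst.
have eqnr : {ae mu, forall t, `[s1, r1]%classic t -> g t + A t (u t) (v t) = f t (u t)}.
  by apply: aeS eqn => t + /sub.
(* What the unperturbed frozen terms do not account for is exactly the difference of the two
   problems along [u'], of norm at most [e * |v'| + e]. *)
have [_ D2n] : in_Lp p `[s1, r1] (N \- (frozen_rhs A f As u' v' \- frozen_rhs A f As u v)) /\
   Lpn p `[s1, r1] (N \- (frozen_rhs A f As u' v' \- frozen_rhs A f As u v)) <=
   e * Lpn p `[s1, r1] v' + e * Lpn p `[s1, r1] (fun=> (1 : R^o)).
  apply: in_Lp_le2; [exact: p1|exact: mitv|exact: D2L.1|exact: e0|exact: e0|exact: vL'|exact: oneL|].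
  apply: aeS (aeI eqn' eqnr) => t [h1 h2] tt.
  have [k1 k2' k3 k4 _] := up t tt; have [pA pf] := pert t _ (in01 _ tt) k2' k3.
  rewrite (_ : (N \- _) t = (f' t (u' t) - f t (u' t)) - (A' t (u' t) (v' t) - A t (u' t) (v' t))).
    apply: (le_trans (ler_normB _ _)); rewrite addrC; apply: lerD; first exact: pA.
    by rewrite normr1 mulr1.
  rewrite /N /frozen_rhs /= -h1// -h2// (linearB As).
  exact: residual_identity.
have V'n : Lpn p `[s1, r1] v' <= Lpn p `[s1, r1] (v' \- v) + Vb.
  have [_] := in_LpD p1 (mitv s1 r1) vBL vLr.
  rewrite (_ : _ \+ _ = v'); last by apply/funext => t; rewrite /= subrK.
  move=> /le_trans; apply; rewrite lerD2l.
  exact: (proj2 (in_LpS p1 (mitv t0 b) sub vL)).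
have loc (Z : completeNormedModType R) (F : R -> Z) d' : in_Lp p `[t0, b] F -> d <= d' ->
    Lpn p `[s1, r1] F <= Lpn p (`[t0, b] `&` `[s - d', s + d']) F.
  move=> FL dd'; have mm : measurable (`[t0, b] `&` `[s - d', s + d'] : set R).
    by apply: measurableI; exact: measurable_itv.
  have [FL' _] := in_LpS p1 (mitv t0 b) (@subIsetl _ _ `[s - d', s + d']) FL.
  apply: (proj2 (in_LpS p1 mm _ FL')) => t tt; split; first exact: sub.
  move: tt; rewrite /= !in_itv/= => /andP[h1 h2]; apply/andP; split.
    by apply: le_trans h1; apply: le_trans sd; rewrite lerD2l lerN2.
  by apply: (le_trans h2); apply: (le_trans r1d); rewrite lerD2l.
have LV : L * Lpn p `[s1, r1] v <= q.
  apply: le_trans Le2; rewrite ler_wpM2l ?(ltW L0)//.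
  exact: (le_trans (loc _ _ _ vL dd2) (ltW d2P)).
have Pq : Lpn p `[s1, r1] Psi <= q by exact: (le_trans (loc _ _ _ PsiL dd3) (ltW d3P)).
have Kn : Lpn p `[s1, r1] (fun=> (1 : R^o)) <= K.
  by apply: (proj2 (in_LpS p1 (mitv t0 b) sub _)); exact: in_Lp_cst.
have EvE : Lpn p `[s1, r1] (v' \- v) <= E by rewrite /E /E1n lerDr addr_ge0// Lpn_ge0.
have Nn : Lpn p `[s1, r1] N <= Lpn p `[s1, r1] (frozen_rhs A f As u' v' \- frozen_rhs A f As u v) +
    Lpn p `[s1, r1] (N \- (frozen_rhs A f As u' v' \- frozen_rhs A f As u v)).
  have [_] := in_LpD p1 (mitv s1 r1) D1L D2L.
  by rewrite (_ : _ \+ _ = N)//; apply/funext => t; rewrite /= addrC subrK.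
have hE := CP s1 r1 _ _ _ t0s1 s1r1 r1b hB xB.
have D2n' : Lpn p `[s1, r1] (N \- (frozen_rhs A f As u' v' \- frozen_rhs A f As u v)) <=
   e * Lpn p `[s1, r1] v' + e * K.
  by apply: (le_trans D2n); rewrite lerD2l ler_wpM2l.
apply: (stability_constant C0 Cq (ltW q0) q8 (ltW L0) E0 om0 (Lpn_ge0 _ _ _) (Lpn_ge0 _ _ _)
  e0 eq_ EvE LV Pq D1n D2n' V'n).
apply: (le_trans hE); rewrite ler_wpM2l// lerD2r; exact: Nn.
Qed.

(** The closeness hypothesis is removed by a bootstrap at level [th / 2]: closeness [th] on
    [[s1, t]] gives the trace bound [C * (e + om) + om], at most [th / 2] once [e + om] is small. *)
Lemma perturbation_bound s : s \in `[t0, b] -> exists d C e0 : R,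
  [/\ 0 < d, 0 <= C, 0 < e0 &
  forall s1 r1 (A' : R -> X0 -> {linear X1 -> X0}) f' (u' g' : R -> X0) (v' : R -> X1) e,
    t0 <= s1 -> s - d <= s1 -> s1 < r1 -> r1 <= b -> r1 <= s + d ->
    E1_data p i `[s1, r1] u' v' g' -> Xp p i (u' s1) ->
    {ae mu, forall t, `[s1, r1]%classic t -> g' t + A' t (u' t) (v' t) = f' t (u' t)} ->
    0 <= e -> perturbation A' f' e -> e + xpn (u' s1 - u s1) <= e0 ->
    En `[s1, r1] (u' \- u) (v' \- v) (g' \- g) <= C * (e + xpn (u' s1 - u s1))].
Proof.
move=> sb; have [d [C [th [d0 C0 /andP[th0 th1] [q q0 est]]]]] := perturbation_estimate sb.
have [e1 e10 Ce1] := small_factor (C + 1) (divr_gt0 th0 (ltr0n R 2)).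
exists d, C, (Num.min q e1); split => //; first by rewrite lt_min q0.
move=> s1 r1 A' f' u' g' v' e t0s1 sd s1r1 r1b r1d hd' xu' eqn' e0 pert.
have om0 := Xpn_ge0 p i (u' s1 - u s1); rewrite le_min => /andP[eq_ e1_].
have eqq : 0 <= e <= q by rewrite e0; apply: le_trans eq_; rewrite lerDl.
set om := xpn _ in om0 eq_ e1_ *.
have Com : (C + 1) * (e + om) <= th / 2.
  by apply: le_trans Ce1; apply: ler_wpM2l => //; rewrite addr_ge0.
have Com' : C * (e + om) + om <= th / 2.
  by apply: le_trans Com; rewrite mulrDl mul1r lerD2l lerDr.
have sub t : t <= r1 -> `[s1, t] `<=` (`[t0, b] : set R).
  by move=> tr; apply: sub_itvcc => //; exact: le_trans r1b.
have hdr t : t <= r1 -> E1_data p i `[s1, t] u v g.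
  by move=> tr; exact: (E1_dataS p_gt1 ic (mitv t0 b) (mitv s1 t) (sub t tr) hd).
have sub' t : t <= r1 -> `[s1, t] `<=` (`[s1, r1] : set R) by exact: sub_itvcc.
have hdr' t : t <= r1 -> E1_data p i `[s1, t] u' v' g'.
  by move=> tr; exact: (E1_dataS p_gt1 ic (mitv s1 r1) (mitv s1 t) (sub' t tr) hd').
have xus : Xp p i (u s1).
  by apply: (Xp_path p_gt1 ic hd xu); rewrite in_itv/= t0s1 (le_trans (ltW s1r1)).
have [xB _] := XpB p_gt1 ic xu' xus.
have hB t : t <= r1 -> E1_data p i `[s1, t] (u' \- u) (v' \- v) (g' \- g).
  by move=> tr; exact: (E1_dataB p_gt1 ic (mitv s1 t) (hdr' t tr) (hdr t tr)).
apply: (est s1 r1 A' f') => //.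
have th2 : 0 < th / 2 by rewrite divr_gt0.
have thE : 2 * (th / 2) = th by field.
move=> t tt; apply: (@le_trans _ _ (th / 2)); last by rewrite ler_pdivrMr// ler_peMr// ?ler1n// ltW.
apply: (@continuity_bootstrap R s1 r1 (th / 2) (fun t => xpn (u' t - u t)) (ltW s1r1) th2 _ _ _ t tt).
- move=> t' tt' e' e'0.
  have [d' d'0 d'P] := Xpn_continuous p_gt1 ic (hB r1 (lexx _)) xB tt' e'0.
  exists d' => // t'' tt'' h; have k := d'P _ tt'' h.
  have x1 := Xp_path p_gt1 ic (hB r1 (lexx _)) xB tt'.
  have x2 := Xp_path p_gt1 ic (hB r1 (lexx _)) xB tt''.
  have k1 := Xpn_leB p_gt1 ic x2 x1; have k2 := Xpn_leB p_gt1 ic x1 x2.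
  rewrite (XpnC p_gt1 ic x1 x2) in k2; apply: (le_lt_trans _ k).
  by rewrite /= in k1 k2 *; rewrite ler_distl lerBlDr k2 k1.
- by apply: le_trans Com'; rewrite lerDr mulr_ge0// addr_ge0.
move=> t' /andP[s1t' t'r1] close.
have tt' : s1 <= t' <= t' by rewrite lexx ltW.
have [_ k1] := trace_bound_itv p_gt1 ic tt' (hB t' t'r1) xB.
apply: (le_trans k1); apply: le_trans Com'; rewrite lerD2r.
apply: (est s1 t' A' f') => //; [exact: le_trans r1b|exact: le_trans r1d|exact: hdr'| |].
  by apply: aeS eqn' => t'' + /(sub' _ t'r1).
by move=> t'' /close; rewrite thE.
Qed.

(** That the perturbed solution lives beyond [s2] is part of the conclusion: the bound on [[s1, r1]]
    does not depend on [r1], so a final time before or at [s2] would be excluded by [blow_up]. *)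
Lemma stability_step s : s \in `[t0, b] -> exists d C e0 : R,
  [/\ 0 < d, 0 <= C, 0 < e0 &
  forall s1 s2 (A' : R -> X0 -> {linear X1 -> X0}) f' (u0' : X0) (T' : \bar R) (u' : R -> X0) e,
    standing_assumptions p i t0 A' f' -> Xp p i u0' -> maximal_solution p i t0 A' f' u0' T' u' ->
    t0 <= s1 -> s - d <= s1 -> s1 < s2 -> s2 <= b -> s2 <= s + d ->
    (s1%:E < t0%:E + T')%E -> 0 <= e -> perturbation A' f' e ->
    e + xpn (u' s1 - u s1) <= e0 ->
    (s2%:E < t0%:E + T')%E /\
    En `[s1, s2] (u' \- u) (path_lift i u' \- v) (path_speed i A' f' u' \- g) <=
      C * (e + xpn (u' s1 - u s1))].
Proof.
move=> sb; have [d [C [e0 [d0 C0 e00 est]]]] := perturbation_bound sb.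
exists d, C, e0; split => // s1 s2 A' f' u0' T' u' e Af' xu0' mx t0s1 sd s12 s2b s2d s1T e_ge pert small.
have [T'0 sol _] := mx; have [u'0 _] := sol.
set v' := path_lift i u'; set g' := path_speed i A' f' u'.
have data r1 : t0 < r1 -> (r1%:E < t0%:E + T')%E -> E1_data p i `[t0, r1] u' v' g'.
  by move=> h1 h2; exact: (solution_data p_gt1 ic inji sol h1 h2).
have key r1 : s1 < r1 -> r1 <= s2 -> (r1%:E < t0%:E + T')%E ->
    [/\ E1_data p i `[t0, r1] u' v' g', E1_data p i `[s1, r1] u' v' g' &
    En `[s1, r1] (u' \- u) (v' \- v) (g' \- g) <= C * (e + xpn (u' s1 - u s1))].
  move=> k1 k2 k3; have t0r1 : t0 < r1 by exact: le_lt_trans k1.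
  have h1 := data r1 t0r1 k3.
  have h2 : E1_data p i `[s1, r1] u' v' g'.
    by apply: (E1_dataS p_gt1 ic (mitv t0 r1) (mitv s1 r1) _ h1); exact: sub_itvcc.
  split => //; apply: (est s1 r1 A' f') => //.
  - exact: le_trans s2b.
  - exact: le_trans s2d.
  - by apply: (Xp_path p_gt1 ic h1); rewrite ?u'0// in_itv/= t0s1 ltW.
  - by apply: ae_all => t _; rewrite path_speedE.
suff s2T : (s2%:E < t0%:E + T')%E by split => //; have [] := key s2 s12 (lexx _) s2T.
rewrite ltNge; apply/negP => Ts2.
have [Tn TE] : exists Tn : R, T' = Tn%:E.
  case: T' T'0 Ts2 {mx sol data key s1T} => [Tn _ _|_|//]; first by exists Tn.
  by rewrite addey// leye_eq.
rewrite TE -EFinD lee_fin in Ts2; rewrite TE -EFinD lte_fin in s1T.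
set tau := t0 + Tn in Ts2 s1T.
set B := C * _ in key; have B0 : 0 <= B by rewrite mulr_ge0// addr_ge0// Xpn_ge0.
have ktau r1 : s1 < r1 < tau -> [/\ E1_data p i `[t0, r1] u' v' g', E1_data p i `[s1, r1] u' v' g' &
    En `[s1, r1] (u' \- u) (v' \- v) (g' \- g) <= B].
  move=> /andP[k1 k2]; apply: key => //; first by rewrite (le_trans (ltW k2)).
  by rewrite TE -EFinD lte_fin.
have [_ _ [gL _] [vL _]] := hd.
(* The uniform bound starts only at [s1]. The interval up to [tau] is covered by
   [[t0, (s1 + tau) / 2]], which ends before [tau], and [[s1, tau]], where [F] is compared with the
   reference function [G]. *)
have tail (Z : completeNormedModType R) (F G : R -> Z) : in_Lp p `[t0, b] G ->
    (forall r1, s1 < r1 < tau -> in_Lp p `[t0, r1] F /\ in_Lp p `[s1, r1] F /\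
        Lpn p `[s1, r1] (F \- G) <= B) -> in_Lp p `[t0, tau] F.
  move=> GL hF; have mid : s1 < (s1 + tau) / 2 < tau by rewrite midf_lt// andbC midf_lt.
  have /andP[m1 m2] := mid; have [FL _] := hF _ mid.
  have e1 : `[t0, tau]%classic = `[t0, (s1 + tau) / 2] `|` `[s1, tau].
    apply/seteqP; split=> t; rewrite /= !in_itv/=.
      move=> /andP[k1 k2]; have [|/ltW k3] := leP t ((s1 + tau) / 2); [left|right].
        by rewrite k1.
      by rewrite k2 andbT (le_trans _ k3)// ltW.
    move=> [] /andP[k1 k2]; first by rewrite k1 (le_trans k2)// ltW.
    by rewrite k2 andbT (le_trans t0s1).
  rewrite e1; apply: (proj1 (in_LpU p1 (mitv _ _) (mitv _ _) FL _)).
  apply: (in_Lp_exhaust p1 s1T (addr_ge0 B0 (Lpn_ge0 p `[t0, b] G))).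
  move=> r1 hr1; have [_ [FL1 Fn]] := hF r1 hr1; split => //.
  have /andP[_ r1tau] := hr1.
  have sub : `[s1, r1] `<=` (`[t0, b] : set R).
    by apply: sub_itvcc => //; rewrite (le_trans (ltW r1tau))// (le_trans Ts2).
  have [GL1 Gn] := in_LpS p1 (mitv _ _) sub GL.
  have [FGL _] := in_LpB p1 (mitv s1 r1) FL1 GL1.
  have [_] := in_LpD p1 (mitv s1 r1) FGL GL1.
  rewrite (_ : _ \+ _ = F); last by apply/funext => t; rewrite /= subrK.
  by move=> /le_trans; apply; exact: lerD.
have vT : in_Lp p `[t0, t0 + Tn] v'.
  apply: (tail _ v' v vL) => r1 hr1; have [h1 h2 h3] := ktau r1 hr1.
  split; first by case: h1 => _ _ _ [].
  split; first by case: h2 => _ _ _ [].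
  by apply: le_trans h3; rewrite /E1n lerDr addr_ge0// Lpn_ge0.
have gT : in_Lp p `[t0, t0 + Tn] g'.
  apply: (tail _ g' g gL) => r1 hr1; have [h1 h2 h3] := ktau r1 hr1.
  split; first by case: h1 => _ _ [].
  split; first by case: h2 => _ _ [].
  by apply: le_trans h3; rewrite /E1n -addrA addrCA lerDl addr_ge0// Lpn_ge0.
rewrite TE in mx; exact: (blow_up p_gt1 ic inji Af' xu0' mx vT gT).
Qed.

End Stability.

(** * Passage to the limit along the sequence *)

Lemma fin_gap {R : realType} (t0 b : R) (T : \bar R) : (b%:E < t0%:E + T)%E ->
  exists2 b' : R, b < b' & (b'%:E < t0%:E + T)%E.
Proof.
case: T => [T| |]; rewrite ?addeNy ?ltNge ?leNye//.
- rewrite -ltNge -EFinD lte_fin => h; exists ((b + (t0 + T)) / 2); first by rewrite midf_lt.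
  by rewrite lte_fin midf_lt.
- by move=> _; exists (b + 1); [rewrite ltrDl|rewrite addey// ltry].
Qed.

Lemma lee_limn_esup {R : realType} (u : nat -> \bar R) (c : \bar R) :
  (forall x : R, (x%:E < c)%E -> \forall n \near \oo, (x%:E <= u n)%E) ->
  (c <= limn_esup u)%E.
Proof.
move=> h; rewrite leNgt; apply/negP => hlt.
have [x [x1 x2]] : exists x : R, (limn_esup u < x%:E)%E /\ (x%:E < c)%E.
  move: (limn_esup u) c {h} hlt => [y| |] [z| |]//.
  - rewrite lte_fin => yz; exists ((y + z) / 2); by rewrite !lte_fin !midf_lt.
  - by move=> _; exists (y + 1); rewrite lte_fin ltrDl ltr01 ltry.
  - by move=> _; exists (z - 1); rewrite lte_fin ltNyr gtrDl oppr_lt0 ltr01.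
  - by move=> _; exists 0; rewrite ltNyr ltry.
have [N _ NP] := h x x2.
move: x1; rewrite limn_esup_lim ltNge => /negP; apply.
apply: lime_ge; first exact: is_cvg_esups.
apply: nearW => n; apply: (@le_trans _ _ (u (maxn n N))).
  by apply: NP; rewrite /= leq_maxr.
by apply: ereal_sup_ubound; exists (maxn n N) => //=; rewrite leq_maxl.
Qed.

Section Convergence.
Context {R : realType} {X0 X1 : completeNormedModType R}.
Local Notation mu := (@lebesgue_measure R).
Variables (p : R) (i : {linear X1 -> X0}).
Hypothesis p_gt1 : 1 < p.
Hypothesis ic : continuous i.
Hypothesis inji : injective i.
Variables (t0 : R) (A : option nat -> R -> X0 -> {linear X1 -> X0})
  (f : option nat -> R -> X0 -> X0) (u0 : option nat -> X0) (T : option nat -> \bar R)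
  (phi : option nat -> R -> X0).
Hypothesis hI : forall n, standing_assumptions p i t0 (A n) (f n).
Hypothesis hII : forall e : R, 0 < e -> forall a b : R, t0 <= a ->
       forall eta : R, 0 < eta -> \forall n \near \oo,
       (ereal_sup [set ereal_sup
            [set (`|f (Some n) t u - f None t u|%R)%:E |
             u in [set u | Xp p i u /\ (Xp_norm p i u <= eta%:E)%E]] |
          t in `[a, b]] < e%:E)%E /\
       (ereal_sup [set ereal_sup
            [set op_norm (A (Some n) t u \- A None t u)%R |
             u in [set u | Xp p i u /\ (Xp_norm p i u <= eta%:E)%E]] |
          t in `[a, b]] < e%:E)%E.
Hypothesis u0_Xp : forall n, Xp p i (u0 n).
Hypothesis u0_cvg : Xp_norm p i (u0 (Some n) - u0 None) @[n --> \oo] --> 0%E.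
Hypothesis hphi : forall n, maximal_solution p i t0 (A n) (f n) (u0 n) (T n) (phi n).
Let p1 : 1 <= p := ltW p_gt1.
Local Notation En := (@E1n R X0 X1 p).
Local Notation xpn := (Xpn p i).
Let mitv (a b : R) : measurable (`[a, b] : set R). Proof. exact: measurable_itv. Qed.
Local Notation lift n := (path_lift i (phi n)).
Local Notation speed n := (path_speed i (A n) (f n) (phi n)).

Lemma perturbation_near b r e : 0 < r -> 0 < e -> \forall n \near \oo,
  perturbation p i t0 (A None) (f None) b r (A (Some n)) (f (Some n)) e.
Proof.
move=> r0 e0; apply: filterS (hII e0 b (lexx t0) r0) => n [h1 h2] t y tt yy yr.
have yin : [set u | Xp p i u /\ (Xp_norm p i u <= r%:E)%E] y.
  by split => //; rewrite XpnE.
split.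
- move=> z; apply: op_norm_lt; apply: le_lt_trans h2.
  apply: (@le_trans _ _ (ereal_sup [set op_norm (A (Some n) t u \- A None t u)%R |
     u in [set u | Xp p i u /\ (Xp_norm p i u <= r%:E)%E]])).
    by apply: ereal_sup_ubound; exists y.
  by apply: ereal_sup_ubound; exists t.
- rewrite -lee_fin; apply: ltW; apply: le_lt_trans h1.
  apply: (@le_trans _ _ (ereal_sup [set (`|f (Some n) t u - f None t u|%R)%:E |
     u in [set u | Xp p i u /\ (Xp_norm p i u <= r%:E)%E]])).
    by apply: ereal_sup_ubound; exists y.
  by apply: ereal_sup_ubound; exists t.
Qed.

Lemma initial_near e : 0 < e -> \forall n \near \oo, xpn (u0 (Some n) - u0 None) <= e.
Proof.
move=> e0; move/fine_cvgP : u0_cvg => [_ /cvgrPdist_lt/(_ e e0)].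
apply: filterS => n; rewrite sub0r normrN => h; apply: ltW; apply: le_lt_trans h.
exact: ler_norm.
Qed.

Lemma E1n_point (u g : R -> X0) (v : R -> X1) t : En `[t, t] u v g = 0.
Proof.
have h (Z : completeNormedModType R) (F : R -> Z) : Lpn p `[t, t] F = 0.
  rewrite Lpn.unlock Lp_norm_null//.
  by rewrite set_itv1 lebesgue_measure_set1.
by rewrite /E1n !h !addr0.
Qed.

(** The property [P s] propagated by real induction contains, besides survival and the E_1 norm up
    to [s], the X_p-distance at [s]: this is the initial error of the next step. *)
Lemma E1n_cvg b : t0 < b -> (b%:E < t0%:E + T None)%E -> forall e, 0 < e ->
  \forall n \near \oo, (b%:E < t0%:E + T (Some n))%E /\
    En `[t0, b] (phi (Some n) \- phi None) (lift (Some n) \- lift None)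
      (speed (Some n) \- speed None) <= e.
Proof.
move=> t0b bT.
have [_ sol _] := hphi None; have [phi0 _] := sol.
have hd := solution_data p_gt1 ic inji sol t0b bT.
have xu : Xp p i (phi None t0) by rewrite phi0.
(* The trace estimate bounds the limit solution in X_p by [K] on the whole interval; [r] adds 1 for
   the perturbed solutions and [b - t0] for the time range. *)
pose K := En `[t0, b] (phi None) (lift None) (speed None) + xpn (phi None t0).
have K0 : 0 <= K by rewrite addr_ge0// ?E1n_ge0 ?Xpn_ge0.
pose r := K + 1 + (b - t0).
have r0 : 0 < r by rewrite /r; lra.
have br : b <= t0 + r by rewrite /r; lra.
have ur : {in `[t0, b], forall t, xpn (phi None t) <= r - 1}.
  move=> t; rewrite in_itv/= => tt; have [_ h] := trace_bound_itv p_gt1 ic tt hd xu.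
  by apply: (le_trans h); rewrite -/K /r; lra.
have eqn : {ae mu, forall t, `[t0, b]%classic t ->
    speed None t + A None t (phi None t) (lift None t) = f None t (phi None t)}.
  by apply: ae_all => t _; rewrite path_speedE.
pose P s := forall e, 0 < e -> \forall n \near \oo, [/\ (s%:E < t0%:E + T (Some n))%E,
    xpn (phi (Some n) s - phi None s) <= e &
    En `[t0, s] (phi (Some n) \- phi None) (lift (Some n) \- lift None)
      (speed (Some n) \- speed None) <= e].
suff Pb : P b by move=> e /Pb; apply: filterS => n [h1 _ h3].
apply: (@real_induction R t0 b P (ltW t0b)).
  move=> e e0; apply: filterS (initial_near e0) => n hn.
  have [Tn [phin0 _] _] := hphi (Some n); split.
  - by rewrite lteDl.
  - by rewrite phin0 phi0.
  - by rewrite E1n_point ltW.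
move=> s sb; have [d [C [e0 [d0 C0 e00 step]]]] := stability_step p_gt1 ic inji (hI None) t0b br hd xu ur eqn sb.
exists d => // s1 s2; rewrite !in_itv/= => /andP[k1 k2] /andP[k3 k4] k5 k6 k7 Ps1.
have [<-//|s12'] := eqVneq s1 s2.
have s12 : s1 < s2 by rewrite lt_neqAle s12'.
(* An error [e'] at [s1] and data at distance [e'] contribute [C * (2 * e')] on [[s1, s2]]; with the
   error already present this makes [(2 * C + 1) * e']. *)
move=> e e_gt0; have [e1 e10 Ce1] := small_factor (2 * C + 1) e_gt0.
pose e' := Num.min e1 (e0 / 2).
have e'0 : 0 < e' by rewrite lt_min e10 divr_gt0.
have e'1 : (2 * C + 1) * e' <= e.
  by apply: le_trans Ce1; rewrite ler_wpM2l ?ge_min ?lexx// addr_ge0// mulr_ge0.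
have e'2 : e' + e' <= e0 by have : e' <= e0 / 2 by [rewrite ge_min lexx orbT]; lra.
apply: filterS2 (Ps1 _ e'0) (perturbation_near b r0 e'0) => n [n1 n2 n3] pert.
have small : e' + xpn (phi (Some n) s1 - phi None s1) <= e0.
  by apply: le_trans e'2; rewrite lerD2l.
have [s2T hE] := step s1 s2 _ _ _ _ _ e' (hI (Some n)) (u0_Xp (Some n)) (hphi (Some n)) k1 k5 s12 k4 k7 n1
   (ltW e'0) pert small.
have [Tn soln _] := hphi (Some n); have [phin0 _] := soln.
have t0s2 : t0 < s2 by exact: le_lt_trans s12.
have hdn := solution_data p_gt1 ic inji soln t0s2 s2T.
have sub2 : `[t0, s2] `<=` (`[t0, b] : set R) by exact: sub_itvcc.
have hd2 := E1_dataS p_gt1 ic (mitv _ _) (mitv _ _) sub2 hd.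
have hB := E1_dataB p_gt1 ic (mitv _ _) hdn hd2.
have subl : `[t0, s1] `<=` (`[t0, s2] : set R) by exact: sub_itvcc.
have subr : `[s1, s2] `<=` (`[t0, s2] : set R) by exact: sub_itvcc.
have hl := E1_dataS p_gt1 ic (mitv _ _) (mitv _ _) subl hB.
have hr := E1_dataS p_gt1 ic (mitv _ _) (mitv _ _) subr hB.
have xs1 : Xp p i (phi (Some n) s1 - phi None s1).
  have xun : Xp p i (phi (Some n) t0) by rewrite phin0.
  apply: (proj1 (XpB p_gt1 ic _ _)).
    by apply: (Xp_path p_gt1 ic hdn xun); rewrite in_itv/= k1.
  by apply: (Xp_path p_gt1 ic hd xu); rewrite in_itv/= k1.
have hE' : En `[s1, s2] (phi (Some n) \- phi None) (lift (Some n) \- lift None)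
      (speed (Some n) \- speed None) <= C * (e' + e').
  by apply: (le_trans hE); rewrite ler_wpM2l// lerD2l.
have fin : e' + C * (e' + e') = (2 * C + 1) * e' by ring.
split => //.
- have s12s : s1 <= s2 <= s2 by rewrite lexx k6.
  have [_ h] := trace_bound_itv p_gt1 ic s12s hr xs1.
  by apply: (le_trans h); apply: le_trans e'1; rewrite -fin addrC; exact: lerD.
- have e2 : `[t0, s2]%classic = `[t0, s1] `|` `[s1, s2].
    apply/seteqP; split=> t; rewrite /= !in_itv/=.
      by move=> /andP[j1 j2]; have [j3|/ltW j3] := leP t s1; [left; rewrite j1|right; rewrite j3].
    move=> [] /andP[j1 j2]; first by rewrite j1 (le_trans j2).
    by rewrite j2 andbT (le_trans k1).
  rewrite e2; apply: (le_trans (E1nU p_gt1 (mitv _ _) (mitv _ _) hl hr)).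
  by apply: le_trans e'1; rewrite -fin; exact: lerD.
Qed.

End Convergence.

(* The index set N u {oo} is [option nat], with [None] for oo. *)
Theorem theorem3p3 (R : realType) (X0 X1 : completeNormedModType R)
    (i : {linear X1 -> X0}) (p t0 : R)
    (A : option nat -> R -> X0 -> {linear X1 -> X0})
    (f : option nat -> R -> X0 -> X0)
    (u0 : option nat -> X0)
    (T : option nat -> \bar R) (phi : option nat -> R -> X0)
    (emb : dense_embedding i) (p_gt1 : 1 < p) (t0_gt0 : 0 < t0)
    (hI : forall n, standing_assumptions p i t0 (A n) (f n))
    (hII : forall e : R, 0 < e -> forall a b : R, t0 <= a ->
       forall eta : R, 0 < eta -> \forall n \near \oo,
       (ereal_sup [set ereal_sup
            [set (`|f (Some n) t u - f None t u|%R)%:E |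
             u in [set u | Xp p i u /\ (Xp_norm p i u <= eta%:E)%E]] |
          t in `[a, b]] < e%:E)%E /\
       (ereal_sup [set ereal_sup
            [set op_norm (A (Some n) t u \- A None t u)%R |
             u in [set u | Xp p i u /\ (Xp_norm p i u <= eta%:E)%E]] |
          t in `[a, b]] < e%:E)%E)
    (hIII : (forall n, Xp p i (u0 n)) /\
       Xp_norm p i (u0 (Some n) - u0 None) @[n --> \oo] --> 0%E)
    (hphi : forall n,
       maximal_solution p i t0 (A n) (f n) (u0 n) (T n) (phi n)) :
  (forall a b : R, t0 <= a -> a <= b -> (b%:E < t0%:E + T None)%E ->
     (\forall n \near \oo, (b%:E < t0%:E + T (Some n))%E) /\
     E1_norm p i `[a, b] (phi (Some n) \- phi None) @[n --> \oo] --> 0%E) /\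
  (T None <= limn_esup (fun n => T (Some n)))%E.
Proof.
have [inji ic _] := emb; have [u0_Xp u0_cvg] := hIII.
have mitv (a b : R) : measurable (`[a, b] : set R) by exact: measurable_itv.
have main := E1n_cvg p_gt1 ic inji hI hII u0_Xp u0_cvg hphi.
(* A slightly later [b'] allows [b = t0]. *)
have reach b : t0 <= b -> (b%:E < t0%:E + T None)%E -> \forall n \near \oo, (b%:E < t0%:E + T (Some n))%E.
  move=> t0b /fin_gap[b' bb' b'T].
  apply: filterS (main b' (le_lt_trans t0b bb') b'T 1 ltr01) => n [h _].
  by apply: lt_trans h; rewrite lte_fin.
split => [a b t0a ab bT|].
  split; first by apply: reach => //; exact: le_trans ab.
  (* The compact interval may be a single point, so convergence is proved on the nondegenerate
     [[t0, b']] and restricted. *)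
  have [b' bb' b'T] := fin_gap bT.
  have t0b' : t0 < b' by apply: le_lt_trans bb'; exact: le_trans ab.
  have [_ sol _] := hphi None; have hd := solution_data p_gt1 ic inji sol t0b' b'T.
  have bound e : 0 < e -> \forall n \near \oo,
      (E1_norm p i `[a, b] (phi (Some n) \- phi None)%R <= e%:E)%E.
    move=> e0; apply: filterS (main b' t0b' b'T e e0) => n [h1 h2].
    have [_ soln _] := hphi (Some n); have hdn := solution_data p_gt1 ic inji soln t0b' h1.
    have hB := E1_dataB p_gt1 ic (mitv t0 b') hdn hd.
    have sub : `[a, b] `<=` (`[t0, b'] : set R) by apply: sub_itvcc => //; exact: ltW.
    have hS := E1_dataS p_gt1 ic (mitv t0 b') (mitv a b) sub hB.
    apply: (le_trans (E1_norm_le hS)); rewrite lee_fin.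
    exact: (le_trans (E1nS p_gt1 (mitv t0 b') sub hB)).
  apply/fine_cvgP; split.
    apply: filterS (bound 1 ltr01) => n h.
    by rewrite ge0_fin_numE ?E1_norm_ge0// (le_lt_trans h)// ltry.
  apply/cvgrPdist_lt => e e0; have e2 : 0 < e / 2 by rewrite divr_gt0.
  apply: filterS (bound _ e2) => n h; rewrite sub0r normrN ger0_norm ?fine_ge0 ?E1_norm_ge0//.
  apply: (@le_lt_trans _ _ (e / 2)); last by rewrite ltr_pdivrMr// ltr_pMr// ltr1n.
  by rewrite -lee_fin fineK// ge0_fin_numE ?E1_norm_ge0// (le_lt_trans h)// ltry.
apply: lee_limn_esup => x xT.
(* For [x <= 0] the point [t0 + x] is not after the initial time, but every lifetime is positive. *)
have [x0|x0] := leP x 0.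
  by apply: nearW => n; have [Tn _ _] := hphi (Some n); apply: le_trans (ltW Tn); rewrite lee_fin.
have h1 : t0 <= t0 + x by rewrite lerDl ltW.
have h2 : ((t0 + x)%:E < t0%:E + T None)%E by rewrite EFinD lteD2lE.
by apply: filterS (reach _ h1 h2) => n; rewrite EFinD lteD2lE// => /ltW.
Qed.
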